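(* Assume $\beta\geq0$, $\gamma\geq0$, and that one of the conditions $C_1$, $C_{2a}$, $C_{2b}$, $C_3$ holds. Then: (1) For every pair of nonnegative $\mathcal F_0$-measurable initial values $(X_0,Y_0)$ with $\mathbb P((X_0,Y_0)=(0,0))=0$, there exists a strong O2BP with these initial values, it takes values in $S\setminus\{(0,0)\}$ at all times, and it is pathwise unique (any two O2BPs driven by the same $(B,C)$ with the same initial values are indistinguishable). (2) There exists an O2BP with $X_0=Y_0=0$. (3) If moreover $\alpha\delta\geq\beta\gamma$, then for every pair of nonnegative $\mathcal F_0$-measurable initial values (including the corner) there exists a pathwise unique O2BP.
   Context: On a complete filtered probability space with usual conditions, $(B,C)$ is an adapted planar Brownian motion started at $0$ with $\langle B\rangle_t=\langle C\rangle_t=t$, $\langle B,C\rangle_t=\rho t$, $\rho\in[-1,1]$. $S=[0,\infty)^2$. With $\alpha>0,\delta>0,\beta,\gamma\in\mathbb R$, an O2BP is an adapted continuous $S$-valued process $(X,Y)$ with $X_t=X_0+B_t+\alpha\int_0^t\frac{ds}{X_s}+\beta\int_0^t\frac{ds}{Y_s}$, $Y_t=Y_0+C_t+\gamma\int_0^t\frac{ds}{X_s}+\delta\int_0^t\frac{ds}{Y_s}$ for all $t\ge0$, nonnegative $\mathcal F_0$-measurable $X_0,Y_0$, $\int_0^t\mathbf 1_{\{X_s=0\}}ds=\int_0^t\mathbf 1_{\{Y_s=0\}}ds=0$ and $\int_0^t\mathbf 1_{\{X_s>0\}}\frac{ds}{X_s}<\infty$, $\int_0^t\mathbf 1_{\{Y_s>0\}}\frac{ds}{Y_s}<\infty$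 for all $t$. Conditions: $C_1$: $\beta\geq0,\gamma\geq0$, $-1\leq\rho\leq\alpha+\delta$. $C_{2a}$: $\alpha\geq\frac12$, $\beta\geq0$. $C_{2b}$: $\delta\geq\frac12$, $\gamma\geq0$. $C_3$: there exist $\lambda>0,\mu>0$ with $\lambda\alpha+\mu\gamma\geq0$, $\lambda\beta+\mu\delta\geq0$ and $\big(\sqrt{\lambda(\lambda\alpha+\mu\gamma)}+\sqrt{\mu(\lambda\beta+\mu\delta)}\big)^2\geq\frac12(\lambda^2+\mu^2+2\rho\lambda\mu)$. *)

(* Defs.v *)
From HB Require Import structures.
From mathcomp Require Import all_boot all_order all_algebra.
From mathcomp Require Import all_classical all_reals all_analysis.
Set Implicit Arguments. Unset Strict Implicit. Unset Printing Implicit Defensive.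
Import Order.TTheory GRing.Theory Num.Theory.
Import numFieldNormedType.Exports.
Local Open Scope classical_set_scope.
Local Open Scope ring_scope.

Section O2BP_defs.
Context {R : realType} {d : measure_display} {Omega : measurableType d}.
Variable P : probability Omega R.

(** A real-valued process indexed by time [t : R] (only [t >= 0] matters). *)
Definition process := R -> Omega -> R.

Definition complete_prob_space : Prop :=
  forall N N' : set Omega, measurable N' -> P N' = 0%E -> N `<=` N' -> measurable N.

Definition Pnull (N : set Omega) : Prop :=
  exists N', [/\ measurable N', P N' = 0%E & N `<=` N'].

Definition usual_filtration (F : R -> set (set Omega)) : Prop :=
  [/\ (forall t, 0 <= t -> sigma_algebra setT (F t) /\ F t `<=` measurable),
      (forall s t, 0 <= s -> s <= t -> F s `<=` F t),
      (forall N, Pnull N -> F 0 N) &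
      (forall t A, 0 <= t -> (forall s, t < s -> F s A) -> F t A)].

Definition G_measurable (G : set (set Omega)) (Z : Omega -> R) : Prop :=
  forall U : set R, measurable U -> G (Z @^-1` U).

Definition adapted (F : R -> set (set Omega)) (X : process) : Prop :=
  forall t, 0 <= t -> G_measurable (F t) (X t).

Definition continuous_paths (X : process) : Prop :=
  forall w, {within `[0, +oo[, continuous (fun t => X t w)}.

(** (B, C) is an (F_t)-planar Brownian motion started at 0 with
    <B>_t = <C>_t = t and <B,C>_t = rho t: continuous adapted paths started
    at 0, and for s <= t the increment (B_t - B_s, C_t - C_s) is independent
    of F_s with centered Gaussian law of covariance (t-s)[[1,rho],[rho,1]];
    this is expressed through the conditional joint characteristic function:
    for all A in F_s and all reals l, m,
    E[1_A exp(i(l dB + m dC))] = P(A) exp(-(t-s)(l^2+2 rho l m+m^2)/2). *)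
Definition correlated_BM (F : R -> set (set Omega)) (rho : R) (B C : process) : Prop :=
  [/\ (forall w, B 0 w = 0 /\ C 0 w = 0),
      continuous_paths B /\ continuous_paths C,
      adapted F B /\ adapted F C &
      (forall s t, 0 <= s -> s <= t -> forall A, F s A -> forall l m : R,
        (\int[P]_(w in A) (cos (l * (B t w - B s w) + m * (C t w - C s w)))%:E
           = P A * (expR (- ((t - s) * (l ^+ 2 + 2 * rho * l * m + m ^+ 2)) / 2))%:E)%E
        /\ (\int[P]_(w in A) (sin (l * (B t w - B s w) + m * (C t w - C s w)))%:E
           = 0)%E)].

(** O2BP with initial values (X0, Y0) driven by (B, C).  Note that for
    x >= 0, x^-1 in MathComp equals 1_{x>0}/x (since 0^-1 = 0). *)
Definition O2BP (F : R -> set (set Omega)) (B C : process)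
    (alpha beta gamma delta : R) (X0 Y0 : Omega -> R) (X Y : process) : Prop :=
  [/\ adapted F X /\ adapted F Y, continuous_paths X /\ continuous_paths Y,
      (forall t w, 0 <= t -> 0 <= X t w /\ 0 <= Y t w),
      (forall w, X 0 w = X0 w /\ Y 0 w = Y0 w) &
      {ae P, forall w, forall t, 0 <= t ->
        [/\ lebesgue_measure (`[0%R, t] `&` [set s | X s w = 0]) = 0%E /\
            lebesgue_measure (`[0%R, t] `&` [set s | Y s w = 0]) = 0%E,
            (\int[lebesgue_measure]_(s in `[0%R, t]) ((X s w)^-1)%:E < +oo)%E,
            (\int[lebesgue_measure]_(s in `[0%R, t]) ((Y s w)^-1)%:E < +oo)%E,
            X t w = X0 w + B t w
                    + alpha * Rintegral lebesgue_measure `[0%R, t] (fun s => (X s w)^-1)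
                    + beta * Rintegral lebesgue_measure `[0%R, t] (fun s => (Y s w)^-1) &
            Y t w = Y0 w + C t w
                    + gamma * Rintegral lebesgue_measure `[0%R, t] (fun s => (X s w)^-1)
                    + delta * Rintegral lebesgue_measure `[0%R, t] (fun s => (Y s w)^-1)]}].

Definition generators (B C : process) (X0 Y0 : Omega -> R) (t : R) : set (set Omega) :=
  [set A | exists U : set R, measurable U /\
     (A = X0 @^-1` U \/ A = Y0 @^-1` U \/
      exists u, [/\ 0 <= u, u <= t & (A = B u @^-1` U \/ A = C u @^-1` U)])].

Definition augmented_natural_filtration (B C : process) (X0 Y0 : Omega -> R)
    : R -> set (set Omega) :=
  fun t => [set A | exists G0, <<s setT, generators B C X0 Y0 t >> G0 /\
                               Pnull ((A `\` G0) `|` (G0 `\` A))].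

Definition strong_O2BP F B C alpha beta gamma delta X0 Y0 (X Y : process) : Prop :=
  O2BP F B C alpha beta gamma delta X0 Y0 X Y /\
  adapted (augmented_natural_filtration B C X0 Y0) X /\
  adapted (augmented_natural_filtration B C X0 Y0) Y.

Definition pathwise_unique F B C alpha beta gamma delta (X0 Y0 : Omega -> R) : Prop :=
  forall X Y X' Y',
    O2BP F B C alpha beta gamma delta X0 Y0 X Y ->
    O2BP F B C alpha beta gamma delta X0 Y0 X' Y' ->
    {ae P, forall w, forall t, 0 <= t -> X t w = X' t w /\ Y t w = Y' t w}.

End O2BP_defs.

Section conditions.
Context {R : realType}.
Definition cond_C1 (rho alpha beta gamma delta : R) : Prop :=
  [/\ 0 <= beta, 0 <= gamma & -1 <= rho <= alpha + delta].
Definition cond_C2a (alpha beta : R) : Prop := 1 / 2 <= alpha /\ 0 <= beta.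
Definition cond_C2b (gamma delta : R) : Prop := 1 / 2 <= delta /\ 0 <= gamma.
Definition cond_C3 (rho alpha beta gamma delta : R) : Prop :=
  exists lambda mu : R, [/\ 0 < lambda, 0 < mu,
    0 <= lambda * alpha + mu * gamma, 0 <= lambda * beta + mu * delta &
    (Num.sqrt (lambda * (lambda * alpha + mu * gamma))
       + Num.sqrt (mu * (lambda * beta + mu * delta))) ^+ 2
      >= (lambda ^+ 2 + mu ^+ 2 + 2 * rho * lambda * mu) / 2].
End conditions.

(* Main.v *)
(* A pathwise construction reduces everything to the one-dimensional Bessel equations
   [x = B + alpha int 1/x] and [y = C + delta int 1/y] started at 0.  Given such paths, the
   system is solved by monotone iteration: adding the nonnegative drifts [beta int 1/Y] and
   [gamma int 1/X] only raises the paths above [x] and [y], so [1/x] and [1/y] dominate every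
   integrand.  The Bessel path itself is the increasing limit of the solutions with the capped
   drift [1 / max(x, 1/(n+1))]; no mass of the drift is lost in the limit because Ito's formula
   for [- x log (1 + 1/(b + x))] makes the drifts uniformly integrable.

   Ito's formula enters only as an inequality in expectation, obtained from a third order Taylor
   bound along a partition and the first four moments of the increments, which are read off the
   characteristic function.

   The corner is avoided because [log (1 + 1/(e + |U|^2)) / 2] is almost a supermartingale for a
   suitable [U]: [U = (X, Y)] under C1, [U = X] or [U = Y] under C2, [U = lambda X + mu Y] under
   C3; a maximal inequality along a grid and [e -> 0] conclude.

   Two solutions have the same noise, so their difference is of bounded variation; if
   [beta gamma <= alpha delta] the monotonicity of [1/x] forces it to vanish, and away from the
   corner one of the two drifts is locally Lipschitz, which gives uniqueness step by step. *)
Require Import Defs.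
From HB Require Import structures.
From mathcomp Require Import all_boot all_order all_algebra.
From mathcomp Require Import all_classical all_reals all_analysis.
From mathcomp Require Import measurable_realfun ring lra.
Set Implicit Arguments. Unset Strict Implicit. Unset Printing Implicit Defensive.
Import Order.TTheory GRing.Theory Num.Theory.
Import numFieldNormedType.Exports.
Local Open Scope classical_set_scope.
Local Open Scope ring_scope.

(** * Time integrals *)

(** The drifts are neither bounded nor Lipschitz at the axes, while the driving paths have infinite
    variation. Both difficulties disappear by writing [X = x + w], with [x] the Bessel path for the
    same noise: the noise cancels, and the height [w] solves an equation whose nonlinearity
    [1 / x - 1 / (x + w)] is nondecreasing in [w] and dominated by [1 / x]. The map from [Y] to [X]
    is then antitone, so two half-steps form a monotone iteration that carries its own upper bound.
    This part works path by path; probability enters only to build [x] and [y] and to exclude the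
    corner.

    There, martingale arguments are replaced by expectations against bounded weights known at the
    start of a time interval. One-sided bounds suffice: for the corner the weight is the indicator
    that a level has not been crossed so far, and for the Bessel path a lower bound on the test
    function turns the estimate into control of its drift. The borderline is Bessel dimension 2,
    where the logarithm is harmonic; each of C1, C2, C3 puts the chosen [U] on the safe side of
    it. *)

Section Rintegral_extra.
Context {d : measure_display} {T : measurableType d} {R : realType}.
Variable mu : {measure set T -> \bar R}.
Implicit Types (D : set T) (f g : T -> R).

Lemma ae_imp2 (U V W : T -> Prop) : (forall x, U x -> V x -> W x) ->
  {ae mu, forall x, U x} -> {ae mu, forall x, V x} -> {ae mu, forall x, W x}.
Proof.
move=> UVW [N1 [mN1 N10 s1]] [N2 [mN2 N20 s2]].
apply: (@negligibleS _ _ _ mu (N1 `|` N2)); last by apply: negligibleU; exact/negligibleP.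
move=> x /= nW; apply: contrapT => /not_orP[nN1 nN2]; apply: nW.
by apply: UVW; apply: contrapT => h; [apply: nN1; exact: s1|apply: nN2; exact: s2].
Qed.

Lemma ae_imp (U W : T -> Prop) : (forall x, U x -> W x) ->
  {ae mu, forall x, U x} -> {ae mu, forall x, W x}.
Proof. by move=> UW; apply: filterS. Qed.

Lemma fine_integral_EFin D f : measurable D -> mu.-integrable D (EFin \o f) ->
  (\int[mu]_(x in D) (f x)%:E)%E = (Rintegral mu D f)%:E.
Proof. by move=> mD fi; rewrite /Rintegral fineK//; exact: integrable_fin_num. Qed.

Lemma integrableD_EFin D f g : measurable D ->
  mu.-integrable D (EFin \o f) -> mu.-integrable D (EFin \o g) ->
  mu.-integrable D (EFin \o (fun x => f x + g x)).
Proof. by move=> mD fi gi; have := integrableD mD fi gi. Qed.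

Lemma integrableZ_EFin D (k : R) f : measurable D ->
  mu.-integrable D (EFin \o f) ->
  mu.-integrable D (EFin \o (fun x => k * f x)).
Proof. by move=> mD fi; have := integrableZl mD k fi. Qed.

Lemma integrableB_EFin D f g : measurable D ->
  mu.-integrable D (EFin \o f) -> mu.-integrable D (EFin \o g) ->
  mu.-integrable D (EFin \o (fun x => f x - g x)).
Proof. by move=> mD fi gi; have := integrableB mD fi gi. Qed.

Lemma le_integrable_EFin D f g : measurable D -> measurable_fun D f ->
  (forall x, D x -> `|f x| <= g x) ->
  mu.-integrable D (EFin \o g) -> mu.-integrable D (EFin \o f).
Proof.
move=> mD mf fg; apply: le_integrable => //; first exact/measurable_EFinP.
by move=> x Dx /=; rewrite lee_fin (le_trans (fg x Dx))// ler_norm.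
Qed.

Lemma integrable_sum_EFin D (I : Type) (s : seq I) (h : I -> T -> R) :
  measurable D -> (forall i, mu.-integrable D (EFin \o h i)) ->
  mu.-integrable D (EFin \o (fun x => \sum_(i <- s) h i x)).
Proof.
move=> mD hi; elim: s => [|i s IH].
  apply: (eq_integrable mD (fun=> 0%E)); last exact: integrable0.
  by move=> x _ /=; rewrite big_nil.
apply: (eq_integrable mD (EFin \o (fun x => h i x + \sum_(i <- s) h i x))).
  by move=> x _ /=; rewrite big_cons.
exact: integrableD_EFin.
Qed.

Lemma Rintegral_sum D (I : Type) (s : seq I) (h : I -> T -> R) :
  measurable D -> (forall i, mu.-integrable D (EFin \o h i)) ->
  Rintegral mu D (fun x => \sum_(i <- s) h i x) = \sum_(i <- s) Rintegral mu D (h i).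
Proof.
move=> mD hi; elim: s => [|i s IH].
  have -> : Rintegral mu D (fun x => \sum_(i <- [::]) h i x) = Rintegral mu D (fun=> 0).
    by apply: eq_Rintegral => x _; rewrite big_nil.
  by rewrite big_nil Rintegral_cst// mul0r.
rewrite big_cons -IH -RintegralD//; last exact: integrable_sum_EFin.
by apply: eq_Rintegral => x _; rewrite big_cons.
Qed.

Lemma integrable_bounded_EFin D f (c : R) : measurable D -> (mu D < +oo)%E ->
  measurable_fun D f -> (forall x, D x -> `|f x| <= c) ->
  mu.-integrable D (EFin \o f).
Proof.
move=> mD muD mf fc; apply: (le_integrable_EFin mD mf fc).
apply/integrableP; split; first by apply/measurable_EFinP; exact: measurable_cst.
under eq_integral do rewrite /=.
by rewrite integral_cst// lte_mul_pinfty.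
Qed.

Lemma ae_le_Rintegral D f g : measurable D ->
  mu.-integrable D (EFin \o f) -> mu.-integrable D (EFin \o g) ->
  {ae mu, forall x, D x -> f x <= g x} ->
  Rintegral mu D f <= Rintegral mu D g.
Proof.
move=> mD fi gi fg; rewrite -subr_ge0 -RintegralB//.
have hi := integrableB_EFin mD gi fi.
rewrite -lee_fin -fine_integral_EFin//.
have /integrableP[mh _] := hi.
(* The positive part agrees with [g - f] almost everywhere and is nonnegative at every point, which
   removes the exceptional set. *)
rewrite (_ : (\int[mu]_(x in D) (g x - f x)%:E =
  \int[mu]_(x in D) (Num.max (g x - f x) 0)%:E)%E).
  by apply: integral_ge0 => x _; rewrite lee_fin le_max lexx orbT.
apply: ae_eq_integral => //.
  by apply/measurable_EFinP/measurable_maxr => //; exact/measurable_EFinP.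
apply: filterS fg => x fg Dx; congr EFin.
by apply/esym/max_idPl; rewrite subr_ge0 fg.
Qed.

Lemma Rintegral_dct D (f_ : nat -> T -> R) f g : measurable D ->
  (forall n, measurable_fun D (f_ n)) -> measurable_fun D f ->
  {ae mu, forall x, D x -> f_ ^~ x @ \oo --> f x} ->
  mu.-integrable D (EFin \o g) ->
  {ae mu, forall x, forall n, D x -> `|f_ n x| <= g x} ->
  mu.-integrable D (EFin \o f) /\
  (fun n => Rintegral mu D (f_ n)) @ \oo --> Rintegral mu D f.
Proof.
move=> mD mf_ mf cf gi fg.
have cf' : {ae mu, forall x, D x -> (EFin \o f_ n) x @[n --> \oo] --> (EFin \o f) x}.
  by apply: filterS cf => x cf Dx; apply: cvg_EFin; [exact: nearW|exact: cf].
have fg' : {ae mu, forall x, forall n, D x -> (`|(EFin \o f_ n) x| <= (EFin \o g) x)%E}.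
  by apply: filterS fg => x fg n Dx /=; rewrite lee_fin; exact: fg.
have mf_' n : measurable_fun D (EFin \o f_ n) by apply/measurable_EFinP.
have mf' : measurable_fun D (EFin \o f) by apply/measurable_EFinP.
have [fi _ c] := dominated_convergence mD mf_' mf' cf' gi fg'.
split => //; move: c; rewrite (fine_integral_EFin mD fi) => /fine_cvg; exact.
Qed.
End Rintegral_extra.

Section real_extra.
Context {R : realType}.

Lemma cvg_maxr {T : Type} (F : set_system T) {FF : Filter F} (f g : T -> R) (a b : R) :
  f @ F --> a -> g @ F --> b -> (fun x => Num.max (f x) (g x)) @ F --> Num.max a b.
Proof.
move=> fa gb; rewrite maxr_absE.
rewrite (_ : (fun x => _) = (fun x => (f x + g x + `|f x - g x|) / 2)); last first.
  by apply/funext => x; rewrite maxr_absE.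
apply: cvgMl; apply: cvgD; first exact: cvgD.
by apply: cvg_norm; exact: cvgB.
Qed.

Lemma cvg_shift1 (u : nat -> R) (l : R) : u @ \oo --> l -> (fun k => u k.+1) @ \oo --> l.
Proof. by rewrite (cvg_shiftS u). Qed.

(** The continuous functions [x / (x ^+ 2 + 1 / (n + 1))] converge to [1 / x] at every point, also
    at [x = 0], where their value 0 matches [0^-1 = 0]. *)
Lemma measurable_invr : measurable_fun [set: R] (fun x : R => x^-1).
Proof.
have pos (n : nat) (x : R) : 0 < x ^+ 2 + n.+1%:R^-1 by rewrite ltr_wpDl// ?sqr_ge0// invr_gt0.
apply: (@measurable_fun_cvg _ _ R _ (fun (n : nat) (x : R) => x / (x ^+ 2 + n.+1%:R^-1) : R)).
  move=> n; apply: continuous_measurable_fun => x.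
  apply: cvgM; first exact: cvg_id.
  apply: cvgV; first by rewrite gt_eqF.
  by apply: cvgD; [exact: exprn_continuous|exact: cvg_cst].
move=> x _; have [->|x0] := eqVneq x 0.
  by rewrite invr0; under eq_fun do rewrite mul0r; exact: cvg_cst.
have -> : x^-1 = x / (x ^+ 2 + 0) by rewrite addr0; field.
apply: cvgM; first exact: cvg_cst.
apply: cvgV; first by rewrite addr0 expf_neq0.
by apply: cvgD; [exact: cvg_cst|exact: cvg_harmonic].
Qed.
End real_extra.

Section time_integral.
Context {R : realType}.
Implicit Types (f g : R -> R) (a b c t : R).
Notation mu := (@lebesgue_measure R).

(** For [b < a] the interval is empty and [J] is 0. Path equations can thus be stated for all real
    times; at negative times only the driving path remains. *)
Definition J f a b : R := Rintegral mu `[a, b] f.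
Definition itg f a b : Prop := mu.-integrable `[a, b] (EFin \o f).

Lemma itg_meas f a b : itg f a b -> measurable_fun `[a, b] f.
Proof. by case/integrableP => /measurable_EFinP. Qed.

Lemma itv_fin a b : (mu `[a, b] < +oo)%E.
Proof. by rewrite lebesgue_measure_itv/=; case: ifP => // _; rewrite -EFinD ltry. Qed.

Lemma itg_bdd f a b k : measurable_fun `[a, b] f ->
  (forall x, a <= x <= b -> `|f x| <= k) -> itg f a b.
Proof.
move=> mf fk; apply: (@integrable_bounded_EFin _ _ _ mu _ _ k) => //; exact: itv_fin.
Qed.

Lemma itg_cont f a b : continuous f -> itg f a b.
Proof.
move=> cf; apply: continuous_compact_integrable; first exact: segment_compact.
by apply: continuous_subspaceT => x; exact: cf.
Qed.

Lemma itg_sub f a b a' b' : a <= a' -> b' <= b -> itg f a b -> itg f a' b'.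
Proof.
move=> aa bb; apply: integrableS => //.
by apply: subset_itv; rewrite bnd_simp.
Qed.

Lemma itg_add f g a b : itg f a b -> itg g a b -> itg (fun x => f x + g x) a b.
Proof. exact: integrableD_EFin. Qed.
Lemma itg_subr f g a b : itg f a b -> itg g a b -> itg (fun x => f x - g x) a b.
Proof. exact: integrableB_EFin. Qed.
Lemma itg_scale k f a b : itg f a b -> itg (fun x => k * f x) a b.
Proof. exact: integrableZ_EFin. Qed.
Lemma itg_le f g a b : measurable_fun `[a, b] f ->
  (forall x, a <= x <= b -> `|f x| <= g x) -> itg g a b -> itg f a b.
Proof.
move=> mf fg; apply: le_integrable_EFin => // x /=; rewrite in_itv/=; exact: fg.
Qed.
Lemma itg_norm f a b : itg f a b -> itg (fun x => `|f x|) a b.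
Proof. by move=> fi; have := integrable_norm fi. Qed.
Lemma itg_cst k a b : itg (fun=> k) a b.
Proof. by apply: (@itg_bdd _ _ _ `|k|) => //; exact: measurable_cst. Qed.

Lemma J_D f g a b : itg f a b -> itg g a b ->
  J (fun x => f x + g x) a b = J f a b + J g a b.
Proof. exact: RintegralD. Qed.
Lemma J_B f g a b : itg f a b -> itg g a b ->
  J (fun x => f x - g x) a b = J f a b - J g a b.
Proof. exact: RintegralB. Qed.
Lemma J_Z k f a b : itg f a b -> J (fun x => k * f x) a b = k * J f a b.
Proof. exact: RintegralZl. Qed.
Lemma J_cst k a b : a <= b -> J (fun=> k) a b = k * (b - a).
Proof.
move=> ab; have -> : b - a = fine (mu `[a, b]).
  rewrite lebesgue_measure_itv/= lte_fin.
  by case: ltgtP ab => //= -> _; rewrite subrr.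
exact: Rintegral_cst.
Qed.
Lemma J_le f g a b : itg f a b -> itg g a b ->
  (forall x, a <= x <= b -> f x <= g x) -> J f a b <= J g a b.
Proof. by move=> fi gi fg; apply: le_Rintegral => // x /=; rewrite in_itv/=; exact: fg. Qed.
Lemma J_le_ae f g a b : itg f a b -> itg g a b ->
  {ae mu, forall x, a <= x <= b -> f x <= g x} -> J f a b <= J g a b.
Proof.
move=> fi gi fg; exact: ae_le_Rintegral.
Qed.
Lemma J_eq f g a b : (forall x, a <= x <= b -> f x = g x) -> J f a b = J g a b.
Proof. by move=> fg; apply: eq_Rintegral => x; rewrite inE/= in_itv/=; exact: fg. Qed.
Lemma itg_eq f g a b : (forall x, a <= x <= b -> f x = g x) -> itg f a b -> itg g a b.
Proof.
by move=> fg; apply: eq_integrable => // x; rewrite inE/= in_itv/= => /fg ->.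
Qed.
Lemma J_ge0 f a b : (forall x, a <= x <= b -> 0 <= f x) -> 0 <= J f a b.
Proof. by move=> f0; apply: Rintegral_ge0 => x /=; rewrite in_itv/=; exact: f0. Qed.
Lemma J_norm f a b : itg f a b -> `|J f a b| <= J (fun x => `|f x|) a b.
Proof. exact: le_normr_Rintegral. Qed.
Lemma J_aa f a : J f a a = 0.
Proof. by rewrite /J set_itv1 Rintegral_set1. Qed.
Lemma J_lt f a b : b < a -> J f a b = 0.
Proof. by move=> ba; rewrite /J set_itv_ge ?Rintegral_set0// bnd_simp -ltNge. Qed.

Lemma J_cat f a b c : a <= b -> b <= c -> itg f a c -> J f a c = J f a b + J f b c.
Proof.
move=> ab bc fi.
have := @Rintegral_itvB R f (BLeft a) (BRight c) b fi.
rewrite !bnd_simp => /(_ ab bc) /eqP; rewrite subr_eq => /eqP; rewrite /J => ->.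
rewrite addrC; congr (_ + _); apply: Rintegral_itv_obnd_cbnd.
by apply: integrableS fi => //; apply: subset_itv; rewrite bnd_simp.
Qed.

Lemma J_dct (f_ : nat -> R -> R) f g a b :
  (forall n, measurable_fun `[a, b] (f_ n)) ->
  measurable_fun `[a, b] f ->
  {ae mu, forall x, a <= x <= b -> f_ ^~ x @ \oo --> f x} ->
  itg g a b ->
  {ae mu, forall x, forall n, a <= x <= b -> `|f_ n x| <= g x} ->
  itg f a b /\ (fun n => J (f_ n) a b) @ \oo --> J f a b.
Proof.
move=> mf_ mf cf gi fg; apply: (@Rintegral_dct _ _ _ mu `[a, b]%classic f_ f g) => //.
Qed.

Lemma J_continuous f : (forall T, itg f 0 T) -> continuous (fun t => J f 0 t).
Proof.
move=> fi t.
(* Integrability is known only to the right of 0. Cutting [f] off at 0 lets the integral start at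
   [- T], so that [t] is an interior point of the interval of continuity. *)
pose f0 := f \_ `[0, +oo[%classic.
pose T := `|t| + 1.
have T0 : 0 < T by rewrite ltr_wpDl.
have tT : - T < t < T.
  by rewrite -ltr_norml ltr_pwDr.
have f0i : itg f0 (- T) T.
  rewrite /itg (_ : EFin \o f0 = (EFin \o f) \_ `[0, +oo[); last by rewrite -restrict_EFin.
  apply/integrable_restrict => //.
  apply: integrableS (fi T) => //; first exact: measurableI.
  by move=> x [] /=; rewrite !in_itv/= andbT => /andP[_ ->] ->.
have eqJ x : - T <= x -> J f 0 x = J f0 (- T) x.
  move=> Tx; rewrite /J /f0 -Rintegral_mkcondr; congr Rintegral.
  apply/seteqP; split => y /=; rewrite !in_itv/=.
    by move=> /andP[y0 ->]; rewrite y0; split => //; rewrite andbT; lra.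
  by move=> [/andP[_ ->]]; rewrite andbT => ->.
have Tlt : - T < T by rewrite (lt_trans _ T0)// oppr_lt0.
have := parameterized_integral_continuous (ltW Tlt) f0i.
move=> /(continuous_within_itvP _ Tlt)[+ _ _] => /(_ t).
rewrite in_itv/= tT => /(_ isT) /=.
rewrite /prop_for /continuous_at /parameterized_integral => c.
rewrite /J in eqJ; rewrite /J eqJ ?ltW//; last by case/andP: tT.
apply: cvg_trans c; apply: near_eq_cvg.
have [Tt _] := andP tT.
near=> x; rewrite eqJ//.
by apply: ltW; near: x; exact: lt_nbhsr.
Unshelve. all: by end_near. Qed.

Lemma J_ndecr f a b c : a <= b -> b <= c -> itg f a c ->
  (forall x, b <= x <= c -> 0 <= f x) -> J f a b <= J f a c.
Proof. by move=> ab bc fi f0; rewrite (J_cat ab bc fi) lerDl J_ge0. Qed.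

Lemma unif_cont f a b (e : R) : continuous f -> 0 < e ->
  exists2 h : R, 0 < h & forall x y, a <= x <= b -> `|x - y| < h -> `|f x - f y| < e.
Proof.
move=> cf e0.
have /compact_near_coveringP nc := @segment_compact R a b.
have := nc R (0^'+) (fun h x => forall y, `|x - y| < h -> `|f x - f y| < e) _.
case.
  move=> x _.
  have /cvgrPdist_lt /(_ (e / 2)) := cf x.
  rewrite divr_gt0// => /(_ isT) [h /= h0 hh].
  exists (ball x (h / 2), [set k | 0 < k < h / 2]).
    split; first by apply: nbhsx_ballx; rewrite divr_gt0.
    exists (h / 2) => /=; first by rewrite divr_gt0.
    by move=> k /=; rewrite sub0r normrN => /ltr_normlP[_ ->] ->.
  move=> [z k] /= [xz /andP[k0 kh]] y zy.
  have -> : f z - f y = (f x - f y) - (f x - f z) by ring.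
  rewrite (le_lt_trans (ler_normB _ _))// (splitr e) ltrD// hh//=.
    rewrite (_ : x - y = (x - z) + (z - y)); last by ring.
    by rewrite (le_lt_trans (ler_normD _ _))// (splitr h) ltrD// (lt_trans zy).
  by rewrite (lt_trans xz)// ltr_pdivrMr// mulr2n mulrDr mulr1 ltrDl.
move=> h /= h0 hh; exists (h / 2); first by rewrite divr_gt0.
move=> x y xab; apply: (hh (h / 2)) => //=.
- by rewrite sub0r normrN gtr0_norm ?divr_gt0// ltr_pdivrMr// mulr2n mulrDr mulr1 ltrDl.
- by rewrite divr_gt0.
Qed.

(** Serves measurability: it makes the time integral of a continuous adapted process a limit of
    finite sums of adapted variables. *)
Lemma riemann_cvg f a b : continuous f -> a <= b ->
  (fun n => (b - a) / n.+1%:R * \sum_(i < n.+1) f (a + (b - a) / n.+1%:R * i%:R))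
    @ \oo --> J f a b.
Proof.
move=> cf ab; apply/cvgrPdist_le => e e0.
have e1 : 0 < e / (b - a + 1) by rewrite divr_gt0// ltr_wpDl// subr_ge0.
have [h h0 hh] := unif_cont a b cf e1.
near=> n.
set k := (b - a) / n.+1%:R.
have k0 : 0 <= k by rewrite divr_ge0// subr_ge0.
have kh : k < h.
  rewrite /k ltr_pdivrMr// mulrC -ltr_pdivrMr//.
  have : (b - a) / h < n%:R by near: n; exact: nbhs_infty_gtr.
  by move=> /lt_trans; apply; rewrite ltr_nat.
pose s i : R := a + k * i%:R.
have ss i : s i.+1 = s i + k by rewrite /s -natr1; ring.
have sa i : a <= s i by rewrite /s lerDl mulr_ge0.
have sb i : (i <= n.+1)%N -> s i <= b.
  move=> ik; rewrite /s -lerBrDl -[leRHS](@mulfVK _ (n.+1%:R : R)) ?pnatr_eq0//.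
  by apply: ler_wpM2l => //; rewrite ler_nat.
have main i : (i <= n.+1)%N ->
    `|J f a (s i) - k * \sum_(j < i) f (s j)| <= e / (b - a + 1) * (k * i%:R).
  elim: i => [|i IH] ik.
    by rewrite big_ord0 /s !mulr0 addr0 J_aa subr0 normr0.
  rewrite big_ord_recr/= (J_cat (sa i) _ (itg_cont _ _ cf)); last by rewrite ss lerDl.
  have -> : J f a (s i) + J f (s i) (s i.+1) - k * (\sum_(j < i) f (s j) + f (s i)) =
    (J f a (s i) - k * \sum_(j < i) f (s j)) + (J f (s i) (s i.+1) - k * f (s i)) by ring.
  have -> : e / (b - a + 1) * (k * i.+1%:R) =
     e / (b - a + 1) * (k * i%:R) + e / (b - a + 1) * k by rewrite -natr1; ring.
  rewrite (le_trans (ler_normD _ _))// lerD// ?IH// 1?ltnW//.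
  have -> : k * f (s i) = J (fun=> f (s i)) (s i) (s i.+1).
    by rewrite J_cst ss ?lerDl// mulrC; congr (_ * _); ring.
  rewrite -J_B; [|exact: itg_cont|exact: itg_cst].
  apply: le_trans (J_norm _) _.
    by apply: itg_subr; [exact: itg_cont|exact: itg_cst].
  have -> : e / (b - a + 1) * k = J (fun=> e / (b - a + 1)) (s i) (s i.+1).
    by rewrite J_cst ss ?lerDl//; congr (_ * _); ring.
  apply: J_le.
  - by apply: itg_norm; apply: itg_subr; [exact: itg_cont|exact: itg_cst].
  - exact: itg_cst.
  move=> x /andP[x1 x2]; apply: ltW; rewrite distrC; apply: hh.
    by rewrite sa sb// ltnW.
  rewrite distrC ger0_norm ?subr_ge0//; apply: le_lt_trans kh.
  by rewrite lerBlDl -ss.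
have := main n.+1 (leqnn _).
have -> : s n.+1 = b by rewrite /s /k mulfVK ?pnatr_eq0//; ring.
move=> /le_trans; apply.
rewrite /k mulfVK ?pnatr_eq0// -mulrA ler_piMr ?(ltW e0)//.
by rewrite mulrC ler_pdivrMr ?ltr_wpDl ?subr_ge0// mul1r lerDl.
Unshelve. all: by end_near. Qed.

(** The point is the supremum of the times in [[a, b]] at which [f] is nonnegative. The
    contradiction arguments below run on the final excursion that starts there. *)
Lemma last_zero f a b : continuous f -> a <= b -> 0 <= f a -> f b < 0 ->
  exists s, [/\ a <= s, s < b, f s = 0 & forall r, s < r <= b -> f r < 0].
Proof.
move=> cf ab fa fb.
pose E := [set x | a <= x <= b /\ 0 <= f x].
have Ea : E a by split => //; rewrite lexx.
have hE : has_sup E.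
  by split; [exists a|exists b => x [/andP[]]].
pose s := sup E.
have sa : a <= s by apply: sup_upper_bound.
have sb : s <= b by apply: ge_sup => [|x [/andP[]]//]; exists a.
have after r : s < r <= b -> f r < 0.
  move=> /andP[sr rb]; rewrite ltNge; apply/negP => fr0.
  have : r <= s by apply: sup_upper_bound => //; split => //; rewrite rb (le_trans sa)// ltW.
  by rewrite leNgt sr.
have fs0 : 0 <= f s.
  rewrite leNgt; apply/negP => fs.
  have /cvgrPdist_lt /(_ (- f s)) := cf s.
  rewrite oppr_gt0 => /(_ fs) [h /= h0 hh].
  have [x [/andP[ax xb] fx] xs] := sup_adherent h0 hE.
  have xs' : x <= s by apply: sup_upper_bound => //; split => //; apply/andP.
  have : `|f s - f x| < - f s.
    by apply: hh; rewrite /= ger0_norm ?subr_ge0// ltrBlDl -ltrBlDr.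
  by move=> /ltr_normlP[]; lra.
have sltb : s < b.
  by rewrite lt_neqAle sb andbT; apply/eqP => sb'; move: fs0; rewrite sb'; lra.
exists s; split => //; apply/eqP; rewrite eq_le fs0 andbT leNgt; apply/negP => fs.
have /cvgrPdist_lt /(_ (f s) fs) [h /= h0 hh] := cf s.
pose r := Num.min b (s + h / 2).
have sr : s < r by rewrite lt_min sltb ltrDl divr_gt0.
have rb : r <= b by rewrite ge_min lexx.
have := after r; rewrite sr rb => /(_ isT) fr.
have : `|f s - f r| < f s.
  apply: hh; rewrite /= distrC gtr0_norm ?subr_gt0//.
  have : r <= s + h / 2 by rewrite ge_min lexx orbT.
  by lra.
by move=> /ltr_normlP[]; lra.
Qed.

Lemma gronwall (u : R -> R) (K a b : R) : continuous u -> 0 <= K ->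
  (forall t, a <= t <= b -> 0 <= u t) ->
  (forall t, a <= t <= b -> u t <= K * J u a t) ->
  forall t, a <= t <= b -> u t = 0.
Proof.
move=> cu K0 u0 uK.
have k0 : 0 < 2 * K + 1 by lra.
(* A step length with [K * h < 1 / 2]: over one step the maximum of [u] is at most half of itself,
   hence 0. *)
pose h := (2 * K + 1)^-1.
have h0 : 0 < h by rewrite invr_gt0.
have Kh : K * h < 1 / 2.
  rewrite /h ltr_pdivrMr//; lra.
suff main n t : a <= t <= b -> t <= a + h * n%:R -> u t = 0.
  move=> t tab; apply: (main (Num.truncn ((t - a) / h)).+1) => //.
  have := truncnS_gt ((t - a) / h).
  by rewrite ltr_pdivrMr// mulrC => /ltW; lra.
elim: n t => [|n IH] t /andP[ta tb].
  rewrite mulr0 addr0 => ta'; have -> : t = a by apply/eqP; rewrite eq_le ta ta'.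
  have ab := le_trans ta tb.
  by apply/eqP; rewrite eq_le u0 ?lexx// andbT (le_trans (uK _ _)) ?lexx// J_aa mulr0.
rewrite -natr1 mulrDr mulr1 => tn.
pose p := a + h * n%:R.
have [tp|pt] := leP t p; first by apply: IH => //; rewrite ta tb.
have ap : a <= p by rewrite lerDl mulr_ge0// ltW.
have [c /[!in_itv]/= /andP[pc ct] cmax] := EVT_max (ltW pt) (continuous_subspaceT cu).
have ac := le_trans ap pc; have cb := le_trans ct tb.
have uc0 : 0 <= u c by rewrite u0// ac.
have : u c <= K * (h * u c).
  rewrite (le_trans (uK c _)) ?ac//; apply: ler_wpM2l => //.
  rewrite (J_cat ap pc (itg_cont _ _ cu)).
  rewrite (@J_eq u (fun=> 0) a p) ?J_cst// ?mul0r ?add0r; last first.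
    by move=> x /andP[ax xp]; apply: IH => //; rewrite ax (le_trans xp)// ltW// (lt_le_trans pt).
  apply: (@le_trans _ _ (J (fun=> u c) p c)).
    apply: J_le; [exact: itg_cont|exact: itg_cst|move=> x /andP[px xc]].
    by apply: cmax; rewrite in_itv/= px (le_trans xc).
  rewrite J_cst// mulrC ler_wpM2r//; rewrite /p in pc *; lra.
move=> uc; have : u c <= 0 by nra.
move=> uc'; apply/eqP; rewrite eq_le u0 ?ta ?tb// andbT (le_trans _ uc')//.
by apply: cmax; rewrite in_itv/= (ltW pt) lexx.
Qed.

End time_integral.

(** * Monotone integral equations *)

Section ode.
Context {R : realType}.
Variables (a : R -> R) (phi : R -> R -> R) (K : R).

(** Since [phi] is nondecreasing, one Picard step is antitone. Starting from the lowest candidate,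
    with [phi] replaced by its bound [K], the even iterates increase, the odd ones decrease and stay
    above, so both converge without any smallness of the time interval. *)
Fixpoint picard (k : nat) : R -> R :=
  if k is k'.+1 then fun t => a t - J (fun s => phi s (picard k' s)) 0 t
  else fun t => a t - J (fun=> K) 0 t.

Definition ode_sol (t : R) : R := limn (fun k => picard k.*2 t).

Variable L : R.
Hypothesis ca : continuous a.
Hypothesis L0 : 0 <= L.
Hypothesis phiK : forall s x, `|phi s x| <= K.
Hypothesis phi_mono : forall s x y, x <= y -> phi s x <= phi s y.
Hypothesis phi_lip : forall s x y, `|phi s x - phi s y| <= L * `|x - y|.
Hypothesis phi_cont : forall u, continuous u -> continuous (fun s => phi s (u s)).

Lemma picard_cont k : continuous (picard k).
Proof.
elim: k => [|k IH] t /=.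
  apply: cvgB; first exact: ca.
  by apply: J_continuous => T; exact: itg_cst.
apply: cvgB; first exact: ca.
by apply: J_continuous => T; apply: itg_cont; exact: phi_cont.
Qed.

Let pi k T : itg (fun s => phi s (picard k s)) 0 T.
Proof. by apply: itg_cont; apply: phi_cont; exact: picard_cont. Qed.

Let step i j : (forall s, picard i s <= picard j s) ->
  forall t, picard j.+1 t <= picard i.+1 t.
Proof. by move=> ij t /=; rewrite lerD2l lerN2; apply: J_le => // s _; exact: phi_mono. Qed.

Let picard_ge k t : picard 0 t <= picard k t.
Proof.
case: k => // k /=; rewrite lerD2l lerN2; apply: J_le => //; first exact: itg_cst.
by move=> s _; rewrite (le_trans (ler_norm _)).
Qed.

Let picard_le k t : picard k t <= picard 1 t.
Proof. by case: k => [|k]; [exact: picard_ge|apply: step => s; exact: picard_ge]. Qed.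

Let even_nd k t : picard k.*2 t <= picard k.+1.*2 t.
Proof. by elim: k t => [|k IH] t; [exact: picard_ge|do 2 apply: step => ?; exact: IH]. Qed.

Let odd_ni k t : picard k.+1.*2.+1 t <= picard k.*2.+1 t.
Proof. by apply: step => s; exact: even_nd. Qed.

Let v (t : R) : R := limn (fun k => picard k.*2.+1 t).

Lemma ode_sol_cvg t : (fun k => picard k.*2 t) @ \oo --> ode_sol t.
Proof.
apply: nondecreasing_is_cvgn; first by apply/nondecreasing_seqP => k; exact: even_nd.
by exists (picard 1 t) => _ [k _ <-].
Qed.

Let v_cvg t : (fun k => picard k.*2.+1 t) @ \oo --> v t.
Proof.
apply: nonincreasing_is_cvgn; first by apply/nonincreasing_seqP => k; exact: odd_ni.
by exists (picard 0 t) => _ [k _ <-].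
Qed.

Let phi_cvg s (u : nat -> R) l : u @ \oo --> l -> (fun k => phi s (u k)) @ \oo --> phi s l.
Proof.
move=> ul.
have Lu : (fun k => L * `|u k - l|) @ \oo --> 0.
  rewrite -(mulr0 L) -(normr0 R) -(subrr l); apply: cvgMr; apply: cvg_norm.
  by apply: cvgB => //; exact: cvg_cst.
apply: (@squeeze_cvgr _ _ _ _ (fun k => phi s l - L * `|u k - l|)
  (fun k => phi s l + L * `|u k - l|)).
- by apply: nearW => k; rewrite -ler_distl.
- by rewrite -[X in _ --> X]subr0; apply: cvgB; first exact: cvg_cst.
- by rewrite -[X in _ --> X]addr0; apply: cvgD; first exact: cvg_cst.
Qed.

Let lim_eq (i : nat -> nat) (u w : R -> R) :
  (forall t, (fun k => picard (i k) t) @ \oo --> u t) ->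
  (forall t, (fun k => picard (i k).+1 t) @ \oo --> w t) ->
  (forall T, itg (fun s => phi s (u s)) 0 T) /\
  forall t, w t = a t - J (fun s => phi s (u s)) 0 t.
Proof.
move=> cu cw.
have key t : itg (fun s => phi s (u s)) 0 t /\
    (fun k => J (fun s => phi s (picard (i k) s)) 0 t) @ \oo --> J (fun s => phi s (u s)) 0 t.
  apply: (@J_dct R _ _ (fun=> K)).
  - by move=> k; exact: itg_meas.
  - apply: (@measurable_fun_cvg _ _ _ _ (fun k s => phi s (picard (i k) s))).
      by move=> k; exact: itg_meas.
    by move=> s _; exact: phi_cvg.
  - by apply: aeW => s _; exact: phi_cvg.
  - exact: itg_cst.
  - by apply: aeW.
split; first by move=> T; have [] := key T.
move=> t; apply: cvg_unique (cw t) _; first exact: Rhausdorff.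
by apply: cvgB; [exact: cvg_cst|have [] := key t].
Qed.

Lemma ode_solP :
  continuous ode_sol /\ forall t, ode_sol t = a t - J (fun s => phi s (ode_sol s)) 0 t.
Proof.
have [iu vE] := lim_eq ode_sol_cvg v_cvg.
have even' t : (fun k => picard k.*2.+2 t) @ \oo --> ode_sol t.
  by have := @ode_sol_cvg t; rewrite -(cvg_shiftS (fun k => picard k.*2 t)).
have [iv uE] := @lim_eq (fun k => k.*2.+1) v ode_sol v_cvg even'.
have cont_ (g h : R -> R) : (forall T, itg (fun s => phi s (g s)) 0 T) ->
    (forall t, h t = a t - J (fun s => phi s (g s)) 0 t) -> continuous h.
  move=> ig hE; rewrite (funext hE) => t.
  by apply: cvgB; [exact: ca|exact: J_continuous].
have cu := cont_ _ _ iv uE; have cv := cont_ _ _ iu vE.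
split => // t.
have [t0|t0] := ltP t 0; first by rewrite uE !J_lt.
(* The even limit and the odd limit [v] satisfy the equation crosswise, each with the other under
   the integral. Their difference is therefore bounded by [L] times its own integral, and Gronwall
   makes it vanish. *)
suff uv s : 0 <= s <= t -> `|ode_sol s - v s| = 0.
  rewrite uE; congr (_ - _); apply: J_eq => s /uv /eqP.
  by rewrite normr_eq0 subr_eq0 => /eqP ->.
move: s; apply: (@gronwall _ _ L) => //.
  by move=> s; apply: cvg_norm; apply: cvgB; [exact: cu|exact: cv].
move=> s /andP[s0 _]; rewrite uE vE.
rewrite (_ : _ - _ = J (fun r => phi r (ode_sol r) - phi r (v r)) 0 s); last first.
  by rewrite J_B//; ring.
apply: le_trans (J_norm _) _; first exact: itg_subr.
have iuv : itg (fun r => `|ode_sol r - v r|) 0 s.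
  apply: itg_cont => r; apply: cvg_norm; apply: cvgB; [exact: cu|exact: cv].
rewrite -J_Z//; apply: J_le => //; [exact/itg_norm/itg_subr|exact: itg_scale].
Qed.

End ode.

(** * Comparison principle for integral equations *)

Section comparison.
Context {R : realType}.
Notation mu := (@lebesgue_measure R).

(** If [w t > w' t], let [s] be the last time before [t] with [w = w']. On the excursion after [s]
    the path [w'] lies strictly below [w], so [p'] removes no more than [p]; as [a' - a] does not
    decrease either, [w' - w] cannot become negative at [t]. *)
Lemma comparison (a a' p p' w w' : R -> R) :
  continuous w -> continuous w' ->
  (forall T, itg p 0 T) -> (forall T, itg p' 0 T) ->
  (forall t, 0 <= t -> w t = a t - J p 0 t) ->
  (forall t, 0 <= t -> w' t = a' t - J p' 0 t) ->
  a 0 <= a' 0 ->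
  (forall s t, 0 <= s -> s <= t -> a' s - a s <= a' t - a t) ->
  {ae mu, forall s, 0 <= s -> w' s < w s -> p' s <= p s} ->
  forall t, 0 <= t -> w t <= w' t.
Proof.
move=> cw cw' ip ip' wE w'E a0 aa pp t t0; rewrite leNgt; apply/negP => wt.
have cd : continuous (fun s => w' s - w s).
  by move=> s; apply: cvgB; [exact: cw'|exact: cw].
have [||s [s0 st /eqP ws neg]] := last_zero cd t0.
- by rewrite wE// w'E// !J_aa; lra.
- by rewrite subr_lt0.
have pJ : J p' s t <= J p s t.
  apply: J_le_ae.
  - exact: itg_sub (ip' t).
  - exact: itg_sub (ip t).
  (* The ordering of [p'] and [p] is available only where [w' < w] strictly, which fails at the
     endpoint [s]; that single point is discarded as a null set. *)
  have ae_s : {ae mu, forall x, x != s}.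
    exists [set s]; split => //; first exact: lebesgue_measure_set1.
    by move=> x /= /negP; rewrite negbK => /eqP.
  apply: ae_imp2 ae_s pp => r rs pp /andP[sr rt]; apply: pp; first exact: le_trans sr.
  by rewrite -subr_lt0; apply: neg; rewrite rt lt_neqAle sr eq_sym rs.
have := wE t t0; have := w'E t t0.
rewrite (J_cat s0 (ltW st) (ip t)) (J_cat s0 (ltW st) (ip' t)).
have := wE s s0; have := w'E s s0; have := aa s t s0 (ltW st).
move: ws; lra.
Qed.
End comparison.

(** * The noise-free equation for the height above a Bessel path *)

Section shift_op.
Context {R : realType}.
Notation mu := (@lebesgue_measure R).
Implicit Types (x A : R -> R) (al : R).

(* [1 / x] dominates the integrands of every solution lying above [x]. *)
Definition good_path x :=
  [/\ continuous x, (forall t, 0 <= x t), {ae mu, forall s, 0 <= s -> 0 < x s} &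
      forall T, itg (fun s => (x s)^-1) 0 T].

Definition floorx x (n : nat) (s : R) : R := Num.max (x s) (n.+1%:R^-1).
(** If [x] and [X = x + w] have the same noise and the self-drift [al / x], [al / X], subtraction
    leaves [w = A - al * J (1 / x - 1 / (x + w))], with [A] the extra input. Here [x] is floored at
    [1 / (n + 1)] and [w] is cut at 0, which makes the integrand bounded, nondecreasing and
    Lipschitz in [w], as [ode_sol] requires. *)
Definition pull x al n (s w : R) : R :=
  al * ((floorx x n s)^-1 - (floorx x n s + Num.max w 0)^-1).

Definition shift_op al x A (t : R) : R :=
  limn (fun n => ode_sol A (pull x al n) (al * n.+1%:R) t).

Lemma floorx_gt0 x n s : 0 < floorx x n s.
Proof. by rewrite lt_max invr_gt0 ltr0Sn orbT. Qed.

Lemma maxr_cont (f g : R -> R) : continuous f -> continuous g ->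
  continuous (fun s => Num.max (f s) (g s)).
Proof. by move=> cf cg s; apply: continuous_max; [exact: cf|exact: cg]. Qed.

Lemma pull_ge0 x al n s w : 0 <= al -> 0 <= pull x al n s w.
Proof.
move=> al0; rewrite mulr_ge0// subr_ge0; have f0 := floorx_gt0 x n s.
have w0 : 0 <= Num.max w 0 by rewrite le_max lexx orbT.
by rewrite lef_pV2 ?posrE ?ltr_wpDr// lerDl.
Qed.

Lemma pull_neg x al n s w : w <= 0 -> pull x al n s w = 0.
Proof. by move=> w0; rewrite /pull (max_idPr w0) addr0 subrr mulr0. Qed.

Lemma pull_leV x al n s w : 0 <= al -> pull x al n s w <= al * (floorx x n s)^-1.
Proof.
move=> al0; apply: ler_wpM2l => //; rewrite lerBlDr lerDl invr_ge0 addr_ge0//.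
  by rewrite ltW// floorx_gt0.
by rewrite le_max lexx orbT.
Qed.

Lemma pull_mono x al n s w w' : 0 <= al -> w <= w' -> pull x al n s w <= pull x al n s w'.
Proof.
move=> al0 ww; apply: ler_wpM2l => //; rewrite lerD2l lerN2.
have f0 := floorx_gt0 x n s.
have m0 u : 0 <= Num.max u 0 :> R by rewrite le_max lexx orbT.
rewrite lef_pV2 ?posrE ?ltr_wpDr// lerD2l.
by rewrite ge_max !le_max ww lexx orbT.
Qed.

Lemma floorx_inv_le x n s : (floorx x n s)^-1 <= n.+1%:R.
Proof.
rewrite -[leRHS]invrK lef_pV2 ?posrE ?floorx_gt0 ?invr_gt0//.
by rewrite le_max lexx orbT.
Qed.

Lemma pull_norm x al n s w : 0 <= al -> `|pull x al n s w| <= al * n.+1%:R.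
Proof.
move=> al0; rewrite ger0_norm ?pull_ge0// (le_trans (pull_leV _ _ _ _ al0))//.
by apply: ler_wpM2l => //; exact: floorx_inv_le.
Qed.

Lemma maxr0_lip (u v : R) : `|Num.max u 0 - Num.max v 0| <= `|u - v|.
Proof.
rewrite /Num.max; case: ltP => u0; case: ltP => v0; rewrite ?subrr ?normr0//.
- by rewrite sub0r normrN ger0_norm// ler_normr; apply/orP; right; lra.
- by rewrite subr0 ger0_norm// ler_normr; apply/orP; left; lra.
Qed.

Lemma pull_lip x al n s w w' : 0 <= al ->
  `|pull x al n s w - pull x al n s w'| <= al * n.+1%:R ^+ 2 * `|w - w'|.
Proof.
move=> al0; rewrite /pull -mulrBr normrM ger0_norm// -mulrA; apply: ler_wpM2l => //.
have f0 := floorx_gt0 x n s; have fi := floorx_inv_le x n s.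
set f := floorx x n s in f0 fi *.
have m0 u : 0 <= Num.max u 0 :> R by rewrite le_max lexx orbT.
have := m0 w; have := m0 w'; have := maxr0_lip w w'.
set m := Num.max w 0; set m' := Num.max w' 0 => mm m'0 m0'.
have fm : 0 < f + m by lra.
have fm' : 0 < f + m' by lra.
have -> : f^-1 - (f + m)^-1 - (f^-1 - (f + m')^-1) = (f + m)^-1 * (f + m')^-1 * (m - m').
  by field; rewrite !gt_eqF.
have fmV : 0 <= (f + m)^-1 by rewrite invr_ge0 ltW.
have fmV' : 0 <= (f + m')^-1 by rewrite invr_ge0 ltW.
rewrite normrM ger0_norm ?mulr_ge0//; apply: ler_pM => //; first exact: mulr_ge0.
by rewrite expr2; apply: ler_pM => //; apply: le_trans fi; rewrite lef_pV2 ?posrE ?lerDl.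
Qed.

Lemma floorx_cont x n : continuous x -> continuous (floorx x n).
Proof. by move=> cx; apply: maxr_cont => // s; exact: cvg_cst. Qed.

Lemma pull_cont x al n u : continuous x -> continuous u ->
  continuous (fun s => pull x al n s (u s)).
Proof.
move=> cx cu s; have f0 := floorx_gt0 x n s.
apply: cvgMr; apply: cvgB.
  by apply: cvgV; [rewrite gt_eqF|exact: floorx_cont].
apply: cvgV.
  by rewrite gt_eqF// ltr_wpDr// le_max lexx orbT.
apply: cvgD; first exact: floorx_cont.
by apply: maxr_cont => // r; exact: cvg_cst.
Qed.

Lemma floorx_ni x n s : floorx x n.+1 s <= floorx x n s.
Proof.
by rewrite ge_max !le_max lexx/= lef_pV2 ?posrE// ler_nat leqnSn orbT.
Qed.

(** The identity [1 / f - 1 / (f + m) = m / (f * (f + m))] shows growth as the floor is lowered. By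
    comparison the regularized heights then decrease in [n], so their limit exists. *)
Lemma pull_nd x al n s w : 0 <= al -> pull x al n s w <= pull x al n.+1 s w.
Proof.
move=> al0; apply: ler_wpM2l => //.
have f0 := floorx_gt0 x n.+1 s; have g0 := floorx_gt0 x n s; have fg := floorx_ni x n s.
have : 0 <= Num.max w 0 by rewrite le_max lexx orbT.
set f := floorx x n s in g0 fg *; set g := floorx x n.+1 s in f0 fg *.
set m := Num.max w 0 => m0.
have -> : f^-1 - (f + m)^-1 = m * (f^-1 * (f + m)^-1).
  by field; rewrite !gt_eqF; lra.
have -> : g^-1 - (g + m)^-1 = m * (g^-1 * (g + m)^-1).
  by field; rewrite !gt_eqF; lra.
by apply: ler_wpM2l => //; apply: ler_pM; rewrite ?invr_ge0 ?lef_pV2 ?posrE; lra.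
Qed.

Lemma floorx_cvg x s : 0 <= x s -> (fun n => floorx x n s) @ \oo --> x s.
Proof.
move=> x0; rewrite -[X in _ --> X](max_idPl x0).
apply: cvg_maxr; first exact: cvg_cst.
exact: cvg_harmonic.
Qed.

Section fixed.
Variables (al : R) (x A : R -> R).
Hypotheses (alp : 0 < al) (gx : good_path x) (cA : continuous A) (A0 : 0 <= A 0)
  (A_nd : forall s t, 0 <= s -> s <= t -> A s <= A t).

Let al0 : 0 <= al := ltW alp.
Let wn n := ode_sol A (pull x al n) (al * n.+1%:R).

Let cx : continuous x. Proof. by case: gx. Qed.

Let wnP n : continuous (wn n) /\
  forall t, wn n t = A t - J (fun s => pull x al n s (wn n s)) 0 t.
Proof.
apply: (@ode_solP _ A (pull x al n) _ (al * n.+1%:R ^+ 2)) => //.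
- by rewrite mulr_ge0// exprn_ge0.
- by move=> s w; exact: pull_norm.
- by move=> s w w'; exact: pull_mono.
- by move=> s w w'; exact: pull_lip.
- by move=> u cu; exact: pull_cont.
Qed.

Let ipull n T : itg (fun s => pull x al n s (wn n s)) 0 T.
Proof. by apply: itg_cont; apply: pull_cont => //; have [] := wnP n. Qed.

Let wn_ge0 n t : 0 <= t -> 0 <= wn n t.
Proof.
have [cw wE] := wnP n.
apply: (@comparison _ (fun=> 0) A (fun=> 0) (fun s => pull x al n s (wn n s)) (fun=> 0)) => //.
- by move=> s; exact: cvg_cst.
- by move=> T; exact: itg_cst.
- by move=> s s0; rewrite J_cst// mul0r subr0.
- by move=> s r s0 sr; rewrite !subr0; exact: A_nd.
- by apply: aeW => s _ /ltW w0; rewrite pull_neg.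
Qed.

Let wn_ni n t : 0 <= t -> wn n.+1 t <= wn n t.
Proof.
have [cw wE] := wnP n; have [cw' wE'] := wnP n.+1.
apply: (@comparison _ A A (fun s => pull x al n.+1 s (wn n.+1 s))
   (fun s => pull x al n s (wn n s))) => //.
- by move=> s r _ _; rewrite !subrr.
- apply: aeW => s _ /ltW ws; apply: (le_trans (pull_mono _ _ _ al0 ws)).
  exact: pull_nd.
Qed.

Lemma shift_op_cvg t : 0 <= t -> wn^~ t @ \oo --> shift_op al x A t.
Proof.
move=> t0; apply: nonincreasing_is_cvgn.
  by apply/nonincreasing_seqP => k; exact: wn_ni.
by exists 0 => _ [k _ <-]; exact: wn_ge0.
Qed.

Lemma shift_op_neg t : t < 0 -> shift_op al x A t = A t.
Proof.
move=> t0; rewrite /shift_op (_ : (fun n => _) = fun=> A t); first exact: lim_cst.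
by apply/funext => n; rewrite -[LHS]/(wn n t); have [_ ->] := wnP n; rewrite J_lt// subr0.
Qed.

Local Notation w := (shift_op al x A).

Lemma shift_op_ge0 t : 0 <= t -> 0 <= w t.
Proof.
move=> t0; apply: limr_ge; first by apply/cvg_ex; eexists; exact: shift_op_cvg.
by apply: nearW => n; exact: wn_ge0.
Qed.

(** The limit of the floored equations: [pull] is at most [al / x], integrable for a good path, and
    it converges wherever [x > 0], that is at almost every time. *)
Lemma shift_opE : [/\ continuous w,
  (forall T, itg (fun s => (x s)^-1 - (x s + w s)^-1) 0 T) &
  forall t, w t = A t - al * J (fun s => (x s)^-1 - (x s + w s)^-1) 0 t].
Proof.
have [_ x0 xpos ix] := gx.
have key t : 0 <= t -> itg (fun s => al * ((x s)^-1 - (x s + w s)^-1)) 0 t /\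
   (fun n => J (fun s => pull x al n s (wn n s)) 0 t) @ \oo -->
   J (fun s => al * ((x s)^-1 - (x s + w s)^-1)) 0 t.
  move=> t0.
  have mw : measurable_fun `[0, t] w.
    apply: (@measurable_fun_cvg _ _ _ _ wn).
      by move=> n; apply: itg_meas; apply: itg_cont; have [] := wnP n.
    by move=> s; rewrite /= in_itv/= => /andP[s0 _]; exact: shift_op_cvg.
  have mx : measurable_fun `[0, t] x by apply: itg_meas; exact: itg_cont.
  have mVx : measurable_fun `[0, t] (fun s => (x s)^-1) by exact: itg_meas.
  apply: (@J_dct _ _ _ (fun s => al * (x s)^-1)).
  - by move=> n; exact: itg_meas.
  - apply: measurable_funM; first exact: measurable_cst.
    apply: measurable_funB => //; apply: measurableT_comp; last exact: measurable_funD.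
    exact: measurable_invr.
  - apply: (ae_imp _ xpos) => s xs /andP[s0 st]; have {}xs := xs s0.
    apply: cvgMr; apply: cvgB.
      by apply: cvgV; [rewrite gt_eqF|exact: floorx_cvg].
    have ws := shift_op_ge0 s0.
    apply: cvgV; first by rewrite gt_eqF// ltr_wpDr.
    apply: cvgD; first exact: floorx_cvg.
    rewrite -[X in _ --> X](max_idPl ws).
    by apply: cvg_maxr; [exact: shift_op_cvg|exact: cvg_cst].
  - exact: itg_scale.
  - apply: (ae_imp _ xpos) => s xs n /andP[s0 st]; have {}xs := xs s0.
    rewrite ger0_norm ?pull_ge0// (le_trans (pull_leV _ _ _ _ al0))//.
    by apply: ler_wpM2l => //; rewrite lef_pV2 ?posrE ?floorx_gt0// le_max lexx.
have iw T : itg (fun s => (x s)^-1 - (x s + w s)^-1) 0 T.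
  have [T0|T0] := ltP T 0.
    by rewrite /itg set_itv_ge ?bnd_simp -?ltNge//; exact: integrable_set0.
  have := itg_scale al^-1 (key T T0).1; apply: itg_eq => s _.
  by rewrite mulrA mulVf ?mul1r// gt_eqF.
have wE t : 0 <= t -> w t = A t - al * J (fun s => (x s)^-1 - (x s + w s)^-1) 0 t.
  move=> t0; apply: cvg_unique (shift_op_cvg t0) _; first exact: Rhausdorff.
  rewrite (_ : wn^~ t = fun n => A t - J (fun s => pull x al n s (wn n s)) 0 t); last first.
    by apply/funext => n; have [_ ->] := wnP n.
  by rewrite -J_Z//; apply: cvgB; [exact: cvg_cst|have [] := key t t0].
have wE' t : w t = A t - al * J (fun s => (x s)^-1 - (x s + w s)^-1) 0 t.
  have [t0|t0] := ltP t 0; last exact: wE.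
  by rewrite J_lt// mulr0 subr0 shift_op_neg.
split => //; rewrite (funext wE') => t; apply: cvgB; first exact: cA.
by apply: cvgMr; apply: J_continuous.
Qed.

End fixed.
End shift_op.

(** * Pathwise construction of the system *)

Section system.
Context {R : realType}.
Notation mu := (@lebesgue_measure R).
Implicit Types (x y X Y : R -> R).

Definition above x X := continuous X /\ forall t, 0 <= t -> x t <= X t.

Lemma above_gt0 x X : good_path x -> above x X -> {ae mu, forall s, 0 <= s -> 0 < X s}.
Proof.
by move=> [_ _ xp _] [_ xX]; apply: (ae_imp _ xp) => s xs s0; exact: lt_le_trans (xs s0) (xX _ s0).
Qed.

Lemma above_cvg x (X_ : nat -> R -> R) X T : good_path x -> (forall k, above x (X_ k)) ->
  (forall t, 0 <= t -> X_^~ t @ \oo --> X t) ->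
  itg (fun s => (X s)^-1) 0 T /\
  (fun k => J (fun s => (X_ k s)^-1) 0 T) @ \oo --> J (fun s => (X s)^-1) 0 T.
Proof.
move=> [cx x0 xp ix] xX cX.
have mX_ k : measurable_fun `[0, T] (X_ k).
  by apply: itg_meas; apply: itg_cont; have [] := xX k.
have mX : measurable_fun `[0, T] X.
  apply: (@measurable_fun_cvg _ _ _ _ X_) => // s.
  by rewrite /= in_itv/= => /andP[s0 _]; exact: cX.
apply: (@J_dct _ _ _ (fun s => (x s)^-1)).
- by move=> k; apply: measurableT_comp (mX_ k); exact: measurable_invr.
- by apply: measurableT_comp mX; exact: measurable_invr.
- apply: (ae_imp _ xp) => s xs /andP[s0 _]; apply: cvgV; last exact: cX.
  rewrite gt_eqF// (lt_le_trans (xs s0))//.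
  apply: cvgr_to_ge (cX _ s0) _.
  by apply: nearW => k; have [_] := xX k; apply.
- exact: ix.
- apply: (ae_imp _ xp) => s xs k /andP[s0 _]; have {}xs := xs s0.
  have xXs : x s <= X_ k s by have [_] := xX k; apply.
  have Xp := lt_le_trans xs xXs.
  by rewrite ger0_norm ?invr_ge0 ?(ltW Xp)// lef_pV2 ?posrE.
Qed.

Lemma above_itg x X : good_path x -> above x X -> forall T, itg (fun s => (X s)^-1) 0 T.
Proof.
move=> gx xX T; have [] := @above_cvg x (fun=> X) X T gx (fun=> xX) => //.
by move=> t _; exact: cvg_cst.
Qed.

(** Solves one equation with the other coordinate frozen. The input of the height is the initial
    value [p] plus the drift received from [Y]; hence [x] itself may start at 0 whatever the initial
    value is. *)
Definition sys_op al be p x Y (t : R) : R :=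
  x t + shift_op al x (fun r => p + be * J (fun s => (Y s)^-1) 0 r) t.

Section op.
Variables (al be p : R) (x y : R -> R).
Hypotheses (al0 : 0 < al) (be0 : 0 <= be) (p0 : 0 <= p) (gx : good_path x) (gy : good_path y).

Let Aof Y r : R := p + be * J (fun s => (Y s)^-1) 0 r.

Let cA Y : above y Y -> continuous (Aof Y).
Proof.
move=> yY t; apply: cvgD; first exact: cvg_cst.
by apply: cvgMr; apply: J_continuous; exact: above_itg yY.
Qed.

Let A0 Y : 0 <= Aof Y 0. Proof. by rewrite /Aof J_aa mulr0 addr0. Qed.

Let Y_ge0 Y s : above y Y -> 0 <= s -> 0 <= Y s.
Proof. by move=> [_ yY] s0; apply: le_trans (yY _ s0); case: gy. Qed.

Let A_nd Y : above y Y -> forall s t, 0 <= s -> s <= t -> Aof Y s <= Aof Y t.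
Proof.
move=> yY s t s0 st; rewrite lerD2l; apply: ler_wpM2l => //.
apply: J_ndecr => //; first exact: above_itg yY _.
by move=> r /andP[sr _]; rewrite invr_ge0; apply: Y_ge0 yY _; exact: le_trans sr.
Qed.

Lemma sys_op_above Y : above y Y -> above x (sys_op al be p x Y).
Proof.
move=> yY; have [cw _ _] := shift_opE al0 gx (cA yY) (A0 Y) (A_nd yY).
split; first by move=> t; apply: cvgD; [case: gx => + _ _ _; exact|exact: cw].
move=> t t0; rewrite lerDl; apply: shift_op_ge0 => //; [exact: cA|exact: A0|exact: A_nd].
Qed.

(** The combination [x t - al * J (fun s => (x s)^-1) 0 t] is kept as it stands; it becomes the
    driving noise once [x] solves its Bessel equation. *)
Lemma sys_opE Y : above y Y -> let X := sys_op al be p x Y in forall t,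
  X t = x t - al * J (fun s => (x s)^-1) 0 t + p + be * J (fun s => (Y s)^-1) 0 t
        + al * J (fun s => (X s)^-1) 0 t.
Proof.
move=> yY X t; have [_ _ wE] := shift_opE al0 gx (cA yY) (A0 Y) (A_nd yY).
have ix : itg (fun s => (x s)^-1) 0 t by case: gx.
have iX := above_itg gx (sys_op_above yY) t.
by rewrite {1}/X /sys_op wE (J_B ix iX) /X /sys_op /Aof; ring.
Qed.

Lemma sys_op_neg Y t : above y Y -> t < 0 -> sys_op al be p x Y t = x t + p.
Proof.
move=> yY t0; rewrite /sys_op shift_op_neg//; first by rewrite J_lt// mulr0 addr0.
exact: cA.
Qed.

(** A larger [Y] gives an input growing more slowly, and the comparison principle transfers this to
    the heights. Composing two antitone maps gives the monotone map that is iterated below. *)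
Lemma sys_op_anti Y Y' : above y Y -> above y Y' -> (forall t, 0 <= t -> Y t <= Y' t) ->
  forall t, 0 <= t -> sys_op al be p x Y' t <= sys_op al be p x Y t.
Proof.
move=> yY yY' YY t t0; rewrite lerD2l; move: t t0.
have [cw iw wE] := shift_opE al0 gx (cA yY) (A0 Y) (A_nd yY).
have [cw' iw' wE'] := shift_opE al0 gx (cA yY') (A0 Y') (A_nd yY').
have w0 s : 0 <= s -> 0 <= shift_op al x (Aof Y) s.
  exact: (shift_op_ge0 al0 gx (cA yY) (A0 Y) (A_nd yY)).
rewrite -/(Aof Y) -/(Aof Y').
move: cw iw wE cw' iw' wE' w0.
move: (shift_op al x (Aof Y)) (shift_op al x (Aof Y')) => w w' cw iw wE cw' iw' wE' w0.
apply: (@comparison _ (Aof Y') (Aof Y) (fun s => al * ((x s)^-1 - (x s + w' s)^-1))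
   (fun s => al * ((x s)^-1 - (x s + w s)^-1)) w' w cw' cw).
- by move=> T; exact: itg_scale.
- by move=> T; exact: itg_scale.
- by move=> t t0; rewrite J_Z.
- by move=> t t0; rewrite J_Z.
- by rewrite /Aof !J_aa.
- move=> s t s0 st; rewrite /Aof.
  have iY := above_itg gy yY t; have iY' := above_itg gy yY' t.
  rewrite (J_cat s0 st iY) (J_cat s0 st iY').
  have : J (fun s => (Y' s)^-1) s t <= J (fun s => (Y s)^-1) s t.
    apply: J_le_ae; [exact: itg_sub iY'|exact: itg_sub iY|].
    apply: (ae_imp _ (above_gt0 gy yY)) => r Yr /andP[sr _].
    have r0 := le_trans s0 sr; have {}Yr := Yr r0.
    by rewrite lef_pV2 ?posrE ?YY// (lt_le_trans Yr)// YY.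
  by move=> /(ler_wpM2l be0); lra.
- case: gx => _ _ xp _; apply: (ae_imp _ xp) => s xs s0 ww; have {}xs := xs s0.
  have := w0 s s0; move=> ws0.
  apply: ler_wpM2l; first exact: ltW.
  by rewrite lerD2l lerN2 lef_pV2 ?posrE; lra.
Qed.

End op.

Section limit.
Variables (al be ga de p q : R) (x y : R -> R).
Hypotheses (al0 : 0 < al) (be0 : 0 <= be) (ga0 : 0 <= ga) (de0 : 0 < de)
  (p0 : 0 <= p) (q0 : 0 <= q) (gx : good_path x) (gy : good_path y).

(** Starting from the lowest admissible path [x], the [X]-iterates increase and the [Y]-iterates
    decrease. The [Y]-iterates are bounded below by [y], and feeding this lowest [Y] into [sys_op]
    bounds all [X]-iterates above. *)
Fixpoint sysX (k : nat) : R -> R :=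
  if k is k'.+1 then sys_op al be p x (sys_op de ga q y (sysX k')) else x.
Definition sysY k := sys_op de ga q y (sysX k).
Definition solX (t : R) : R := limn (fun k => sysX k.+1 t).
Definition solY (t : R) : R := limn (fun k => sysY k t).

Let good_above z : good_path z -> above z z.
Proof. by case. Qed.

Lemma sysX_above k : above x (sysX k).
Proof.
elim: k => [|k IH]; first exact: good_above.
exact: (sys_op_above al0 be0 p0 gx gy (sys_op_above de0 ga0 q0 gy gx IH)).
Qed.

Lemma sysY_above k : above y (sysY k).
Proof. exact: (sys_op_above de0 ga0 q0 gy gx (sysX_above k)). Qed.

Let sysX_nd k t : 0 <= t -> sysX k t <= sysX k.+1 t.
Proof.
elim: k t => [|k IH] t t0; first by have [_] := sysX_above 1; apply.
have YY s : 0 <= s -> sysY k.+1 s <= sysY k s.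
  exact (sys_op_anti de0 ga0 q0 gy gx (sysX_above k) (sysX_above k.+1) IH (t := s)).
exact (sys_op_anti al0 be0 p0 gx gy (sysY_above k.+1) (sysY_above k) YY t0).
Qed.

Let sysX_le k t : 0 <= t -> sysX k.+1 t <= sys_op al be p x y t.
Proof.
move=> t0; have [_ yY] := sysY_above k.
exact (sys_op_anti al0 be0 p0 gx gy (good_above gy) (sysY_above k) yY t0).
Qed.

Lemma solX_cvg t : (fun k => sysX k.+1 t) @ \oo --> solX t.
Proof.
have [t0|t0] := ltP t 0.
  apply/cvg_ex; exists (x t + p).
  rewrite (_ : (fun k => _) = fun=> x t + p); first exact: cvg_cst.
  by apply/funext => k; exact (sys_op_neg be p al0 gx gy (sysY_above k) t0).
apply: nondecreasing_is_cvgn; first by apply/nondecreasing_seqP => k; exact: sysX_nd.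
by exists (sys_op al be p x y t) => _ [k _ <-]; exact: sysX_le.
Qed.

Lemma solY_cvg t : (fun k => sysY k t) @ \oo --> solY t.
Proof.
have [t0|t0] := ltP t 0.
  apply/cvg_ex; exists (y t + q).
  rewrite (_ : (fun k => _) = fun=> y t + q); first exact: cvg_cst.
  by apply/funext => k; exact (sys_op_neg ga q de0 gy gx (sysX_above k) t0).
apply: nonincreasing_is_cvgn.
  apply/nonincreasing_seqP => k.
  exact (sys_op_anti de0 ga0 q0 gy gx (sysX_above k) (sysX_above k.+1) (@sysX_nd k) t0).
by exists (y t) => _ [k _ <-]; have [_] := sysY_above k; apply.
Qed.

Let solX_ge t : 0 <= t -> x t <= solX t.
Proof.
move=> t0; apply: cvgr_to_ge (@solX_cvg t) _.
by apply: nearW => k; have [_] := sysX_above k.+1; apply.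
Qed.

Let solY_ge t : 0 <= t -> y t <= solY t.
Proof.
move=> t0; apply: cvgr_to_ge (@solY_cvg t) _.
by apply: nearW => k; have [_] := sysY_above k; apply.
Qed.

Let JX T := above_cvg T gx (fun k => sysX_above k.+1) (fun t _ => @solX_cvg t).
Let JY T := above_cvg T gy sysY_above (fun t _ => @solY_cvg t).

Lemma solXE t : solX t = x t - al * J (fun s => (x s)^-1) 0 t + p
  + be * J (fun s => (solY s)^-1) 0 t + al * J (fun s => (solX s)^-1) 0 t.
Proof.
apply: cvg_unique (@solX_cvg t) _; first exact: Rhausdorff.
have -> : (fun k => sysX k.+1 t) = (fun k => x t - al * J (fun s => (x s)^-1) 0 t + p
    + be * J (fun s => (sysY k s)^-1) 0 t + al * J (fun s => (sysX k.+1 s)^-1) 0 t).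
  by apply/funext => k; exact (sys_opE al0 be0 p0 gx gy (sysY_above k) t).
apply: cvgD; last by apply: cvgMr; have [] := JX t.
by apply: cvgD; [exact: cvg_cst|apply: cvgMr; have [] := JY t].
Qed.

Lemma solYE t : solY t = y t - de * J (fun s => (y s)^-1) 0 t + q
  + ga * J (fun s => (solX s)^-1) 0 t + de * J (fun s => (solY s)^-1) 0 t.
Proof.
have Yc : (fun k => sysY k.+1 t) @ \oo --> solY t.
  exact (cvg_shift1 (u := fun k => sysY k t) (@solY_cvg t)).
apply: cvg_unique Yc _; first exact: Rhausdorff.
have -> : (fun k => sysY k.+1 t) = (fun k => y t - de * J (fun s => (y s)^-1) 0 t + q
    + ga * J (fun s => (sysX k.+1 s)^-1) 0 t + de * J (fun s => (sysY k.+1 s)^-1) 0 t).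
  by apply/funext => k; exact (sys_opE de0 ga0 q0 gy gx (sysX_above k.+1) t).
apply: cvgD; last first.
  apply: cvgMr; have [_ JYt] := JY t.
  exact (cvg_shift1 (u := fun k => J (fun s => (sysY k s)^-1) 0 t) JYt).
by apply: cvgD; [exact: cvg_cst|apply: cvgMr; have [] := JX t].
Qed.

Lemma solX_above : above x solX.
Proof.
split => //; rewrite (funext solXE) => t.
have JXc : continuous (fun t => J (fun s => (solX s)^-1) 0 t).
  by apply: J_continuous => T; have [] := JX T.
have JYc : continuous (fun t => J (fun s => (solY s)^-1) 0 t).
  by apply: J_continuous => T; have [] := JY T.
have [cx _ _ ix] := gx.
apply: cvgD; last by apply: cvgMr; exact: JXc.
apply: cvgD; last by apply: cvgMr; exact: JYc.
apply: cvgD; last exact: cvg_cst.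
by apply: cvgB; [exact: cx|apply: cvgMr; exact: J_continuous].
Qed.

Lemma solY_above : above y solY.
Proof.
split => //; rewrite (funext solYE) => t.
have JXc : continuous (fun t => J (fun s => (solX s)^-1) 0 t).
  by apply: J_continuous => T; have [] := JX T.
have JYc : continuous (fun t => J (fun s => (solY s)^-1) 0 t).
  by apply: J_continuous => T; have [] := JY T.
have [cy _ _ iy] := gy.
apply: cvgD; last by apply: cvgMr; exact: JYc.
apply: cvgD; last by apply: cvgMr; exact: JXc.
apply: cvgD; last exact: cvg_cst.
by apply: cvgB; [exact: cy|apply: cvgMr; exact: J_continuous].
Qed.

End limit.
End system.

(** * Adaptedness *)

Section G_measurable_theory.
Context {R : realType} {d : measure_display} {Omega : measurableType d}.
Variable G : set (set Omega).
Hypothesis sG : sigma_algebra setT G.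
Implicit Types f g : Omega -> R.

(** Reads measurability with respect to [G] as ordinary measurability on [Omega] equipped with the
    sigma-algebra generated by [G], which is [G] itself; all closure properties below are inherited
    in this way. *)
Lemma gmP f : G_measurable G f <-> measurable_fun [set: g_sigma_algebraType G] f.
Proof.
split=> [mf _ U mU|mf U mU].
  by rewrite setTI measurable_g_measurableTypeE//; exact: mf.
by have := mf measurableT U mU; rewrite setTI measurable_g_measurableTypeE.
Qed.

Lemma gm_cst (r : R) : G_measurable G (fun=> r).
Proof. by apply/gmP; exact: measurable_cst. Qed.
Lemma gm_add f g : G_measurable G f -> G_measurable G g -> G_measurable G (fun w => f w + g w).
Proof. by move=> /gmP mf /gmP mg; apply/gmP; exact: measurable_funD. Qed.
Lemma gm_sub f g : G_measurable G f -> G_measurable G g -> G_measurable G (fun w => f w - g w).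
Proof. by move=> /gmP mf /gmP mg; apply/gmP; exact: measurable_funB. Qed.
Lemma gm_mul f g : G_measurable G f -> G_measurable G g -> G_measurable G (fun w => f w * g w).
Proof. by move=> /gmP mf /gmP mg; apply/gmP; exact: measurable_funM. Qed.
Lemma gm_max f g : G_measurable G f -> G_measurable G g ->
  G_measurable G (fun w => Num.max (f w) (g w)).
Proof. by move=> /gmP mf /gmP mg; apply/gmP; exact: measurable_maxr. Qed.
Lemma gm_inv f : G_measurable G f -> G_measurable G (fun w => (f w)^-1).
Proof. by move=> /gmP mf; apply/gmP; apply: measurableT_comp mf; exact: measurable_invr. Qed.
Lemma gm_comp (h : R -> R) f : measurable_fun setT h -> G_measurable G f ->
  G_measurable G (fun w => h (f w)).
Proof. by move=> mh /gmP mf; apply/gmP; exact: measurableT_comp mf. Qed.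
Lemma gm_sum (I : Type) (s : seq I) (h : I -> Omega -> R) :
  (forall i, G_measurable G (h i)) -> G_measurable G (fun w => \sum_(i <- s) h i w).
Proof.
move=> mh; elim: s => [|i s IH].
  by rewrite (_ : (fun w => _) = fun=> 0); [exact: gm_cst|apply/funext => w; rewrite big_nil].
rewrite (_ : (fun w => _) = fun w => h i w + \sum_(i <- s) h i w); first exact: gm_add.
by apply/funext => w; rewrite big_cons.
Qed.
Lemma gm_cvg (f_ : nat -> Omega -> R) f : (forall n, G_measurable G (f_ n)) ->
  (forall w, f_^~ w @ \oo --> f w) -> G_measurable G f.
Proof.
move=> mf cf; apply/gmP.
apply: (@measurable_fun_cvg _ _ _ _ (f_ : nat -> g_sigma_algebraType G -> R)) => //.
by move=> n; exact/gmP.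
Qed.
Lemma gm_if (A : set Omega) f g : G A -> G_measurable G f -> G_measurable G g ->
  G_measurable G (fun w => if w \in A then f w else g w).
Proof.
move=> GA /gmP mf /gmP mg; apply/gmP.
have mA : measurable (A : set (g_sigma_algebraType G)) by rewrite measurable_g_measurableTypeE.
apply: measurable_fun_ifT => //.
by apply: (@measurable_fun_bool _ _ _ _ true) => //; rewrite setTI; rewrite (_ : _ @^-1` _ = A)//;
  apply/seteqP; split => w /=; [move/set_mem|move/mem_set].
Qed.
End G_measurable_theory.

Section adapted_theory.
Context {R : realType} {d : measure_display} {Omega : measurableType d}.
Variable H : R -> set (set Omega).
Hypothesis sH : forall t, 0 <= t -> sigma_algebra setT (H t).
Hypothesis ndH : forall s t, 0 <= s -> s <= t -> H s `<=` H t.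
Implicit Types A Z X Y : R -> Omega -> R.

Lemma adapted_le Z s t : adapted H Z -> 0 <= s -> s <= t -> G_measurable (H t) (Z s).
Proof. by move=> aZ s0 st U mU; apply: (ndH s0 st); exact: aZ. Qed.

Lemma gm_init (p : Omega -> R) t : 0 <= t -> G_measurable (H 0) p -> G_measurable (H t) p.
Proof. by move=> t0 mp U mU; apply: (ndH (lexx 0) t0); exact: mp. Qed.

(** The Riemann sums over [[0, t]] involve values of [Z] at times at most [t] only. *)
Lemma adapted_J Z : (forall w, continuous (Z^~ w)) -> adapted H Z ->
  adapted H (fun t w => J (Z^~ w) 0 t).
Proof.
move=> cZ aZ t t0.
apply: (@gm_cvg _ _ _ _ (sH t0) (fun n w => (t - 0) / n.+1%:R *
    \sum_(i < n.+1) Z (0 + (t - 0) / n.+1%:R * i%:R) w)).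
  move=> n; apply: gm_mul; [exact: sH|apply: gm_cst; exact: sH|].
  apply: gm_sum; first exact: sH.
  move=> i; apply: adapted_le => //; rewrite add0r subr0.
    by rewrite mulr_ge0// divr_ge0.
  by rewrite mulrAC ler_pdivrMr// ler_wpM2l// ler_nat ltnW.
by move=> w; apply: riemann_cvg; [exact: cZ|].
Qed.

Lemma adapted_ode A (phi : Omega -> R -> R -> R) K L :
  0 <= L -> (forall w, continuous (A^~ w)) -> adapted H A ->
  (forall w s x, `|phi w s x| <= K) ->
  (forall w s x y, x <= y -> phi w s x <= phi w s y) ->
  (forall w s x y, `|phi w s x - phi w s y| <= L * `|x - y|) ->
  (forall w u, continuous u -> continuous (fun s => phi w s (u s))) ->
  (forall Z, adapted H Z -> adapted H (fun s w => phi w s (Z s w))) ->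
  adapted H (fun t w => ode_sol (A^~ w) (phi w) K t).
Proof.
move=> L0 cA aA phiK mono lip cont ad.
have cp k w : continuous (picard (A^~ w) (phi w) K k) by apply: picard_cont => //; exact: cont.
have ap k : adapted H (fun t w => picard (A^~ w) (phi w) K k t).
  elim: k => [|k IH] t t0 /=.
    apply: gm_sub; [exact: sH|exact: aA|].
    by apply: gm_cst; exact: sH.
  apply: gm_sub; [exact: sH|exact: aA|].
  apply: (@adapted_J (fun s w => phi w s (picard (A^~ w) (phi w) K k s))) => //.
    by move=> w; apply: cont; exact: cp.
  by apply: ad.
move=> t t0; apply: (@gm_cvg _ _ _ _ (sH t0)
   (fun k w => picard (A^~ w) (phi w) K k.*2 t)); first by move=> k; exact: ap.
by move=> w; apply: ode_sol_cvg; [exact: cA|exact: phiK|exact: mono|exact: cont].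
Qed.

Lemma adapted_shift_op al X A : 0 < al ->
  (forall w, good_path (X^~ w)) -> adapted H X ->
  (forall w, continuous (A^~ w)) -> (forall w, 0 <= A 0 w) ->
  (forall w s t, 0 <= s -> s <= t -> A s w <= A t w) -> adapted H A ->
  adapted H (fun t w => shift_op al (X^~ w) (A^~ w) t).
Proof.
move=> al0 gX aX cA A0 And aA t t0.
apply: (@gm_cvg _ _ _ _ (sH t0)
  (fun n w => ode_sol (A^~ w) (pull (X^~ w) al n) (al * n.+1%:R) t)); last first.
  by move=> w; apply: shift_op_cvg => //; exact: And.
have cX w : continuous (X^~ w) by case: (gX w).
have al0' := ltW al0.
move=> n; apply: (@adapted_ode A (fun w => pull (X^~ w) al n) _ (al * n.+1%:R ^+ 2)) => //.
- by rewrite mulr_ge0// exprn_ge0.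
- by move=> w s z; exact: pull_norm.
- by move=> w s z z'; exact: pull_mono.
- by move=> w s z z'; exact: pull_lip.
- by move=> w u cu; exact: pull_cont.
- move=> Z aZ s s0; have sHs := sH s0.
  have mf : G_measurable (H s) (fun w => floorx (X^~ w) n s).
    by apply: gm_max => //; [exact: aX|exact: gm_cst].
  apply: gm_mul => //; first exact: gm_cst.
  apply: gm_sub => //; first exact: gm_inv.
  apply: gm_inv => //; apply: gm_add => //; apply: gm_max => //; [exact: aZ|exact: gm_cst].
Qed.

(** The paths [1 / Z] need not be continuous, so Riemann sums do not reach their integral. Its
    adaptedness is therefore carried along as an invariant of the iteration. *)
Definition adaptedV Z := adapted H Z /\ adapted H (fun t w => J (fun s => (Z s w)^-1) 0 t).

Lemma adapted_sys_op al be (p : Omega -> R) X Y0 Y : 0 < al -> 0 <= be -> (forall w, 0 <= p w) ->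
  G_measurable (H 0) p ->
  (forall w, good_path (X^~ w)) -> (forall w, good_path (Y0^~ w)) ->
  (forall w, above (Y0^~ w) (Y^~ w)) -> adaptedV X -> adaptedV Y ->
  adaptedV (fun t w => sys_op al be (p w) (X^~ w) (Y^~ w) t).
Proof.
move=> al0 be0 p0 mp gX gY yY [aX aJX] [aY aJY].
have iY w T : itg (fun s => (Y s w)^-1) 0 T by apply: (above_itg (gY w)); exact: yY.
have aA : adapted H (fun t w => p w + be * J (fun s => (Y s w)^-1) 0 t).
  move=> t t0; have sHt := sH t0; apply: gm_add => //; first exact: gm_init.
  by apply: gm_mul => //; [exact: gm_cst|exact: aJY].
have aW : adapted H (fun t w => sys_op al be (p w) (X^~ w) (Y^~ w) t).
  move=> t t0; apply: gm_add; [exact: sH|exact: aX|].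
  apply: (@adapted_shift_op al X (fun t w => p w + be * J (fun s => (Y s w)^-1) 0 t)) => //.
  - move=> w r; apply: cvgD; first exact: cvg_cst.
    by apply: cvgMr; apply: J_continuous.
  - by move=> w; rewrite J_aa mulr0 addr0.
  - move=> w s r s0 sr; rewrite lerD2l; apply: ler_wpM2l => //; apply: J_ndecr => //.
    move=> v /andP[sv _]; rewrite invr_ge0; have v0 := le_trans s0 sv.
    by have [_ /(_ _ v0)] := yY w; apply: le_trans; case: (gY w).
split => // t t0.
(* The path equation is solved for the integral of [1 / X], which expresses it through quantities
   already known to be adapted. *)
have E w : J (fun s => (sys_op al be (p w) (X^~ w) (Y^~ w) s)^-1) 0 t =
  al^-1 * (sys_op al be (p w) (X^~ w) (Y^~ w) t - X t w + al * J (fun s => (X s w)^-1) 0 t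
     - p w - be * J (fun s => (Y s w)^-1) 0 t).
  have := sys_opE al0 be0 (p0 w) (gX w) (gY w) (yY w) t => /= ->.
  by field; rewrite gt_eqF.
rewrite (funext E).
have sHt := sH t0.
apply: gm_mul => //; first exact: gm_cst.
apply: gm_sub => //; last by apply: gm_mul => //; [exact: gm_cst|exact: aJY].
apply: gm_sub => //; last exact: gm_init.
apply: gm_add => //; last by apply: gm_mul => //; [exact: gm_cst|exact: aJX].
by apply: gm_sub => //; [exact: aW|exact: aX].
Qed.

Lemma adapted_sol al be ga de (p q : Omega -> R) X Y :
  0 < al -> 0 <= be -> 0 <= ga -> 0 < de -> (forall w, 0 <= p w) -> (forall w, 0 <= q w) ->
  G_measurable (H 0) p -> G_measurable (H 0) q ->
  (forall w, good_path (X^~ w)) -> (forall w, good_path (Y^~ w)) -> adaptedV X -> adaptedV Y ->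
  adapted H (fun t w => solX al be ga de (p w) (q w) (X^~ w) (Y^~ w) t) /\
  adapted H (fun t w => solY al be ga de (p w) (q w) (X^~ w) (Y^~ w) t).
Proof.
move=> al0 be0 ga0 de0 p0 q0 mp mq gX gY aX aY.
pose sX k t w := sysX al be ga de (p w) (q w) (X^~ w) (Y^~ w) k t.
have abX k w : above (X^~ w) (fun t => sX k t w) by exact: sysX_above.
have abY k w : above (Y^~ w) (fun t => sysY al be ga de (p w) (q w) (X^~ w) (Y^~ w) k t).
  exact: sysY_above.
have aS k : adaptedV (sX k) ->
    adaptedV (fun t w => sysY al be ga de (p w) (q w) (X^~ w) (Y^~ w) k t).
  by move=> aK; apply: (@adapted_sys_op de ga q Y X (sX k)).
have asX k : adaptedV (sX k).
  elim: k => [|k IH]; first exact aX.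
  exact (adapted_sys_op al0 be0 p0 mp gX gY (abY k) aX (aS k IH)).
split=> t t0.
  apply: (@gm_cvg _ _ _ _ (sH t0) (fun k w => sX k.+1 t w)).
    by move=> k; exact ((asX k.+1).1 t t0).
  by move=> w; exact (@solX_cvg _ _ _ _ _ _ _ _ _ al0 be0 ga0 de0 (p0 w) (q0 w) (gX w) (gY w) t).
apply: (@gm_cvg _ _ _ _ (sH t0)
  (fun k w => sysY al be ga de (p w) (q w) (X^~ w) (Y^~ w) k t)).
  by move=> k; exact ((aS k (asX k)).1 t t0).
by move=> w; exact (@solY_cvg _ _ _ _ _ _ _ _ _ al0 be0 ga0 de0 (p0 w) (q0 w) (gX w) (gY w) t).
Qed.
End adapted_theory.

(** * Pathwise uniqueness *)

Section uniqueness.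
Context {R : realType}.
Notation mu := (@lebesgue_measure R).

(** A Tanaka formula without local time, for a path of bounded variation. On a fine partition, a
    cell that ends away from 0 keeps the sign of [Z], and there [u] pushes [Z] towards 0 with full
    strength. The other cells lie where [Z] is small; their contribution vanishes with the mesh
    because [u = 0] where [Z = 0]. *)
Lemma abs_drift_le (al be a b : R) (Z u v : R -> R) : 0 <= al -> 0 <= be -> a <= b ->
  continuous Z -> itg u a b -> itg v a b ->
  (forall t, a <= t <= b -> Z t = Z a + al * J u a t + be * J v a t) ->
  {ae mu, forall r, a <= r <= b -> [/\ 0 < Z r -> u r <= 0, Z r < 0 -> 0 <= u r &
     Z r = 0 -> u r = 0]} ->
  `|Z b| <= `|Z a| - al * J (fun r => `|u r|) a b + be * J (fun r => `|v r|) a b.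
Proof.
move=> al0 be0 ab cZ iu iv ZE sgn.
have iau := itg_norm iu; have iav := itg_norm iv.
(* A continuous majorant of the indicator of [|Z r| < 2 e]: it is at least 1 there because then
   [Z r ^+ 2 <= 4 e ^+ 2], at most 5 everywhere, and tends to 0 with [e] wherever [Z r] is
   nonzero. *)
pose c (e r : R) : R := 5 * e ^+ 2 / (e ^+ 2 + Z r ^+ 2).
have cc e : 0 < e -> continuous (c e).
  move=> e0 r; apply: cvgM; first exact: cvg_cst.
  apply: cvgV; first by rewrite gt_eqF// ltr_wpDr ?sqr_ge0// exprn_gt0.
  apply: cvgD; first exact: cvg_cst.
  by have := @exprn_continuous R 2 (Z r); apply: continuous_comp; exact: cZ.
have c0 e r : 0 < e -> 0 <= c e r.
  by move=> e0; rewrite /c divr_ge0// ?addr_ge0 ?sqr_ge0// mulr_ge0// sqr_ge0.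
have c5 e r : 0 < e -> c e r <= 5.
  move=> e0; have e2 : 0 < e ^+ 2 by rewrite exprn_gt0.
  have z2 := sqr_ge0 (Z r).
  by rewrite /c ler_pdivrMr ?ltr_wpDr//; lra.
have c1 e r : 0 < e -> `|Z r| < 2 * e -> 1 <= c e r.
  move=> e0 Zr; have e2 : 0 < e ^+ 2 by rewrite exprn_gt0.
  have z2 := sqr_ge0 (Z r).
  have : Z r ^+ 2 <= 4 * e ^+ 2.
    have -> : 4 * e ^+ 2 = (2 * e) ^+ 2 by ring.
    rewrite -(ger0_norm z2) normrX ler_pXn2r ?nnegrE//; first exact: ltW.
    by rewrite mulr_ge0// ltW.
  by move=> ?; rewrite /c ler_pdivlMr ?ltr_wpDr//; lra.
have icu e : 0 < e -> itg (fun r => c e r * `|u r|) a b.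
  move=> e0; apply: (@itg_le _ _ (fun r => 5 * `|u r|)); last exact: itg_scale.
    apply: measurable_funM; last exact: itg_meas.
    by apply: itg_meas; apply: itg_cont; exact: cc.
  move=> r _; rewrite normrM normr_id ler_wpM2r//.
  by rewrite ger0_norm ?c0// c5.
have step e : 0 < e -> `|Z b| <= `|Z a| - al * J (fun r => `|u r|) a b
     + be * J (fun r => `|v r|) a b + 2 * al * J (fun r => c e r * `|u r|) a b.
  move=> e0.
  have [h h0 hh] := unif_cont a b cZ e0.
  have [n nh] : exists n : nat, (b - a) / n.+1%:R < h.
    exists (Num.truncn ((b - a) / h)).
    by rewrite ltr_pdivrMr// mulrC -ltr_pdivrMr// truncnS_gt.
  set k := (b - a) / n.+1%:R in nh.
  have k0 : 0 <= k by rewrite divr_ge0// subr_ge0.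
  pose s i : R := a + k * i%:R.
  have ss i : s i.+1 = s i + k by rewrite /s -natr1; ring.
  have sa i : a <= s i by rewrite /s lerDl mulr_ge0.
  have sb i : (i <= n.+1)%N -> s i <= b.
    move=> ik; rewrite /s -lerBrDl -[leRHS](@mulfVK _ (n.+1%:R : R)) ?pnatr_eq0//.
    by apply: ler_wpM2l => //; rewrite ler_nat.
  suff main i : (i <= n.+1)%N -> `|Z (s i)| <= `|Z a| - al * J (fun r => `|u r|) a (s i)
      + be * J (fun r => `|v r|) a (s i) + 2 * al * J (fun r => c e r * `|u r|) a (s i).
    have := main n.+1 (leqnn _).
    by have -> : s n.+1 = b by rewrite /s /k mulfVK ?pnatr_eq0//; ring.
  elim: i => [|i IH] ik.
    by rewrite /s mulr0 addr0 !J_aa !mulr0 subr0 !addr0.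
  have {}IH := IH (ltnW ik).
  have si : s i <= s i.+1 by rewrite ss lerDl.
  have sbi := sb _ ik.
  have sub f : itg f a b -> itg f a (s i.+1) by apply: itg_sub.
  have sub' f : itg f a b -> itg f (s i) (s i.+1) by apply: itg_sub.
  rewrite (J_cat (sa i) si (sub _ iau)) (J_cat (sa i) si (sub _ iav)).
  rewrite (J_cat (sa i) si (sub _ (icu _ e0))).
  have Zi : Z (s i.+1) - Z (s i) = al * J u (s i) (s i.+1) + be * J v (s i) (s i.+1).
    rewrite (ZE (s i.+1)) ?sa ?sbi// (ZE (s i)) ?sa ?(le_trans si)//.
    by rewrite (J_cat (sa i) si (sub _ iu)) (J_cat (sa i) si (sub _ iv)); ring.
  have near r : s i <= r <= s i.+1 -> `|Z (s i.+1) - Z r| < e.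
    move=> /andP[r1 r2]; apply: hh; first by rewrite sa sbi.
    by rewrite ger0_norm ?subr_ge0//; apply: le_lt_trans nh; rewrite ss in r2 *; lra.
  have cu0 : 0 <= J (fun r => c e r * `|u r|) (s i) (s i.+1).
    by apply: J_ge0 => r _; rewrite mulr_ge0// c0.
  have Jv : `|J v (s i) (s i.+1)| <= J (fun r => `|v r|) (s i) (s i.+1).
    exact: J_norm (sub' _ iv).
  have beJv : be * `|J v (s i) (s i.+1)| <= be * J (fun r => `|v r|) (s i) (s i.+1).
    exact: ler_wpM2l.
  have bev : `|be * J v (s i) (s i.+1)| = be * `|J v (s i) (s i.+1)|.
    by rewrite normrM (ger0_norm be0).
  have al2 : 0 <= al * J (fun r => c e r * `|u r|) (s i) (s i.+1) by rewrite mulr_ge0.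
  (* In a cell ending near 0 the sign of [u] gives nothing. The term in [u] is charged to the cutoff
     twice, once for a possible increase of [|Z|] and once for the decrease that is claimed; this is
     the factor 2. *)
  have [small|large] := ltP `|Z (s i.+1)| e.
    have : J (fun r => `|u r|) (s i) (s i.+1) <= J (fun r => c e r * `|u r|) (s i) (s i.+1).
      apply: J_le; [exact: sub'|exact/sub'/icu|move=> r rs].
      rewrite ler_peMl//; apply: c1 => //.
      have := near r rs; rewrite distrC => nr.
      have := ler_normD (Z r - Z (s i.+1)) (Z (s i.+1)); rewrite subrK; lra.
    move=> /(ler_wpM2l al0) H1.
    have Ju : `|J u (s i) (s i.+1)| <= J (fun r => `|u r|) (s i) (s i.+1).
      exact: J_norm (sub' _ iu).
    have : al * `|J u (s i) (s i.+1)| <= al * J (fun r => `|u r|) (s i) (s i.+1).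
      exact: ler_wpM2l.
    have : `|Z (s i.+1)| <= `|Z (s i)| + `|Z (s i.+1) - Z (s i)|.
      by have := ler_normD (Z (s i)) (Z (s i.+1) - Z (s i)); rewrite addrC subrK.
    rewrite Zi; have := ler_normD (al * J u (s i) (s i.+1)) (be * J v (s i) (s i.+1)).
    rewrite bev normrM (ger0_norm al0); lra.
  have Jvb := ler_norm (be * J v (s i) (s i.+1)).
  have Jvb' : - (be * J v (s i) (s i.+1)) <= `|be * J v (s i) (s i.+1)|.
    by rewrite -normrN ler_norm.
  rewrite bev in Jvb Jvb'.
  have iu' := sub' _ iu; have iau' := sub' _ iau.
  have sgn' : {ae mu, forall r, s i <= r <= s i.+1 -> [/\ 0 < Z r -> u r <= 0, Z r < 0 -> 0 <= u r &
     Z r = 0 -> u r = 0]}.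
    apply: (ae_imp _ sgn) => r sr /andP[r1 r2]; apply: sr.
    by rewrite (le_trans (sa i) r1) (le_trans r2 sbi).
  have [Zp|Zn] := leP 0 (Z (s i.+1)).
    have : J (fun r => `|u r|) (s i) (s i.+1) <= J (fun r => (-1) * u r) (s i) (s i.+1).
      apply: J_le_ae => //; first exact: itg_scale.
      apply: (ae_imp _ sgn') => r sr rs; have [sp _ _] := sr rs.
      rewrite ler0_norm ?mulN1r//; apply: sp.
      by have := near r rs; rewrite ger0_norm// in large => /ltr_normlP[]; lra.
    rewrite J_Z// mulN1r => /(ler_wpM2l al0).
    have := ler_norm (Z (s i)); rewrite (ger0_norm Zp); lra.
  have : J (fun r => `|u r|) (s i) (s i.+1) <= J u (s i) (s i.+1).
    apply: J_le_ae => //.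
    apply: (ae_imp _ sgn') => r sr rs; have [_ sp _] := sr rs.
    rewrite ger0_norm//; apply: sp.
    by have := near r rs; rewrite ltr0_norm// in large => /ltr_normlP[]; lra.
  move=> /(ler_wpM2l al0).
  have := ler_norm (- Z (s i)); rewrite normrN (ltr0_norm Zn); lra.
have [_ lim0] : itg (fun=> 0 : R) a b /\
   (fun n : nat => J (fun r => c n.+1%:R^-1 r * `|u r|) a b) @ \oo --> J (fun=> 0) a b.
  apply: (@J_dct _ _ _ (fun r => 5 * `|u r|)).
  - by move=> n; apply: itg_meas; apply: icu; rewrite invr_gt0.
  - exact: measurable_cst.
  - apply: (ae_imp _ sgn) => r sr rab; have [_ _ s0] := sr rab.
    have [Z0|Z0] := eqVneq (Z r) 0.
      by rewrite s0// normr0; under eq_fun do rewrite mulr0; exact: cvg_cst.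
    have -> : 0 = 5 * 0 ^+ 2 / (0 ^+ 2 + Z r ^+ 2) * `|u r| :> R by rewrite expr0n/= mulr0 !mul0r.
    have h2 : (fun n : nat => n.+1%:R^-1 ^+ 2 : R) @ \oo --> (0 ^+ 2 : R).
      by rewrite expr2; under eq_fun do rewrite expr2; apply: cvgM; exact: cvg_harmonic.
    apply: cvgMl; apply: cvgM; first exact: cvgMr.
    apply: cvgV; first by rewrite expr0n/= add0r expf_neq0.
    by apply: cvgD => //; exact: cvg_cst.
  - exact: itg_scale.
  - apply: aeW => r n _; rewrite normrM normr_id ler_wpM2r//.
    by rewrite ger0_norm ?c0 ?c5// invr_gt0.
rewrite J_cst// mul0r in lim0.
have : (fun n : nat => `|Z a| - al * J (fun r => `|u r|) a b + be * J (fun r => `|v r|) a b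
   + 2 * al * J (fun r => c n.+1%:R^-1 r * `|u r|) a b) @ \oo -->
   `|Z a| - al * J (fun r => `|u r|) a b + be * J (fun r => `|v r|) a b + 2 * al * 0.
  by apply: cvgD; [exact: cvg_cst|exact: cvgMr].
rewrite mulr0 addr0 => /cvgr_to_ge; apply.
by apply: nearW => n; apply: step; rewrite invr_gt0.
Qed.

(* [b] and [c] carry the initial values; [t < 0] is immaterial. *)
Definition det_sol (al be ga de : R) (b c X Y : R -> R) : Prop :=
  [/\ continuous X /\ continuous Y, (forall t, 0 <= t -> 0 <= X t /\ 0 <= Y t),
   {ae mu, forall s, 0 <= s -> 0 < X s /\ 0 < Y s},
   (forall T, itg (fun s => (X s)^-1) 0 T /\ itg (fun s => (Y s)^-1) 0 T) &
   forall t, 0 <= t ->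
     X t = b t + al * J (fun s => (X s)^-1) 0 t + be * J (fun s => (Y s)^-1) 0 t /\
     Y t = c t + ga * J (fun s => (X s)^-1) 0 t + de * J (fun s => (Y s)^-1) 0 t].

Lemma det_sol_swap al be ga de b c X Y :
  det_sol al be ga de b c X Y -> det_sol de ga be al c b Y X.
Proof.
move=> [[cX cY] ge0 pos ig E]; split => //.
- by move=> t t0; have [] := ge0 t t0.
- by apply: (ae_imp _ pos) => s h s0; have [] := h s0.
- by move=> T; have [] := ig T.
- by move=> t t0; have [XE YE] := E t t0; rewrite {1}XE {1}YE; split; ring.
Qed.

Lemma inv_diff_sign (x y : R) : 0 < x -> 0 < y -> [/\ 0 < x - y -> x^-1 - y^-1 <= 0,
  x - y < 0 -> 0 <= x^-1 - y^-1 & x - y = 0 -> x^-1 - y^-1 = 0].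
Proof.
move=> x0 y0; split.
- by move=> xy; rewrite subr_le0 lef_pV2 ?posrE//; lra.
- by move=> xy; rewrite subr_ge0 lef_pV2 ?posrE//; lra.
- by move=> /eqP; rewrite subr_eq0 => /eqP ->; rewrite subrr.
Qed.

Section two_solutions.
Variables (al be ga de : R) (b c X Y X' Y' : R -> R).
Hypotheses (al0 : 0 < al) (be0 : 0 <= be) (ga0 : 0 <= ga) (de0 : 0 < de).
Hypotheses (S : det_sol al be ga de b c X Y) (S' : det_sol al be ga de b c X' Y').

Let u s := (X s)^-1 - (X' s)^-1.
Let v s := (Y s)^-1 - (Y' s)^-1.

Lemma diff_itg a t : 0 <= a -> itg u a t /\ itg v a t.
Proof.
move=> a0; have [_ _ _ ig _] := S; have [_ _ _ ig' _] := S'.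
have [iX iY] := ig t; have [iX' iY'] := ig' t.
by split; apply: itg_subr; (apply: itg_sub; [exact: a0|exact: lexx|]).
Qed.

(** As [1 / x] is decreasing, the self-drift difference [u] always has the sign opposite to
    [X - X'], so it contributes with a minus sign; nothing is known about the sign of [v], which is
    bounded in absolute value. *)
Lemma diffX_le a t : 0 <= a -> a <= t ->
  `|X t - X' t| <= `|X a - X' a| - al * J (fun r => `|u r|) a t + be * J (fun r => `|v r|) a t.
Proof.
move=> a0 at_; have [[cX _] _ pos ig E] := S; have [[cX' _] _ pos' ig' E'] := S'.
have [iu iv] := diff_itg t a0.
apply: (@abs_drift_le al be a t (fun t => X t - X' t)) => //; first exact: ltW.
- by move=> s; apply: cvgB; [exact: cX|exact: cX'].
- move=> s /andP[as_ st]; have s0 := le_trans a0 as_.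
  have [XE _] := E s s0; have [XE' _] := E' s s0.
  have [XEa _] := E a a0; have [XEa' _] := E' a a0.
  have [iX iY] := ig s; have [iX' iY'] := ig' s.
  have sub f : itg f 0 s -> itg f a s by apply: itg_sub.
  rewrite XE XE' XEa XEa' /u /v (J_B (sub _ iX) (sub _ iX')) (J_B (sub _ iY) (sub _ iY')).
  by rewrite !(J_cat a0 as_)//; ring.
- apply: ae_imp2 pos pos' => r h h' /andP[ar _].
  have r0 := le_trans a0 ar.
  by have [xr _] := h r0; have [xr' _] := h' r0; exact: inv_diff_sign.
Qed.
End two_solutions.

Lemma diffY_le al be ga de b c X Y X' Y' a t : 0 < de -> 0 <= ga ->
  det_sol al be ga de b c X Y -> det_sol al be ga de b c X' Y' ->
  0 <= a -> a <= t ->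
  `|Y t - Y' t| <= `|Y a - Y' a| + ga * J (fun r => `|(X r)^-1 - (X' r)^-1|) a t
     - de * J (fun r => `|(Y r)^-1 - (Y' r)^-1|) a t.
Proof.
move=> de0 ga0 S S' a0 at_.
by have := diffX_le de0 ga0 (det_sol_swap S) (det_sol_swap S') a0 at_; lra.
Qed.

Lemma det_sol_init al be ga de b c X Y X' Y' :
  det_sol al be ga de b c X Y -> det_sol al be ga de b c X' Y' -> X 0 = X' 0 /\ Y 0 = Y' 0.
Proof.
move=> [_ _ _ _ E] [_ _ _ _ E'].
have [X0 Y0] := E 0 (lexx 0); have [X0' Y0'] := E' 0 (lexx 0).
by rewrite X0 Y0 X0' Y0' !J_aa.
Qed.

Lemma det_unique_monotone al be ga de b c X Y X' Y' :
  0 < al -> 0 <= be -> 0 <= ga -> 0 < de -> be * ga <= al * de ->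
  det_sol al be ga de b c X Y -> det_sol al be ga de b c X' Y' ->
  forall t, 0 <= t -> X t = X' t /\ Y t = Y' t.
Proof.
move=> al0 be0 ga0 de0 D S S' t t0.
have := diffX_le al0 be0 S S' (lexx 0) t0.
have := diffY_le de0 ga0 S S' (lexx 0) t0.
have [-> ->] := det_sol_init S S'; rewrite !subrr !normr0.
have : 0 <= J (fun r => `|(X r)^-1 - (X' r)^-1|) 0 t by apply: J_ge0.
have : 0 <= J (fun r => `|(Y r)^-1 - (Y' r)^-1|) 0 t by apply: J_ge0.
set V := J (fun r => `|(Y r)^-1 - (Y' r)^-1|) 0 t.
set U := J (fun r => `|(X r)^-1 - (X' r)^-1|) 0 t => V0 U0 H1 H2.
have Z0 := normr_ge0 (X t - X' t); have W0 := normr_ge0 (Y t - Y' t).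
set Z := `|X t - X' t| in H2 Z0; set W := `|Y t - Y' t| in H1 W0.
(* With the weights [de + ga] and [al + be], the integrals [U] and [V] both appear with coefficient
   [be * ga - al * de], which is nonpositive. *)
have key : (de + ga) * Z + (al + be) * W <= 0 by nra.
have Ze : Z = 0 by nra.
have We : W = 0 by nra.
by move/normr0P: Ze; move/normr0P: We; rewrite !subr_eq0 => /eqP -> /eqP ->.
Qed.

(** The set of [s] such that [f] vanishes on [[0, s]] is closed by continuity and open to the right
    by assumption, so its supremum below [t] can only be [t]. *)
Lemma zero_extend (f : R -> R) : continuous f -> f 0 = 0 ->
  (forall s, 0 <= s -> (forall r, 0 <= r <= s -> f r = 0) ->
     exists2 h, 0 < h & forall r, s <= r <= s + h -> f r = 0) ->
  forall t, 0 <= t -> f t = 0.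
Proof.
move=> cf f0 ext t t0; apply: contrapT => /eqP ft.
pose E := [set s | 0 <= s <= t /\ forall r, 0 <= r <= s -> f r = 0].
have E0 : E 0.
  by split; [rewrite lexx|move=> r /andP[r0 r0']; have -> : r = 0 by apply/eqP; rewrite eq_le r0 r0'].
have hE : has_sup E by split; [exists 0|exists t => s [/andP[]]].
pose s := sup E.
have s0 : 0 <= s by apply: sup_upper_bound.
have st : s <= t by apply: ge_sup => [|x [/andP[]]//]; exists 0.
have below r : 0 <= r -> r < s -> f r = 0.
  move=> r0 rs; have e0 : 0 < s - r by rewrite subr_gt0.
  have [x [_ fx] xs] := sup_adherent e0 hE.
  by apply: fx; rewrite r0/=; move: xs; rewrite -/s; lra.
have fs : f s = 0.
  apply: contrapT => /eqP fs0.
  have s0' : 0 < s by rewrite lt_neqAle s0 andbT; apply: contra_neq fs0 => <-.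
  have ns : 0 < `|f s| by rewrite normr_gt0.
  have /cvgrPdist_lt /(_ _ ns) [h /= h0 hh] := cf s.
  pose r := Num.max 0 (s - h / 2).
  have r0 : 0 <= r by rewrite le_max lexx.
  have rs : r < s by rewrite gt_max s0' ltrBlDr ltrDl divr_gt0.
  have sr : s - h / 2 <= r by rewrite le_max lexx orbT.
  have : `|f s - f r| < `|f s| by apply: hh; rewrite /= gtr0_norm ?subr_gt0//; lra.
  by rewrite (below r)// subr0 ltxx.
have all0 r : 0 <= r <= s -> f r = 0.
  by move=> /andP[r0]; rewrite le_eqVlt => /predU1P[->//|]; exact: below.
have [h h0 hh] := ext s s0 all0.
have slt : s < t.
  by rewrite lt_neqAle st andbT; apply: contra_neq ft => <-.
pose r := Num.min t (s + h).
have sr : s < r by rewrite lt_min slt ltrDl.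
have : E r.
  split; first by rewrite ge_min lexx andbT (le_trans s0)// ltW.
  move=> x /andP[x0 xr]; have [xs|sx] := leP x s; first by apply: all0; rewrite x0.
  apply: hh; rewrite (ltW sx)/= (le_trans xr)//.
  by rewrite ge_min lexx orbT.
by move=> Er; have := sup_upper_bound hE Er; rewrite leNgt -/s sr.
Qed.

(** With the weights [de] and [be], the integral of [|1 / Y - 1 / Y'|] cancels between the two
    estimates, and the remaining positive term is [be * ga] times the integral of
    [|1 / X - 1 / X'|]. Near a time with [X > 0] the inverse is Lipschitz in [X], and Gronwall
    applies. *)
Lemma det_unique_local al be ga de b c X Y X' Y' s :
  0 < al -> 0 <= be -> 0 <= ga -> 0 < de ->
  det_sol al be ga de b c X Y -> det_sol al be ga de b c X' Y' ->
  0 <= s -> X s = X' s -> Y s = Y' s -> 0 < X s ->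
  exists2 h, 0 < h & forall r, s <= r <= s + h -> X r = X' r /\ Y r = Y' r.
Proof.
move=> al0 be0 ga0 de0 S S' s0 Xs Ys Xp.
have [[cX cY] _ _ _ _] := S; have [[cX' cY'] _ _ _ _] := S'.
pose e := X s / 2.
have e0 : 0 < e by rewrite divr_gt0.
have eX : e < X s by rewrite /e; lra.
have [h h0 hh] : exists2 h, 0 < h & forall r, s <= r <= s + h -> e <= X r /\ e <= X' r.
  have /cvgr_gt /(_ _ eX) [h1 /= h10 hh1] := cX s.
  have eX' : e < X' s by rewrite -Xs.
  have /cvgr_gt /(_ _ eX') [h2 /= h20 hh2] := cX' s.
  pose h := Num.min h1 h2 / 2.
  have m0 : 0 < Num.min h1 h2 by rewrite lt_min h10.
  have m1 : Num.min h1 h2 <= h1 by rewrite ge_min lexx.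
  have m2 : Num.min h1 h2 <= h2 by rewrite ge_min lexx orbT.
  exists h; first by rewrite divr_gt0.
  rewrite /h => r /andP[r1 r2].
  by split; apply: ltW; [apply: hh1|apply: hh2]; rewrite /= distrC ger0_norm; lra.
exists h => //.
pose K := be * ga / e ^+ 2 / de.
have e2 : 0 < e ^+ 2 by rewrite exprn_gt0.
have K0 : 0 <= K by rewrite /K !divr_ge0 ?mulr_ge0// ltW.
have cPhi : continuous (fun r => de * `|X r - X' r| + be * `|Y r - Y' r|).
  move=> r; apply: cvgD; apply: cvgMr; apply: cvg_norm; apply: cvgB;
    [exact: cX|exact: cX'|exact: cY|exact: cY'].
have ub r : s <= r <= s + h -> `|(X r)^-1 - (X' r)^-1| <= `|X r - X' r| / e ^+ 2.
  move=> /hh [x1 x2]; have xr : 0 < X r by lra.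
  have xr' : 0 < X' r by lra.
  have -> : (X r)^-1 - (X' r)^-1 = (X r)^-1 * (X' r)^-1 * (X' r - X r).
    by field; rewrite !gt_eqF.
  have xx : 0 < (X r)^-1 * (X' r)^-1 by rewrite mulr_gt0 ?invr_gt0.
  rewrite normrM mulrC distrC ler_wpM2l// gtr0_norm//.
  by rewrite -invfM lef_pV2 ?posrE ?mulr_gt0// expr2; nra.
have Phi0 : forall r, s <= r <= s + h -> de * `|X r - X' r| + be * `|Y r - Y' r| = 0.
  apply: (@gronwall _ _ K) => //.
    by move=> t _; rewrite addr_ge0// mulr_ge0// ltW.
  move=> t /andP[st th].
  have [iu iv] := diff_itg S S' t s0.
  have HX := diffX_le al0 be0 S S' s0 st.
  have HY := diffY_le de0 ga0 S S' s0 st.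
  rewrite Xs Ys !subrr !normr0 in HX HY.
  have : be * ga * J (fun r => `|(X r)^-1 - (X' r)^-1|) s t <=
     K * J (fun r => de * `|X r - X' r| + be * `|Y r - Y' r|) s t.
    rewrite -!J_Z; [|exact: itg_cont|exact: itg_norm].
    apply: J_le; [exact/itg_scale/itg_norm|exact/itg_scale/itg_cont|].
    move=> r /andP[sr rt]; have := ub r; rewrite sr (le_trans rt th) => /(_ isT) ubr.
    apply: (@le_trans _ _ (be * ga * (`|X r - X' r| / e ^+ 2))).
      by apply: ler_wpM2l => //; rewrite mulr_ge0.
    have -> : be * ga * (`|X r - X' r| / e ^+ 2) = K * (de * `|X r - X' r|).
      by rewrite /K; field; rewrite !gt_eqF.
    by apply: ler_wpM2l => //; rewrite lerDl mulr_ge0.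
  have : 0 <= J (fun r => `|(X r)^-1 - (X' r)^-1|) s t by apply: J_ge0.
  move: HX HY; set U := J (fun r => `|(X r)^-1 - (X' r)^-1|) s t.
  set V := J (fun r => `|(Y r)^-1 - (Y' r)^-1|) s t; set W := K * _ => HX HY.
  move: HX => /(ler_wpM2l (ltW de0)); move: HY => /(ler_wpM2l be0).
  have := mulr_ge0 (ltW al0) (ltW de0) => ad HY HX U0 UW.
  have := mulr_ge0 ad U0; lra.
have XX r : s <= r <= s + h -> X r = X' r.
  move=> rs; have := Phi0 r rs => P0.
  have : `|X r - X' r| = 0.
    have := normr_ge0 (X r - X' r); have := mulr_ge0 be0 (normr_ge0 (Y r - Y' r)).
    by move: P0; nra.
  by move=> /normr0P; rewrite subr_eq0 => /eqP.
(* Since [be] may be 0, the weighted sum controls only [X]. Once [X = X'] is known, the estimate for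
   [Y] has no positive term left. *)
move=> r /andP[sr rh]; split; first by apply: XX; rewrite sr.
have := diffY_le de0 ga0 S S' s0 sr; rewrite Ys subrr normr0.
have -> : J (fun r => `|(X r)^-1 - (X' r)^-1|) s r = J (fun=> 0) s r.
  by apply: J_eq => x /andP[x1 x2]; rewrite XX ?subrr ?normr0// x1 (le_trans x2).
rewrite J_cst// mul0r mulr0.
have : 0 <= de * J (fun r => `|(Y r)^-1 - (Y' r)^-1|) s r.
  by rewrite mulr_ge0 ?(ltW de0)//; apply: J_ge0.
move=> H1 H2; have : `|Y r - Y' r| <= 0 by lra.
by rewrite normr_le0 subr_eq0 => /eqP.
Qed.

(** Avoidance of the corner is asked of one solution only, which fits its use: the constructed
    solution is compared with an arbitrary one. Where the two agree, one common coordinate is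
    positive, and local uniqueness applies, after exchanging coordinates if necessary. *)
Lemma det_unique_off_corner al be ga de b c X Y X' Y' :
  0 < al -> 0 <= be -> 0 <= ga -> 0 < de ->
  det_sol al be ga de b c X Y -> det_sol al be ga de b c X' Y' ->
  (forall t, 0 <= t -> ~ (X t = 0 /\ Y t = 0)) ->
  forall t, 0 <= t -> X t = X' t /\ Y t = Y' t.
Proof.
move=> al0 be0 ga0 de0 S S' off.
have [[cX cY] ge0 _ _ _] := S; have [[cX' cY'] _ _ _ _] := S'.
have [X0 Y0] := det_sol_init S S'.
have z r : `|X r - X' r| + `|Y r - Y' r| = 0 <-> X r = X' r /\ Y r = Y' r.
  split=> [/eqP|[-> ->]]; last by rewrite !subrr !normr0 addr0.
  by rewrite paddr_eq0// !normr_eq0 !subr_eq0 => /andP[/eqP -> /eqP ->].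
suff f0 t : 0 <= t -> `|X t - X' t| + `|Y t - Y' t| = 0 by move=> t t0; apply/z/f0.
move: t; apply: zero_extend.
- move=> r; apply: cvgD; apply: cvg_norm; apply: cvgB;
    [exact: cX|exact: cX'|exact: cY|exact: cY'].
- exact/z.
move=> s s0 fs.
have [Xs Ys] : X s = X' s /\ Y s = Y' s by apply/z/fs; rewrite s0 lexx.
have [Xs0 Ys0] := ge0 s s0.
have [Xp|Xn] := ltP 0 (X s).
  have [h h0 hh] := det_unique_local al0 be0 ga0 de0 S S' s0 Xs Ys Xp.
  by exists h => // r /hh /z.
have Yp : 0 < Y s.
  rewrite lt_neqAle Ys0 andbT; apply/eqP => Y00; apply: (off s s0); split => //.
  by apply/eqP; rewrite eq_le Xn.
have [h h0 hh] := det_unique_local de0 ga0 be0 al0 (det_sol_swap S) (det_sol_swap S') s0 Ys Xs Yp.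
by exists h => // r /hh [? ?]; apply/z.
Qed.

End uniqueness.

(** * Moments from characteristic functions *)

Section calculus.
Context {R : realType}.

Lemma lip_of_derive (f df : R -> R) (K : R) : (forall x : R, is_derive x 1 f (df x)) ->
  (forall x, `|df x| <= K) -> forall a b, `|f b - f a| <= K * `|b - a|.
Proof.
move=> fd dK.
have cf : continuous f.
  by move=> x; apply: differentiable_continuous; apply/derivable1_diffP; have [] := fd x.
have main a b : a <= b -> `|f b - f a| <= K * `|b - a|.
  move=> ab; have [c _ ->] := MVT_segment ab (fun x _ => fd x) (continuous_subspaceT cf).
  by rewrite normrM ler_wpM2r.
move=> a b; have [ab|/ltW ab] := leP a b; first exact: main.
by rewrite distrC (distrC b a); exact: main.
Qed.

Lemma sin_lip (a b : R) : `|sin b - sin a| <= `|b - a|.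
Proof.
rewrite -[leRHS]mul1r; apply: (@lip_of_derive sin cos).
exact: cos_max.
Qed.

Lemma cos_lip (a b : R) : `|cos b - cos a| <= `|b - a|.
Proof.
rewrite -[leRHS]mul1r; apply: (@lip_of_derive cos (fun x => - sin x)).
by move=> x; rewrite normrN sin_max.
Qed.

Lemma sin_le_norm (x : R) : `|sin x| <= `|x|.
Proof. by have := sin_lip 0 x; rewrite sin0 !subr0. Qed.

Lemma sin_taylor (x : R) : `|sin x - x| <= x ^+ 2.
Proof.
have fd (y : R) : is_derive y 1 (fun z : R => sin z - z) (cos y - 1).
  by apply: is_deriveB.
have cf : continuous (fun z : R => sin z - z).
  by move=> y; apply: cvgB; [exact: continuous_sin|exact: cvg_id].
have b (c : R) : `|c| <= `|x| -> `|cos c - 1| <= `|x|.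
  by move=> cx; have := cos_lip 0 c; rewrite cos0 subr0 => /le_trans; exact.
have -> : sin x - x = (sin x - x) - (sin 0 - 0) by rewrite sin0; ring.
have -> : x ^+ 2 = `|x| * `|x| by rewrite -normrM -expr2 ger0_norm// sqr_ge0.
have [x0|x0] := leP 0 x.
  have [c /[!in_itv]/= /andP[c0 cx] ->] :=
    MVT_segment x0 (fun y _ => fd y) (continuous_subspaceT cf).
  by rewrite subr0 normrM ler_wpM2r// b// !ger0_norm.
have [c /[!in_itv]/= /andP[c0 cx] E] :=
    MVT_segment (ltW x0) (fun y _ => fd y) (continuous_subspaceT cf).
rewrite distrC E sub0r normrM normrN ler_wpM2r// b//.
by rewrite !ler0_norm ?lerN2// ltW.
Qed.

Lemma natS_sin_cvg (x : R) : (fun n : nat => n.+1%:R * sin (x / n.+1%:R)) @ \oo --> x.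
Proof.
have h0 : (fun n : nat => x ^+ 2 * n.+1%:R^-1 : R) @ \oo --> (0 : R).
  by rewrite -(mulr0 (x ^+ 2)); apply: cvgMr; exact: cvg_harmonic.
have key (n : nat) : `|n.+1%:R * sin (x / n.+1%:R) - x| <= x ^+ 2 * n.+1%:R^-1.
  have : (0 : R) < n.+1%:R by [].
  move: n.+1%:R => N N0.
  have -> : N * sin (x / N) - x = N * (sin (x / N) - x / N).
    by rewrite mulrBr; congr (_ - _); field; rewrite gt_eqF.
  rewrite normrM gtr0_norm//.
  have -> : x ^+ 2 * N^-1 = N * (x / N) ^+ 2 by field; rewrite gt_eqF.
  by apply: ler_wpM2l; [exact: ltW|exact: sin_taylor].
apply: (@squeeze_cvgr _ _ _ _ (fun n => x - x ^+ 2 * n.+1%:R^-1)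
  (fun n => x + x ^+ 2 * n.+1%:R^-1)).
- by apply: nearW => n; rewrite -ler_distl.
- by rewrite -[X in _ --> X]subr0; apply: cvgB => //; exact: cvg_cst.
- by rewrite -[X in _ --> X]addr0; apply: cvgD => //; exact: cvg_cst.
Qed.

(** A trigonometric approximation of [x ^+ 2] from below. Its integral can be read off the
    characteristic function, and so moments are obtained without a density. *)
Definition cosq (n : nat) (x : R) : R := 2 * n.+1%:R ^+ 2 * (1 - cos (x / n.+1%:R)).

Lemma cosqE n x : cosq n x = (n.+1%:R * sin (x / 2 / n.+1%:R) * 2) ^+ 2.
Proof.
rewrite /cosq; have : (0 : R) < n.+1%:R by [].
move: n.+1%:R => N N0; have -> : x / N = (x / 2 / N) *+ 2.
  by rewrite -mulr_natr; field; rewrite gt_eqF.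
rewrite cos_mulr2n -mulr_natr cos2sin2; ring.
Qed.

Lemma cosq_ge0 n x : 0 <= cosq n x.
Proof. by rewrite cosqE sqr_ge0. Qed.

Lemma cosq_le n x : cosq n x <= x ^+ 2.
Proof.
rewrite cosqE; have : (0 : R) < n.+1%:R by [].
move: n.+1%:R => N n0; rewrite -[leRHS]ger0_norm ?sqr_ge0// -[leLHS]ger0_norm ?sqr_ge0// !normrX.
rewrite ler_pXn2r ?nnegrE// !normrM (gtr0_norm n0) (@gtr0_norm _ 2)//.
have := sin_le_norm (x / 2 / N).
rewrite !normrM !normfV (gtr0_norm n0) (@gtr0_norm _ 2)// => h.
have -> : `|x| = N * (`|x| / 2 / N) * 2 by field; rewrite gt_eqF.
by rewrite ler_pM2r// ler_pM2l.
Qed.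

Lemma cosq_cvg x : cosq^~ x @ \oo --> x ^+ 2.
Proof.
rewrite (_ : cosq^~ x = fun n => (n.+1%:R * sin (x / 2 / n.+1%:R) * 2) *
   (n.+1%:R * sin (x / 2 / n.+1%:R) * 2)); last by apply/funext => n; rewrite cosqE expr2.
have -> : x ^+ 2 = (x / 2 * 2) * (x / 2 * 2) by field.
by apply: cvgM; apply: cvgMl; exact: natS_sin_cvg.
Qed.

(** Linearizing the square of the cosine leaves only two frequencies, at which the characteristic
    function is known. *)
Lemma cosq_sqr n x : cosq n x ^+ 2 =
  2 * n.+1%:R ^+ 4 * (3 - 4 * cos (n.+1%:R^-1 * x) + cos ((2 * n.+1%:R^-1) * x)).
Proof.
rewrite /cosq; have : (0 : R) < n.+1%:R by [].
move: n.+1%:R => N N0; have -> : (2 * N^-1) * x = (x / N) *+ 2.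
  by rewrite -mulr_natr; field; rewrite gt_eqF.
rewrite cos_mulr2n -mulr_natr (mulrC _ x); ring.
Qed.
End calculus.

Section fatou_real.
Context {d : measure_display} {T : measurableType d} {R : realType}.
Variable mu : {measure set T -> \bar R}.

Lemma fatou_real (D : set T) (f_ : nat -> T -> R) (f : T -> R) (c : R) : measurable D ->
  (forall n, mu.-integrable D (EFin \o f_ n)) -> (forall n x, D x -> 0 <= f_ n x) ->
  (forall x, D x -> f_^~ x @ \oo --> f x) -> (forall n, Rintegral mu D (f_ n) <= c) ->
  mu.-integrable D (EFin \o f) /\ Rintegral mu D f <= c.
Proof.
move=> mD fi f0 cf fc.
have mf_ n : measurable_fun D (f_ n) by case/integrableP: (fi n) => /measurable_EFinP.
have mf : measurable_fun D f by exact: (@measurable_fun_cvg _ _ _ _ f_).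
have f0' x : D x -> 0 <= f x.
  by move=> Dx; apply: cvgr_to_ge (cf x Dx) _; apply: nearW => n; exact: f0.
have le : (\int[mu]_(x in D) (f x)%:E <= c%:E)%E.
  have := @fatou _ _ _ mu D mD (fun n => EFin \o f_ n) (fun n => (measurable_EFinP _ _).2 (mf_ n))
    (fun n x Dx => f0 n x Dx).
  rewrite (_ : (\int[mu]_(x in D) limn_einf (fun n => (EFin \o f_ n) x) =
     \int[mu]_(x in D) (f x)%:E)%E); last first.
    apply: eq_integral => x /set_mem Dx.
    have : (fun n => (f_ n x)%:E) @ \oo --> (f x)%:E.
      by apply: cvg_EFin; [exact: nearW|exact: cf].
    by move=> /cvg_limn_einf_sup[-> _].
  move=> /le_trans; apply; rewrite limn_einf_lim.
  apply: lime_le; first exact: is_cvg_einfs.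
  apply: nearW => n; apply: (@le_trans _ _ (\int[mu]_(x in D) (f_ n x)%:E)%E).
    by apply: ereal_inf_lbound; exists n => //=.
  by rewrite fine_integral_EFin// lee_fin.
have fi' : mu.-integrable D (EFin \o f).
  apply/integrableP; split; first exact/measurable_EFinP.
  rewrite (_ : (\int[mu]_(x in D) `|(EFin \o f) x| = \int[mu]_(x in D) (f x)%:E)%E).
    by rewrite (le_lt_trans le)// ltry.
  by apply: eq_integral => x /set_mem Dx /=; rewrite ger0_norm// f0'.
by split => //; rewrite -lee_fin -fine_integral_EFin.
Qed.
End fatou_real.

(** * Moments of a Gaussian variable restricted to an event *)

Section char_moments.
Context {R : realType} {d : measure_display} {Omega : measurableType d}.
Variable P : probability Omega R.
Variables (A : set Omega) (X : Omega -> R) (v : R).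
Hypotheses (mA : measurable A) (mX : measurable_fun setT X) (v0 : 0 <= v).
Hypothesis cX : forall l : R,
  (\int[P]_(w in A) (cos (l * X w))%:E = P A * (expR (- (l ^+ 2 * v) / 2))%:E)%E.
Hypothesis sX : forall l : R, (\int[P]_(w in A) (sin (l * X w))%:E = 0)%E.

Let PA : (P A < +oo)%E.
Proof. by rewrite (le_lt_trans (probability_le1 P mA))// ltry. Qed.
Let pA : R := fine (P A).
Let PAE : P A = pA%:E. Proof. by rewrite /pA fineK// ge0_fin_numE. Qed.
Let pA0 : 0 <= pA. Proof. by rewrite -lee_fin -PAE. Qed.

Let bint (f : R -> R) (c : R) : measurable_fun setT f -> (forall x, `|f x| <= c) ->
  P.-integrable A (EFin \o (fun w => f (X w))).
Proof.
move=> mf fc; apply: (@integrable_bounded_EFin _ _ _ P _ _ c) => //.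
by apply: (measurable_funTS); apply: measurableT_comp.
Qed.

Let mcos (l : R) : measurable_fun setT (fun x : R => cos (l * x)).
Proof.
apply: continuous_measurable_fun => x; apply: continuous_comp; last exact: continuous_cos.
by apply: cvgMr; exact: cvg_id.
Qed.
Let msin (l : R) : measurable_fun setT (fun x : R => sin (l * x)).
Proof.
apply: continuous_measurable_fun => x; apply: continuous_comp; last exact: continuous_sin.
by apply: cvgMr; exact: cvg_id.
Qed.

Let icos l : P.-integrable A (EFin \o (fun w => cos (l * X w))).
Proof. by apply: (@bint (fun x => cos (l * x)) 1) => // x; exact: cos_max. Qed.
Let isin l : P.-integrable A (EFin \o (fun w => sin (l * X w))).
Proof. by apply: (@bint (fun x => sin (l * x)) 1) => // x; exact: sin_max. Qed.

Let Ecos l : Rintegral P A (fun w => cos (l * X w)) = expR (- (l ^+ 2 * v) / 2) * pA.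
Proof. by rewrite /Rintegral cX PAE -EFinM/= mulrC. Qed.
Let Esin l : Rintegral P A (fun w => sin (l * X w)) = 0.
Proof. by rewrite /Rintegral sX. Qed.
Let Ecst (k : R) : Rintegral P A (fun=> k) = k * pA.
Proof. exact: Rintegral_cst. Qed.
Let icst (k : R) : P.-integrable A (EFin \o (fun=> k)).
Proof. by apply: (@bint (fun=> k) `|k|). Qed.

(** Integrability comes together with the bound, both from Fatou's lemma along [cosq n X ^+ 2]. The
    upper bound is enough, and the lower moments inherit integrability from it. *)
Lemma char_moment4 : P.-integrable A (EFin \o (fun w => X w ^+ 4)) /\
  Rintegral P A (fun w => X w ^+ 4) <= 3 * v ^+ 2 * pA.
Proof.
have E4 n w : cosq n (X w) ^+ 2 = 2 * n.+1%:R ^+ 4 *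
    (3 + ((-4) * cos (n.+1%:R^-1 * X w) + cos ((2 * n.+1%:R^-1) * X w))).
  by rewrite cosq_sqr; ring.
have i1 n := integrableZ_EFin (-4) mA (icos n.+1%:R^-1).
have i2 n := integrableD_EFin mA (i1 n) (icos (2 * n.+1%:R^-1)).
have i3 n := integrableD_EFin mA (icst 3) (i2 n).
have i4 n : P.-integrable A (EFin \o (fun w => cosq n (X w) ^+ 2)).
  have := integrableZ_EFin (2 * n.+1%:R ^+ 4) mA (i3 n).
  by apply: eq_integrable => // w _ /=; rewrite E4.
apply: (@fatou_real _ _ _ P A (fun n w => cosq n (X w) ^+ 2)) => //.
- by move=> n w _; exact: sqr_ge0.
- move=> w _; have -> : X w ^+ 4 = X w ^+ 2 * X w ^+ 2 by ring.
  by under eq_fun do rewrite expr2; apply: cvgM; exact: cosq_cvg.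
move=> n.
have -> : Rintegral P A (fun w => cosq n (X w) ^+ 2) =
    2 * n.+1%:R ^+ 4 * (3 * pA + ((-4) * (expR (- (n.+1%:R^-1 ^+ 2 * v) / 2) * pA)
     + expR (- ((2 * n.+1%:R^-1) ^+ 2 * v) / 2) * pA)).
  under eq_Rintegral do rewrite E4.
  rewrite RintegralZl//.
  congr (_ * _); rewrite RintegralD//.
  rewrite Ecst; congr (_ + _); rewrite RintegralD//.
  by rewrite RintegralZl// !Ecos.
have : (0 : R) < n.+1%:R by [].
move: n.+1%:R => N n0.
set y := N^-1 ^+ 2 * v / 2; set z := expR (- y).
have -> : expR (- (N^-1 ^+ 2 * v) / 2) = z by rewrite /z /y; congr expR; ring.
have -> : expR (- ((2 * N^-1) ^+ 2 * v) / 2) = z ^+ 4.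
  by rewrite /z -expRM_natl /y; congr expR; field; rewrite gt_eqF.
have y0 : 0 <= y by rewrite /y divr_ge0// mulr_ge0// sqr_ge0.
have z1 : z <= 1 by rewrite /z -(@expR0 R) ler_expR oppr_le0.
have z0 : 0 <= z by rewrite expR_ge0.
have zy : 1 - z <= y by have := expR_ge1Dx (- y); rewrite -/z; lra.
have -> : 3 * v ^+ 2 * pA = 2 * N ^+ 4 * (6 * y ^+ 2 * pA).
  by rewrite /y; field; rewrite gt_eqF.
apply: ler_wpM2l; first by rewrite mulr_ge0// exprn_ge0// ltW.
(* The factorization exhibits the double zero at [z = 1]. With [1 - z <= y] and [z <= 1] it is at
   most [6 * y ^+ 2], which rescales to exactly [3 * v ^+ 2]. *)
have -> : 3 * pA + (-4 * (z * pA) + z ^+ 4 * pA) = ((1 - z) ^+ 2 * (3 + 2 * z + z ^+ 2)) * pA.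
  by ring.
apply: ler_wpM2r => //; rewrite mulrC; apply: ler_pM; rewrite ?sqr_ge0//; [nra|nra|].
by rewrite ler_pXn2r// ?nnegrE//; lra.
Qed.

Lemma char_integrable k : (k <= 4)%N -> P.-integrable A (EFin \o (fun w => `|X w| ^+ k)).
Proof.
move=> k4.
apply: (@le_integrable_EFin _ _ _ P A _ (fun w => 1 + X w ^+ 4)) => //.
- apply: measurable_funTS; apply: measurable_funX; exact: measurableT_comp.
- move=> w _; rewrite ger0_norm ?exprn_ge0//.
  have X4 : `|X w| ^+ 4 = X w ^+ 4 by rewrite -normrX ger0_norm// exprn_even_ge0.
  have X0 := normr_ge0 (X w).
  have [X1|X1] := leP `|X w| 1.
    apply: (@le_trans _ _ 1); first exact: exprn_ile1.
    by rewrite lerDl -X4 exprn_ge0.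
  apply: (@le_trans _ _ (`|X w| ^+ 4)); last by rewrite X4 lerDr.
  by rewrite ler_weXn2l// ltW.
- by apply: integrableD_EFin => //; case: char_moment4.
Qed.

Let iX2 : P.-integrable A (EFin \o (fun w => X w ^+ 2)).
Proof.
have := char_integrable (k := 2) isT; apply: eq_integrable => // w _ /=.
by rewrite -normrX ger0_norm// sqr_ge0.
Qed.

(** Here an equality is needed, since the second moment must be compensated exactly. Dominated
    convergence gives it: [cosq n X] lies below [X ^+ 2], which is integrable thanks to the fourth
    moment. *)
Lemma char_moment2 : Rintegral P A (fun w => X w ^+ 2) = v * pA.
Proof.
have i1 n := integrableZ_EFin (-1) mA (icos n.+1%:R^-1).
have i2 n := integrableD_EFin mA (icst 1) (i1 n).
have E2 n w : cosq n (X w) = 2 * n.+1%:R ^+ 2 * (1 + (-1) * cos (n.+1%:R^-1 * X w)).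
  by rewrite /cosq mulN1r (mulrC (X w)).
have i3 n : P.-integrable A (EFin \o (fun w => cosq n (X w))).
  have := integrableZ_EFin (2 * n.+1%:R ^+ 2) mA (i2 n).
  by apply: eq_integrable => // w _ /=; rewrite E2.
have En n : Rintegral P A (fun w => cosq n (X w)) =
    2 * n.+1%:R ^+ 2 * (1 - expR (- (n.+1%:R^-1 ^+ 2 * v) / 2)) * pA.
  under eq_Rintegral do rewrite E2.
  rewrite RintegralZl//.
  by rewrite RintegralD// RintegralZl// Ecst Ecos; ring.
have [_ c1] : P.-integrable A (EFin \o (fun w => X w ^+ 2)) /\
   (fun n => Rintegral P A (fun w => cosq n (X w))) @ \oo --> Rintegral P A (fun w => X w ^+ 2).
  apply: (@Rintegral_dct _ _ _ P A _ _ (fun w => X w ^+ 2)) => //.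
  - by move=> n; case/integrableP: (i3 n) => /measurable_EFinP.
  - by case/integrableP: iX2 => /measurable_EFinP.
  - by apply: aeW => w _; exact: cosq_cvg.
  - by apply: aeW => w n _; rewrite ger0_norm ?cosq_ge0// cosq_le.
have c2 : (fun n => Rintegral P A (fun w => cosq n (X w))) @ \oo --> v * pA.
  rewrite (funext En); apply: cvgMl.
  (* With [y = v / (2 N ^+ 2)], the bounds are [y / (1 + y) <= 1 - exp (- y) <= y], multiplied by
     [2 N ^+ 2]; the lower one is weakened by replacing [y] with [N * y] in the denominator. *)
  apply: (@squeeze_cvgr _ _ _ _ (fun n => v / (1 + v / 2 * n.+1%:R^-1)) (fun=> v)).
  - apply: nearW => n; have : (1 : R) <= n.+1%:R by rewrite ler1n.
    move: n.+1%:R => N N1; have N0 : 0 < N by lra.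
    set y := N^-1 ^+ 2 * v / 2.
    have -> : - (N^-1 ^+ 2 * v) / 2 = - y by rewrite /y; ring.
    have y0 : 0 <= y by rewrite /y divr_ge0// mulr_ge0// sqr_ge0.
    have vE : v = 2 * N ^+ 2 * y by rewrite /y; field; rewrite gt_eqF.
    have c0 : 0 <= 2 * N ^+ 2 by rewrite mulr_ge0// sqr_ge0.
    apply/andP; split; last first.
      by rewrite [leRHS]vE; apply: ler_wpM2l => //; have := expR_ge1Dx (- y); lra.
    rewrite [X in X / _]vE -[leLHS]mulrA; apply: ler_wpM2l => //.
    set k := v / 2 * N^-1.
    have yk : y <= k.
      have -> : k = N * y by rewrite /k vE; field; rewrite gt_eqF.
      by rewrite ler_peMl.
    have ey : expR (- y) <= (1 + y)^-1.
      by rewrite expRN lef_pV2 ?posrE ?expR_gt0 ?expR_ge1Dx//; lra.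
    have k1 : (1 + k)^-1 <= (1 + y)^-1 by rewrite lef_pV2 ?posrE; lra.
    have : y * (1 + k)^-1 <= y * (1 + y)^-1 by apply: ler_wpM2l.
    have : 1 - (1 + y)^-1 = y * (1 + y)^-1 by field; rewrite gt_eqF//; lra.
    by lra.
  - rewrite -[X in _ --> X](_ : v / (1 + v / 2 * 0) = v); last by rewrite mulr0 addr0 divr1.
    apply: cvgMr; apply: cvgV; first by rewrite mulr0 addr0.
    apply: cvgD; first exact: cvg_cst.
    by apply: cvgMr; exact: cvg_harmonic.
  - exact: cvg_cst.
by apply: cvg_unique c1 c2; exact: Rhausdorff.
Qed.

Lemma char_moment1 : P.-integrable A (EFin \o X) /\ Rintegral P A X = 0.
Proof.
have iX : P.-integrable A (EFin \o (fun w => `|X w|)).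
  by have := char_integrable (k := 1) isT; apply: eq_integrable => // w _ /=; rewrite expr1.
have iXX : P.-integrable A (EFin \o X).
  by apply: (@le_integrable_EFin _ _ _ P A _ (fun w => `|X w|)) => //; exact: measurable_funTS.
split => //.
have [_ c1] : P.-integrable A (EFin \o X) /\
   (fun n : nat => Rintegral P A (fun w => n.+1%:R * sin (n.+1%:R^-1 * X w))) @ \oo --> Rintegral P A X.
  apply: (@Rintegral_dct _ _ _ P A _ _ (fun w => `|X w|)) => //.
  - move=> n; have := integrableZ_EFin n.+1%:R mA (isin n.+1%:R^-1).
    by case/integrableP => /measurable_EFinP.
  - exact: measurable_funTS.
  - by apply: aeW => w _; under eq_fun do rewrite mulrC (mulrC _ (X w)) mulrC; exact: natS_sin_cvg.
  - apply: aeW => w n _; have n0 : (0 : R) < n.+1%:R by [].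
    rewrite normrM gtr0_norm//; have := sin_le_norm (n.+1%:R^-1 * X w).
    rewrite normrM normfV (gtr0_norm n0) => /(ler_wpM2l (ltW n0)).
    by rewrite mulrA mulfV ?mul1r// gt_eqF.
have : (fun n : nat => Rintegral P A (fun w => n.+1%:R * sin (n.+1%:R^-1 * X w))) = fun=> 0.
  by apply/funext => n; rewrite RintegralZl// Esin mulr0.
move=> E; rewrite E in c1; apply: cvg_unique c1 _; [exact: Rhausdorff|exact: cvg_cst].
Qed.
End char_moments.

(** * Orthogonality to bounded weights known at the initial time *)

Section conditional.
Context {R : realType} {d : measure_display} {Omega : measurableType d}.
Variable P : probability Omega R.
Implicit Types (Z phi : Omega -> R).

Notation E f := (Rintegral P setT f).

Lemma Rintegral_indic (A : set Omega) Z : Rintegral P A Z = E (fun w => \1_A w * Z w).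
Proof.
rewrite Rintegral_mkcond; apply: eq_Rintegral => w _.
by rewrite patchE indicE; case: ifPn => _; rewrite ?mul1r ?mul0r.
Qed.

Lemma integrable_bmul Z phi (c : R) : P.-integrable setT (EFin \o Z) ->
  measurable_fun setT phi -> (forall w, `|phi w| <= c) ->
  P.-integrable setT (EFin \o (fun w => phi w * Z w)).
Proof.
move=> iZ mphi phic.
have mZ : measurable_fun setT Z by case/integrableP: iZ => /measurable_EFinP.
apply: (@le_integrable_EFin _ _ _ P setT _ (fun w => c * `|Z w|)) => //.
- exact: measurable_funM.
- by move=> w _; rewrite normrM ler_wpM2r.
- by apply: integrableZ_EFin => //; exact: integrable_norm.
Qed.

(** Stands in for conditional expectation. The weight shifted by [c] is nonnegative, and it is
    approximated uniformly by step functions on its level sets of width [1 / (n + 1)], which belong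
    to [G]. *)
Lemma orthogonal_bounded (G : set (set Omega)) Z phi (c : R) : sigma_algebra setT G ->
  G `<=` measurable -> P.-integrable setT (EFin \o Z) ->
  (forall A, G A -> Rintegral P A Z = 0) ->
  G_measurable G phi -> (forall w, `|phi w| <= c) -> E (fun w => phi w * Z w) = 0.
Proof.
move=> sG Gm iZ Z0 gphi phic.
have mphi : measurable_fun setT phi.
  by move=> _ U mU; rewrite setTI; apply: Gm; exact: gphi.
have iphi := integrable_bmul iZ mphi phic.
have GT : G setT by have [_ + _] := sG => /(_ set0); rewrite setD0; apply; case: sG.
have EZ : E Z = 0 by exact: Z0.
pose b n k : set Omega := [set w | (k%:R <= n.+1%:R * (phi w + c) < k.+1%:R)%R].
have Gb n k : G (b n k).
  have -> : b n k = (fun w => n.+1%:R * (phi w + c)) @^-1` `[k%:R, k.+1%:R[.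
    by apply/seteqP; split => w; rewrite /b/= in_itv.
  apply: gm_mul => //; first exact: gm_cst.
  by apply: gm_add => //; exact: gm_cst.
pose K n := (Num.truncn (n.+1%:R * (c + c))).+1.
pose phin n w : R := \sum_(k < K n) (k%:R / n.+1%:R) * \1_(b n k) w.
have app n w : `|phi w + c - phin n w| <= n.+1%:R^-1.
  have n0 : (0 : R) < n.+1%:R by [].
  have pc0 : 0 <= phi w + c by have := phic w => /ler_normlP[]; lra.
  have pc1 : phi w + c <= c + c by have := phic w => /ler_normlP[]; lra.
  pose k0 := Num.truncn (n.+1%:R * (phi w + c)).
  have /andP[k1 k2] : (k0%:R <= n.+1%:R * (phi w + c) < k0.+1%:R)%R.
    by apply: truncn_itv; rewrite mulr_ge0.
  have k0K : (k0 < K n)%N by rewrite ltnS; apply: le_truncn; rewrite ler_pM2l.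
  have -> : phin n w = k0%:R / n.+1%:R.
    rewrite /phin (bigD1 (Ordinal k0K))//= big1 ?addr0.
      by rewrite indicE mem_set ?mulr1// /b/= k1 k2.
    move=> i ik; rewrite indicE memNset ?mulr0// /b/= => /andP[i1 i2].
    move/eqP: ik; apply; apply: val_inj => /=.
    apply/eqP; rewrite eqn_leq; apply/andP; split.
      by rewrite -ltnS -(ltr_nat R) (le_lt_trans i1).
    by rewrite -ltnS -(ltr_nat R) (le_lt_trans k1).
  have -> : phi w + c - k0%:R / n.+1%:R = n.+1%:R^-1 * (n.+1%:R * (phi w + c) - k0%:R).
    by field; rewrite gt_eqF.
  rewrite ger0_norm; last by rewrite mulr_ge0 ?invr_ge0 ?subr_ge0// ltW.
  rewrite -[leRHS]mulr1; apply: ler_wpM2l; first by rewrite invr_ge0 ltW.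
  by rewrite -natr1 in k2; lra.
have mind n k : measurable_fun setT (\1_(b n k) : Omega -> R).
  by apply: measurable_indic; apply: Gm.
have iterm n k : P.-integrable setT (EFin \o (fun w => k%:R / n.+1%:R * (\1_(b n k) w * Z w))).
  apply: integrableZ_EFin => //; apply: (@integrable_bmul Z _ 1) => // w.
  by rewrite indicE; case: (_ \in _); rewrite ?normr1 ?normr0.
have phinZ n w : phin n w * Z w = \sum_(k < K n) (k%:R / n.+1%:R * (\1_(b n k) w * Z w)).
  by rewrite mulr_suml; apply: eq_bigr => k _; rewrite mulrA.
have iphin n : P.-integrable setT (EFin \o (fun w => phin n w * Z w)).
  have := @integrable_sum_EFin _ _ _ P setT _ (index_enum 'I_(K n))
    (fun k w => k%:R / n.+1%:R * (\1_(b n k) w * Z w)) measurableT (fun k => iterm n k).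
  by apply: eq_integrable => // w _ /=; rewrite phinZ.
have E0 n : E (fun w => phin n w * Z w) = 0.
  under eq_Rintegral do rewrite phinZ.
  rewrite Rintegral_sum// big1// => k _.
  rewrite RintegralZl//; last first.
    apply: (@integrable_bmul Z _ 1) => // w.
    by rewrite indicE; case: (_ \in _); rewrite ?normr1 ?normr0.
  by rewrite -Rintegral_indic Z0 ?mulr0.
(* The shift by [c] costs nothing because [Z] has mean 0, and every step function integrates to 0
   against [Z]; only the uniform error remains. *)
have bound n : `|E (fun w => phi w * Z w)| <= E (fun w => `|Z w|) * n.+1%:R^-1.
  have -> : E (fun w => phi w * Z w) = E (fun w => (phi w * Z w + c * Z w) - phin n w * Z w).
    rewrite RintegralB//; last by apply: integrableD_EFin => //; exact: integrableZ_EFin.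
    by rewrite E0 subr0 RintegralD// ?RintegralZl ?EZ ?mulr0 ?addr0//; exact: integrableZ_EFin.
  have idiff : P.-integrable setT (EFin \o (fun w => (phi w * Z w + c * Z w) - phin n w * Z w)).
    by apply: integrableB_EFin => //; apply: integrableD_EFin => //; exact: integrableZ_EFin.
  apply: le_trans (le_normr_Rintegral _ idiff) _ => //.
  rewrite -RintegralZr//; last exact: integrable_norm.
  apply: le_Rintegral => //; first exact: integrable_norm.
    have := integrableZ_EFin n.+1%:R^-1 measurableT (integrable_norm iZ).
    by apply: eq_integrable => // w _ /=; rewrite mulrC.
  move=> w _; have -> : phi w * Z w + c * Z w - phin n w * Z w = (phi w + c - phin n w) * Z w.
    by ring.
  by rewrite normrM mulrC ler_wpM2l.
apply/eqP; rewrite -normr_le0.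
have : (fun n : nat => E (fun w => `|Z w|) * n.+1%:R^-1) @ \oo --> E (fun w => `|Z w|) * 0.
  by apply: cvgMr; exact: cvg_harmonic.
by rewrite mulr0 => /cvgr_to_ge; apply; apply: nearW.
Qed.
End conditional.

(** * A one-sided Ito formula *)

Section test_functions.
Context {R : realType}.
Implicit Types f : R -> R -> R.

Definition bounded2 (K : R) f := forall x y, `|f x y| <= K.
Definition lip2 (K : R) f :=
  forall x y x' y', `|f x y - f x' y'| <= K * (`|x - x'| + `|y - y'|).
Definition meas2 f := measurable_fun [set: R * R] (fun p => f p.1 p.2).
Definition nice2 K f := [/\ bounded2 K f, lip2 K f & meas2 f].

(* A function with bounded Lipschitz derivatives up to order two, in the only form in which
   it enters Ito-type estimates: a one-sided third order Taylor bound. *)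
Definition test_fun (K : R) (V Vx Vy Vxx Vxy Vyy : R -> R -> R) :=
  [/\ lip2 K V /\ meas2 V, nice2 K Vx /\ nice2 K Vy,
      [/\ nice2 K Vxx, nice2 K Vxy & nice2 K Vyy] &
      forall x y a b, V (x + a) (y + b) <= V x y + Vx x y * a + Vy x y * b
        + (Vxx x y * a ^+ 2 + 2 * Vxy x y * a * b + Vyy x y * b ^+ 2) / 2
        + K * (`|a| ^+ 3 + `|b| ^+ 3)].

Lemma gm_meas2 (d : measure_display) (Omega : measurableType d) (G : set (set Omega)) f
    (X Y : Omega -> R) : sigma_algebra setT G -> meas2 f ->
  G_measurable G X -> G_measurable G Y -> G_measurable G (fun w => f (X w) (Y w)).
Proof.
move=> sG mf /(gmP sG) mX /(gmP sG) mY; apply/(gmP sG).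
by have := measurableT_comp mf (measurable_fun_pair mX mY).
Qed.

End test_functions.

(** * Taylor sums along one path *)

Section path_limit.
Context {R : realType}.
Notation mu := (@lebesgue_measure R).
Variables (K : R) (V Vx Vy Vxx Vxy Vyy : R -> R -> R).
Hypothesis tV : test_fun K V Vx Vy Vxx Vxy Vyy.
Variables (s11 s12 s22 : R).

(** The second-order part of the generator, without its factor [1 / 2], for a noise whose covariance
    matrix has the entries [s11], [s12], [s22]. *)
Definition lapl x y : R := s11 * Vxx x y + 2 * s12 * Vxy x y + s22 * Vyy x y.
Let sg : R := `|s11| + 2 * `|s12| + `|s22|.

Lemma test_K0 : 0 <= K.
Proof. by have [_ [[b _ _] _] _ _] := tV; exact: le_trans (b 0 0). Qed.

Lemma lapl_bounded : bounded2 (sg * K) lapl.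
Proof.
have [_ _ [[b1 _ _] [b2 _ _] [b3 _ _]] _] := tV => x y.
rewrite /sg 2!mulrDl.
apply: le_trans (ler_normD _ _) _; apply: lerD; last by rewrite normrM ler_wpM2l.
apply: le_trans (ler_normD _ _) _; apply: lerD; first by rewrite normrM ler_wpM2l.
by rewrite normrM normrM (@ger0_norm _ 2)// ler_wpM2l// mulr_ge0.
Qed.

Lemma lapl_lip : lip2 (sg * K) lapl.
Proof.
have [_ _ [[_ b1 _] [_ b2 _] [_ b3 _]] _] := tV => x y x' y'.
rewrite /lapl.
set D := (`|x - x'| + `|y - y'|).
have -> : s11 * Vxx x y + 2 * s12 * Vxy x y + s22 * Vyy x y -
  (s11 * Vxx x' y' + 2 * s12 * Vxy x' y' + s22 * Vyy x' y') =
  s11 * (Vxx x y - Vxx x' y') + (2 * s12) * (Vxy x y - Vxy x' y') +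
  s22 * (Vyy x y - Vyy x' y') by ring.
have -> : sg * K * D = `|s11| * (K * D) + 2 * `|s12| * (K * D) + `|s22| * (K * D).
  by rewrite /sg; ring.
apply: le_trans (ler_normD _ _) _; apply: lerD; last by rewrite normrM ler_wpM2l.
apply: le_trans (ler_normD _ _) _; apply: lerD; first by rewrite normrM ler_wpM2l.
by rewrite normrM normrM (@ger0_norm _ 2)// ler_wpM2l// mulr_ge0.
Qed.

Lemma lapl_meas : meas2 lapl.
Proof.
have [_ _ [[_ _ m1] [_ _ m2] [_ _ m3]] _] := tV.
apply: measurable_funD; last by apply: measurable_funM => //; exact: measurable_cst.
by apply: measurable_funD; apply: measurable_funM => //; exact: measurable_cst.
Qed.

Variables (s t : R) (u1 u2 m1 m2 dx dy th : R -> R).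
Hypothesis st : s <= t.
Hypothesis idx : itg dx s t.
Hypothesis idy : itg dy s t.
Hypothesis ith : itg th s t.
Hypothesis dx0 : forall r, s <= r <= t -> 0 <= dx r.
Hypothesis dy0 : forall r, s <= r <= t -> 0 <= dy r.
Hypothesis u1E : forall r, s <= r <= t -> u1 r = u1 s + (m1 r - m1 s) + J dx s r.
Hypothesis u2E : forall r, s <= r <= t -> u2 r = u2 s + (m2 r - m2 s) + J dy s r.
Hypothesis ineq : {ae mu, forall r, s <= r <= t ->
  Vx (u1 r) (u2 r) * dx r + Vy (u1 r) (u2 r) * dy r + lapl (u1 r) (u2 r) / 2 <= th r}.

Definition grid n (i : nat) : R := s + (t - s) / n.+1%:R * i%:R.

(** The part of a cell's increment that is treated path by path: the effect of the drift after the
    noise increment has been added, plus the compensator of the noise. The complementary part, noise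
    alone minus compensator, is estimated in expectation by [ito_step]. *)
Definition ito_term n i : R :=
  V (u1 (grid n i.+1)) (u2 (grid n i.+1))
  - V (u1 (grid n i) + (m1 (grid n i.+1) - m1 (grid n i)))
      (u2 (grid n i) + (m2 (grid n i.+1) - m2 (grid n i)))
  + (t - s) / n.+1%:R * lapl (u1 (grid n i)) (u2 (grid n i)) / 2.

Lemma grid_step n i : grid n i.+1 = grid n i + (t - s) / n.+1%:R.
Proof. by rewrite /grid -natr1; ring. Qed.
Lemma grid_h0 n : 0 <= (t - s) / n.+1%:R.
Proof. by rewrite divr_ge0// subr_ge0. Qed.
Lemma grid_ge n i : s <= grid n i.
Proof. by rewrite /grid lerDl mulr_ge0// grid_h0. Qed.
Lemma grid_le n i : (i <= n.+1)%N -> grid n i <= t.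
Proof.
move=> ik; rewrite /grid -lerBrDl -[leRHS](@mulfVK _ (n.+1%:R : R)) ?pnatr_eq0//.
by apply: ler_wpM2l; [exact: grid_h0|rewrite ler_nat].
Qed.
Lemma grid0 n : grid n 0 = s.
Proof. by rewrite /grid mulr0 addr0. Qed.
Lemma grid_last n : grid n n.+1 = t.
Proof. by rewrite /grid mulfVK ?pnatr_eq0//; ring. Qed.

Let gi n i : (i < n.+1)%N -> [/\ s <= grid n i, grid n i <= grid n i.+1 & grid n i.+1 <= t].
Proof. by move=> ni; rewrite grid_ge grid_le// grid_step lerDl grid_h0. Qed.

Let incr n i : (i < n.+1)%N ->
  u1 (grid n i.+1) = u1 (grid n i) + (m1 (grid n i.+1) - m1 (grid n i)) + J dx (grid n i) (grid n i.+1) /\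
  u2 (grid n i.+1) = u2 (grid n i) + (m2 (grid n i.+1) - m2 (grid n i)) + J dy (grid n i) (grid n i.+1).
Proof.
move=> /gi[g1 g2 g3].
have g1' := le_trans g1 g2; have g3' := le_trans g2 g3.
have ix : itg dx s (grid n i.+1) by apply: itg_sub idx.
have iy : itg dy s (grid n i.+1) by apply: itg_sub idy.
rewrite (u1E (r := grid n i.+1)) ?g1'// (u1E (r := grid n i)) ?g1//.
rewrite (u2E (r := grid n i.+1)) ?g1'// (u2E (r := grid n i)) ?g1//.
by rewrite (J_cat g1 g2 ix) (J_cat g1 g2 iy); split; ring.
Qed.

Let Jpos n i : (i < n.+1)%N ->
  0 <= J dx (grid n i) (grid n i.+1) /\ 0 <= J dy (grid n i) (grid n i.+1).
Proof.
move=> /gi[g1 g2 g3]; split; apply: J_ge0 => r /andP[r1 r2]; [apply: dx0|apply: dy0];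
  by rewrite (le_trans g1 r1) (le_trans r2 g3).
Qed.

Let Jsum (f : R -> R) n k : itg f s t -> (k <= n.+1)%N ->
  \sum_(i < k) J f (grid n i) (grid n i.+1) = J f s (grid n k).
Proof.
move=> fi; elim: k => [|k IH] kn; first by rewrite big_ord0 grid0 J_aa.
have [g1 g2 g3] := gi kn.
rewrite big_ord_recr/= IH ?(ltnW kn)//; rewrite -J_cat//.
by apply: itg_sub fi.
Qed.

(** The bound does not depend on the grid; it supplies the dominating function when the mesh tends
    to 0. *)
Lemma ito_sum_bound n : `|\sum_(i < n.+1) ito_term n i| <=
  K * (J dx s t + J dy s t) + sg * K * (t - s).
Proof.
have [[LV _] _ _ _] := tV.
apply: le_trans (ler_norm_sum _ _ _) _.
have -> : K * (J dx s t + J dy s t) + sg * K * (t - s) =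
  \sum_(i < n.+1) (K * (J dx (grid n i) (grid n i.+1) + J dy (grid n i) (grid n i.+1))
    + sg * K * ((t - s) / n.+1%:R)).
  rewrite big_split/= -mulr_sumr big_split/= !Jsum// grid_last.
  by rewrite sumr_const card_ord -(mulr_natr (sg * K * ((t - s) / n.+1%:R))) -(mulrA (sg * K)) mulfVK ?pnatr_eq0.
apply: ler_sum => i _; have [e1 e2] := incr (ltn_ord i); have [p1 p2] := Jpos (ltn_ord i).
apply: le_trans (ler_normD _ _) _; apply: lerD.
  apply: le_trans (LV _ _ _ _) _; rewrite ler_wpM2l ?test_K0//.
  have d1 : u1 (grid n i.+1) - (u1 (grid n i) + (m1 (grid n i.+1) - m1 (grid n i))) =
    J dx (grid n i) (grid n i.+1) by rewrite e1; ring.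
  have d2 : u2 (grid n i.+1) - (u2 (grid n i) + (m2 (grid n i.+1) - m2 (grid n i))) =
    J dy (grid n i) (grid n i.+1) by rewrite e2; ring.
  by rewrite d1 d2 (ger0_norm p1) (ger0_norm p2).
have h0 := grid_h0 n; have l := lapl_bounded (u1 (grid n i)) (u2 (grid n i)).
rewrite normrM (@ger0_norm _ 2^-1)// normrM (ger0_norm h0).
apply: (@le_trans _ _ ((t - s) / n.+1%:R * `|lapl (u1 (grid n i)) (u2 (grid n i))|)).
  by rewrite ler_piMr//; [apply: mulr_ge0|lra].
by rewrite mulrC ler_wpM2r.
Qed.

(** If [u] and [m] vary by at most [e] over a cell, the Taylor remainder in the drift costs [7 K e]
    per unit of drift, and moving the gradient from the path to the Taylor base point costs [4 K e];
    together these are the 11. Moving [lapl] to the left endpoint costs the term in [sg]. *)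
Lemma ito_sum_le (e : R) n : 0 < e -> e <= 1 ->
  (forall r r', s <= r <= t -> s <= r' <= t -> `|r - r'| <= (t - s) / n.+1%:R ->
     [/\ `|u1 r - u1 r'| <= e, `|u2 r - u2 r'| <= e, `|m1 r - m1 r'| <= e & `|m2 r - m2 r'| <= e]) ->
  \sum_(i < n.+1) ito_term n i <=
    J th s t + (11 * K * (J dx s t + J dy s t) + sg * K * (t - s)) * e.
Proof.
move=> e0 e1 mod.
have K0 := test_K0.
have [_ [[bx lx _] [by_ ly _]] [[bxx _ _] [bxy _ _] [byy _ _]] T3] := tV.
have -> : J th s t + (11 * K * (J dx s t + J dy s t) + sg * K * (t - s)) * e =
  \sum_(i < n.+1) (J th (grid n i) (grid n i.+1)
     + 11 * K * e * (J dx (grid n i) (grid n i.+1) + J dy (grid n i) (grid n i.+1))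
    + sg * K * e * ((t - s) / n.+1%:R)).
  rewrite big_split/= big_split/= -mulr_sumr big_split/= !Jsum// grid_last.
  rewrite sumr_const card_ord -(mulr_natr (sg * K * e * ((t - s) / n.+1%:R))) -(mulrA (sg * K * e)) mulfVK ?pnatr_eq0//.
  by ring.
apply: ler_sum => i _; have ii := ltn_ord i.
have [g1 g2 g3] := gi ii; have [E1 E2] := incr ii; have [p1 p2] := Jpos ii.
have g1' := le_trans g1 g2; have g3' := le_trans g2 g3.
have hE : grid n i.+1 - grid n i = (t - s) / n.+1%:R by rewrite grid_step; ring.
rewrite /ito_term -hE.
have h0 : 0 <= grid n i.+1 - grid n i by rewrite subr_ge0.
move: hE; set a := grid n i; set b := grid n i.+1 => hE.
rewrite -/a -/b in g1 g2 g3 g1' g3' E1 E2 p1 p2 h0.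
set al := J dx a b in E1 p1 *; set be := J dy a b in E2 p2 *.
set q1 := u1 a + _ in E1 *; set q2 := u2 a + _ in E2 *.
have ain : s <= a <= t by rewrite g1 g3'.
have bin : s <= b <= t by rewrite g1' g3.
have [|ab1 ab2 ab3 ab4] := mod b a bin ain; first by rewrite ger0_norm -?hE.
have alE : al = (u1 b - u1 a) - (m1 b - m1 a) by rewrite E1 /q1; ring.
have beE : be = (u2 b - u2 a) - (m2 b - m2 a) by rewrite E2 /q2; ring.
(* The drift over the cell is the increment of [u] minus that of [m], hence at most [2 e]; this
   makes the quadratic and cubic terms linear in the drift with a factor [e]. *)
have al2 : al <= 2 * e.
  by move: ab1 ab3; rewrite alE => /ler_normlP[? ?] /ler_normlP[? ?]; lra.
have be2 : be <= 2 * e.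
  by move: ab2 ab4; rewrite beE => /ler_normlP[? ?] /ler_normlP[? ?]; lra.
have sub f : itg f s t -> itg f a b by apply: itg_sub.
have Tay : V (u1 b) (u2 b) - V q1 q2 <= Vx q1 q2 * al + Vy q1 q2 * be + 7 * K * e * (al + be).
  have := T3 q1 q2 al be; rewrite -E1 -E2 (ger0_norm p1) (ger0_norm p2).
  have := bxx q1 q2 => /ler_normlP[_ w1]; have := bxy q1 q2 => /ler_normlP[_ w2].
  have := byy q1 q2 => /ler_normlP[_ w3].
  have : Vxx q1 q2 * al ^+ 2 <= K * (2 * e * al).
    apply: (@le_trans _ _ (K * al ^+ 2)); first by rewrite ler_wpM2r ?sqr_ge0.
    by rewrite ler_wpM2l// expr2 ler_wpM2r.
  have : 2 * Vxy q1 q2 * al * be <= 2 * (K * (2 * e * be)).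
    rewrite -!mulrA ler_pM2l//; apply: (@le_trans _ _ (K * (al * be))).
      by rewrite ler_wpM2r// mulr_ge0.
    by rewrite ler_wpM2l// mulrA ler_wpM2r.
  have : Vyy q1 q2 * be ^+ 2 <= K * (2 * e * be).
    apply: (@le_trans _ _ (K * be ^+ 2)); first by rewrite ler_wpM2r ?sqr_ge0.
    by rewrite ler_wpM2l// expr2 ler_wpM2r.
  have cube c : 0 <= c -> c <= 2 * e -> c ^+ 3 <= 4 * e * c.
    move=> c0 c2; rewrite exprS mulrC ler_wpM2r// expr2.
    by apply: (@le_trans _ _ (2 * e * (2 * e))); [apply: ler_pM|nra].
  have : K * (al ^+ 3 + be ^+ 3) <= K * (4 * e * al + 4 * e * be).
    by rewrite ler_wpM2l// lerD// cube.
  have := mulr_ge0 (mulr_ge0 K0 (ltW e0)) p1; have := mulr_ge0 (mulr_ge0 K0 (ltW e0)) p2.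
  by lra.
have Main : Vx q1 q2 * al + Vy q1 q2 * be <= J th a b - (b - a) * lapl (u1 a) (u2 a) / 2
    + sg * K * e * (b - a) + 4 * K * e * (al + be).
  have -> : Vx q1 q2 * al + Vy q1 q2 * be = J (fun r => Vx q1 q2 * dx r + Vy q1 q2 * dy r) a b.
    by rewrite J_D ?J_Z//; try apply: itg_scale; exact: sub.
  pose kk := sg * K * e - lapl (u1 a) (u2 a) / 2.
  have -> : J th a b - (b - a) * lapl (u1 a) (u2 a) / 2 + sg * K * e * (b - a)
      + 4 * K * e * (al + be) =
      J (fun r => (th r + 4 * K * e * (dx r + dy r)) + kk) a b.
    have ixy := itg_add (sub _ idx) (sub _ idy).
    have iz := itg_scale (4 * K * e) ixy.
    rewrite (J_D (itg_add (sub _ ith) iz) (itg_cst kk a b)) (J_D (sub _ ith) iz).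
    by rewrite (J_Z _ ixy) (J_D (sub _ idx) (sub _ idy)) J_cst// -/al -/be /kk; ring.
  apply: J_le_ae.
  - by apply: itg_add; apply: itg_scale; exact: sub.
  - apply: itg_add; last exact: itg_cst.
    by apply: itg_add; [exact: sub|apply: itg_scale; apply: itg_add; exact: sub].
  apply: (ae_imp _ ineq) => r hr /andP[r1 r2].
  have rin : s <= r <= t by rewrite (le_trans g1 r1) (le_trans r2 g3).
  have {}hr := hr rin.
  have [|c1 c2 _ _] := mod r a rin ain; first by rewrite ger0_norm ?subr_ge0// -hE lerB.
  have D1 : `|q1 - u1 r| <= 2 * e.
    have -> : q1 - u1 r = (m1 b - m1 a) - (u1 r - u1 a) by rewrite /q1; ring.
    by apply: le_trans (ler_normB _ _) _; lra.
  have D2 : `|q2 - u2 r| <= 2 * e.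
    have -> : q2 - u2 r = (m2 b - m2 a) - (u2 r - u2 a) by rewrite /q2; ring.
    by apply: le_trans (ler_normB _ _) _; lra.
  have KD : K * (`|q1 - u1 r| + `|q2 - u2 r|) <= 4 * K * e.
    by apply: (@le_trans _ _ (K * (4 * e))); [rewrite ler_wpM2l//; lra|lra].
  have := le_trans (lx q1 q2 (u1 r) (u2 r)) KD => /ler_normlP[_ /(ler_wpM2r (dx0 rin)) X1].
  have := le_trans (ly q1 q2 (u1 r) (u2 r)) KD => /ler_normlP[_ /(ler_wpM2r (dy0 rin)) Y1].
  have L1 : lapl (u1 a) (u2 a) - lapl (u1 r) (u2 r) <= sg * K * (2 * e).
    apply: le_trans (ler_norm _) _; rewrite distrC; apply: le_trans (lapl_lip _ _ _ _) _.
    rewrite ler_wpM2l//; last lra.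
    by rewrite mulr_ge0// /sg !addr_ge0// mulr_ge0.
  by rewrite /kk; lra.
lra.
Qed.

End path_limit.

Section half_line.
Context {R : realType}.
Implicit Types f : R -> R.

Lemma within_half_line f : {within `[0, +oo[, continuous f} ->
  continuous (fun r : R => f (Num.max r 0)).
Proof.
move=> /continuous_within_itvcyP[ci c0] r.
have [r0|r0|r0] := ltgtP r 0.
- have E : \forall x \near r, f 0 = f (Num.max x 0).
    near=> x; rewrite (max_idPr _)//; apply: ltW; near: x; exact: lt_nbhsl.
  rewrite /continuous_at (max_idPr (ltW r0)).
  by apply: cvg_trans (near_eq_cvg E) _; exact: cvg_cst.
- have E : \forall x \near r, f x = f (Num.max x 0).
    near=> x; rewrite (max_idPl _)//; apply: ltW; near: x; exact: lt_nbhsr.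
  rewrite /continuous_at (max_idPl (ltW r0)).
  by apply: cvg_trans (near_eq_cvg E) _; apply: ci; rewrite in_itv/= r0.
- rewrite r0 /continuous_at maxxx; apply/cvgrPdist_lt => e e0.
  have /cvgrPdist_lt /(_ e e0) [h /= h0 hh] := c0.
  exists h => //= x xh.
  have [x0|x0] := leP x 0; first by rewrite subrr normr0.
  exact: hh.
Unshelve. all: by end_near. Qed.

Lemma unif_half_line f a b (e : R) : continuous (fun r : R => f (Num.max r 0)) -> 0 <= a -> 0 < e ->
  exists2 h : R, 0 < h & forall x y, a <= x <= b -> a <= y <= b -> `|x - y| < h -> `|f x - f y| < e.
Proof.
move=> cf a0 e0; have [h h0 hh] := unif_cont a b cf e0; exists h => // x y xab /andP[ya _] xy.
have := hh x y xab xy; case/andP: xab => xa _.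
by rewrite !(max_idPl _)//; [exact: le_trans ya|exact: le_trans xa].
Qed.
End half_line.

Section zero_mean.
Context {R : realType} {d : measure_display} {Omega : measurableType d}.
Variable P : probability Omega R.
Definition zm (f : Omega -> R) := P.-integrable setT (EFin \o f) /\ Rintegral P setT f = 0.

Lemma zm_add f g : zm f -> zm g -> zm (fun w => f w + g w).
Proof.
move=> [fi f0] [gi g0]; split; first exact: integrableD_EFin.
by rewrite RintegralD// f0 g0 addr0.
Qed.

Lemma integrable_cst_prob (k : R) : P.-integrable setT (EFin \o (fun=> k)).
Proof. exact: finite_measure_integrable_cst. Qed.

Lemma ae_le_integrable (f g : Omega -> R) : measurable_fun setT f ->
  P.-integrable setT (EFin \o g) -> {ae P, forall w, `|f w| <= g w} ->
  P.-integrable setT (EFin \o f).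
Proof.
move=> mf gi fg.
(* Dominated convergence for the constant sequence [f] turns the almost sure bound into
   integrability. *)
have [] := @Rintegral_dct _ _ _ P setT (fun=> f) f g measurableT (fun=> mf) mf _ gi _ => //.
- by apply: aeW => w _; exact: cvg_cst.
- by apply: (ae_imp _ fg) => w ? ? _.
Qed.
End zero_mean.

(** * Brownian increments and an upper Dynkin formula *)

Section brownian.
Context {R : realType} {d : measure_display} {Omega : measurableType d}.
Variable P : probability Omega R.
Variables (F : R -> set (set Omega)) (rho : R) (B C : R -> Omega -> R).
Hypotheses (uF : usual_filtration P F) (rho1 : -1 <= rho <= 1) (bm : correlated_BM P F rho B C).
Notation E f := (Rintegral P setT f).

Definition BM (l m t : R) (w : Omega) : R := l * B t w + m * C t w.
Definition var (l m : R) : R := l ^+ 2 + 2 * rho * l * m + m ^+ 2.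
Definition cov (l m l' m' : R) : R := l * l' + rho * (l * m' + l' * m) + m * m'.

Lemma F_sigma t : 0 <= t -> sigma_algebra setT (F t).
Proof. by case: uF => h _ _ _ /h[]. Qed.
Lemma F_sub t : 0 <= t -> F t `<=` measurable.
Proof. by case: uF => h _ _ _ /h[]. Qed.
Lemma F_nd s t : 0 <= s -> s <= t -> F s `<=` F t.
Proof. by case: uF => _ h _ _; exact: h. Qed.
Lemma F_meas t (f : Omega -> R) : 0 <= t -> G_measurable (F t) f -> measurable_fun setT f.
Proof. by move=> t0 mf _ U mU; rewrite setTI; apply: (F_sub t0); exact: mf. Qed.

Lemma BM_adapted l m : adapted F (BM l m).
Proof.
have [_ _ [aB aC] _] := bm => t t0; have sF := F_sigma t0.
by apply: gm_add => //; (apply: gm_mul => //; first exact: gm_cst); [exact: aB|exact: aC].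
Qed.

Lemma var_ge0 l m : 0 <= var l m.
Proof.
case/andP: rho1 => r1 r2.
(* Diagonalization of the covariance: the eigenvectors are [(1, 1)] and [(1, -1)], with eigenvalues
   [1 + rho] and [1 - rho]. *)
have -> : var l m = (1 + rho) / 2 * (l + m) ^+ 2 + (1 - rho) / 2 * (l - m) ^+ 2.
  by rewrite /var; field.
by rewrite addr_ge0// mulr_ge0 ?sqr_ge0//; lra.
Qed.

Section incr.
Variables (s t l m : R).
Hypotheses (s0 : 0 <= s) (st : s < t).
Let D w := BM l m t w - BM l m s w.
Let v := (t - s) * var l m.
Let t0 : 0 <= t. Proof. exact: le_trans (ltW st). Qed.

Let v0 : 0 <= v. Proof. by rewrite mulr_ge0 ?var_ge0// subr_ge0 ltW. Qed.

Let mD : measurable_fun setT D.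
Proof.
apply: measurable_funB; [exact: (F_meas t0 (BM_adapted _ _ t0))|].
exact: (F_meas s0 (BM_adapted _ _ s0)).
Qed.

Let charc A (FA : F s A) k :
  (\int[P]_(w in A) (cos (k * D w))%:E = P A * (expR (- (k ^+ 2 * v) / 2))%:E)%E.
Proof.
have [_ _ _ /(_ s t s0 (ltW st) A FA (k * l) (k * m))[h _]] := bm.
rewrite (_ : - (k ^+ 2 * v) / 2 =
  - ((t - s) * ((k * l) ^+ 2 + 2 * rho * (k * l) * (k * m) + (k * m) ^+ 2)) / 2); last first.
  by rewrite /v /var; field.
rewrite -h; apply: eq_integral => w _; congr (cos _)%:E.
by rewrite /D /BM; ring.
Qed.

Let chars A (FA : F s A) k : (\int[P]_(w in A) (sin (k * D w))%:E = 0)%E.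
Proof.
have [_ _ _ /(_ s t s0 (ltW st) A FA (k * l) (k * m))[_ h]] := bm.
rewrite -h; apply: eq_integral => w _; congr (sin _)%:E.
by rewrite /D /BM; ring.
Qed.

Let FT : F s setT.
Proof. by have [? h _] := F_sigma s0; rewrite -(setD0 setT); exact: h. Qed.

Lemma incr_integrable k : (k <= 4)%N -> P.-integrable setT (EFin \o (fun w => `|D w| ^+ k)).
Proof. exact: (char_integrable measurableT mD v0 (charc FT)). Qed.

Let i2 : P.-integrable setT (EFin \o (fun w => D w ^+ 2)).
Proof.
have := incr_integrable (k := 2) isT; apply: eq_integrable => // w _ /=.
by rewrite -normrX ger0_norm// sqr_ge0.
Qed.

(** The third moment is interpolated between the second and the fourth by
    [y ^+ 3 <= (a y ^+ 2 + y ^+ 4 / a) / 2]. The choice [a = sqrt (t - s)] balances both terms and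
    gives the order [3 / 2] in the time step. *)
Lemma incr3 : E (fun w => `|D w| ^+ 3) <=
  (var l m + 3 * var l m ^+ 2) / 2 * ((t - s) * Num.sqrt (t - s)).
Proof.
have h0 : 0 < t - s by rewrite subr_gt0.
set a := Num.sqrt (t - s).
have a0 : 0 < a by rewrite sqrtr_gt0.
have aE : t - s = a ^+ 2 by rewrite sqr_sqrtr// ltW.
have [i4 e4] := char_moment4 measurableT mD v0 (charc FT).
have e2 := char_moment2 measurableT mD v0 (charc FT).
have PT : fine (P setT) = 1 by rewrite probability_setT.
rewrite PT mulr1 in e4 e2.
apply: (@le_trans _ _ (E (fun w => a / 2 * D w ^+ 2 + a^-1 / 2 * D w ^+ 4))).
  apply: le_Rintegral => //.
  - exact: incr_integrable.
  - by apply: integrableD_EFin => //; exact: integrableZ_EFin.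
  move=> w _; have y0 := normr_ge0 (D w).
  have -> : D w ^+ 2 = `|D w| ^+ 2 by rewrite -normrX ger0_norm// sqr_ge0.
  have -> : D w ^+ 4 = `|D w| ^+ 4 by rewrite -normrX ger0_norm// exprn_even_ge0.
  move: y0; set y := `|D w| => y0.
  have -> : a / 2 * y ^+ 2 + a^-1 / 2 * y ^+ 4 = y ^+ 3 + (a - y) ^+ 2 * y ^+ 2 * (a^-1 / 2).
    by field; rewrite gt_eqF.
  have a2 : 0 <= a^-1 / 2 by rewrite divr_ge0// invr_ge0 ltW.
  by rewrite lerDl; apply: mulr_ge0 => //; apply: mulr_ge0; exact: sqr_ge0.
rewrite RintegralD//; try exact: integrableZ_EFin.
rewrite !RintegralZl// e2 /v aE.
have -> : (var l m + 3 * var l m ^+ 2) / 2 * (a ^+ 2 * a) =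
  a / 2 * (a ^+ 2 * var l m) + a^-1 / 2 * (3 * (a ^+ 2 * var l m) ^+ 2).
  by field; rewrite gt_eqF.
rewrite mulr1 lerD2l; apply: ler_wpM2l; first by rewrite divr_ge0// invr_ge0 ltW.
by rewrite -aE.
Qed.

Variables (phi : Omega -> R) (c : R).
Hypotheses (gphi : G_measurable (F s) phi) (phic : forall w, `|phi w| <= c).

Lemma incr_zm1 : zm P (fun w => phi w * D w).
Proof.
have [i1 _] := char_moment1 measurableT mD v0 (charc FT) (chars FT).
split; first exact: (integrable_bmul i1 (F_meas s0 gphi) phic).
apply: (orthogonal_bounded (F_sigma s0) (F_sub s0) i1 _ gphi phic) => A FA.
by have [] := char_moment1 (F_sub s0 FA) mD v0 (charc FA) (chars FA).
Qed.

Lemma incr_zm2 : zm P (fun w => phi w * (D w ^+ 2 - v)).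
Proof.
have ic := integrable_cst_prob P v.
have iZ : P.-integrable setT (EFin \o (fun w => D w ^+ 2 - v)) by exact: integrableB_EFin.
split; first exact: (integrable_bmul iZ (F_meas s0 gphi) phic).
apply: (orthogonal_bounded (F_sigma s0) (F_sub s0) iZ _ gphi phic) => A FA.
have mA := F_sub s0 FA.
have e2 := char_moment2 mA mD v0 (charc FA).
rewrite RintegralB//; last 2 first.
- exact: integrableS i2.
- exact: integrableS ic.
by rewrite e2 Rintegral_cst// subrr.
Qed.
End incr.

Section dynkin_formula.
Variables (K : R) (V Vx Vy Vxx Vxy Vyy : R -> R -> R).
Hypothesis tV : test_fun K V Vx Vy Vxx Vxy Vyy.
Variables (l1 m1 l2 m2 : R).
Local Notation lap := (lapl Vxx Vxy Vyy (var l1 m1) (cov l1 m1 l2 m2) (var l2 m2)).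
Local Notation M1 := (BM l1 m1).
Local Notation M2 := (BM l2 m2).

Lemma gm_test (G : set (set Omega)) f (X Y : Omega -> R) : sigma_algebra setT G -> nice2 K f ->
  G_measurable G X -> G_measurable G Y -> G_measurable G (fun w => f (X w) (Y w)).
Proof. by move=> sG [_ _ mf]; exact: gm_meas2. Qed.

(** For pure noise the first- and second-order Taylor terms have mean 0 after compensation, even
    against a weight known at time [s]. What is left is the cubic remainder, of order [3 / 2] in the
    time step, so its sum over a grid vanishes. *)
Lemma ito_step (s t : R) (phi X Y : Omega -> R) : 0 <= s -> s < t ->
  G_measurable (F s) phi -> (forall w, 0 <= phi w <= 1) ->
  G_measurable (F s) X -> G_measurable (F s) Y ->
  let f w := phi w * (V (X w + (M1 t w - M1 s w)) (Y w + (M2 t w - M2 s w)) - V (X w) (Y w)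
                      - (t - s) * lap (X w) (Y w) / 2) in
  P.-integrable setT (EFin \o f) /\
  E f <= K * ((var l1 m1 + 3 * var l1 m1 ^+ 2) / 2 + (var l2 m2 + 3 * var l2 m2 ^+ 2) / 2)
     * ((t - s) * Num.sqrt (t - s)).
Proof.
move=> s0 st gphi phi01 gX gY f.
have K0 := test_K0 tV.
have t0 : 0 <= t by exact: le_trans (ltW st).
have sFs := F_sigma s0; have sFt := F_sigma t0.
have [[LV mV] [nx ny] [nxx nxy nyy] T3] := tV.
pose a w := M1 t w - M1 s w; pose b w := M2 t w - M2 s w.
have phi1 w : `|phi w| <= 1 by case/andP: (phi01 w) => p0 p1; rewrite ger0_norm.
have bd g : nice2 K g -> forall w, `|phi w * g (X w) (Y w)| <= K.
  by move=> [bg _ _] w; rewrite normrM -[leRHS]mul1r ler_pM.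
have gg g : nice2 K g -> G_measurable (F s) (fun w => phi w * g (X w) (Y w)).
  by move=> ng; apply: gm_mul => //; exact: gm_test.
have gc (k : R) : G_measurable (F s) (fun=> k) by exact: gm_cst.
have bd2 g g' w : nice2 K g -> nice2 K g' ->
    `|2^-1 * (phi w * g (X w) (Y w) - phi w * g' (X w) (Y w))| <= K.
  move=> ng ng'; rewrite normrM (@ger0_norm _ 2^-1)//.
  have := bd _ ng w; have := bd _ ng' w.
  by have := ler_normB (phi w * g (X w) (Y w)) (phi w * g' (X w) (Y w)); lra.
have gg2 g g' : nice2 K g -> nice2 K g' ->
    G_measurable (F s) (fun w => 2^-1 * (phi w * g (X w) (Y w) - phi w * g' (X w) (Y w))).
  by move=> ng ng'; apply: gm_mul => //; apply: gm_sub => //; exact: gg.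
have z1 := incr_zm1 l1 m1 s0 st (gg _ nx) (bd _ nx).
have z2 := incr_zm1 l2 m2 s0 st (gg _ ny) (bd _ ny).
(* Only squares of increments are known to be centred after compensation. The cross term is
   rewritten by [2 a b = (a + b)^2 - a^2 - b^2], where [a + b] is the increment with coefficients
   [l1 + l2], [m1 + m2]; hence the differences [Vxx - Vxy] and [Vyy - Vxy]. *)
have z3 := incr_zm2 l1 m1 s0 st (gg2 _ _ nxx nxy) (fun w => bd2 _ _ w nxx nxy).
have z4 := incr_zm2 l2 m2 s0 st (gg2 _ _ nyy nxy) (fun w => bd2 _ _ w nyy nxy).
have gxy : G_measurable (F s) (fun w => 2^-1 * (phi w * Vxy (X w) (Y w))).
  by apply: gm_mul => //; exact: gg.
have bxy w : `|2^-1 * (phi w * Vxy (X w) (Y w))| <= K.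
  by rewrite normrM (@ger0_norm _ 2^-1)//; have := bd _ nxy w; have := normr_ge0 (phi w * Vxy (X w) (Y w)); lra.
have z5 := incr_zm2 (l1 + l2) (m1 + m2) s0 st gxy bxy.
have zz := zm_add (zm_add (zm_add (zm_add z1 z2) z3) z4) z5.
have i3a := incr_integrable l1 m1 s0 st (k := 3) isT.
have i3b := incr_integrable l2 m2 s0 st (k := 3) isT.
have i1a := incr_integrable l1 m1 s0 st (k := 1) isT.
have i1b := incr_integrable l2 m2 s0 st (k := 1) isT.
have gmono (Z : Omega -> R) : G_measurable (F s) Z -> G_measurable (F t) Z.
  by move=> gZ U mU; apply: (F_nd s0 (ltW st)); exact: gZ.
have gM l m : G_measurable (F t) (fun w => BM l m t w - BM l m s w).
  by apply: gm_sub => //; [exact: BM_adapted|apply: gmono; exact: BM_adapted].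
have mf : measurable_fun setT f.
  apply: (F_meas t0); apply: gm_mul => //; first exact: gmono.
  apply: gm_sub => //.
    apply: gm_sub => //; apply: gm_meas2 => //; try exact: gmono.
      by apply: gm_add => //; exact: gmono.
    by apply: gm_add => //; exact: gmono.
  apply: gm_mul => //; last exact: gm_cst.
  apply: gm_mul => //; first exact: gm_cst.
  by apply: gm_meas2 => //; [exact: (lapl_meas tV)|exact: gmono|exact: gmono].
set sg := (`|var l1 m1| + 2 * `|cov l1 m1 l2 m2| + `|var l2 m2|).
have fi : P.-integrable setT (EFin \o f).
  apply: (@le_integrable_EFin _ _ _ P setT _
    (fun w => K * (`|a w| ^+ 1 + `|b w| ^+ 1) + (t - s) * (sg * K))) => //.
    move=> w _; rewrite /f normrM -[leRHS]mul1r ler_pM// ?phi1//.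
    apply: le_trans (ler_normB _ _) _; apply: lerD.
      apply: le_trans (LV _ _ _ _) _.
      by rewrite !expr1 ler_wpM2l// ![_ + (_ - _)]addrC !addrK.
    have := lapl_bounded tV (var l1 m1) (cov l1 m1 l2 m2) (var l2 m2) (X w) (Y w).
    rewrite -/sg => lb; rewrite !normrM (@ger0_norm _ 2^-1)// (@ger0_norm _ (t - s)) ?subr_ge0 ?(ltW st)//.
    have h0 : 0 <= t - s by rewrite subr_ge0 ltW.
    apply: (@le_trans _ _ ((t - s) * `|lap (X w) (Y w)|)); last by rewrite ler_wpM2l.
    by rewrite ler_piMr//; [apply: mulr_ge0|lra].
  apply: integrableD_EFin => //.
    by apply: integrableZ_EFin => //; exact: integrableD_EFin.
  exact: integrable_cst_prob.
split => //.
have ib : P.-integrable setT (EFin \o (fun w => K * (`|a w| ^+ 3 + `|b w| ^+ 3))).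
  by apply: integrableZ_EFin => //; exact: integrableD_EFin.
have [zi zE] := zz.
apply: (@le_trans _ _ (E (fun w => (phi w * Vx (X w) (Y w) * a w + phi w * Vy (X w) (Y w) * b w
   + 2^-1 * (phi w * Vxx (X w) (Y w) - phi w * Vxy (X w) (Y w)) * (a w ^+ 2 - (t - s) * var l1 m1)
   + 2^-1 * (phi w * Vyy (X w) (Y w) - phi w * Vxy (X w) (Y w)) * (b w ^+ 2 - (t - s) * var l2 m2)
   + 2^-1 * (phi w * Vxy (X w) (Y w)) *
      ((BM (l1 + l2) (m1 + m2) t w - BM (l1 + l2) (m1 + m2) s w) ^+ 2
        - (t - s) * var (l1 + l2) (m1 + m2)))
   + K * (`|a w| ^+ 3 + `|b w| ^+ 3)))).
  apply: le_Rintegral => //; first exact: integrableD_EFin.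
  move=> w _; rewrite /f.
  have := T3 (X w) (Y w) (a w) (b w); rewrite -/(a w) -/(b w).
  have -> : BM (l1 + l2) (m1 + m2) t w - BM (l1 + l2) (m1 + m2) s w = a w + b w.
    by rewrite /a /b /BM; ring.
  have -> : var (l1 + l2) (m1 + m2) = var l1 m1 + 2 * cov l1 m1 l2 m2 + var l2 m2.
    by rewrite /var /cov; ring.
  have /andP[p0 p1] := phi01 w.
  have k0 : 0 <= K * (`|a w| ^+ 3 + `|b w| ^+ 3) by rewrite mulr_ge0// addr_ge0// exprn_ge0.
  set Va := V (X w + a w) (Y w + b w); set V0 := V (X w) (Y w).
  move: k0; set kk := K * _ => k0.
  rewrite -subr_ge0 => /(mulr_ge0 p0) H.
  have k1 : phi w * kk <= kk by rewrite ler_piMl.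
  rewrite /lapl; lra.
rewrite RintegralD// zE add0r RintegralZl//; last exact: integrableD_EFin.
rewrite -mulrA ler_wpM2l// RintegralD// mulrDl lerD//; exact: incr3.
Qed.

Lemma telescope_ord (f : nat -> R) n : \sum_(i < n) (f i.+1 - f i) = f n - f 0.
Proof.
elim: n => [|n IH]; first by rewrite big_ord0 subrr.
by rewrite big_ord_recr/= IH; ring.
Qed.

(** The function [th] is any integrable upper bound of the generator along the path, so a generator
    that is awkward to integrate can be replaced by a simpler majorant. *)
Definition ito_path (s t : R) (u1 u2 n1 n2 : R -> R) (Th : R) :=
  exists dx dy th : R -> R,
  [/\ [/\ itg dx s t, itg dy s t & itg th s t],
      (forall r, s <= r <= t -> 0 <= dx r /\ 0 <= dy r),
      (forall r, s <= r <= t -> u1 r = u1 s + (n1 r - n1 s) + J dx s r /\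
                                u2 r = u2 s + (n2 r - n2 s) + J dy s r),
      {ae lebesgue_measure, forall r, s <= r <= t ->
        Vx (u1 r) (u2 r) * dx r + Vy (u1 r) (u2 r) * dy r + lap (u1 r) (u2 r) / 2 <= th r} &
      Th = J th s t].

(** On each grid the weighted increment of [V] splits into [phi * S n], handled along paths, and
    noise terms [T n i], handled in expectation. Both [U1] and [U2] are noise plus a nondecreasing
    drift, whose total [D1], [D2] is integrable and dominates the pathwise sums. *)
Theorem dynkin_formula (s t : R) (U1 U2 : R -> Omega -> R) (Th phi : Omega -> R) :
  0 <= s -> s < t -> adapted F U1 -> adapted F U2 ->
  P.-integrable setT (EFin \o Th) ->
  P.-integrable setT (EFin \o (fun w => U1 t w - U1 s w - (M1 t w - M1 s w))) ->
  P.-integrable setT (EFin \o (fun w => U2 t w - U2 s w - (M2 t w - M2 s w))) ->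
  {ae P, forall w, [/\ continuous (fun r : R => U1 (Num.max r 0) w),
     continuous (fun r : R => U2 (Num.max r 0) w) &
     ito_path s t (U1^~ w) (U2^~ w) (M1^~ w) (M2^~ w) (Th w)]} ->
  G_measurable (F s) phi -> (forall w, 0 <= phi w <= 1) ->
  P.-integrable setT (EFin \o (fun w => phi w * (V (U1 t w) (U2 t w) - V (U1 s w) (U2 s w)))) /\
  E (fun w => phi w * (V (U1 t w) (U2 t w) - V (U1 s w) (U2 s w))) <= E (fun w => phi w * Th w).
Proof.
move=> s0 st aU1 aU2 iTh iD1 iD2 path gphi phi01.
have K0 := test_K0 tV.
have t0 : 0 <= t by exact: le_trans (ltW st).
have sFt := F_sigma t0.
have [[LV mV] _ _ _] := tV.
have phi1 w : `|phi w| <= 1 by case/andP: (phi01 w) => p0 p1; rewrite ger0_norm.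
pose D1 w := U1 t w - U1 s w - (M1 t w - M1 s w).
pose D2 w := U2 t w - U2 s w - (M2 t w - M2 s w).
set sg := (`|var l1 m1| + 2 * `|cov l1 m1 l2 m2| + `|var l2 m2|).
pose S n w := \sum_(i < n.+1) ito_term V Vxx Vxy Vyy (var l1 m1) (cov l1 m1 l2 m2) (var l2 m2)
   s t (U1^~ w) (U2^~ w) (M1^~ w) (M2^~ w) n i.
pose g n i := grid s t n i.
have g1 n i : s <= g n i by exact: grid_ge (ltW st) _ _.
have g2 n i : (i <= n.+1)%N -> g n i <= t by exact: grid_le (ltW st) _ _.
have gU (Z : R -> Omega -> R) n i : adapted F Z -> (i <= n.+1)%N -> G_measurable (F t) (Z (g n i)).
  move=> aZ ik; apply: (adapted_le F_nd) => //; last exact: g2.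
  exact: le_trans (g1 n i).
have hp n : 0 < (t - s) / n.+1%:R by rewrite divr_gt0// subr_gt0.
pose T n i w := phi w * (V (U1 (g n i) w + (M1 (g n i.+1) w - M1 (g n i) w))
     (U2 (g n i) w + (M2 (g n i.+1) w - M2 (g n i) w)) - V (U1 (g n i) w) (U2 (g n i) w)
   - (g n i.+1 - g n i) * lap (U1 (g n i) w) (U2 (g n i) w) / 2).
set cK := K * ((var l1 m1 + 3 * var l1 m1 ^+ 2) / 2 + (var l2 m2 + 3 * var l2 m2 ^+ 2) / 2).
have gstep n i : g n i.+1 - g n i = (t - s) / n.+1%:R by rewrite /g grid_step; ring.
have TP n i : (i < n.+1)%N -> P.-integrable setT (EFin \o T n i) /\
    E (T n i) <= cK * ((t - s) / n.+1%:R * Num.sqrt ((t - s) / n.+1%:R)).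
  move=> ni; have gi0 : 0 <= g n i by exact: le_trans (g1 n i).
  have gii : g n i < g n i.+1 by rewrite -subr_gt0 gstep.
  have gphi' : G_measurable (F (g n i)) phi.
    by move=> U mU; apply: (F_nd s0 (g1 n i)); exact: gphi.
  by rewrite -(gstep n i); exact: (ito_step gi0 gii gphi' phi01 (aU1 _ gi0) (aU2 _ gi0)).
have dec n w : phi w * (V (U1 t w) (U2 t w) - V (U1 s w) (U2 s w)) =
    phi w * S n w + \sum_(i < n.+1) T n i w.
  rewrite /S /T -mulr_sumr -mulrDr -big_split/=; congr (_ * _).
  transitivity (\sum_(i < n.+1) (V (U1 (g n i.+1) w) (U2 (g n i.+1) w) - V (U1 (g n i) w) (U2 (g n i) w))).
    rewrite (telescope_ord (fun i => V (U1 (g n i) w) (U2 (g n i) w)))/g.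
    by rewrite grid_last grid0.
  by apply: eq_bigr => i _; rewrite /ito_term gstep -/(g n i) -/(g n i.+1); ring.
have mS n : measurable_fun setT (S n).
  apply: (F_meas t0); apply: gm_sum => // i; apply: gm_add => //.
    have ii := ltn_ord i.
    apply: gm_sub => //; apply: gm_meas2 => //; try exact: gU.
      apply: gm_add => //; first by apply: gU => //; exact: ltnW.
      by apply: gm_sub => //; apply: gU => //; try exact: BM_adapted; exact: ltnW.
    apply: gm_add => //; first by apply: gU => //; exact: ltnW.
    by apply: gm_sub => //; apply: gU => //; try exact: BM_adapted; exact: ltnW.
  apply: gm_mul => //; last exact: gm_cst.
  apply: gm_mul => //; first exact: gm_cst.
  apply: gm_meas2 => //; first exact: (lapl_meas tV).
    by apply: gU => //; exact: ltnW.
  by apply: gU => //; exact: ltnW.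
have iBd : P.-integrable setT (EFin \o (fun w => K * (D1 w + D2 w) + sg * K * (t - s))).
  apply: integrableD_EFin => //.
    by apply: integrableZ_EFin => //; exact: integrableD_EFin.
  exact: integrable_cst_prob.
have Sbd : {ae P, forall w, forall n, `|S n w| <= K * (D1 w + D2 w) + sg * K * (t - s)}.
  apply: (ae_imp _ path) => w [_ _ [dx [dy [th [[ix iy ith] pos eqs ineq ThE]]]]] n.
  have tt : s <= t <= t by rewrite (ltW st) lexx.
  have [e1 e2] := eqs t tt.
  have -> : D1 w = J dx s t by rewrite /D1 e1; ring.
  have -> : D2 w = J dy s t by rewrite /D2 e2; ring.
  apply: (ito_sum_bound tV _ _ _ (ltW st) ix iy).
  - by move=> r /pos[].
  - by move=> r /pos[].
  - by move=> r /eqs[].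
  - by move=> r /eqs[].
have iS n : P.-integrable setT (EFin \o S n).
  by apply: ae_le_integrable (mS n) iBd _; apply: (ae_imp _ Sbd) => w; exact.
have iphiS n : P.-integrable setT (EFin \o (fun w => phi w * S n w)).
  exact: (integrable_bmul (iS n) (F_meas s0 gphi) phi1).
have iphiTh : P.-integrable setT (EFin \o (fun w => phi w * Th w)).
  exact: (integrable_bmul iTh (F_meas s0 gphi) phi1).
have iT n : P.-integrable setT (EFin \o (fun w => \sum_(i < n.+1) T n i w)).
  apply: integrable_sum_EFin => // i.
  by have [] := TP n i (ltn_ord i).
have iL : P.-integrable setT
   (EFin \o (fun w => phi w * (V (U1 t w) (U2 t w) - V (U1 s w) (U2 s w)))).
  have := integrableD_EFin measurableT (iphiS 0) (iT 0).
  by apply: eq_integrable => // w _ /=; rewrite (dec 0).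
split => //.
have mTh : measurable_fun setT Th by case/integrableP: iTh => /measurable_EFinP.
(* Only an upper bound for [S n] is available in the limit. Its excess over [Th] tends to 0 almost
   surely and is dominated, so its expectation tends to 0. *)
pose W n w := Num.max (S n w - Th w) 0.
have Wlim : {ae P, forall w, setT w -> W^~ w @ \oo --> 0}.
  apply: (ae_imp _ path) => w [c1 c2 [dx [dy [th [[ix iy ith] pos eqs ineq ThE]]]]] _.
  pose CC := 11 * K * (J dx s t + J dy s t) + sg * K * (t - s).
  have dx0 r : s <= r <= t -> 0 <= dx r by move=> /pos[].
  have dy0 r : s <= r <= t -> 0 <= dy r by move=> /pos[].
  have CC0 : 0 <= CC.
    have := mulr_ge0 K0 (J_ge0 dx0); have := mulr_ge0 K0 (J_ge0 dy0).
    have : 0 <= sg * K * (t - s).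
      rewrite mulr_ge0 ?subr_ge0 ?(ltW st)// mulr_ge0// /sg !addr_ge0// mulr_ge0//.
    by rewrite /CC; lra.
  have cM l m : continuous (fun r : R => BM l m (Num.max r 0) w).
    have [_ [cB cC] _ _] := bm => r.
    by apply: cvgD; apply: cvgMr; [exact: (within_half_line (cB w))|exact: (within_half_line (cC w))].
  apply/cvgrPdist_le => e e0.
  pose e' := Num.min 1 (e / (CC + 1)).
  have CC1 : 0 < CC + 1 by lra.
  have e'0 : 0 < e' by rewrite lt_min ltr01 divr_gt0.
  have e'1 : e' <= 1 by rewrite ge_min lexx.
  have e'e : CC * e' <= e.
    have : e' <= e / (CC + 1) by rewrite ge_min lexx orbT.
    rewrite ler_pdivlMr// => h.
    have := ltW e'0; lra.
  have [h1 h10 hh1] := unif_half_line (f := U1^~ w) t c1 s0 e'0.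
  have [h2 h20 hh2] := unif_half_line (f := U2^~ w) t c2 s0 e'0.
  have [h3 h30 hh3] := unif_half_line (f := (BM l1 m1)^~ w) t (cM l1 m1) s0 e'0.
  have [h4 h40 hh4] := unif_half_line (f := (BM l2 m2)^~ w) t (cM l2 m2) s0 e'0.
  pose h := Num.min (Num.min h1 h2) (Num.min h3 h4).
  have h0 : 0 < h by rewrite !lt_min h10 h20 h30 h40.
  near=> n.
  have hn : (t - s) / n.+1%:R < h.
    rewrite ltr_pdivrMr// mulrC -ltr_pdivrMr//.
    have : (t - s) / h < n%:R by near: n; exact: nbhs_infty_gtr.
    by move=> /lt_trans; apply; rewrite ltr_nat.
  have le : S n w <= J th s t + CC * e'.
    apply: (ito_sum_le tV (ltW st) ix iy ith dx0 dy0 _ _ ineq e'0 e'1).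
    - by move=> r /eqs[].
    - by move=> r /eqs[].
    move=> r r' rr rr' rd; have := le_lt_trans rd hn; rewrite !lt_min.
    move=> /andP[/andP[d1 d2] /andP[d3 d4]].
    by split; apply: ltW; [exact: hh1|exact: hh2|exact: hh3|exact: hh4].
  rewrite sub0r normrN ger0_norm; last by rewrite le_max lexx orbT.
  by rewrite /W ge_max (ltW e0) andbT ThE; lra.
have mW n : measurable_fun setT (W n).
  by apply: measurable_maxr; [exact: measurable_funB|exact: measurable_cst].
have iWb : P.-integrable setT (EFin \o (fun w => K * (D1 w + D2 w) + sg * K * (t - s) + `|Th w|)).
  by apply: integrableD_EFin => //; exact: integrable_norm.
have Wb : {ae P, forall w, forall n, setT w -> `|W n w| <=
    K * (D1 w + D2 w) + sg * K * (t - s) + `|Th w|}.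
  apply: (ae_imp _ Sbd) => w Sb n _; have := Sb n => /ler_normlP[S1 S2].
  rewrite ger0_norm; last by rewrite le_max lexx orbT.
  have T1 := ler_norm (- Th w); rewrite normrN in T1.
  have T2 := normr_ge0 (Th w).
  by rewrite /W ge_max; apply/andP; split; lra.
have [_ EW] := Rintegral_dct measurableT mW (@measurable_cst _ _ _ _ setT (0 : R)) Wlim iWb Wb.
have iW n : P.-integrable setT (EFin \o W n).
  by apply: ae_le_integrable (mW n) iWb _; apply: (ae_imp _ Wb) => w h; exact: h.
have key n : E (fun w => phi w * (V (U1 t w) (U2 t w) - V (U1 s w) (U2 s w))) <=
   E (fun w => phi w * Th w) + E (W n) + cK * (t - s) * Num.sqrt ((t - s) / n.+1%:R).
  under eq_Rintegral do rewrite (dec n).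
  rewrite RintegralD//; apply: lerD.
    have -> : E (fun w => phi w * Th w) + E (W n) = E (fun w => phi w * Th w + W n w).
      by rewrite RintegralD.
    apply: le_Rintegral => //; first exact: integrableD_EFin.
    move=> w _; have /andP[p0 p1] := phi01 w.
    have : phi w * (S n w - Th w) <= W n w.
      apply: (@le_trans _ _ (phi w * W n w)); first by rewrite ler_wpM2l// le_max lexx.
      by rewrite ler_piMl// le_max lexx orbT.
    by rewrite mulrBr; lra.
  have Ti (i : 'I_n.+1) : P.-integrable setT (EFin \o T n i) by have [] := TP n i (ltn_ord i).
  rewrite Rintegral_sum//.
  (* There are [n + 1] noise terms, each of order mesh to the power [3 / 2]; their sum is of the
     order of the square root of the mesh. *)
  have -> : cK * (t - s) * Num.sqrt ((t - s) / n.+1%:R) =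
    \sum_(i < n.+1) (cK * ((t - s) / n.+1%:R * Num.sqrt ((t - s) / n.+1%:R))).
    rewrite sumr_const card_ord -(mulr_natr (cK * ((t - s) / n.+1%:R * Num.sqrt ((t - s) / n.+1%:R)))).
    have aux (c x q N : R) : N != 0 -> c * x * q = c * (x / N * q) * N by move=> N0; field.
    by apply: aux; rewrite pnatr_eq0.
  by apply: ler_sum => i _; have [] := TP n i (ltn_ord i).
have lim : (fun n : nat => E (fun w => phi w * Th w) + E (W n)
   + cK * (t - s) * Num.sqrt ((t - s) / n.+1%:R)) @ \oo --> E (fun w => phi w * Th w) + 0 + cK * (t - s) * 0.
  apply: cvgD.
    apply: cvgD; first exact: cvg_cst.
    have -> : (0 : R) = Rintegral P setT (fun=> 0) by rewrite Rintegral_cst// mul0r.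
    exact: EW.
  apply: cvgMr; rewrite -(@sqrtr0 R); apply: continuous_cvg; first exact: sqrt_continuous.
  by rewrite -(mulr0 (t - s)); apply: cvgMr; exact: cvg_harmonic.
rewrite mulr0 !addr0 in lim; apply: cvgr_to_ge lim _.
by apply: nearW.
Unshelve. all: by end_near. Qed.
End dynkin_formula.
End brownian.

(** * Logarithmic test functions *)

Section derivatives.
Context {R : realType}.
Implicit Types (f g : R -> R) (x a b : R).

Lemma dd_eq f x a b : is_derive x 1 f a -> a = b -> is_derive x 1 f b.
Proof. by move=> df <-. Qed.
Lemma dd_add f g x a b : is_derive x 1 f a -> is_derive x 1 g b ->
  is_derive x 1 (fun y => f y + g y) (a + b).
Proof. by move=> df dg; exact: is_deriveD. Qed.
Lemma dd_sub f g x a b : is_derive x 1 f a -> is_derive x 1 g b ->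
  is_derive x 1 (fun y => f y - g y) (a - b).
Proof. by move=> df dg; exact: is_deriveB. Qed.
Lemma dd_mul f g x a b : is_derive x 1 f a -> is_derive x 1 g b ->
  is_derive x 1 (fun y => f y * g y) (a * g x + f x * b).
Proof.
move=> df dg; apply: (dd_eq (is_deriveM df dg)).
by rewrite /GRing.scale/= addrC (mulrC a).
Qed.
Lemma dd_cst x (k : R) : is_derive x 1 (fun=> k) 0.
Proof. exact: is_derive_cst. Qed.
Lemma dd_id x : is_derive x 1 (fun y : R => y) 1.
Proof. exact: is_derive_id. Qed.
Lemma dd_inv f x a : f x != 0 -> is_derive x 1 f a ->
  is_derive x 1 (fun y => (f y)^-1) (- a / f x ^+ 2).
Proof.
move=> fx df; apply: (dd_eq (is_deriveV fx df)).
by rewrite /GRing.scale/=; field.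
Qed.
Lemma dd_ln f x a : 0 < f x -> is_derive x 1 f a -> is_derive x 1 (fun y => ln (f y)) (a / f x).
Proof.
move=> fx df; have dl := is_derive1_ln fx.
by apply: (dd_eq (is_derive1_comp dl df)); rewrite mulrC.
Qed.

Lemma dd_cont f df : (forall x : R, is_derive x 1 f (df x)) -> continuous f.
Proof.
by move=> fd x; apply: differentiable_continuous; apply/derivable1_diffP; have [] := fd x.
Qed.

Lemma taylor1d (f df ddf : R -> R) (k : R) :
  (forall x : R, is_derive x 1 f (df x)) -> (forall x : R, is_derive x 1 df (ddf x)) ->
  (forall x, 0 <= x <= 1 -> `|ddf x - ddf 0| <= k) ->
  `|f 1 - f 0 - df 0 - ddf 0 / 2| <= k.
Proof.
move=> fd dfd kb.
pose r x := f x - (f 0 + (df 0 * x + ddf 0 / 2 * (x * x))).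
pose r' x := df x - (df 0 + ddf 0 * x).
have rd (x : R) : is_derive x 1 r (r' x).
  apply: (dd_eq (dd_sub (fd x) (dd_add (dd_cst x (f 0)) (dd_add
    (dd_mul (dd_cst x (df 0)) (dd_id x))
    (dd_mul (dd_cst x (ddf 0 / 2)) (dd_mul (dd_id x) (dd_id x))))))).
  by rewrite /r'; field.
have r'd (x : R) : is_derive x 1 r' (ddf x - ddf 0).
  apply: (dd_eq (dd_sub (dfd x) (dd_add (dd_cst x (df 0)) (dd_mul (dd_cst x (ddf 0)) (dd_id x))))).
  by ring.
have k0 : 0 <= k by apply: le_trans (kb 0 _) => //; rewrite lexx ler01.
have r'b x : 0 <= x <= 1 -> `|r' x| <= k.
  move=> /andP[x0 x1].
  have [c /[!in_itv]/= /andP[c0 cx] E] := MVT_segment x0 (fun y _ => r'd y)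
    (continuous_subspaceT (dd_cont r'd)).
  have -> : r' x = r' x - r' 0 by rewrite /r'; ring.
  rewrite E subr0 normrM (ger0_norm x0) -[leRHS]mulr1 ler_pM//.
  by apply: kb; rewrite c0 (le_trans cx).
have [c /[!in_itv]/= c01 E] := MVT_segment (@ler01 R) (fun y _ => rd y)
    (continuous_subspaceT (dd_cont rd)).
have -> : f 1 - f 0 - df 0 - ddf 0 / 2 = r 1 - r 0 by rewrite /r; ring.
by rewrite E subr0 mulr1; exact: r'b.
Qed.
End derivatives.

(** * Planar functions with bounded Lipschitz derivatives *)

Section nice_functions.
Context {R : realType}.
Implicit Types f g : R -> R -> R.

Definition nice f := exists K, nice2 K f.

Lemma nice2_le K K' f : K <= K' -> nice2 K f -> nice2 K' f.
Proof.
move=> KK [b l m]; split => //.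
  by move=> x y; exact: le_trans (b x y) _.
by move=> x y x' y'; apply: le_trans (l _ _ _ _) _; rewrite ler_wpM2r// addr_ge0.
Qed.

Lemma nice_cst (k : R) : nice (fun _ _ => k).
Proof.
exists `|k|; split => // [x y x' y'|]; first by rewrite subrr normr0 mulr_ge0// addr_ge0.
exact: measurable_cst.
Qed.

Lemma nice_add f g : nice f -> nice g -> nice (fun x y => f x y + g x y).
Proof.
move=> [K [b l m]] [K' [b' l' m']]; exists (K + K'); split.
- by move=> x y; apply: le_trans (ler_normD _ _) _; exact: lerD.
- move=> x y x' y'; rewrite mulrDl.
  have -> : f x y + g x y - (f x' y' + g x' y') = (f x y - f x' y') + (g x y - g x' y') by ring.
  by apply: le_trans (ler_normD _ _) _; exact: lerD.
- exact: measurable_funD.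
Qed.

Lemma nice_mul f g : nice f -> nice g -> nice (fun x y => f x y * g x y).
Proof.
move=> [K [b l m]] [K' [b' l' m']].
have K0 : 0 <= K by exact: le_trans (b 0 0).
have K'0 : 0 <= K' by exact: le_trans (b' 0 0).
exists (K * K' + K * K'); split.
- move=> x y; rewrite normrM; apply: (@le_trans _ _ (K * K')); first exact: ler_pM.
  by rewrite lerDl mulr_ge0.
- move=> x y x' y'; rewrite mulrDl.
  have -> : f x y * g x y - f x' y' * g x' y' =
    f x y * (g x y - g x' y') + (f x y - f x' y') * g x' y' by ring.
  apply: le_trans (ler_normD _ _) _; rewrite !normrM; apply: lerD.
    by rewrite -mulrA ler_pM.
  by rewrite (mulrC K K') -mulrA mulrC ler_pM.
- exact: measurable_funM.
Qed.

Lemma nice_scale (k : R) f : nice f -> nice (fun x y => k * f x y).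
Proof. by move=> nf; apply: nice_mul => //; exact: nice_cst. Qed.

Lemma nice_sub f g : nice f -> nice g -> nice (fun x y => f x y - g x y).
Proof.
move=> nf ng; have := nice_add nf (nice_scale (-1) ng).
by congr nice; apply/funext => x; apply/funext => y; rewrite mulN1r.
Qed.

(** The regularization [c] keeps the squared norm away from 0. The derivatives of its logarithm are
    polynomials in [rinv], [rinvx] and [rinvy], so it is enough to show these three to be bounded
    and Lipschitz. *)
Definition nrm2 (c x y : R) : R := c + x ^+ 2 + y ^+ 2.
Definition rinv c x y : R := (nrm2 c x y)^-1.
Definition rinvx c x y : R := x * rinv c x y.
Definition rinvy c x y : R := y * rinv c x y.

Section fixed_c.
Variable c : R.
Hypothesis c0 : 0 < c.
Let K1 : R := 1 + c^-1.
Let cV0 : 0 < c^-1. Proof. by rewrite invr_gt0. Qed.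

Lemma nrm2_gt0 x y : 0 < nrm2 c x y.
Proof. by rewrite /nrm2 -addrA ltr_pwDl// addr_ge0// sqr_ge0. Qed.

Lemma nrm2_ge x y : c <= nrm2 c x y.
Proof. by rewrite /nrm2 -addrA lerDl addr_ge0// sqr_ge0. Qed.

Lemma rinv_gt0 x y : 0 < rinv c x y.
Proof. by rewrite invr_gt0 nrm2_gt0. Qed.

Lemma rinv_le x y : rinv c x y <= c^-1.
Proof. by rewrite lef_pV2 ?posrE ?nrm2_gt0// nrm2_ge. Qed.

Let abs_le x y : `|x| <= K1 * nrm2 c x y.
Proof.
have n0 := nrm2_gt0 x y; have nc := nrm2_ge x y.
have [x1|x1] := leP `|x| 1.
  have : 1 <= c^-1 * nrm2 c x y by rewrite mulrC ler_pdivlMr// mul1r.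
  by rewrite /K1 mulrDl mul1r; lra.
have : `|x| <= `|x| ^+ 2 by rewrite expr2 ler_peMl// ltW.
have -> : `|x| ^+ 2 = x ^+ 2 by rewrite -normrX ger0_norm// sqr_ge0.
move=> h.
have : x ^+ 2 <= nrm2 c x y.
  by rewrite /nrm2 (addrC c) -addrA lerDl; apply: addr_ge0; [exact: ltW|exact: sqr_ge0].
have : 0 <= c^-1 * nrm2 c x y by rewrite mulr_ge0// ltW.
by rewrite /K1 mulrDl mul1r; lra.
Qed.

Let nrm2C x y : nrm2 c x y = nrm2 c y x.
Proof. by rewrite /nrm2 addrAC. Qed.

Let K10 : 0 < K1. Proof. by rewrite /K1 addr_gt0. Qed.

Let absr x y : `|x| * rinv c x y <= K1.
Proof. by rewrite /rinv ler_pdivrMr ?nrm2_gt0//; exact: abs_le. Qed.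

Let absr' x y : `|y| * rinv c x y <= K1.
Proof. by rewrite /rinv nrm2C; exact: absr. Qed.

Let prod_le x y : `|x| * `|x| * rinv c x y <= 1 /\ `|x| * `|y| * rinv c x y <= 1.
Proof.
have n0 := nrm2_gt0 x y.
have ex : `|x| * `|x| = x ^+ 2 by rewrite -normrM ger0_norm -?expr2 ?sqr_ge0.
have ey : `|y| * `|y| = y ^+ 2 by rewrite -normrM ger0_norm -?expr2 ?sqr_ge0.
have x0 := normr_ge0 x; have y0 := normr_ge0 y.
rewrite /rinv !ler_pdivrMr// !mul1r; split.
  by rewrite ex /nrm2 (addrC c) -addrA lerDl; apply: addr_ge0; [exact: ltW|exact: sqr_ge0].
have h : 2 * (`|x| * `|y|) <= x ^+ 2 + y ^+ 2.
  by rewrite -ex -ey; have := sqr_ge0 (`|x| - `|y|); rewrite expr2; lra.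
have := ltW c0; have := sqr_ge0 x; have := sqr_ge0 y; rewrite /nrm2; lra.
Qed.

(** The differences of squares grow linearly in the coordinates, but on the right every coordinate
    is paired with a factor [rinv], and such products are bounded. *)
Let diff_le x y x' y' : `|rinv c x y - rinv c x' y'| <=
  (`|x - x'| + `|y - y'|) * ((`|x| + `|y|) * rinv c x y * rinv c x' y' +
     rinv c x y * ((`|x'| + `|y'|) * rinv c x' y')).
Proof.
have n0 := nrm2_gt0 x y; have n0' := nrm2_gt0 x' y'.
have r0 := ltW (rinv_gt0 x y); have r0' := ltW (rinv_gt0 x' y').
have -> : rinv c x y - rinv c x' y' =
    (rinv c x y * rinv c x' y') * ((x' - x) * (x' + x) + (y' - y) * (y' + y)).
  rewrite /rinv.
  have -> : (x' - x) * (x' + x) + (y' - y) * (y' + y) = nrm2 c x' y' - nrm2 c x y.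
    by rewrite /nrm2; ring.
  by field; rewrite !gt_eqF.
rewrite normrM ger0_norm ?mulr_ge0//.
have -> : (`|x - x'| + `|y - y'|) * ((`|x| + `|y|) * rinv c x y * rinv c x' y' +
     rinv c x y * ((`|x'| + `|y'|) * rinv c x' y')) =
  (rinv c x y * rinv c x' y') * ((`|x - x'| + `|y - y'|) * (`|x| + `|y| + (`|x'| + `|y'|))).
  by ring.
apply: ler_wpM2l; first exact: mulr_ge0.
apply: le_trans (ler_normD _ _) _; rewrite !normrM mulrDl distrC (distrC y).
have a0 := normr_ge0 x; have a1 := normr_ge0 x'; have b0 := normr_ge0 y; have b1 := normr_ge0 y'.
by apply: lerD; apply: ler_wpM2l => //; apply: le_trans (ler_normD _ _) _; lra.
Qed.

Lemma meas_nrm2 : meas2 (nrm2 c).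
Proof.
apply: measurable_funD; last by apply: measurable_funX; exact: measurable_snd.
apply: measurable_funD; first exact: measurable_cst.
by apply: measurable_funX; exact: measurable_fst.
Qed.

Let meas_rinv : meas2 (rinv c).
Proof. by apply: measurableT_comp; [exact: measurable_invr|exact: meas_nrm2]. Qed.

Lemma nice_rinv : nice (rinv c).
Proof.
exists (c^-1 + 4 * K1 * c^-1); split => //.
- move=> x y; rewrite gtr0_norm ?rinv_gt0//; have := rinv_le x y.
  by have := mulr_ge0 (ltW K10) (ltW cV0); lra.
move=> x y x' y'; apply: le_trans (diff_le _ _ _ _) _; rewrite mulrC; apply: ler_wpM2r.
  by rewrite addr_ge0.
have h1 := absr x y; have h2 := absr' x y; have h3 := absr x' y'; have h4 := absr' x' y'.
have r0 := ltW (rinv_gt0 x y); have r0' := ltW (rinv_gt0 x' y').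
have q := rinv_le x y; have q' := rinv_le x' y'.
have : (`|x| + `|y|) * rinv c x y * rinv c x' y' <= 2 * K1 * c^-1.
  by apply: ler_pM => //; [rewrite mulr_ge0// addr_ge0|rewrite mulrDl; lra].
have : rinv c x y * ((`|x'| + `|y'|) * rinv c x' y') <= c^-1 * (2 * K1).
  by apply: ler_pM => //; [rewrite mulr_ge0// addr_ge0|rewrite mulrDl; lra].
by lra.
Qed.

Lemma nice_rinvx : nice (rinvx c).
Proof.
exists (K1 + c^-1 + (2 * K1 * K1 + 2 * c^-1)); split => //.
- move=> x y; rewrite normrM (gtr0_norm (rinv_gt0 x y)).
  by have := absr x y; have := mulr_ge0 (ltW K10) (ltW K10); have := ltW cV0; lra.
- move=> x y x' y'.
  have -> : rinvx c x y - rinvx c x' y' =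
     (x - x') * rinv c x y + x' * (rinv c x y - rinv c x' y') by rewrite /rinvx; ring.
  apply: le_trans (ler_normD _ _) _; rewrite !normrM (gtr0_norm (rinv_gt0 x y)).
  set D := `|x - x'| + `|y - y'|.
  have D0 : 0 <= D by rewrite addr_ge0.
  have r0 := ltW (rinv_gt0 x y); have r0' := ltW (rinv_gt0 x' y').
  have q := rinv_le x y.
  have D1 : `|x - x'| * rinv c x y <= D * c^-1.
    by apply: ler_pM => //; rewrite lerDl.
  have h1 := absr x y; have h2 := absr' x y; have h3 := absr x' y'; have [p1 p2] := prod_le x' y'.
  have D2 : `|x'| * `|rinv c x y - rinv c x' y'| <= D * (2 * K1 * K1 + 2 * c^-1).
    apply: le_trans (ler_wpM2l (normr_ge0 x') (diff_le x y x' y')) _.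
    rewrite -/D mulrCA; apply: ler_wpM2l => //.
    have -> : `|x'| * ((`|x| + `|y|) * rinv c x y * rinv c x' y' +
       rinv c x y * ((`|x'| + `|y'|) * rinv c x' y')) =
      ((`|x| + `|y|) * rinv c x y) * (`|x'| * rinv c x' y') +
      rinv c x y * (`|x'| * `|x'| * rinv c x' y' + `|x'| * `|y'| * rinv c x' y') by ring.
    apply: lerD.
      apply: ler_pM => //; [by rewrite mulr_ge0// addr_ge0|by rewrite mulr_ge0|].
      by rewrite mulrDl; lra.
    rewrite mulrC; apply: ler_pM => //; last by lra.
    by rewrite addr_ge0// mulr_ge0// mulr_ge0.
  have := mulr_ge0 (ltW K10) D0; lra.
- by apply: measurable_funM => //; exact: measurable_fst.
Qed.
End fixed_c.

Lemma nice_swap f : nice f -> nice (fun x y => f y x).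
Proof.
move=> [K [b l m]]; exists K; split => // [x y x' y'|].
  by rewrite (addrC `|x - x'|).
have := measurableT_comp m (measurable_fun_pair (@measurable_snd _ _ R R) (@measurable_fst _ _ R R)).
exact.
Qed.

Lemma nice_rinvy c : 0 < c -> nice (rinvy c).
Proof.
move=> c0; have := nice_swap (nice_rinvx c0); congr nice.
by apply/funext => x; apply/funext => y; rewrite /rinvx /rinvy /rinv /nrm2 addrAC.
Qed.

(** A two-sided version of [test_fun]. It is stable under linear combinations with coefficients of
    any sign, as needed for a difference of logarithms. *)
Definition test_abs f fx fy fxx fxy fyy :=
  [/\ (exists K, lip2 K f) /\ meas2 f, nice fx /\ nice fy, [/\ nice fxx, nice fxy & nice fyy] &
  exists K, forall x y a b, `|f (x + a) (y + b) - f x y - (fx x y * a + fy x y * b)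
    - (fxx x y * a ^+ 2 + 2 * fxy x y * a * b + fyy x y * b ^+ 2) / 2| <=
     K * (`|a| ^+ 3 + `|b| ^+ 3)].

Lemma cube_sum (a b : R) : 0 <= a -> 0 <= b -> (a + b) ^+ 3 <= 4 * (a ^+ 3 + b ^+ 3).
Proof.
move=> a0 b0; rewrite -subr_ge0.
have -> : 4 * (a ^+ 3 + b ^+ 3) - (a + b) ^+ 3 = 3 * (a + b) * (a - b) ^+ 2 by ring.
by rewrite mulr_ge0 ?sqr_ge0// mulr_ge0// addr_ge0.
Qed.

Lemma hess_diff_le (K a b p q r : R) (D : R) : 0 <= K -> 0 <= D ->
  `|p| <= K * D -> `|q| <= K * D -> `|r| <= K * D ->
  `|p * a ^+ 2 + 2 * q * a * b + r * b ^+ 2| <= K * D * (`|a| + `|b|) ^+ 2.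
Proof.
move=> K0 D0 hp hq hr.
have -> : K * D * (`|a| + `|b|) ^+ 2 =
  K * D * `|a| ^+ 2 + 2 * (K * D) * (`|a| * `|b|) + K * D * `|b| ^+ 2 by ring.
have e2 (z : R) : `|z| ^+ 2 = z ^+ 2 by rewrite -normrX ger0_norm// sqr_ge0.
apply: le_trans (ler_normD _ _) _; apply: lerD; last by rewrite normrM normrX ler_wpM2r// exprn_ge0.
apply: le_trans (ler_normD _ _) _; apply: lerD; first by rewrite normrM normrX ler_wpM2r// exprn_ge0.
rewrite !normrM (@ger0_norm _ 2)//.
have -> : 2 * (K * D) * (`|a| * `|b|) = 2 * ((K * D) * (`|a| * `|b|)) by ring.
have -> : 2 * `|q| * `|a| * `|b| = 2 * (`|q| * (`|a| * `|b|)) by ring.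
by rewrite ler_pM2l// ler_wpM2r// mulr_ge0.
Qed.

(** Derivatives are taken along the segments [h] to [(x + h a, y + h b)], which reduces the planar
    Taylor bound to one variable. The 4 comes from [(|a| + |b|) ^+ 3 <= 4 (|a| ^+ 3 + |b| ^+ 3)]. *)
Lemma test_abs_of_derive f fx fy fxx fxy fyy :
  (forall x y a b th : R, is_derive th 1 (fun h => f (x + h * a) (y + h * b))
     (fx (x + th * a) (y + th * b) * a + fy (x + th * a) (y + th * b) * b)) ->
  (forall x y a b th : R, is_derive th 1
     (fun h => fx (x + h * a) (y + h * b) * a + fy (x + h * a) (y + h * b) * b)
     (fxx (x + th * a) (y + th * b) * a ^+ 2 + 2 * fxy (x + th * a) (y + th * b) * a * b
       + fyy (x + th * a) (y + th * b) * b ^+ 2)) ->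
  meas2 f -> nice fx -> nice fy -> nice fxx -> nice fxy -> nice fyy ->
  test_abs f fx fy fxx fxy fyy.
Proof.
move=> d1 d2 mf nx ny nxx nxy nyy; split => //.
  split => //; have [K [bx _ _]] := nx; have [K' [by_ _ _]] := ny.
  exists (K + K') => x y x' y'.
  have K0 : 0 <= K by exact: le_trans (bx 0 0).
  have K'0 : 0 <= K' by exact: le_trans (by_ 0 0).
  have := @lip_of_derive _ _ _ (K * `|x - x'| + K' * `|y - y'|) (d1 x' y' (x - x') (y - y')) _ 0 1.
  rewrite !mul0r !mul1r !addr0 !(addrC _ (_ - _)) !subrK subr0 normr1 mulr1 => h.
  apply: le_trans (h _) _.
    move=> th; apply: le_trans (ler_normD _ _) _; rewrite !normrM.
    by apply: lerD; apply: ler_wpM2r.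
  rewrite mulrDl !mulrDr; have := mulr_ge0 K0 (normr_ge0 (y - y')).
  by have := mulr_ge0 K'0 (normr_ge0 (x - x')); lra.
have [K1 [b1 _ _]] := nxx; have [K2 [b2 _ _]] := nxy; have [K3 [b3 _ _]] := nyy.
have [K1' h1] := nxx; have [K2' h2] := nxy; have [K3' h3] := nyy.
pose K := Num.max K1' (Num.max K2' K3').
have [_ l1 _] : nice2 K fxx by apply: nice2_le h1; rewrite le_max lexx.
have [_ l2 _] : nice2 K fxy by apply: nice2_le h2; rewrite !le_max lexx orbT.
have [b3' l3 _] : nice2 K fyy by apply: nice2_le h3; rewrite !le_max lexx !orbT.
have K0 : 0 <= K by exact: le_trans (b3' 0 0).
exists (4 * K) => x y a b.
set D := `|a| + `|b|.
have D0 : 0 <= D by rewrite addr_ge0.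
have := @taylor1d _ _ _ _ (K * D ^+ 3) (d1 x y a b) (d2 x y a b).
rewrite !mul0r !mul1r !addr0 => h.
apply: le_trans (h _) _; last first.
  rewrite (mulrC 4 K) -mulrA; apply: ler_wpM2l => //.
  by apply: cube_sum; exact: normr_ge0.
move=> th /andP[th0 th1].
set x1 := x + th * a; set y1 := y + th * b.
have dist : `|x1 - x| + `|y1 - y| <= D.
  have -> : x1 - x = th * a by rewrite /x1; ring.
  have -> : y1 - y = th * b by rewrite /y1; ring.
  by rewrite !normrM (ger0_norm th0) -mulrDr ler_piMl.
have bnd g : lip2 K g -> `|g x1 y1 - g x y| <= K * D.
  by move=> lg; apply: le_trans (lg _ _ _ _) _; exact: ler_wpM2l.
have -> : fxx x1 y1 * a ^+ 2 + 2 * fxy x1 y1 * a * b + fyy x1 y1 * b ^+ 2 -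
   (fxx x y * a ^+ 2 + 2 * fxy x y * a * b + fyy x y * b ^+ 2) =
   (fxx x1 y1 - fxx x y) * a ^+ 2 + 2 * (fxy x1 y1 - fxy x y) * a * b +
   (fyy x1 y1 - fyy x y) * b ^+ 2 by ring.
have -> : K * D ^+ 3 = K * D * (`|a| + `|b|) ^+ 2 by rewrite -/D; ring.
by apply: hess_diff_le => //; exact: bnd.
Qed.

Section log_norm.
Variable c : R.
Hypothesis c0 : 0 < c.

Definition lnG x y : R := ln (nrm2 c x y).
Definition lnGx x y : R := 2 * rinvx c x y.
Definition lnGy x y : R := 2 * rinvy c x y.
Definition lnGxx x y : R := 2 * rinv c x y - 4 * (rinvx c x y * rinvx c x y).
Definition lnGxy x y : R := (-4) * (rinvx c x y * rinvy c x y).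
Definition lnGyy x y : R := 2 * rinv c x y - 4 * (rinvy c x y * rinvy c x y).

Let lind (x a th : R) : is_derive th 1 (fun h : R => x + h * a) a.
Proof.
apply: (dd_eq (dd_add (dd_cst th x) (dd_mul (dd_id th) (dd_cst th a)))).
by ring.
Qed.

Let pd (x y a b th : R) : is_derive th 1 (fun h => nrm2 c (x + h * a) (y + h * b))
  (2 * (x + th * a) * a + 2 * (y + th * b) * b).
Proof.
apply: (dd_eq (dd_add (dd_add (dd_cst th c) (dd_mul (lind x a th) (lind x a th)))
  (dd_mul (lind y b th) (lind y b th)))).
by ring.
Qed.

Lemma test_lnG : test_abs lnG lnGx lnGy lnGxx lnGxy lnGyy.
Proof.
have nr := nice_rinv c0; have nx := nice_rinvx c0; have ny := nice_rinvy c0.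
apply: test_abs_of_derive.
- move=> x y a b th.
  apply: (dd_eq (@dd_ln _ (fun h => nrm2 c (x + h * a) (y + h * b)) _ _
    (nrm2_gt0 c0 (x + th * a) (y + th * b)) (pd x y a b th))).
  by rewrite /lnGx /lnGy /rinvx /rinvy /rinv; ring.
- move=> x y a b th.
  have n0 := nrm2_gt0 c0 (x + th * a) (y + th * b).
  have := dd_mul (dd_add (dd_mul (dd_mul (dd_cst th 2) (lind x a th)) (dd_cst th a))
     (dd_mul (dd_mul (dd_cst th 2) (lind y b th)) (dd_cst th b)))
     (@dd_inv _ (fun h => nrm2 c (x + h * a) (y + h * b)) _ _ (lt0r_neq0 n0) (pd x y a b th)).
  rewrite (_ : (fun y0 => _) = (fun h => lnGx (x + h * a) (y + h * b) * a
      + lnGy (x + h * a) (y + h * b) * b)); last first.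
    by apply/funext => h; rewrite /lnGx /lnGy /rinvx /rinvy /rinv; ring.
  move/dd_eq; apply; rewrite /lnGxx /lnGxy /lnGyy /rinvx /rinvy /rinv.
  by field; rewrite gt_eqF.
- by apply: measurableT_comp; [exact: measurable_ln|exact: meas_nrm2].
- exact: nice_scale.
- exact: nice_scale.
- by apply: nice_sub; apply: nice_scale => //; exact: nice_mul.
- by apply: nice_scale; exact: nice_mul.
- by apply: nice_sub; apply: nice_scale => //; exact: nice_mul.
Qed.
End log_norm.

Lemma test_abs_lin (k l : R) f fx fy fxx fxy fyy g gx gy gxx gxy gyy :
  test_abs f fx fy fxx fxy fyy -> test_abs g gx gy gxx gxy gyy ->
  test_abs (fun x y => k * f x y + l * g x y) (fun x y => k * fx x y + l * gx x y)
   (fun x y => k * fy x y + l * gy x y) (fun x y => k * fxx x y + l * gxx x y)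
   (fun x y => k * fxy x y + l * gxy x y) (fun x y => k * fyy x y + l * gyy x y).
Proof.
move=> [[[K lf] mf] [nx ny] [nxx nxy nyy] [T tf]] [[[K' lg] mg] [nx' ny'] [nxx' nxy' nyy'] [T' tg]].
split; last 1 first.
- exists (`|k| * T + `|l| * T') => x y a b.
  have := tf x y a b; have := tg x y a b.
  set U := f (x + a) (y + b) - f x y - _ - _; set W := g (x + a) (y + b) - g x y - _ - _ => hW hU.
  rewrite [X in `|X|](_ : _ = k * U + l * W); last by rewrite /U /W; field.
  apply: le_trans (ler_normD _ _) _; rewrite !normrM mulrDl.
  by apply: lerD; rewrite -mulrA; apply: ler_wpM2l.
- split; last by apply: measurable_funD; apply: measurable_funM => //; exact: measurable_cst.
  exists (`|k| * K + `|l| * K') => x y x' y'.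
  have -> : k * f x y + l * g x y - (k * f x' y' + l * g x' y') =
    k * (f x y - f x' y') + l * (g x y - g x' y') by ring.
  apply: le_trans (ler_normD _ _) _; rewrite !normrM mulrDl.
  by apply: lerD; rewrite -mulrA; apply: ler_wpM2l.
- by split; apply: nice_add; exact: nice_scale.
- by split; apply: nice_add; exact: nice_scale.
Qed.

Lemma test_fun_nice f fx fy fxx fxy fyy : (exists K, lip2 K f) -> meas2 f ->
  nice fx -> nice fy -> nice fxx -> nice fxy -> nice fyy ->
  (exists K, forall x y a b, f (x + a) (y + b) <= f x y + fx x y * a + fy x y * b
    + (fxx x y * a ^+ 2 + 2 * fxy x y * a * b + fyy x y * b ^+ 2) / 2
    + K * (`|a| ^+ 3 + `|b| ^+ 3)) ->
  exists K, test_fun K f fx fy fxx fxy fyy.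
Proof.
move=> [K lf] mf [K1 n1] [K2 n2] [K3 n3] [K4 n4] [K5 n5] [T tf].
pose M := Num.max K (Num.max K1 (Num.max K2 (Num.max K3 (Num.max K4 (Num.max K5 T))))).
exists M; split.
- split => // x y x' y'; apply: le_trans (lf _ _ _ _) _; rewrite ler_wpM2r ?addr_ge0//.
  by rewrite /M le_max lexx.
- by split; [apply: nice2_le n1|apply: nice2_le n2]; rewrite /M !le_max lexx ?orbT.
- by split; [apply: nice2_le n3|apply: nice2_le n4|apply: nice2_le n5]; rewrite /M !le_max lexx ?orbT.
- move=> x y a b; apply: le_trans (tf x y a b) _; rewrite lerD2l.
  by apply: ler_wpM2r; [rewrite addr_ge0// exprn_ge0|rewrite /M !le_max lexx !orbT].
Qed.

Lemma test_abs_fun f fx fy fxx fxy fyy : test_abs f fx fy fxx fxy fyy ->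
  exists K, test_fun K f fx fy fxx fxy fyy.
Proof.
move=> [[lf mf] [n1 n2] [n3 n4 n5] [K tf]]; apply: test_fun_nice => //.
by exists K => x y a b; have := tf x y a b => /ler_normlP[_]; lra.
Qed.
End nice_functions.

(** * Avoidance of the origin *)

Section log_barrier.
Context {R : realType}.
Variable e : R.
Hypothesis e0 : 0 < e.
Let e1 : 0 < 1 + e. Proof. by rewrite addr_gt0. Qed.

(** Minus the logarithm of the norm alone would be unbounded below; the added logarithm makes the
    function nonnegative, as the maximal inequality requires. The form as a combination of two [lnG]
    yields its derivatives and Taylor bounds. *)
Definition barrier x y : R := 2^-1 * lnG (1 + e) x y + (- 2^-1) * lnG e x y.
Definition barrierx x y : R := 2^-1 * lnGx (1 + e) x y + (- 2^-1) * lnGx e x y.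
Definition barriery x y : R := 2^-1 * lnGy (1 + e) x y + (- 2^-1) * lnGy e x y.
Definition barrierxx x y : R := 2^-1 * lnGxx (1 + e) x y + (- 2^-1) * lnGxx e x y.
Definition barrierxy x y : R := 2^-1 * lnGxy (1 + e) x y + (- 2^-1) * lnGxy e x y.
Definition barrieryy x y : R := 2^-1 * lnGyy (1 + e) x y + (- 2^-1) * lnGyy e x y.

Lemma barrier_test : exists K,
  test_fun K barrier barrierx barriery barrierxx barrierxy barrieryy.
Proof.
apply: test_abs_fun.
exact: (test_abs_lin 2^-1 (- 2^-1) (test_lnG e1) (test_lnG e0)).
Qed.

Lemma barrierE x y : barrier x y = ln (1 + (e + (x ^+ 2 + y ^+ 2))^-1) / 2.
Proof.
have q0 : 0 <= x ^+ 2 + y ^+ 2 by rewrite addr_ge0// sqr_ge0.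
have p0 : 0 < e + (x ^+ 2 + y ^+ 2) by apply: ltr_pwDl.
have -> : 1 + (e + (x ^+ 2 + y ^+ 2))^-1 =
    (1 + e + x ^+ 2 + y ^+ 2) / (e + x ^+ 2 + y ^+ 2).
  by rewrite -!addrA; field; rewrite gt_eqF.
rewrite ln_div ?posrE; last 2 first.
- by rewrite -!addrA addr_gt0.
- by rewrite -addrA.
by rewrite /barrier /lnG /nrm2; field.
Qed.

Lemma barrier_ge0 x y : 0 <= barrier x y.
Proof.
rewrite barrierE divr_ge0// ln_ge0// lerDl invr_ge0 addr_ge0 ?(ltW e0)//.
by rewrite addr_ge0// sqr_ge0.
Qed.

Lemma barrier_large x y : x ^+ 2 + y ^+ 2 <= e -> ln (1 + (2 * e)^-1) / 2 <= barrier x y.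
Proof.
have q0 : 0 <= x ^+ 2 + y ^+ 2 by rewrite addr_ge0// sqr_ge0.
have p0 : 0 < e + (x ^+ 2 + y ^+ 2) by apply: ltr_pwDl.
move=> qe; rewrite barrierE ler_pM2r ?invr_gt0//.
have i0 : 0 < (2 * e)^-1 by rewrite invr_gt0 mulr_gt0.
have j0 : 0 < 1 + (e + (x ^+ 2 + y ^+ 2))^-1 by rewrite addr_gt0 ?invr_gt0.
have l0 : 0 < 1 + (2 * e)^-1 by rewrite addr_gt0.
rewrite ler_ln ?posrE// lerD2l lef_pV2 ?posrE//; last by rewrite mulr_gt0.
by have := qe; lra.
Qed.

Lemma barrier_le x y (c : R) : 0 < c -> c <= x ^+ 2 + y ^+ 2 -> barrier x y <= ln (1 + c^-1) / 2.
Proof.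
move=> c0 cq; have p0 : 0 < e + (x ^+ 2 + y ^+ 2) by have := e0; lra.
rewrite barrierE ler_pM2r ?invr_gt0//.
have j0 : 0 < 1 + (e + (x ^+ 2 + y ^+ 2))^-1 by rewrite addr_gt0 ?invr_gt0.
have l0 : 0 < 1 + c^-1 by rewrite addr_gt0 ?invr_gt0.
rewrite ler_ln ?posrE// lerD2l lef_pV2 ?posrE//.
by have := e0; lra.
Qed.

(** The hypotheses say that radial drift plus half the trace dominates the quadratic form in the
    direction of [U]: dimension at least 2. With [r = 1 / (e + q)], [s = 1 / (1 + e + q)] and
    [r - s = r s], the part with [r] is absorbed by [q r <= 1], and the part with [s] leaves at most
    [k], uniformly in [e]. *)
Lemma barrier_generator (s11 s12 s22 x y dx dy k : R) : 0 <= k ->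
  k <= x * dx + y * dy + (s11 + s22) / 2 ->
  s11 * x ^+ 2 + 2 * s12 * x * y + s22 * y ^+ 2 <= k * (x ^+ 2 + y ^+ 2) ->
  barrierx x y * dx + barriery x y * dy
   + lapl barrierxx barrierxy barrieryy s11 s12 s22 x y / 2 <= k.
Proof.
move=> k0 drift quad.
set q := x ^+ 2 + y ^+ 2 in quad.
have q0 : 0 <= q by rewrite addr_ge0// sqr_ge0.
have p0 : 0 < e + q by apply: ltr_pwDl.
have p1 : 0 < 1 + e + q by rewrite -addrA addr_gt0.
pose r := (e + q)^-1; pose s := (1 + e + q)^-1.
have rE : rinv e x y = r by rewrite /rinv /nrm2 -addrA.
have sE : rinv (1 + e) x y = s by rewrite /rinv /nrm2 -addrA.
have r0 : 0 < r by rewrite invr_gt0.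
have s0 : 0 < s by rewrite invr_gt0.
set A := x * dx + y * dy in drift.
set Ga := s11 * x ^+ 2 + 2 * s12 * x * y + s22 * y ^+ 2 in quad.
have -> : barrierx x y * dx + barriery x y * dy
   + lapl barrierxx barrierxy barrieryy s11 s12 s22 x y / 2 =
   - ((r - s) * (A + (s11 + s22) / 2 - Ga * (s + r))).
  rewrite /lapl /barrierx /barriery /barrierxx /barrierxy /barrieryy.
  rewrite /lnGx /lnGy /lnGxx /lnGxy /lnGyy /rinvx /rinvy rE sE /A /Ga; by field.
have rs : r - s = r * s by rewrite /r /s; field; rewrite !gt_eqF.
have qr : q * r <= 1 by rewrite /r ler_pdivrMr// mul1r lerDr ltW.
have s1 : s <= 1 by rewrite /s invf_le1// -addrA lerDl ltW.
have b1 : k - k * q * (s + r) <= A + (s11 + s22) / 2 - Ga * (s + r).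
  have : Ga * (s + r) <= k * q * (s + r) by rewrite ler_wpM2r// addr_ge0// ltW.
  lra.
have b2 : - (k * q * s) <= k - k * q * (s + r).
  have : k * (q * r) <= k by rewrite ler_piMr.
  lra.
have rs0 : 0 <= r * s by rewrite mulr_ge0// ltW.
have := ler_wpM2l rs0 (le_trans b2 b1); rewrite rs.
have : r * s * (k * q * s) <= k.
  have -> : r * s * (k * q * s) = k * ((q * r) * (s * s)) by ring.
  rewrite ler_piMr//.
  have ss : s * s <= 1 by rewrite mulr_ile1// ltW.
  have qr0 : 0 <= q * r by rewrite mulr_ge0// ltW.
  have ss0 : 0 <= s * s by rewrite mulr_ge0// ltW.
  by rewrite mulr_ile1.
lra.
Qed.
End log_barrier.

(** * Maximal inequality and hitting of the origin *)

Section avoidance.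
Context {R : realType} {d : measure_display} {Omega : measurableType d}.
Variable P : probability Omega R.
Variables (F : R -> set (set Omega)) (rho : R) (B C : R -> Omega -> R).
Hypotheses (uF : usual_filtration P F) (rho1 : -1 <= rho <= 1) (bm : correlated_BM P F rho B C).
Notation E f := (Rintegral P setT f).
Notation mu := (@lebesgue_measure R).

Variables (l1 m1 l2 m2 k : R) (U1 U2 : R -> Omega -> R).
Local Notation M1 := (BM B C l1 m1).
Local Notation M2 := (BM B C l2 m2).
Local Notation s11 := (var rho l1 m1).
Local Notation s12 := (cov rho l1 m1 l2 m2).
Local Notation s22 := (var rho l2 m2).

Definition drift_path w := exists dx dy : R -> R,
  [/\ (forall T, itg dx 0 T /\ itg dy 0 T), (forall r, 0 <= r -> 0 <= dx r /\ 0 <= dy r),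
   (forall r, 0 <= r -> U1 r w = U1 0 w + M1 r w + J dx 0 r /\
                        U2 r w = U2 0 w + M2 r w + J dy 0 r) &
   {ae mu, forall r, 0 <= r ->
     k <= U1 r w * dx r + U2 r w * dy r + (s11 + s22) / 2 /\
     s11 * U1 r w ^+ 2 + 2 * s12 * U1 r w * U2 r w + s22 * U2 r w ^+ 2
       <= k * (U1 r w ^+ 2 + U2 r w ^+ 2)}].

Hypotheses (k0 : 0 <= k) (aU1 : adapted F U1) (aU2 : adapted F U2).
Hypothesis iU1 : forall T, 0 <= T ->
  P.-integrable setT (EFin \o (fun w => U1 T w - U1 0 w - M1 T w)).
Hypothesis iU2 : forall T, 0 <= T ->
  P.-integrable setT (EFin \o (fun w => U2 T w - U2 0 w - M2 T w)).
Hypothesis path : {ae P, forall w, [/\ continuous (fun r : R => U1 (Num.max r 0) w),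
     continuous (fun r : R => U2 (Num.max r 0) w) & drift_path w]}.

Definition sqn t w : R := U1 t w ^+ 2 + U2 t w ^+ 2.

Let PT : fine (P setT) = 1. Proof. by rewrite probability_setT. Qed.

Let V e t w := barrier e (U1 t w) (U2 t w).

Lemma barrier_super e s t (phi : Omega -> R) : 0 < e -> 0 <= s -> s < t ->
  G_measurable (F s) phi -> (forall w, 0 <= phi w <= 1) ->
  P.-integrable setT (EFin \o (fun w => phi w * (V e t w - V e s w))) /\
  E (fun w => phi w * (V e t w - V e s w)) <= k * (t - s).
Proof.
move=> e0 s0 st gphi phi01.
have t0 : 0 <= t by exact: le_trans (ltW st).
have [K tV] := barrier_test e0.
have ic (c : R) : P.-integrable setT (EFin \o (fun=> c)) by exact: integrable_cst_prob.
have iD (U M : R -> Omega -> R) : (forall T, 0 <= T ->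
     P.-integrable setT (EFin \o (fun w => U T w - U 0 w - M T w))) ->
   P.-integrable setT (EFin \o (fun w => U t w - U s w - (M t w - M s w))).
  move=> iU; have := integrableB_EFin measurableT (iU t t0) (iU s s0).
  by apply: eq_integrable => // w _ /=; congr EFin; ring.
have [|i1 h1] := dynkin_formula uF rho1 bm tV s0 st aU1 aU2 (ic (k * (t - s)))
   (iD _ _ iU1) (iD _ _ iU2) _ gphi phi01.
  apply: (ae_imp _ path) => w [c1 c2 [dx [dy [ig pos eqs ineq]]]]; split => //.
  have [ixt iyt] := ig t.
  have ix : itg dx s t by apply: itg_sub ixt.
  have iy : itg dy s t by apply: itg_sub iyt.
  exists dx, dy, (fun=> k); split.
  - by split => //; exact: itg_cst.
  - by move=> r /andP[sr _]; apply: pos; exact: le_trans sr.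
  - move=> r /andP[sr rt]; have r0 := le_trans s0 sr.
    have [ixr iyr] := ig r.
    have [r1 r2] := eqs r r0; have [q1 q2] := eqs s s0.
    by rewrite r1 r2 q1 q2 (J_cat s0 sr ixr) (J_cat s0 sr iyr); split; ring.
  - apply: (ae_imp _ ineq) => r h /andP[sr _]; have [h1 h2] := h (le_trans s0 sr).
    exact: barrier_generator.
  - by rewrite J_cst// ltW.
split => //; apply: le_trans h1 _.
have mphi := F_meas uF s0 gphi.
have iphi : P.-integrable setT (EFin \o phi).
  apply: (@le_integrable_EFin _ _ _ P setT _ (fun=> 1)) => //.
  by move=> w _; case/andP: (phi01 w) => p0 p1; rewrite ger0_norm.
rewrite RintegralZr//.
have kt : 0 <= k * (t - s) by rewrite mulr_ge0// subr_ge0 ltW.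
rewrite -[leRHS]mul1r ler_wpM2r//.
apply: (@le_trans _ _ (E (fun=> 1))).
  by apply: le_Rintegral => // w _; case/andP: (phi01 w).
by rewrite Rintegral_cst// PT mulr1.
Qed.

Section stopped.
Variables (s T e c : R) (A : set Omega) (c1 : R) (n : nat).
Hypotheses (s0 : 0 <= s) (sT : s < T) (e0 : 0 < e) (c0 : 0 < c) (FA : F s A).
Hypothesis Vs : forall w, A w -> V e s w <= c1.
Hypothesis c10 : 0 <= c1.

Let g i := grid s T n i.
Let below i w : R := \1_(`]-oo, c[%classic) (V e (g i) w).
(** Replaces stopping times: the indicator that [A] holds and that the level [c] has not been
    reached at the grid points up to [i]. It is known at time [g i] and so can weight the next
    increment. *)
Fixpoint alive (i : nat) (w : Omega) : R :=
  if i is i'.+1 then alive i' w * below i w else \1_A w * below 0 w.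

Let g0 i : 0 <= g i. Proof. exact: le_trans (grid_ge (ltW sT) _ _). Qed.
Let gstep i : g i.+1 - g i = (T - s) / n.+1%:R.
Proof. by rewrite /g grid_step; ring. Qed.
Let glt i : g i < g i.+1.
Proof. by rewrite -subr_gt0 gstep divr_gt0// subr_gt0. Qed.
Let sF i := F_sigma uF (g0 i).

Let below01 i w : below i w = 1 /\ V e (g i) w < c \/ below i w = 0 /\ c <= V e (g i) w.
Proof.
rewrite /below indicE; have [Vc|Vc] := ltP (V e (g i) w) c; [left|right]; split => //.
  by rewrite mem_set//= in_itv.
by rewrite memNset//= in_itv/= => /(le_lt_trans Vc); rewrite ltxx.
Qed.

Let gV i : G_measurable (F (g i)) (V e (g i)).
Proof.
have [K [[_ mV] _ _ _]] := barrier_test e0.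
exact: (gm_meas2 (sF i) mV (aU1 (g0 i)) (aU2 (g0 i))).
Qed.

Let gbelow i : G_measurable (F (g i)) (below i).
Proof.
apply: (gm_comp (sF i) (h := \1_(`]-oo, c[%classic))) (gV i).
by apply: measurable_indic; exact: measurable_itv.
Qed.

Let gind : G_measurable (F s) (\1_A : Omega -> R).
Proof.
apply/(gmP (F_sigma uF s0)); apply: measurable_indic.
by rewrite measurable_g_measurableTypeE//; exact: (F_sigma uF s0).
Qed.

Let mono i (Z : Omega -> R) : G_measurable (F (g i)) Z -> G_measurable (F (g i.+1)) Z.
Proof. by move=> gZ S mS; apply: (F_nd uF (g0 i) (ltW (glt i))); exact: gZ. Qed.

Let galive i : G_measurable (F (g i)) (alive i).
Proof.
elim: i => [|i IH]; last by apply: (gm_mul (sF i.+1)); [exact: mono|exact: gbelow].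
apply: (gm_mul (sF 0)); last exact: gbelow.
by rewrite /g grid0.
Qed.

Let alive01 i w : alive i w = 0 \/ alive i w = 1.
Proof.
elim: i => [|i IH] /=.
  rewrite indicE; have [[-> _]|[-> _]] := below01 0 w; rewrite ?mulr0 ?mulr1; last by left.
  by case: (w \in A); [right|left].
case: IH => ->; first by left; rewrite mul0r.
by rewrite mul1r; have [[-> _]|[-> _]] := below01 i.+1 w; [right|left].
Qed.

(** The barrier stopped at the first grid point where it reaches [c], with the value there lowered
    to [c]. Lowering can only help, so its expectation grows by at most [k] times the elapsed
    time. *)
Let pot i w : R := c * (\1_A w - alive i w) + alive i w * V e (g i) w.

Let V0 t w : 0 <= V e t w. Proof. exact: barrier_ge0. Qed.

Let pot_step i w : pot i.+1 w - pot i w <= alive i w * (V e (g i.+1) w - V e (g i) w).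
Proof.
rewrite /pot /=; have Vi := V0 (g i.+1) w.
have [->|->] := alive01 i w; first by rewrite !mul0r; lra.
rewrite !mul1r; have [[-> _]|[-> h]] := below01 i.+1 w; rewrite ?mul1r ?mul0r; lra.
Qed.

Let pot0 w : 0 <= pot 0 w <= c1.
Proof.
rewrite /pot /= indicE; have Vg : V e (g 0) w = V e s w by rewrite /g grid0.
have := V0 s w; rewrite Vg; have := c0 => c0'.
case: (boolP (w \in A)) => [/set_mem Aw|_] Vw; last first.
  by rewrite !mul0r subrr mulr0 addr0 lexx.
have h := Vs Aw; have [[-> hc]|[-> hc]] := below01 0 w; rewrite Vg in hc;
  rewrite !mul1r ?mul0r ?subrr ?mulr0 ?subr0 ?mulr1 ?add0r ?addr0; apply/andP; split; lra.
Qed.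

Let pot_int i : P.-integrable setT (EFin \o pot i) /\ E (pot i) <= c1 + k * (g i - s).
Proof.
have mV i' : measurable_fun setT (V e (g i')) by exact: (F_meas uF (g0 i') (gV i')).
have ma i' : measurable_fun setT (alive i') by exact: (F_meas uF (g0 i') (galive i')).
have mA : measurable_fun setT (\1_A : Omega -> R) by exact: (F_meas uF s0 gind).
have mpot i' : measurable_fun setT (pot i').
  apply: measurable_funD; last exact: measurable_funM.
  by apply: measurable_funM; [exact: measurable_cst|exact: measurable_funB].
elim: i => [|i [IHi IHe]].
  have i0 : P.-integrable setT (EFin \o pot 0).
    apply: (@le_integrable_EFin _ _ _ P setT _ (fun=> c1)) => //; last exact: integrable_cst_prob.
    by move=> w _; case/andP: (pot0 w) => a b; rewrite ger0_norm.
  split => //; rewrite /g grid0 subrr mulr0 addr0.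
  apply: (@le_trans _ _ (E (fun=> c1))).
    apply: le_Rintegral => //; first exact: integrable_cst_prob.
    by move=> w _; case/andP: (pot0 w).
  by rewrite Rintegral_cst// PT mulr1.
have a01 w : 0 <= alive i w <= 1 by have [->|->] := alive01 i w; rewrite ?lexx ?ler01.
have [ii ie] := barrier_super e0 (g0 i) (glt i) (galive i) a01.
have pge j w : 0 <= pot j w.
  rewrite /pot addr_ge0//; last by rewrite mulr_ge0//; have [->|->] := alive01 j w.
  rewrite mulr_ge0 ?(ltW c0)// subr_ge0.
  elim: j => [|j IH] /=.
    by rewrite ler_piMr ?indicE//; have [[-> _]|[-> _]] := below01 0 w.
  apply: le_trans IH; have [->|->] := alive01 j w; rewrite ?mul0r ?mul1r//.
  by have [[-> _]|[-> _]] := below01 j.+1 w.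
have isum := integrableD_EFin measurableT IHi ii.
have iS : P.-integrable setT (EFin \o pot i.+1).
  apply: (@le_integrable_EFin _ _ _ P setT _
    (fun w => pot i w + alive i w * (V e (g i.+1) w - V e (g i) w))) => //.
  by move=> w _; rewrite ger0_norm// -lerBlDl; exact: pot_step.
split => //.
apply: (@le_trans _ _ (E (fun w => pot i w + alive i w * (V e (g i.+1) w - V e (g i) w)))).
  by apply: le_Rintegral => // w _; rewrite -lerBlDl; exact: pot_step.
by rewrite RintegralD//; lra.
Qed.

Let alive_le w i j : (i <= j)%N -> alive j w <= alive i w.
Proof.
move=> /subnK <-; elim: (j - i)%N => // m IH; rewrite addSn /=; apply: le_trans IH.
have [->|->] := alive01 (m + i) w; rewrite ?mul0r ?mul1r//.
by have [[-> _]|[-> _]] := below01 (m + i).+1 w.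
Qed.

(** Markov's inequality for the final value of [pot], which equals [c] on the part of [A] that is no
    longer alive. *)
Lemma maximal_grid : exists Bad : set Omega,
  [/\ measurable Bad, (P Bad <= ((c1 + k * (T - s)) / c)%:E)%E &
      forall w i, A w -> (i <= n.+1)%N -> c <= V e (g i) w -> Bad w].
Proof.
have ma : measurable_fun setT (alive n.+1) by exact: (F_meas uF (g0 _) (galive _)).
exists (A `&` [set w | alive n.+1 w <= 0]).
have mB : measurable (A `&` [set w | alive n.+1 w <= 0]).
  apply: measurableI; first exact: (F_sub uF s0 FA).
  have := ma measurableT _ (measurable_itv `]-oo, (0 : R)]); rewrite setTI.
  by congr measurable; apply/seteqP; split => w; rewrite /= in_itv.
split => //.
  have [pi pe] := pot_int n.+1.
  have gT : g n.+1 = T by rewrite /g grid_last.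
  rewrite gT in pe.
  have -> : P (A `&` [set w | alive n.+1 w <= 0]) =
      (E (\1_(A `&` [set w | alive n.+1 w <= 0]) : Omega -> R))%:E.
    rewrite -fine_integral_EFin//; first by rewrite integral_indic// setIT.
    exact: integrable_indic.
  rewrite lee_fin ler_pdivlMr// mulrC -RintegralZl//; last exact: integrable_indic.
  apply: le_trans pe; apply: le_Rintegral => //.
    by apply: integrableZ_EFin => //; exact: integrable_indic.
  move=> w _; rewrite /pot indicE.
  have a0 : 0 <= alive n.+1 w by have [->|->] := alive01 n.+1 w.
  have aA : alive n.+1 w <= \1_A w.
    apply: le_trans (alive_le w (leq0n _)) _ => /=.
    by rewrite ler_piMr ?indicE//; have [[-> _]|[-> _]] := below01 0 w.
  have c0' := c0.
  case: (boolP (w \in _)) => [/set_mem[Aw al]|_]; last first.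
    rewrite mulr0 addr_ge0//; last by rewrite mulr_ge0.
    by rewrite mulr_ge0 ?(ltW c0)// subr_ge0.
  have -> : alive n.+1 w = 0 by apply/eqP; rewrite eq_le al.
  by rewrite mul0r addr0 subr0 mem_set.
move=> w i Aw ik Vc; split => //=.
apply: le_trans (alive_le w ik) _.
have b0 : below i w = 0.
  by have [[_ h]|[->]//] := below01 i w; move: (le_lt_trans Vc h); rewrite ltxx.
by case: i b0 {Vc ik} => [|i] /= ->; rewrite mulr0.
Qed.
End stopped.

(** On [A] the barrier starts below [c1], whatever [e j] is, whereas a path at 0 drives it beyond
    [c j], which tends to infinity as [e j] tends to 0. The probability [bd j] of reaching that
    level therefore vanishes. *)
Let hit_null s T m : 0 <= s -> s < T ->
  {ae P, forall w, m.+1%:R^-1 <= sqn s w -> forall t, s <= t <= T -> sqn t w != 0}.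
Proof.
move=> s0 sT.
pose A := [set w | m.+1%:R^-1 <= sqn s w].
have sFs := F_sigma uF s0.
have FA : F s A.
  have : G_measurable (F s) (sqn s).
    by apply: gm_add => //; under eq_fun do rewrite expr2; apply: gm_mul => //; [exact: aU1|exact: aU1|exact: aU2|exact: aU2].
  move=> /(_ _ (measurable_itv `[m.+1%:R^-1, +oo[)).
  by congr F; apply/seteqP; split => w; rewrite /A /= in_itv/= andbT.
pose e (j : nat) : R := j.+1%:R^-1.
have e0 j : 0 < e j by rewrite invr_gt0.
pose c j : R := ln (1 + (2 * e j)^-1) / 2.
have c0 j : 0 < c j.
  by rewrite divr_gt0// ln_gt0// ltrDl invr_gt0 mulr_gt0.
pose c1 : R := ln (1 + (m.+1%:R^-1)^-1) / 2.
have c10 : 0 <= c1 by rewrite divr_ge0// ln_ge0// lerDl invr_ge0 invr_ge0.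
have Vs j w : A w -> V (e j) s w <= c1.
  by move=> Aw; apply: barrier_le => //; rewrite invr_gt0.
pose bd j : R := (c1 + k * (T - s)) / c j.
have [Bad BadP] : {Bad : nat -> nat -> set Omega | forall j n, [/\ measurable (Bad j n),
   (P (Bad j n) <= (bd j)%:E)%E &
   forall w i, A w -> (i <= n.+1)%N -> c j <= V (e j) (grid s T n i) w -> Bad j n w]}.
  have h j n := cid (maximal_grid n s0 sT (e0 j) (c0 j) FA (Vs j) c10).
  by exists (fun j n => sval (h j n)) => j n; exact: (svalP (h j n)).
(* A grid need not contain the hitting time. By continuity, however, every sufficiently fine grid
   has a point where the squared norm is below [e j], so a hitting path lies in all but finitely
   many [Bad j n]; the increasing union keeps the uniform bound. *)
pose Q j := \bigcup_i \bigcap_(n in [set n | (i <= n)%N]) Bad j n.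
have mQi j i : measurable (\bigcap_(n in [set n | (i <= n)%N]) Bad j n).
  by apply: bigcap_measurable => [|n _]; [exists i => /=|have [] := BadP j n].
have mQ j : measurable (Q j) by apply: bigcup_measurable.
have PQ j : (P (Q j) <= (bd j)%:E)%E.
  have nd : nondecreasing_seq (fun i => \bigcap_(n in [set n | (i <= n)%N]) Bad j n).
    move=> i i' ii; apply/subsetPset => w h n /= ni; apply: h => /=.
    exact: leq_trans ni.
  have := nondecreasing_cvg_mu (mu := P) (mQi j) (mQ j) nd.
  move=> /cvg_lim <-//; apply: lime_le.
    by apply/cvg_ex; eexists; apply: nondecreasing_cvg_mu (mQi j) (mQ j) nd.
  apply: nearW => i /=; have [mB PB _] := BadP j i.
  apply: le_trans PB; apply: le_measure; rewrite ?inE//.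
  by move=> w h; apply: h => /=.
pose N := \bigcap_j Q j.
have mN : measurable N by apply: bigcap_measurable => // ; exists 0.
have bd0 : bd @ \oo --> 0.
  have bd1 : 0 <= c1 + k * (T - s) by rewrite addr_ge0// mulr_ge0// subr_ge0 ltW.
  apply/cvgrPdist_le => eps eps0.
  near=> j; rewrite sub0r normrN ger0_norm; last by rewrite divr_ge0// ltW.
  rewrite ler_pdivrMr// -ler_pdivrMl//.
  set L := eps^-1 * (c1 + k * (T - s)).
  have L0 : 0 <= L by rewrite mulr_ge0// invr_ge0 ltW.
  rewrite /c ler_pdivlMr// -[leLHS]expRK ler_ln ?posrE ?expR_gt0//; last first.
    by rewrite addr_gt0// invr_gt0 mulr_gt0.
  have -> : (2 * e j)^-1 = j.+1%:R / 2 by rewrite /e invfM invrK mulrC.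
  have : expR (L * 2) * 2 <= j%:R by near: j; exact: nbhs_infty_ger.
  by rewrite -[j.+1%:R]natr1; lra.
have PN : P N = 0%E.
  apply/eqP; rewrite eq_le measure_ge0 andbT.
  have PNj j : (P N <= (bd j)%:E)%E.
    by apply: le_trans (PQ j); apply: le_measure; rewrite ?inE//; exact: bigcap_inf.
  have PNf : P N \is a fin_num by exact: fin_num_measure.
  rewrite -(fineK PNf) lee_fin; apply: cvgr_to_ge bd0 _.
  by apply: nearW => j; rewrite -lee_fin fineK.
apply: (ae_imp2 _ path (_ : {ae P, forall w, ~ N w})); last first.
  by exists N; split => // w /= /contrapT.
move=> w [cU1 cU2 _] nN Aw t /andP[st tT]; apply/negP => /eqP qt0; apply: nN => j _.
have cq : continuous (fun r : R => sqn (Num.max r 0) w).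
  move=> r; rewrite /sqn; apply: cvgD; under eq_fun do rewrite expr2; rewrite expr2;
    by apply: cvgM; [exact: cU1||exact: cU2|] ; try exact: cU1; exact: cU2.
have [h h0 hh] := unif_half_line (f := sqn^~ w) T cq s0 (e0 j).
have [i0 i0h] : exists i : nat, (T - s) / i.+1%:R < h.
  exists (Num.truncn ((T - s) / h)).
  by rewrite ltr_pdivrMr// mulrC -ltr_pdivrMr// truncnS_gt.
exists i0 => // n /= in_.
have nh : (T - s) / n.+1%:R < h.
  apply: le_lt_trans i0h; rewrite ler_pM2l ?subr_gt0// lef_pV2 ?posrE// ler_nat ltnS//.
have [_ _ BP] := BadP j n.
have kn : 0 < (T - s) / n.+1%:R by rewrite divr_gt0// subr_gt0.
pose i := Num.truncn ((t - s) / ((T - s) / n.+1%:R)).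
have x0 : 0 <= (t - s) / ((T - s) / n.+1%:R) by rewrite divr_ge0 ?subr_ge0// ltW.
have /andP[i1 i2] := truncn_itv x0.
rewrite -/i ler_pdivlMr// in i1; rewrite -/i ltr_pdivrMr// in i2.
have ile : (i <= n.+1)%N.
  rewrite -(ler_nat R) -(ler_pM2r kn) (le_trans i1)// mulrC mulfVK ?pnatr_eq0//; lra.
apply: (BP w i Aw ile); apply: (le_trans _ (barrier_large (e0 j) _)) => //.
have gE : grid s T n i = s + i%:R * ((T - s) / n.+1%:R) by rewrite /grid mulrC.
have gin : s <= grid s T n i <= T by rewrite grid_ge ?grid_le// ltW.
have := hh t (grid s T n i); rewrite st tT gin => /(_ isT isT).
rewrite qt0 sub0r normrN => hq.
apply: ltW; apply: le_lt_trans (ler_norm _) (hq _).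
move: i1 i2 nh; rewrite gE -[i.+1%:R]natr1; move: (_ / n.+1%:R) => st_n.
rewrite mulrDl mul1r; move: (i%:R * st_n) => ist i1 i2 nh; by rewrite ger0_norm; lra.
Unshelve. all: by end_near. Qed.

Theorem avoid_zero s : 0 <= s ->
  {ae P, forall w, 0 < sqn s w -> forall t, s <= t -> sqn t w != 0}.
Proof.
move=> s0.
have : {ae P, forall w, forall i m : nat, m.+1%:R^-1 <= sqn s w ->
    forall t, s <= t <= s + i.+1%:R -> sqn t w != 0}.
  apply: ae_foralln => i; apply: ae_foralln => m; apply: hit_null => //.
  by rewrite ltrDl.
apply: ae_imp => w h q0 t st.
pose m := Num.truncn (sqn s w)^-1.
pose i := Num.truncn (t - s).
apply: (h i m); last first.
  by rewrite st/= -lerBlDl ltW// truncnS_gt.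
rewrite -[leRHS]invrK lef_pV2 ?posrE ?invr_gt0//.
by rewrite ltW// truncnS_gt.
Qed.
End avoidance.

(** * Bessel processes started at the origin *)

Section half_line_log.
Context {R : realType}.

Lemma taylor1d_le (f df ddf : R -> R) (c k : R) : 0 <= k ->
  (forall x : R, 0 <= x <= 1 -> is_derive x 1 f (df x)) ->
  (forall x : R, 0 <= x <= 1 -> is_derive x 1 df (ddf x)) ->
  (forall x, 0 <= x <= 1 -> ddf x <= c + k) ->
  f 1 <= f 0 + df 0 + c / 2 + k.
Proof.
move=> k0 fd dfd kb.
pose r x := f x - (f 0 + (df 0 * x + c / 2 * (x * x))).
pose r' x := df x - (df 0 + c * x).
have rd (x : R) : 0 <= x <= 1 -> is_derive x 1 r (r' x).
  move=> x01; apply: (dd_eq (dd_sub (fd x x01) (dd_add (dd_cst x (f 0)) (dd_add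
    (dd_mul (dd_cst x (df 0)) (dd_id x))
    (dd_mul (dd_cst x (c / 2)) (dd_mul (dd_id x) (dd_id x))))))).
  by rewrite /r'; field.
have r'd (x : R) : 0 <= x <= 1 -> is_derive x 1 r' (ddf x - c).
  move=> x01.
  apply: (dd_eq (dd_sub (dfd x x01) (dd_add (dd_cst x (df 0)) (dd_mul (dd_cst x c) (dd_id x))))).
  by ring.
have mvt (g dg : R -> R) (x : R) : (forall y : R, 0 <= y <= 1 -> is_derive y 1 g (dg y)) ->
    (forall y, 0 <= y <= 1 -> dg y <= k) -> 0 <= x <= 1 -> g x <= g 0 + k * x.
  move=> gd gk /andP[x0 x1].
  have gd' (y : R) : 0 <= y <= x -> is_derive y 1 g (dg y).
    by move=> /andP[y0 yx]; apply: gd; rewrite y0 (le_trans yx).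
  have [||z /[!in_itv]/= /andP[z0 zx] E] := MVT_segment (f := g) (df := dg) x0.
  - by move=> y; rewrite in_itv/= => /andP[y0 yx]; apply: gd'; rewrite !ltW.
  - apply: continuous_in_subspaceT => y; rewrite inE/= in_itv/= => yx.
    apply: differentiable_continuous; apply/derivable1_diffP.
    by have [] := gd' y yx.
  rewrite -lerBlDl E subr0 ler_wpM2r//; apply: gk; by rewrite z0 (le_trans zx).
have r'b x : 0 <= x <= 1 -> r' x <= k.
  move=> x01; case/andP: (x01) => x0 x1.
  have := mvt r' _ x r'd _ x01; rewrite {2}/r' mulr0 addr0 subrr add0r => h.
  apply: le_trans (h _) _; last by rewrite ler_piMr.
  by move=> y y01; have := kb y y01; lra.
have := mvt r r' 1 rd r'b; rewrite lexx ler01 /r => /(_ isT).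
lra.
Qed.

(** Cutting [u] at 0 makes these functions Lipschitz on the whole line; the processes with capped
    drift may be negative. *)
Definition hinv (c u : R) : R := (c + Num.max u 0)^-1.
Definition hlog (b u : R) : R := ln (1 + hinv b u).

Section hinv.
Variable c : R.
Hypothesis c0 : 0 < c.
Let m0 (u : R) : 0 <= Num.max u 0. Proof. by rewrite le_max lexx orbT. Qed.
Let d0 u : 0 < c + Num.max u 0. Proof. by rewrite ltr_wpDr. Qed.

Lemma hinv_gt0 u : 0 < hinv c u. Proof. by rewrite invr_gt0. Qed.
Lemma hinv_le u : hinv c u <= c^-1.
Proof. by rewrite lef_pV2 ?posrE// lerDl. Qed.
Lemma hinv_neg u : u <= 0 -> hinv c u = c^-1.
Proof. by move=> u0; rewrite /hinv (max_idPr u0) addr0. Qed.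
Lemma hinv_pos u : 0 <= u -> hinv c u = (c + u)^-1.
Proof. by move=> u0; rewrite /hinv (max_idPl u0). Qed.
Lemma hinvB u v : hinv c u - hinv c v = (Num.max v 0 - Num.max u 0) * (hinv c u * hinv c v).
Proof. by rewrite /hinv; have := d0 u; have := d0 v; move=> p q; field; rewrite !gt_eqF. Qed.
Lemma hinv_lip u v : `|hinv c u - hinv c v| <= (c^-1 * c^-1) * `|u - v|.
Proof.
rewrite hinvB normrM mulrC distrC.
apply: ler_pM => //; last exact: maxr0_lip.
have p := hinv_gt0 u; have q := hinv_gt0 v.
by rewrite gtr0_norm ?mulr_gt0// ler_pM ?hinv_le// ltW.
Qed.
Lemma hinv_mono u v : u <= v -> hinv c v <= hinv c u.
Proof.
move=> uv; rewrite -subr_ge0 hinvB.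
apply: mulr_ge0; last by apply: ltW; rewrite mulr_gt0// hinv_gt0.
by rewrite subr_ge0 ge_max !le_max uv lexx orbT.
Qed.
Lemma measurable_hinv : measurable_fun setT (hinv c).
Proof.
apply: measurableT_comp; first exact: measurable_invr.
apply: measurable_funD; first exact: measurable_cst.
by apply: measurable_maxr => //; exact: measurable_cst.
Qed.
End hinv.

Lemma nice_of_lip (f : R -> R) (K : R) : (forall x, `|f x| <= K) ->
  (forall x y, `|f x - f y| <= K * `|x - y|) -> measurable_fun setT f -> nice (fun x _ => f x).
Proof.
move=> bf lf mf; exists K; split => [x y|x y x' y'|]; first exact: bf.
  have K0 : 0 <= K by exact: le_trans (bf 0).
  by apply: le_trans (lf _ _) _; rewrite ler_wpM2l// lerDl.
by apply: measurableT_comp => //; exact: measurable_fst.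
Qed.

Lemma nice_hinv c : 0 < c -> nice (fun x _ => hinv c x).
Proof.
move=> c0; have cV : 0 < c^-1 by rewrite invr_gt0.
apply: (@nice_of_lip _ (c^-1 + c^-1 * c^-1)); last exact: measurable_hinv.
  move=> x; rewrite gtr0_norm ?hinv_gt0//; have := hinv_le c0 x.
  by have := mulr_gt0 cV cV; lra.
move=> x y; apply: le_trans (hinv_lip c0 _ _) _; apply: ler_wpM2r => //.
by have := cV; lra.
Qed.

Section log_test.
Variable b : R.
Hypothesis b0 : 0 < b.
Let b1 : 0 < 1 + b. Proof. by rewrite addr_gt0. Qed.
Let bV : 0 < b^-1. Proof. by rewrite invr_gt0. Qed.
Notation L := (hlog b).
Notation r := (hinv b).
Notation s := (hinv (1 + b)).
Let r0 u : 0 < r u. Proof. exact: hinv_gt0. Qed.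
Let s0 u : 0 < s u. Proof. exact: hinv_gt0. Qed.

Lemma hlog_ge0 u : 0 <= L u.
Proof. by rewrite ln_ge0// lerDl ltW. Qed.
Lemma hlog_le u : L u <= r u.
Proof. by apply: le_ln1Dx; have := r0 u; lra. Qed.
Lemma hlog_mono u v : u <= v -> L v <= L u.
Proof.
move=> uv; rewrite /hlog ler_ln ?posrE ?lerD2l ?hinv_mono//; first by have := r0 v; lra.
by have := r0 u; lra.
Qed.
Let hlog_diff u v : u <= v -> 0 <= L u - L v <= (r u - r v) / (1 + r v).
Proof.
move=> uv; rewrite subr_ge0 hlog_mono//= /hlog.
have p := r0 u; have q := r0 v; have rr := hinv_mono b0 uv.
have -> : 1 + r u = (1 + r v) * (1 + (r u - r v) / (1 + r v)).
  by field; rewrite gt_eqF//; lra.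
have z0 : 0 <= (r u - r v) / (1 + r v) by apply: divr_ge0; lra.
rewrite lnM ?posrE; [|lra|lra].
by rewrite addrC addKr; apply: le_ln1Dx; lra.
Qed.
Lemma hlog_lip u v : `|L u - L v| <= (b^-1 * b^-1) * `|u - v|.
Proof.
wlog uv : u v / u <= v.
  by move=> h; have [/h//|/ltW /h] := leP u v; rewrite distrC (distrC v).
have /andP[h1 h2] := hlog_diff uv; rewrite ger0_norm//.
have rr := hinv_mono b0 uv; have q := r0 v.
have h3 : (r u - r v) / (1 + r v) <= r u - r v.
  by rewrite ler_pdivrMr; [rewrite ler_peMr; lra|lra].
apply: le_trans (le_trans h2 h3) _; apply: le_trans (ler_norm _) _; exact: hinv_lip.
Qed.
Lemma measurable_hlog : measurable_fun setT L.
Proof.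
apply: measurableT_comp; first exact: measurable_ln.
by apply: measurable_funD; [exact: measurable_cst|exact: measurable_hinv].
Qed.

(* [- u log (1 + 1 / (b + u))] on the half line, extended linearly; [vlogxx] is only an upper
   bound for the second derivative, which jumps at [0]. *)
Definition vlog u : R := - (u * L u).
Definition vlogx u : R := - (L u - (1 + b) * s u + b * r u).
Definition vlogxx u : R := 2 * r u.

Let vpos u a : 0 <= u -> 0 <= u + a ->
  vlog (u + a) <= vlog u + vlogx u * a + vlogxx u * a ^+ 2 / 2 + 2 * (b^-1 * b^-1) * `|a| ^+ 3.
Proof.
move=> u0 ua0.
pose z (h : R) := u + h * a.
have z0 h : 0 <= h <= 1 -> 0 <= z h.
  by rewrite /z => /andP[h0 h1]; have [a0|a0] := leP 0 a; nra.
pose f h := - (z h * ln (1 + (b + z h)^-1)).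
pose df h := - (ln (1 + (b + z h)^-1) - (1 + b) * (1 + b + z h)^-1 + b * (b + z h)^-1) * a.
pose ddf h := ((b + z h)^-1 * (1 + b + z h)^-1 - (1 + b) * (1 + b + z h)^-1 ^+ 2
   + b * (b + z h)^-1 ^+ 2) * a ^+ 2.
have fE h : 0 <= h <= 1 -> vlog (z h) = f h by move=> /z0 zh; rewrite /vlog /hlog hinv_pos.
have dfE h : 0 <= h <= 1 -> vlogx (z h) * a = df h.
  by move=> /z0 zh; rewrite /vlogx /hlog !hinv_pos.
have i01 : 0 <= (0 : R) <= 1 by rewrite lexx ler01.
have i11 : 0 <= (1 : R) <= 1 by rewrite lexx ler01.
have zz : z 0 = u by rewrite /z mul0r addr0.
have z1 : z 1 = u + a by rewrite /z mul1r.
have dz (h : R) : is_derive h 1 z a.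
  by apply: (dd_eq (dd_add (dd_cst h u) (dd_mul (dd_id h) (dd_cst h a)))); ring.
have dzc (k h : R) : is_derive h 1 (fun h => k + z h) a.
  by apply: (dd_eq (dd_add (dd_cst h k) (dz h))); rewrite add0r.
have dL (h : R) : 0 <= h <= 1 -> is_derive h 1 (fun h => ln (1 + (b + z h)^-1))
    (- (b + z h)^-1 * (1 + b + z h)^-1 * a).
  move=> /z0 zh; have bz : 0 < b + z h by rewrite ltr_wpDr.
  have bz1 : 0 < 1 + b + z h by rewrite ltr_wpDr.
  have l0 : 0 < 1 + (b + z h)^-1 by rewrite addr_gt0// invr_gt0.
  have bz' : b + z h != 0 by rewrite gt_eqF.
  apply: (dd_eq (dd_ln (f := fun h => 1 + (b + z h)^-1) l0
    (dd_add (dd_cst h 1) (dd_inv (f := fun h => b + z h) bz' (dzc b h))))).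
  by field; rewrite bz' gt_eqF.
have dfp (h : R) : 0 <= h <= 1 -> is_derive h 1 f (df h).
  move=> h01; have zh := z0 h h01.
  have bz : b + z h != 0 by rewrite gt_eqF// ltr_wpDr.
  have bz1 : 1 + b + z h != 0 by rewrite gt_eqF// ltr_wpDr.
  rewrite /f; apply: (dd_eq (is_deriveN (dd_mul (dz h) (dL h h01)))).
  by rewrite /df; field; rewrite bz bz1.
have ddfp (h : R) : 0 <= h <= 1 -> is_derive h 1 df (ddf h).
  move=> h01; have zh := z0 h h01.
  have bz : b + z h != 0 by rewrite gt_eqF// ltr_wpDr.
  have bz1 : 1 + b + z h != 0 by rewrite gt_eqF// ltr_wpDr.
  apply: (dd_eq (dd_mul (is_deriveN (dd_add (dd_sub (dL h h01) (dd_mul (dd_cst h (1 + b))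
    (dd_inv (f := fun h => 1 + b + z h) bz1 (dzc (1 + b) h)))) (dd_mul (dd_cst h b) (dd_inv (f := fun h => b + z h) bz (dzc b h))))) (dd_cst h a))).
  by rewrite /ddf; field; rewrite bz bz1.
have k0 : 0 <= 2 * (b^-1 * b^-1) * `|a| ^+ 3 by rewrite !mulr_ge0// ?ltW// exprn_ge0.
have a3 : `|a| * a ^+ 2 = `|a| ^+ 3.
  by rewrite [RHS]exprS -normrX (@ger0_norm _ (a ^+ 2))// sqr_ge0.
have := @taylor1d_le f df ddf (vlogxx u * a ^+ 2) _ k0 dfp ddfp.
rewrite -!fE// -dfE// zz z1; apply => h h01; have zh := z0 h h01.
rewrite /ddf -!(hinv_pos _ zh).
have -> : vlogxx u * a ^+ 2 + 2 * (b^-1 * b^-1) * `|a| ^+ 3 =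
    (2 * (r u + b^-1 * b^-1 * `|a|)) * a ^+ 2 by rewrite /vlogxx -a3; ring.
apply: ler_wpM2r; first exact: sqr_ge0.
have := hinv_lip b0 (z h) u.
have -> : z h - u = h * a by rewrite /z; ring.
case/andP: h01 => h0 h1; rewrite normrM (ger0_norm h0) => /(le_trans (ler_norm _)) lip.
have ha : b^-1 * b^-1 * (h * `|a|) <= b^-1 * b^-1 * `|a|.
  by apply: ler_wpM2l; [apply: mulr_ge0; exact: ltW|rewrite ler_piMl].
have p := r0 (z h); have q := s0 (z h).
have q1 : s (z h) <= 1.
  by apply: le_trans (hinv_le b1 _) _; rewrite invf_le1// lerDl ltW.
have rs : r (z h) * s (z h) <= r (z h) by rewrite ler_piMr// ltW.
have br : b * r (z h) <= 1 by rewrite -ler_pdivlMl// mulr1 hinv_le.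
have brr : b * r (z h) ^+ 2 <= r (z h) by rewrite expr2 mulrA ler_piMl// ltW.
have : 0 <= (1 + b) * s (z h) ^+ 2 by rewrite mulr_ge0 ?sqr_ge0// ltW.
lra.
Qed.

Let vneg u : u <= 0 -> [/\ vlog u = - (u * L 0), vlogx u = - L 0 & vlogxx u = 2 * b^-1].
Proof.
move=> u0; have E : L u = L 0 by rewrite /hlog !hinv_neg.
rewrite /vlog /vlogx /vlogxx E !hinv_neg//; split => //.
by field; rewrite !gt_eqF.
Qed.

(** Controls the slope between [u] and 0; it is what allows a Taylor segment to cross the kink of
    the second derivative from right to left. *)
Let vlogx_diff u : 0 <= u -> vlogx u - vlogx 0 <= vlogxx u * u + b^-1 * b^-1 * u ^+ 2.
Proof.
move=> u0; have [_ -> _] := vneg (lexx 0).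
have /andP[_ h1] := hlog_diff u0.
have E : r 0 = b^-1 by rewrite hinv_neg.
have rrE : r 0 - r u = u * (r 0 * r u).
  by rewrite (hinvB b0) (max_idPl u0) (max_idPl (lexx 0)); ring.
have sE : (1 + b) * s u <= 1 by rewrite -ler_pdivlMl// mulr1 hinv_le.
have br : b * r u = 1 - u * r u.
  by rewrite hinv_pos//; field; rewrite gt_eqF// ltr_wpDr.
have p := r0 u.
have h2 : (r 0 - r u) / (1 + r u) <= u * b^-1.
  rewrite ler_pdivrMr; last by lra.
  rewrite rrE E mulrA ler_wpM2l//; last by lra.
  by rewrite mulr_ge0// ltW.
have h3 : u * b^-1 <= u * r u + b^-1 * b^-1 * u ^+ 2.
  have -> : u * b^-1 = u * r u + u * u * b^-1 * r u.
    by rewrite hinv_pos//; field; rewrite !gt_eqF// ltr_wpDr.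
  rewrite lerD2l; have -> : b^-1 * b^-1 * u ^+ 2 = u * u * b^-1 * b^-1 by ring.
  by apply: ler_wpM2l; [rewrite !mulr_ge0// ltW|exact: hinv_le].
rewrite /vlogx /vlogxx; lra.
Qed.

(** Four cases by the signs of the endpoints. A segment crossing 0 is cut there: the negative side
    is linear, the positive side is [vpos], and the change of slope is absorbed by the quadratic and
    cubic terms. *)
Lemma vlog_taylor u a : vlog (u + a) <= vlog u + vlogx u * a + vlogxx u * a ^+ 2 / 2
   + 2 * (b^-1 * b^-1) * `|a| ^+ 3.
Proof.
set K := b^-1 * b^-1; have K0 : 0 < K by rewrite mulr_gt0.
have [u0|u0] := leP 0 u; have [v0|v0] := leP 0 (u + a).
- exact: vpos.
- have := @vpos u (- u) u0; rewrite subrr normrN (ger0_norm u0) => /(_ (lexx _)).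
  have [-> _ _] := vneg (ltW v0); have := vlogx_diff u0; have [E1 E2 _] := vneg (lexx 0).
  rewrite E1 E2 mul0r oppr0 -/K => h1 h2.
  pose v := - (u + a); have vp : 0 < v by rewrite oppr_gt0.
  have -> : a = - (u + v) by rewrite /v; ring.
  rewrite normrN (@ger0_norm _ (u + v)) ?addr_ge0 ?(ltW vp)//.
  have -> : - ((u + - (u + v)) * L 0) = v * L 0 by ring.
  have h3 : (vlogx u + L 0) * v <= (vlogxx u * u + K * u ^+ 2) * v.
    by rewrite ler_wpM2r ?(ltW vp)//; lra.
  have q : 0 <= vlogxx u by rewrite /vlogxx mulr_ge0// ltW.
  have h4 : 0 <= vlogxx u * v ^+ 2 by rewrite mulr_ge0// sqr_ge0.
  have h5 : 2 * K * u ^+ 3 + K * u ^+ 2 * v <= 2 * K * (u + v) ^+ 3.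
    have -> : 2 * K * (u + v) ^+ 3 = 2 * K * u ^+ 3 + K * u ^+ 2 * v +
      (5 * (K * u ^+ 2 * v) + 6 * (K * u * v ^+ 2) + 2 * (K * v ^+ 3)) by ring.
    have vv := ltW vp; have kk := ltW K0.
    by rewrite lerDl; apply: addr_ge0; [apply: addr_ge0|]; rewrite !mulr_ge0 ?(ltW bV)// ?exprn_ge0.
  by lra.
- have := @vpos 0 (u + a) (lexx 0); rewrite add0r => /(_ v0).
  have [-> -> ->] := vneg (lexx 0); have [-> -> ->] := vneg (ltW u0).
  rewrite (ger0_norm v0) -/K => h.
  have a0 : 0 <= a by lra.
  rewrite (ger0_norm a0).
  have h2 : (u + a) ^+ 2 <= a ^+ 2 by rewrite ler_pXn2r// ?nnegrE//; lra.
  have h3 : (u + a) ^+ 3 <= a ^+ 3 by rewrite ler_pXn2r// ?nnegrE//; lra.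
  have h4 : 2 * b^-1 * (u + a) ^+ 2 <= 2 * b^-1 * a ^+ 2 by rewrite ler_wpM2l// mulr_ge0// ltW.
  have h5 : 2 * K * (u + a) ^+ 3 <= 2 * K * a ^+ 3 by rewrite ler_wpM2l// mulr_ge0// ltW.
  lra.
- have [-> -> ->] := vneg (ltW u0); have [-> _ _] := vneg (ltW v0).
  have : 0 <= 2 * b^-1 * a ^+ 2.
    by apply: mulr_ge0; [rewrite mulr_ge0// ltW|exact: sqr_ge0].
  have : 0 <= 2 * K * `|a| ^+ 3 by rewrite !mulr_ge0 ?(ltW bV)// ?exprn_ge0.
  by lra.
Qed.

Lemma vlog_lip u v : `|vlog u - vlog v| <= (2 * b^-1) * `|u - v|.
Proof.
wlog uv : u v / u <= v.
  by move=> h; have [/h//|/ltW /h] := leP u v; rewrite distrC (distrC v).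
have L0 w : 0 <= L w <= b^-1.
  by rewrite hlog_ge0//=; apply: le_trans (hlog_le w) (hinv_le b0 w).
have nb (x w : R) : `|x * L w| <= `|x| * b^-1.
  by case/andP: (L0 w) => p q; rewrite normrM (ger0_norm p) ler_wpM2l.
have uv' : `|u - v| = v - u by rewrite distrC ger0_norm// subr_ge0.
have [u0|u0] := leP 0 u.
  have -> : vlog u - vlog v = (v - u) * L v - u * (L u - L v) by rewrite /vlog; ring.
  apply: le_trans (ler_normB _ _) _; rewrite uv'.
  have := nb (v - u) v; rewrite (ger0_norm (_ : 0 <= v - u)) ?subr_ge0// => h1.
  have /andP[h2 h3] := hlog_diff uv.
  have rr := hinv_mono b0 uv; have q := r0 v.
  have h4 : (r u - r v) / (1 + r v) <= r u - r v.
    by rewrite ler_pdivrMr; [rewrite ler_peMr; lra|lra].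
  rewrite (ger0_norm (_ : 0 <= u * (L u - L v))) ?mulr_ge0//.
  have v0 := le_trans u0 uv.
  have h5 : u * (L u - L v) <= (v - u) * b^-1.
    apply: le_trans (ler_wpM2l u0 (le_trans h3 h4)) _.
    rewrite (hinvB b0) (max_idPl u0) (max_idPl v0) mulrCA ler_wpM2l ?subr_ge0//.
    rewrite mulrA; have : u * r u <= 1.
      by rewrite hinv_pos// ler_pdivrMr ?ltr_wpDr// mul1r lerDr ltW.
    by have := hinv_le b0 v; have := r0 u; nra.
  lra.
have [-> _ _] := vneg (ltW u0).
have [v0|v0] := leP v 0.
  have [-> _ _] := vneg v0.
  have -> : - (u * L 0) - - (v * L 0) = (v - u) * L 0 by ring.
  apply: le_trans (nb _ _) _; rewrite distrC mulrC ler_wpM2r//.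
  by have := bV; lra.
have -> : - (u * L 0) - vlog v = (- u) * L 0 + v * L v by rewrite /vlog; ring.
apply: le_trans (ler_normD _ _) _.
apply: le_trans (lerD (nb _ _) (nb _ _)) _.
by rewrite normrN (ltr0_norm u0) (gtr0_norm v0) uv'; have := bV; nra.
Qed.

(** For [u >= 0], [u * log (1 + 1 / (b + u)) <= u / (b + u) <= 1]. Independence of [b] is the point:
    it bounds the expected generator uniformly over all caps. *)
Lemma vlog_ge u : -1 <= vlog u.
Proof.
rewrite /vlog lerN2; have [u0|u0] := leP 0 u.
  apply: le_trans (ler_wpM2l u0 (hlog_le u)) _.
  by rewrite hinv_pos// ler_pdivrMr ?ltr_wpDr// mul1r lerDr ltW.
by apply: le_trans (_ : 0 <= 1) => //; rewrite nmulr_rle0// hlog_ge0.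
Qed.

Lemma vlogx_le u : vlogx u <= 1 - L u.
Proof.
have : (1 + b) * s u <= 1 by rewrite -ler_pdivlMl// mulr1 hinv_le.
have : 0 <= b * r u by rewrite mulr_ge0// ltW.
by rewrite /vlogx; lra.
Qed.

Lemma vlog_test : exists K, test_fun K (fun x _ => vlog x) (fun x _ => vlogx x) (fun _ _ => 0)
  (fun x _ => vlogxx x) (fun _ _ => 0) (fun _ _ => 0).
Proof.
have n0 : nice (fun _ _ : R => 0 : R) by exact: nice_cst.
apply: test_fun_nice => //.
- exists (2 * b^-1) => x y x' y'; apply: le_trans (vlog_lip _ _) _.
  by rewrite ler_wpM2l ?lerDl// mulr_ge0// ltW.
- apply: (measurableT_comp (f := vlog)); last exact: measurable_fst.
  by apply: measurableT_comp => //; apply: measurable_funM => //; exact: measurable_hlog.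
- have nL : nice (fun x _ => L x).
    apply: (@nice_of_lip _ (b^-1 + b^-1 * b^-1)); last exact: measurable_hlog.
      move=> x; rewrite ger0_norm ?hlog_ge0//; have := hinv_le b0 x; have := hlog_le x.
      by have := mulr_gt0 bV bV; lra.
    move=> x y; apply: le_trans (hlog_lip _ _) _; apply: ler_wpM2r => //.
    by have := bV; lra.
  have := nice_scale (-1) (nice_add (nice_sub nL (nice_scale (1 + b) (nice_hinv b1)))
    (nice_scale b (nice_hinv b0))).
  by congr nice; apply/funext => x; apply/funext => y; rewrite /vlogx mulN1r.
- exact: nice_scale (nice_hinv b0).
- exists (2 * (b^-1 * b^-1)) => x y a c.
  have K0 : 0 <= 2 * (b^-1 * b^-1) by rewrite !mulr_ge0// ltW.
  have := mulr_ge0 K0 (exprn_ge0 3 (normr_ge0 c)).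
  by have := vlog_taylor x a; lra.
Qed.

End log_test.
End half_line_log.

Section capped_inverse.
Context {R : realType}.
Implicit Types u v : R.

Definition capinv (n : nat) u : R := (Num.max u n.+1%:R^-1)^-1.

Lemma capinv_max n u : 0 < Num.max u n.+1%:R^-1 :> R.
Proof. by rewrite lt_max invr_gt0 ltr0Sn orbT. Qed.

Lemma capinv_gt0 n u : 0 < capinv n u.
Proof. by rewrite invr_gt0 capinv_max. Qed.

Lemma capinv_le n u : capinv n u <= n.+1%:R.
Proof.
rewrite -[leRHS]invrK lef_pV2 ?posrE ?capinv_max ?invr_gt0//.
by rewrite le_max lexx orbT.
Qed.

Lemma capinv_mono n u v : u <= v -> capinv n v <= capinv n u.
Proof.
move=> uv; rewrite lef_pV2 ?posrE ?capinv_max//.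
by rewrite ge_max !le_max uv lexx orbT.
Qed.

Lemma capinv_nd n m u : (n <= m)%N -> capinv n u <= capinv m u.
Proof.
move=> nm; rewrite lef_pV2 ?posrE ?capinv_max//.
by rewrite ge_max !le_max lexx/= lef_pV2 ?posrE// ler_nat ltnS nm orbT.
Qed.

Lemma capinv_npos n u : u <= 0 -> capinv n u = n.+1%:R.
Proof. by move=> u0; rewrite /capinv (max_idPr _) ?invrK// (le_trans u0). Qed.

Lemma capinv_lip n u v : `|capinv n u - capinv n v| <= n.+1%:R ^+ 2 * `|u - v|.
Proof.
have := capinv_le n u; have := capinv_le n v; have := capinv_gt0 n u; have := capinv_gt0 n v.
have -> : capinv n u - capinv n v = (Num.max v n.+1%:R^-1 - Num.max u n.+1%:R^-1) *
    (capinv n u * capinv n v).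
  by rewrite /capinv; have := capinv_max n u; have := capinv_max n v => p q;
    field; rewrite !gt_eqF.
move=> v0 u0 vn un; rewrite normrM mulrC distrC; apply: ler_pM => //.
  by rewrite gtr0_norm ?mulr_gt0// expr2 ler_pM// ltW.
have := @maxr0_lip R (u - n.+1%:R^-1) (v - n.+1%:R^-1).
have E w : Num.max (w - n.+1%:R^-1) 0 = Num.max w n.+1%:R^-1 - n.+1%:R^-1 :> R.
  by rewrite addr_maxl subrr.
by rewrite !E; rewrite (_ : Num.max u _ - _ - _ = Num.max u n.+1%:R^-1 - Num.max v n.+1%:R^-1);
  [rewrite (_ : u - _ - _ = u - v)//; ring|ring].
Qed.

Lemma capinv_cont n : continuous (capinv n).
Proof.
move=> u; apply: cvgV; first by rewrite gt_eqF// capinv_max.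
by apply: cvg_maxr; [exact: cvg_id|exact: cvg_cst].
Qed.

Lemma capinv_cvg u : 0 < u -> (fun n => capinv n u) @ \oo --> u^-1.
Proof.
move=> u0; apply: cvgV; first by rewrite gt_eqF.
rewrite -[X in _ --> X](max_idPl (ltW u0)); apply: cvg_maxr; first exact: cvg_cst.
exact: cvg_harmonic.
Qed.

Lemma capinv_leV n u : 0 < u -> capinv n u <= u^-1.
Proof. by move=> u0; rewrite lef_pV2 ?posrE ?capinv_max// le_max lexx. Qed.
End capped_inverse.

(** * Bessel paths as limits of capped equations *)

Section bessel_path.
Context {R : realType}.
Notation mu := (@lebesgue_measure R).
Variables (al : R) (M : R -> R).
Hypotheses (al0 : 0 < al) (cM : continuous M) (M0 : forall t, t <= 0 -> M t = 0).

(** The sign is dictated by [ode_sol], which subtracts a nondecreasing nonlinearity, while the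
    capped drift is added and nonincreasing. *)
Definition bes n : R -> R := ode_sol M (fun _ u => - (al * capinv n u)) (al * n.+1%:R).
Definition bessel (t : R) : R := limn (fun n => bes n t).

Lemma besP n : continuous (bes n) /\
  forall t, bes n t = M t + al * J (fun s => capinv n (bes n s)) 0 t.
Proof.
have [] := @ode_solP R M (fun _ u => - (al * capinv n u)) (al * n.+1%:R) (al * n.+1%:R ^+ 2) cM.
- by rewrite mulr_ge0 ?exprn_ge0// ltW.
- move=> _ u; rewrite normrN gtr0_norm ?mulr_gt0 ?capinv_gt0// ler_pM2l//.
  exact: capinv_le.
- by move=> _ u v uv; rewrite lerN2 ler_pM2l//; exact: capinv_mono.
- move=> _ u v; rewrite -opprD normrN -mulrN -mulrDr normrM (gtr0_norm al0) -mulrA ler_pM2l//.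
  exact: capinv_lip.
- move=> u cu s; apply: cvgN; apply: cvgMr.
  by apply: continuous_comp; [exact: cu|exact: capinv_cont].
rewrite -/(bes n) => c E; split => // t; rewrite E.
rewrite (_ : J _ 0 t = J (fun s => - al * capinv n (bes n s)) 0 t); last first.
  by apply: J_eq => s _; rewrite mulNr.
rewrite J_Z ?mulNr ?opprK//; apply: itg_cont => s.
by apply: continuous_comp; [exact: c|exact: capinv_cont].
Qed.

Let cb n : continuous (bes n). Proof. by have [] := besP n. Qed.
Let bE n : forall t, bes n t = M t + al * J (fun s => capinv n (bes n s)) 0 t.
Proof. by have [] := besP n. Qed.

Let cg m n : continuous (fun s => capinv m (bes n s)).
Proof. by move=> s; apply: continuous_comp; [exact: cb|exact: capinv_cont]. Qed.

Let ig m n a b : itg (fun s => capinv m (bes n s)) a b.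
Proof. exact: itg_cont. Qed.

Lemma bes_npos n t : t <= 0 -> bes n t = 0.
Proof.
move=> t0; rewrite bE M0// add0r.
by move: t0; rewrite le_eqVlt => /orP[/eqP ->|t0]; rewrite ?J_aa ?J_lt// mulr0.
Qed.

Lemma bes_nd n t : bes n t <= bes n.+1 t.
Proof.
have [t0|t0] := leP t 0; first by rewrite !bes_npos.
have ip k T : itg (fun s => (- al) * capinv k (bes k s)) 0 T by apply: itg_scale.
have bE' k s : 0 <= s -> bes k s = M s - J (fun s => (- al) * capinv k (bes k s)) 0 s.
  by move=> _; rewrite J_Z// mulNr opprK.
have := comparison (@cb n) (@cb n.+1) (ip n) (ip n.+1) (bE' n) (bE' n.+1) (lexx _).
apply; last exact: ltW.
  by move=> s r _ _; rewrite !subrr.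
apply: aeW => s s0 h; rewrite !mulNr lerN2 ler_pM2l//.
apply: le_trans (capinv_nd _ (leqnSn n)) _; exact/capinv_mono/ltW.
Qed.

(** After the last time at which the path equals 1 its drift is at most [al], whatever the cap. Only
    the oscillation of [M] and a term linear in time can then be added. *)
Lemma bes_bounded t : exists c, forall n, bes n t <= c.
Proof.
have [t0|t0] := ltP t 0; first by exists 0 => n; rewrite bes_npos// ltW.
have [K [_ KP]] : bounded_set (M @` `[0, t]).
  apply: compact_bounded; apply: continuous_compact; last exact: segment_compact.
  exact: continuous_subspaceT.
have Kb s : 0 <= s <= t -> `|M s| <= K + 1.
  move=> st; apply: (KP (K + 1)); first by rewrite ltrDl.
  by exists s => //=; rewrite in_itv.
exists (1 + 2 * (K + 1) + al * t) => n.
rewrite leNgt; apply/negP => h.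
have K0 : 0 <= K + 1 by apply: le_trans (Kb 0 _); rewrite ?lexx.
have att : 0 <= al * t by rewrite mulr_ge0// ltW.
have c1 : continuous (fun s => 1 - bes n s).
  by move=> s; apply: cvgB; [exact: cvg_cst|exact: cb].
have [||s [s0 st E neg]] := last_zero c1 t0.
- by rewrite bes_npos// subr0.
- by lra.
have := bE n t; rewrite (J_cat s0 (ltW st) (ig n n 0 t)) mulrDr.
have Es := bE n s.
have Jb : J (fun r => capinv n (bes n r)) s t <= J (fun=> 1) s t.
  apply: J_le; [exact: ig|exact: itg_cst|move=> r /andP[sr rt]].
  have br : 1 <= bes n r.
    move: sr; rewrite le_eqVlt => /orP[/eqP <-|sr]; first by lra.
    by have := neg r; rewrite sr rt => /(_ isT); lra.
  apply: le_trans (capinv_leV _ _) _; first exact: lt_le_trans br.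
  by rewrite invf_le1//; exact: lt_le_trans br.
rewrite J_cst ?(ltW st)// mul1r in Jb.
have := Kb s; rewrite s0 (ltW st) => /(_ isT) /ler_normlP[Ms _].
have := Kb t; rewrite t0 lexx => /(_ isT) /ler_normlP[_ Mt].
have : al * J (fun r => capinv n (bes n r)) s t <= al * (t - s) by rewrite ler_pM2l.
have : al * (t - s) <= al * t by rewrite ler_pM2l// gerBl.
lra.
Qed.

Lemma bessel_cvg t : (fun n => bes n t) @ \oo --> bessel t.
Proof.
have [c cP] := bes_bounded t.
apply: nondecreasing_is_cvgn; first by apply/nondecreasing_seqP => n; exact: bes_nd.
by exists c => _ [n _ <-].
Qed.

Lemma bessel_npos t : t <= 0 -> bessel t = 0.
Proof.
move=> t0; apply: cvg_lim => //.
under eq_fun do rewrite bes_npos//; exact: cvg_cst.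
Qed.

Let cap_cvg m t : (fun n => capinv m (bes n t)) @ \oo --> capinv m (bessel t).
Proof. by apply: continuous_cvg; [exact: capinv_cont|exact: bessel_cvg]. Qed.

Let mbes (a b : R) : measurable_fun `[a, b] bessel.
Proof.
apply: (@measurable_fun_cvg _ _ _ _ bes) => [n|s _]; last exact: bessel_cvg.
apply: measurable_funTS; apply: continuous_measurable_fun; exact: cb.
Qed.

Lemma capinv_bessel_cvg m a b : itg (fun s => capinv m (bessel s)) a b /\
  (fun n => J (fun s => capinv m (bes n s)) a b) @ \oo --> J (fun s => capinv m (bessel s)) a b.
Proof.
apply: (@J_dct R _ _ (fun=> m.+1%:R)).
- by move=> n; exact: itg_meas.
- apply: measurableT_comp; last exact: mbes.
  by apply: continuous_measurable_fun; exact: capinv_cont.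
- by apply: aeW => s _; exact: cap_cvg.
- exact: itg_cst.
- by apply: aeW => s n _; rewrite gtr0_norm ?capinv_gt0// capinv_le.
Qed.

(** For [n >= m] the cap [n] gives the larger drift, so each fixed cap survives the limit as a lower
    bound. Equality could fail only through drift mass escaping near 0. *)
Lemma bessel_drift_ge m s t : 0 <= s -> s <= t ->
  al * J (fun r => capinv m (bessel r)) s t <= bessel t - bessel s - (M t - M s).
Proof.
move=> s0 st; have [_ cJ] := capinv_bessel_cvg m s t.
have l1 : (fun n => al * J (fun r => capinv m (bes n r)) s t) @ \oo -->
    al * J (fun r => capinv m (bessel r)) s t by apply: cvgMr.
have l2 : (fun n => bes n t - bes n s - (M t - M s)) @ \oo --> bessel t - bessel s - (M t - M s).
  by apply: cvgB; [apply: cvgB; exact: bessel_cvg|exact: cvg_cst].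
apply: (ler_cvg_to l1 l2); near=> n.
rewrite (bE n t) (bE n s) (J_cat s0 st (ig n n 0 t)).
rewrite [leRHS](_ : _ = al * J (fun r => capinv n (bes n r)) s t); last by ring.
rewrite ler_pM2l//; apply: J_le => // r _; apply: capinv_nd; near: n; exact: nbhs_infty_ge.
Unshelve. all: by end_near. Qed.

Let mneg (b : R) : measurable (`[0, b] `&` [set s | bessel s <= 0]).
Proof.
have := @mbes 0 b (measurable_itv _) _ (measurable_itv `]-oo, (0 : R)]).
by congr measurable; apply/seteqP; split => s /= [s1 s2]; split => //; move: s2; rewrite in_itv.
Qed.

(** On the times with [bessel s <= 0] the capped drift equals [m + 1]. Since its integral is bounded
    independently of [m], these times form a null set. *)
Lemma bessel_pos : {ae mu, forall s, 0 <= s -> 0 < bessel s}.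
Proof.
have key (T : nat) : mu (`[0, T%:R] `&` [set s | bessel s <= 0]) = 0%E.
  set A := _ `&` _.
  have mA : measurable A by exact: mneg.
  have Afin : (mu A <= mu `[0%R, T%:R%R])%E by apply: le_measure; rewrite ?inE//; exact: subIsetl.
  have Af : mu A \is a fin_num.
    by rewrite ge0_fin_numE// (le_lt_trans Afin)// itv_fin.
  have iA : itg (\1_A : R -> R) 0 T%:R.
    apply: (@itg_bdd _ _ _ _ 1); first by apply: measurable_indic.
    by move=> s _; rewrite indicE; case: (_ \in _); rewrite ?normr1 ?normr0.
  have JA : J (\1_A : R -> R) 0 T%:R = fine (mu A).
    rewrite /J /Rintegral integral_indic//; congr (fine (mu _)).
    by rewrite setIidl//; exact: subIsetl.
  set D := bessel T%:R - bessel 0 - (M T%:R - M 0).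
  have h m : al * m.+1%:R * fine (mu A) <= D.
    apply: le_trans (bessel_drift_ge m (lexx 0) (ler0n _ T)).
    rewrite -mulrA ler_pM2l// -JA -J_Z//.
    apply: J_le; [exact: itg_scale|by have [] := capinv_bessel_cvg m 0 T%:R|move=> s _].
    rewrite indicE; case: (boolP (s \in A)) => [/set_mem[_ sA]|_].
      by rewrite mulr1 capinv_npos.
    by rewrite mulr0 ltW// capinv_gt0.
  have f0 : 0 <= fine (mu A) by exact: fine_ge0.
  suff : fine (mu A) <= 0 by move=> f1; rewrite -(fineK Af); congr EFin; apply/eqP; rewrite eq_le f1.
  rewrite leNgt; apply/negP => p.
  have := h (Num.truncn (D / (al * fine (mu A)))).
  rewrite mulrAC mulrC -ler_pdivlMr ?mulr_gt0//; have := truncnS_gt (D / (al * fine (mu A))).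
  by move=> h1 h2; have := lt_le_trans h1 h2; rewrite ltxx.
have : {ae mu, forall s, forall T : nat, ~ ((`[0, T%:R] `&` [set s | bessel s <= 0]) s)}.
  apply: ae_foralln => T; exists (`[0, T%:R] `&` [set s | bessel s <= 0]); split.
  - exact: mneg.
  - exact: key.
  - by move=> s ns; exact: (contrapT ns).
apply: ae_imp => s h s0; rewrite ltNge; apply/negP => b0.
apply: (h (Num.truncn s).+1); split => //=.
by rewrite in_itv/= s0 ltW// truncnS_gt.
Qed.

Lemma bessel_inv s t : 0 <= s -> s <= t ->
  [/\ itg (fun r => (bessel r)^-1) s t,
   (fun m => J (fun r => capinv m (bessel r)) s t) @ \oo --> J (fun r => (bessel r)^-1) s t &
   al * J (fun r => (bessel r)^-1) s t <= bessel t - bessel s - (M t - M s)].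
Proof.
move=> s0 st.
(* Because [0^-1 = 0], the ratio [pb r / pb r] is the indicator of [bessel r > 0]. The products
   [f m] thus converge at every point to [1 / pb], as Fatou's lemma is used here without exceptional
   set. *)
pose pb r := Num.max (bessel r) 0.
pose f m r := capinv m (bessel r) * (pb r / pb r).
have ic m : itg (fun r => capinv m (bessel r)) s t by have [] := capinv_bessel_cvg m s t.
have mpb : measurable_fun `[s, t] pb by apply: measurable_maxr => //; exact: measurable_cst.
have fb m r : 0 <= f m r <= capinv m (bessel r).
  have c0 := capinv_gt0 m (bessel r); rewrite /f /pb.
  have [b0|b0] := leP (bessel r) 0; first by rewrite mul0r mulr0 lexx ltW.
  by rewrite mulfV ?mulr1 ?lexx ?gt_eqF// ltW.
have if_ m : itg (f m) s t.
  apply: (itg_le _ _ (ic m)).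
    apply: measurable_funM; first exact: itg_meas (ic m).
    apply: measurable_funM => //; apply: measurableT_comp => //; exact: measurable_invr.
  by move=> r _; case/andP: (fb m r) => f0 f1; rewrite ger0_norm.
have [ipb _] : itg (fun r => (pb r)^-1) s t /\ J (fun r => (pb r)^-1) s t <=
    al^-1 * (bessel t - bessel s - (M t - M s)).
  apply: (@fatou_real _ _ _ mu `[s, t] f _ (al^-1 * (bessel t - bessel s - (M t - M s)))) => //.
  - by move=> m r _; case/andP: (fb m r).
  - move=> r _; rewrite /f /pb; have [b0|b0] := leP (bessel r) 0.
      by under eq_fun do rewrite mul0r mulr0; rewrite invr0; exact: cvg_cst.
    under eq_fun do rewrite mulfV ?gt_eqF// mulr1; exact: capinv_cvg.
  - move=> m; rewrite ler_pdivlMl//; apply: le_trans (bessel_drift_ge m s0 st).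
    by rewrite ler_pM2l//; apply: J_le => // r _; case/andP: (fb m r).
have [ii cc] : itg (fun r => (bessel r)^-1) s t /\
   (fun m => J (fun r => capinv m (bessel r)) s t) @ \oo --> J (fun r => (bessel r)^-1) s t.
  apply: (@J_dct R _ _ (fun r => (pb r)^-1)) => //.
  - by move=> m; exact: itg_meas (ic m).
  - by apply: measurableT_comp; [exact: measurable_invr|exact: mbes].
  - apply: (ae_imp _ bessel_pos) => r h /andP[sr _]; apply: capinv_cvg; apply: h.
    exact: le_trans sr.
  - apply: (ae_imp _ bessel_pos) => r h m /andP[sr _]; have b0 := h (le_trans s0 sr).
    by rewrite gtr0_norm ?capinv_gt0// /pb (max_idPl (ltW b0)) capinv_leV.
split => //.
have l1 : (fun m => al * J (fun r => capinv m (bessel r)) s t) @ \oo -->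
    al * J (fun r => (bessel r)^-1) s t by apply: cvgMr.
apply: (cvgr_to_le l1).
by apply: nearW => m; exact: bessel_drift_ge.
Qed.

(** The defect [bessel t - M t - al * J (1 / bessel) 0 t] is nonnegative and nondecreasing in [t] by
    [bessel_inv]. Its vanishing at integer times, a countable condition, makes it vanish
    everywhere. *)
Lemma bessel_good : (forall N : nat, bessel N%:R <= M N%:R + al * J (fun r => (bessel r)^-1) 0 N%:R) ->
  good_path bessel /\
  forall t, bessel t = M t + al * J (fun r => (bessel r)^-1) 0 t.
Proof.
move=> hN.
have ib t : itg (fun r => (bessel r)^-1) 0 t.
  have t0 : 0 <= Num.max t 0 by rewrite le_max lexx orbT.
  have [+ _ _] := bessel_inv (lexx 0) t0; apply: itg_sub => //; by rewrite le_max lexx.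
have bt t : bessel t = M t + al * J (fun r => (bessel r)^-1) 0 t.
  have [t0|t0] := ltP t 0.
    by rewrite bessel_npos ?ltW// M0 ?ltW// J_lt// mulr0 addr0.
  have [_ _ h1] := bessel_inv (lexx 0) t0.
  have tN : t <= (Num.truncn t).+1%:R by rewrite ltW// truncnS_gt.
  have [_ _ h2] := bessel_inv t0 tN.
  have := hN (Num.truncn t).+1; rewrite (J_cat t0 tN (ib _)).
  rewrite (bessel_npos (lexx 0)) (M0 (lexx 0)) in h1.
  by move=> h3; apply/eqP; rewrite eq_le; apply/andP; split; lra.
have cb' : continuous bessel.
  rewrite (funext bt) => t; apply: cvgD; first exact: cM.
  by apply: cvgMr; apply: J_continuous.
split => //; split => //; last exact: bessel_pos.
move=> t; have [t0|t0] := leP t 0; first by rewrite bessel_npos.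
rewrite leNgt; apply/negP => bt0.
have [e e0 he] : exists2 e : R, 0 < e & forall r, `|t - r| < e -> bessel r < 0.
  have /cvgrPdist_lt /(_ (- bessel t)) := cb' t; rewrite oppr_gt0 => /(_ bt0).
  move=> /nbhs_ballP[e /= e0 h]; exists e => // r /h.
  by rewrite distrC => /(le_lt_trans (ler_norm _)); lra.
have [A [mA A0 Asub]] := bessel_pos.
have : (mu `]t, (t + e)%R[ <= mu A)%E.
  apply: le_measure; rewrite ?inE//.
  move=> r /=; rewrite in_itv/= => /andP[tr re]; apply: Asub => /= h.
  have := h (ltW (lt_trans t0 tr)); have := he r; rewrite ltr0_norm ?subr_lt0// => h'.
  by have := h' _; rewrite opprB ltrBlDl => /(_ re); lra.
rewrite A0 lebesgue_measure_itv/= lte_fin ltrDl e0 -EFinB lee_fin; lra.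
Qed.
End bessel_path.

Section adapted_bessel.
Context {R : realType} {d : measure_display} {Omega : measurableType d}.
Variable H : R -> set (set Omega).
Hypothesis sH : forall t, 0 <= t -> sigma_algebra setT (H t).
Hypothesis ndH : forall s t, 0 <= s -> s <= t -> H s `<=` H t.
Variables (al : R) (M : R -> Omega -> R).
Hypotheses (al0 : 0 < al) (cM : forall w, continuous (M^~ w))
  (M0 : forall w t, t <= 0 -> M t w = 0) (aM : adapted H M).

Let mcap m : measurable_fun setT (@capinv R m).
Proof. by apply: continuous_measurable_fun; exact: capinv_cont. Qed.

Lemma adapted_bes n : adapted H (fun t w => bes al (M^~ w) n t).
Proof.
apply: (@adapted_ode _ _ _ _ sH ndH M (fun _ _ u => - (al * capinv n u)) _ (al * n.+1%:R ^+ 2)) => //.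
- by rewrite mulr_ge0 ?exprn_ge0// ltW.
- move=> _ _ u; rewrite normrN gtr0_norm ?mulr_gt0 ?capinv_gt0// ler_pM2l//.
  exact: capinv_le.
- by move=> _ _ u v uv; rewrite lerN2 ler_pM2l//; exact: capinv_mono.
- move=> _ _ u v; rewrite -opprD normrN -mulrN -mulrDr normrM (gtr0_norm al0) -mulrA ler_pM2l//.
  exact: capinv_lip.
- move=> _ u cu s; apply: cvgN; apply: cvgMr.
  by apply: continuous_comp; [exact: cu|exact: capinv_cont].
- move=> Z aZ s s0; have sHs := sH s0.
  apply: (gm_comp sHs (h := fun u => - (al * capinv n u))); last exact: aZ.
  by apply: measurableT_comp => //; apply: measurable_funM => //; exact: measurable_cst.
Qed.

Lemma adapted_J_bes m n : adapted H (fun t w => J (fun s => capinv m (bes al (M^~ w) n s)) 0 t).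
Proof.
apply: (@adapted_J _ _ _ _ sH ndH (fun s w => capinv m (bes al (M^~ w) n s))).
  move=> w s; apply: continuous_comp; last exact: capinv_cont.
  by have [c _] := besP al0 (@cM w) n; exact: c.
by move=> s s0; apply: (gm_comp (sH s0) (h := capinv m)); [|exact: adapted_bes].
Qed.

Lemma adapted_bessel : adapted H (fun t w => bessel al (M^~ w) t).
Proof.
move=> t t0; apply: (gm_cvg (sH t0) (f_ := fun n w => bes al (M^~ w) n t)).
  by move=> n; exact: adapted_bes.
by move=> w; apply: bessel_cvg => // s s0; exact: M0.
Qed.

Lemma adapted_J_cap m : adapted H (fun t w => J (fun s => capinv m (bessel al (M^~ w) s)) 0 t).
Proof.
move=> t t0.
apply: (gm_cvg (sH t0) (f_ := fun n w => J (fun s => capinv m (bes al (M^~ w) n s)) 0 t)).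
  by move=> n; exact: adapted_J_bes.
by move=> w; have [] := capinv_bessel_cvg al0 (@cM w) (@M0 w) m 0 t.
Qed.

Lemma adaptedV_bessel : adaptedV H (fun t w => bessel al (M^~ w) t).
Proof.
split; first exact: adapted_bessel.
move=> t t0.
apply: (gm_cvg (sH t0) (f_ := fun m w => J (fun s => capinv m (bessel al (M^~ w) s)) 0 t)).
  by move=> m; exact: adapted_J_cap.
by move=> w; have [] := bessel_inv al0 (@cM w) (@M0 w) (lexx 0) t0.
Qed.
End adapted_bessel.

(** * No drift is lost: the Bessel equation holds almost surely *)

Section bessel_process.
Context {R : realType} {d : measure_display} {Omega : measurableType d}.
Variable P : probability Omega R.
Variables (F : R -> set (set Omega)) (rho : R) (B C : R -> Omega -> R).
Hypotheses (uF : usual_filtration P F) (rho1 : -1 <= rho <= 1) (bm : correlated_BM P F rho B C).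
Notation E f := (Rintegral P setT f).
Notation mu := (@lebesgue_measure R).
Variables (l m al : R).
Hypotheses (al0 : 0 < al) (var1 : var rho l m = 1).

Definition driver (t : R) w := BM B C l m (Num.max t 0) w.
Notation N := driver.
Notation X n t w := (bes al (N^~ w) n t).
Notation Z t w := (bessel al (N^~ w) t).

Lemma driver_cont w : continuous (N^~ w).
Proof.
have [_ [cB cC] _ _] := bm => t.
apply: cvgD; apply: cvgMr; [exact: (within_half_line (cB w))|exact: (within_half_line (cC w))].
Qed.

Lemma driver_npos w t : t <= 0 -> N t w = 0.
Proof.
have [z _ _ _] := bm; have [B0 C0] := z w.
by move=> t0; rewrite /driver (max_idPr t0) /BM B0 C0 !mulr0 addr0.
Qed.

Lemma driver_pos w t : 0 <= t -> N t w = BM B C l m t w.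
Proof. by move=> t0; rewrite /driver (max_idPl t0). Qed.

Lemma driver_adapted : adapted F N.
Proof.
by move=> t t0; rewrite /driver (max_idPl t0); exact: (BM_adapted uF bm).
Qed.

Let sF t (t0 : 0 <= t) := F_sigma uF t0.
Let ndF s t (s0 : 0 <= s) (st : s <= t) := F_nd uF s0 st.
Let aX n : adapted F (fun t w => X n t w).
Proof. exact: (adapted_bes sF ndF al0 driver_cont driver_adapted). Qed.
Let cX n w : continuous (fun t => X n t w).
Proof. by have [] := besP al0 (@driver_cont w) n. Qed.
Let XE n w t : X n t w = N t w + al * J (fun s => capinv n (X n s w)) 0 t.
Proof. by have [] := besP al0 (@driver_cont w) n. Qed.
Let ccap k n w : continuous (fun s => capinv k (X n s w)).
Proof. by move=> s; apply: continuous_comp; [exact: cX|exact: capinv_cont]. Qed.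

Let b n : R := n.+1%:R^-1.
Let b0 n : 0 < b n. Proof. by rewrite invr_gt0. Qed.
(** An upper bound for the generator of [vlog] along the equation with cap [n], where [b n] equals
    the level of the cap. Near 0 the factor of [capinv] is a large negative multiple of the
    logarithm, and this is the gain. *)
Let th n u : R := capinv n u * (al + 1 - al * hlog (b n) u).

Let generator n u : vlogx (b n) u * (al * capinv n u) + vlogxx (b n) u / 2 <= th n u.
Proof.
have g0 := capinv_gt0 n u; have h := vlogx_le (b0 n) u.
have ag : 0 <= al * capinv n u by rewrite mulr_ge0// ltW.
have h1 := ler_wpM2r ag h.
have h2 : hinv (b n) u <= capinv n u.
  rewrite lef_pV2 ?posrE ?capinv_max//; last by rewrite ltr_wpDr// le_max lexx orbT.
  rewrite ge_max -/(b n); have := b0 n; have [u0|u0] := leP u 0; rewrite ?addr0; lra.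
by rewrite /vlogxx /th; lra.
Qed.

Let cth n w : continuous (fun s => th n (X n s w)).
Proof.
move=> s; apply: cvgM; first exact: ccap.
apply: cvgB; first exact: cvg_cst.
apply: cvgMr.
have lc u : {for u, continuous (hlog (b n))}.
  apply/cvgrPdist_le => e e0.
  have k0 : 0 < (b n)^-1 * (b n)^-1 by rewrite mulr_gt0// invr_gt0.
  near=> v; apply: le_trans (hlog_lip (b0 n) _ _) _; rewrite -ler_pdivlMl//.
  by near: v; apply: cvgr_dist_le; [exact: cvg_id|rewrite mulr_gt0// invr_gt0].
by apply: continuous_comp; [exact: cX|exact: lc].
Unshelve. all: by end_near. Qed.

Section fixed_time.
Variable T : R.
Hypothesis T0 : 0 < T.

Let Th n w := J (fun s => th n (X n s w)) 0 T.

Let iJ (k : R) (f : Omega -> R -> R) : (forall w, continuous (f w)) ->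
  adapted F (fun t w => f w t) -> (forall w s, `|f w s| <= k) ->
  P.-integrable setT (EFin \o (fun w => J (f w) 0 T)).
Proof.
move=> cf af fk.
have aJ := @adapted_J _ _ _ _ sF ndF (fun t w => f w t) cf af.
have mJ := F_meas uF (ltW T0) (aJ T (ltW T0)).
apply: (@integrable_bounded_EFin _ _ _ P setT _ (k * T)) => //.
  by rewrite -ge0_fin_numE//; exact: fin_num_measure.
move=> w _; apply: le_trans (J_norm (itg_cont _ _ (@cf w))) _.
have -> : k * T = J (fun=> k) 0 T by rewrite J_cst ?subr0// ltW.
by apply: J_le; [exact/itg_norm/itg_cont|exact: itg_cst|].
Qed.

Let iTh n : P.-integrable setT (EFin \o Th n).
Proof.
apply: (@iJ (n.+1%:R * (al + 1 + al * n.+1%:R)) (fun w s => th n (X n s w))).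
- by move=> w; exact: cth.
- move=> t t0; apply: (gm_comp (sF t0) (h := th n)); last exact: aX.
  apply: measurable_funM.
    by apply: continuous_measurable_fun; exact: capinv_cont.
  apply: measurable_funB; first exact: measurable_cst.
  by apply: measurable_funM; [exact: measurable_cst|exact: measurable_hlog].
- move=> w s; set u := X n s w.
  have g0 := capinv_gt0 n u; have L0 := hlog_ge0 (b0 n) u.
  have L1 : hlog (b n) u <= n.+1%:R.
    by apply: le_trans (hlog_le (b0 n) u) _; rewrite -[leRHS]invrK; exact: hinv_le.
  rewrite /th normrM (gtr0_norm g0); apply: ler_pM => //; first exact: ltW.
    exact: capinv_le.
  apply: le_trans (ler_normB _ _) _.
  rewrite (ger0_norm (_ : 0 <= al + 1)) ?addr_ge0 ?(ltW al0)// lerD2l.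
  by rewrite normrM (gtr0_norm al0) (ger0_norm L0) ler_pM2l.
Qed.

Let icap k n : P.-integrable setT (EFin \o (fun w => J (fun s => capinv k (X n s w)) 0 T)).
Proof.
apply: (@iJ k.+1%:R (fun w s => capinv k (X n s w))).
- by move=> w; exact: ccap.
- move=> t t0; apply: (gm_comp (sF t0) (h := capinv k)); last exact: aX.
  by apply: continuous_measurable_fun; exact: capinv_cont.
- by move=> w s; rewrite gtr0_norm ?capinv_gt0// capinv_le.
Qed.

Let PT : fine (P setT) = 1. Proof. by rewrite probability_setT. Qed.

(* Ito's formula for [- x log (1 + 1 / (b + x))] yields a logarithmic gain over the
   mere boundedness of the expected drift. *)
Let ETh n : -1 <= E (Th n).
Proof.
have [K tV] := vlog_test (b0 n).
have g1 : G_measurable (F 0) (fun=> 1 : R) by apply: gm_cst; exact: sF.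
have aC0 : adapted F (fun _ _ => 0 : R) by move=> t t0; apply: gm_cst; exact: sF.
have iD : P.-integrable setT (EFin \o (fun w =>
   X n T w - X n 0 w - (BM B C l m T w - BM B C l m 0 w))).
  have := integrableZ_EFin al measurableT (icap n n).
  apply: eq_integrable => // w _ /=; congr EFin.
  have := driver_npos w (lexx 0); rewrite (driver_pos _ (lexx 0)) => ->.
  by rewrite (XE n w T) (XE n w 0) J_aa (driver_npos w (lexx 0)) (driver_pos w (ltW T0)); ring.
have iD0 : P.-integrable setT (EFin \o (fun w : Omega =>
   0 - 0 - (BM B C 0 0 T w - BM B C 0 0 0 w))).
  have := integrable_cst_prob P 0; apply: eq_integrable => // w _ /=; congr EFin.
  by rewrite /BM !mul0r; ring.
have := dynkin_formula uF rho1 bm tV (l1 := l) (m1 := m) (l2 := 0) (m2 := 0)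
  (lexx 0) T0 (aX n) aC0 (iTh n) iD iD0 _ g1 (fun w => _).
move=> [].
- apply: aeW => w; split.
  + by move=> r; apply: (continuous_comp (f := fun r : R => Num.max r 0) (g := fun t => X n t w));
      [apply: maxr_cont => s; [exact: cvg_id|exact: cvg_cst]|exact: cX].
  + by move=> r; exact: cvg_cst.
  exists (fun s => al * capinv n (X n s w)), (fun=> 0), (fun s => th n (X n s w)); split => //.
  + split; [apply: itg_scale; exact/itg_cont/ccap|exact: itg_cst|exact/itg_cont/cth].
  + by move=> r _; split => //; rewrite mulr_ge0 ?ltW// capinv_gt0.
  + move=> r /andP[r0 rT]; rewrite /BM !mul0r J_cst// mul0r; split; last by ring.
    rewrite (XE n w r) (XE n w 0) J_aa J_Z; last exact/itg_cont/ccap.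
    by rewrite (driver_pos w r0) (driver_pos w (lexx 0)) /BM; ring.
  + apply: aeW => r _; apply: le_trans (generator n (X n r w)).
    by rewrite /lapl var1 /var /cov; lra.
- by move=> w; rewrite ler01 lexx.
move=> iV hV.
have -> : E (Th n) = E (fun w => 1 * Th n w) by apply: eq_Rintegral => w _; rewrite mul1r.
apply: le_trans hV.
have -> : -1 = E (fun=> -1) by rewrite Rintegral_cst// PT mulr1.
apply: le_Rintegral => //; first exact: integrable_cst_prob.
move=> w _; rewrite mul1r (bes_npos al0 (@driver_cont w) (@driver_npos w) n (lexx 0)).
by rewrite {2}/vlog mul0r oppr0 subr0; exact: vlog_ge.
Qed.

(** A lower bound for [hlog] below the level [1 / (k + 1)]: there [b n + u] is at most [2 / (k + 1)]
    when [n >= k]. *)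
Let ell (k : nat) : R := ln (1 + k.+1%:R / 2).

Let ell_cvg (c : R) : exists k0, forall k, (k0 <= k)%N -> c <= ell k.
Proof.
exists (Num.truncn (expR c * 2)) => k kk; rewrite /ell -[leLHS]expRK ler_ln ?posrE ?expR_gt0//.
  have : expR c * 2 <= k.+1%:R.
    by apply: le_trans (ltW (truncnS_gt _)) _; rewrite ler_nat ltnS.
  by lra.
Qed.

Let hlog_large n k u : (k <= n)%N -> u < k.+1%:R^-1 -> ell k <= hlog (b n) u.
Proof.
move=> kn uk; have k0 : 0 < k.+1%:R^-1 :> R by rewrite invr_gt0.
have bk : b n <= k.+1%:R^-1 by rewrite lef_pV2 ?posrE// ler_nat ltnS.
have mk : Num.max u 0 <= k.+1%:R^-1 by rewrite ge_max !ltW.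
have r0 := hinv_gt0 (b0 n) u.
rewrite /ell /hlog ler_ln ?posrE; [|by rewrite addr_gt0// divr_gt0|by rewrite addr_gt0].
rewrite lerD2l -[leLHS]invrK lef_pV2 ?posrE ?invr_gt0 ?divr_gt0//; last first.
  by rewrite ltr_wpDr// le_max lexx orbT.
have -> : (k.+1%:R / 2)^-1 = 2 * k.+1%:R^-1 :> R by rewrite invfM invrK mulrC.
by rewrite mulr2n mulrDl mul1r lerD.
Qed.

(** The drift above the cap [k], multiplied by the logarithmic gain, is paid for by [- th] up to a
    constant. Below [1 / (k + 1)] this is the gain itself; above it the two caps agree, and [th] is
    negative below [1 / (k0 + 1)] and bounded beyond. The index [k0] is such that the gain is at
    least 1. *)
Let tail n k k0 u : al + 2 <= al * ell k0 -> (k0 <= k)%N -> (k <= n)%N ->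
  (capinv n u - capinv k u) * (al * ell k - al - 1) <= (al + 1) * k0.+1%:R - th n u.
Proof.
move=> hk0 k0k kn; have g0 := capinv_gt0 n u; have gk := capinv_gt0 k u.
have L0 := hlog_ge0 (b0 n) u.
have ellm : ell k0 <= ell k.
  rewrite /ell ler_ln ?posrE ?addr_gt0 ?divr_gt0// lerD2l ler_pM2r ?invr_gt0//.
  by rewrite ler_nat ltnS.
have ek : al + 2 <= al * ell k by apply: le_trans hk0 _; rewrite ler_pM2l.
have c0 : 0 <= (al + 1) * k0.+1%:R by rewrite mulr_ge0// addr_ge0// ltW.
have [uk|uk] := ltP u k.+1%:R^-1.
  have h1 : al * ell k <= al * hlog (b n) u by rewrite ler_pM2l//; exact: hlog_large.
  have h2 : (capinv n u - capinv k u) * (al * ell k - al - 1) <= capinv n u * (al * ell k - al - 1).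
    by rewrite ler_wpM2r//; lra.
  have h3 : capinv n u * (al * ell k - al - 1) <= capinv n u * (al * hlog (b n) u - al - 1).
    by rewrite ler_wpM2l ?(ltW g0)//; lra.
  by rewrite /th; lra.
have nk : n.+1%:R^-1 <= k.+1%:R^-1 :> R by rewrite lef_pV2 ?posrE// ler_nat ltnS.
have -> : capinv n u = capinv k u.
  by rewrite /capinv !(max_idPl _)//; exact: le_trans nk uk.
rewrite subrr mul0r subr_ge0.
have [uk0|uk0] := ltP u k0.+1%:R^-1.
  have h1 : al * ell k0 <= al * hlog (b n) u.
    by rewrite ler_pM2l//; apply: hlog_large => //; exact: leq_trans kn.
  apply: le_trans c0; rewrite /th pmulr_rle0//; lra.
have gu : capinv n u <= k0.+1%:R.
  apply: le_trans (capinv_leV _ _) _; first by apply: lt_le_trans uk0; rewrite invr_gt0.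
  rewrite -[leRHS]invrK lef_pV2 ?posrE ?invr_gt0//.
  by apply: lt_le_trans uk0; rewrite invr_gt0.
rewrite /th; apply: (@le_trans _ _ (capinv n u * (al + 1))).
  by rewrite ler_pM2l// gerBl mulr_ge0// ltW.
by rewrite mulrC ler_wpM2l// addr_ge0// ltW.
Qed.

(** The drift of the limit path that the cap [k] does not account for: genuine mass near 0 and any
    mass lost in the limit. *)
Let rest k w := Z T w - N T w - al * J (fun s => capinv k (Z s w)) 0 T.

Let rest_ge0 k w : 0 <= rest k w.
Proof.
have := bessel_drift_ge al0 (@driver_cont w) (@driver_npos w) k (lexx 0) (ltW T0).
rewrite (bessel_npos al0 (@driver_cont w) (@driver_npos w) (lexx 0)) (driver_npos w (lexx 0)).
by rewrite /rest; lra.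
Qed.

(** The numerator collects the bound [ETh] and the constant of [tail] integrated over [[0, T]]; the
    denominator grows with [ell k], so the quotient tends to 0. *)
Let eps k0 k : R := al * (1 + (al + 1) * k0.+1%:R * T) / (al * ell k - al - 1).

Let rest_int k0 k : al + 2 <= al * ell k0 -> (k0 <= k)%N ->
  P.-integrable setT (EFin \o rest k) /\ E (rest k) <= eps k0 k.
Proof.
move=> hk0 k0k.
have ellm : ell k0 <= ell k.
  rewrite /ell ler_ln ?posrE ?addr_gt0 ?divr_gt0// lerD2l ler_pM2r ?invr_gt0//.
  by rewrite ler_nat ltnS.
have ek : 0 < al * ell k - al - 1.
  by have : al * ell k0 <= al * ell k; [rewrite ler_pM2l|lra].
set c := (al + 1) * k0.+1%:R.
pose D n w := X n T w - N T w - al * J (fun s => capinv k (X n s w)) 0 T.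
have DE n w : D n w = al * J (fun s => capinv n (X n s w) - capinv k (X n s w)) 0 T.
  by rewrite /D (XE n w T) J_B; [ring|exact/itg_cont/ccap|exact/itg_cont/ccap].
have iD n : P.-integrable setT (EFin \o D n).
  have := integrableB_EFin measurableT (integrableZ_EFin al measurableT (icap n n))
    (integrableZ_EFin al measurableT (icap k n)).
  by apply: eq_integrable => // w _ /=; congr EFin; rewrite /D (XE n w T); ring.
have iJJ n w : itg (fun s => capinv n (X n s w) - capinv k (X n s w)) 0 T.
  by apply: itg_subr; exact/itg_cont/ccap.
(* Only indices at least [k] are used: there the drift with cap [n] exceeds that with cap [k], so
   [D n] is nonnegative and [tail] applies. *)
apply: (@fatou_real _ _ _ P setT (fun i => D (i + k)%N) (rest k) (eps k0 k)).
- exact: measurableT.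
- by move=> n; exact: iD.
- move=> n w _; rewrite DE mulr_ge0 ?(ltW al0)// J_ge0// => s _.
  by rewrite subr_ge0 capinv_nd// leq_addl.
- move=> w _; rewrite (cvg_shiftn k (fun n => D n w)).
  apply: cvgB; first by apply: cvgB; [exact: (bessel_cvg al0 (@driver_cont w) (@driver_npos w))|exact: cvg_cst].
  by apply: cvgMr; have [] := capinv_bessel_cvg al0 (@driver_cont w) (@driver_npos w) k 0 T.
- move=> i; have kn := leq_addl i k; move: (i + k)%N kn => n kn.
  rewrite /eps ler_pdivlMr// mulrC -RintegralZl//.
  apply: (@le_trans _ _ (E (fun w => al * (c * T - Th n w)))).
    have iC : P.-integrable setT (EFin \o (fun w => c * T - Th n w)).
      exact: (integrableB_EFin measurableT (integrable_cst_prob P _) (iTh n)).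
    apply: le_Rintegral => //.
    - exact: (integrableZ_EFin _ measurableT (iD n)).
    - exact: (integrableZ_EFin _ measurableT iC).
    move=> w _; rewrite -/(D n w) DE mulrCA ler_pM2l// -J_Z//.
    have -> : c * T - Th n w = J (fun s => c - th n (X n s w)) 0 T.
      rewrite J_B; [|exact: itg_cst|exact/itg_cont/cth].
      by rewrite J_cst ?subr0// ltW.
    apply: J_le; [exact: itg_scale|apply: itg_subr; [exact: itg_cst|exact/itg_cont/cth]|].
    by move=> s _; rewrite mulrC; exact: tail.
  rewrite RintegralZl//; last exact: (integrableB_EFin measurableT (integrable_cst_prob P _) (iTh n)).
  rewrite ler_pM2l// RintegralB//; last exact: integrable_cst_prob.
  by rewrite Rintegral_cst// PT mulr1 /c; have := ETh n; rewrite /Th; lra.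
exact: iD.
Qed.

Lemma bessel_drift_int : P.-integrable setT (EFin \o (fun w => Z T w - N T w)).
Proof.
have [k0 hk] := ell_cvg (al^-1 * (al + 2)).
have hk0 : al + 2 <= al * ell k0 by rewrite -ler_pdivrMl//; exact: hk.
have [ir _] := rest_int hk0 (leqnn k0).
have mJ := F_meas uF (ltW T0) (adapted_J_cap sF ndF al0 driver_cont driver_npos driver_adapted k0 (ltW T0)).
have iJ' : P.-integrable setT (EFin \o (fun w => J (fun s => capinv k0 (Z s w)) 0 T)).
  apply: (@integrable_bounded_EFin _ _ _ P setT _ (k0.+1%:R * T)) => //.
    by rewrite -ge0_fin_numE//; exact: fin_num_measure.
  move=> w _; have [ic _] := capinv_bessel_cvg al0 (@driver_cont w) (@driver_npos w) k0 0 T.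
  apply: le_trans (J_norm ic) _.
  have -> : k0.+1%:R * T = J (fun=> k0.+1%:R) 0 T by rewrite J_cst ?subr0// ltW.
  apply: J_le; [exact: itg_norm|exact: itg_cst|move=> s _].
  by rewrite gtr0_norm ?capinv_gt0// capinv_le.
have := integrableD_EFin measurableT ir (integrableZ_EFin al measurableT iJ').
by apply: eq_integrable => // w _ /=; congr EFin; rewrite /rest; ring.
Qed.

(** The defect [r] is nonnegative and at most [rest k] for every [k], so its expectation is at most
    [eps k0 k] and hence 0. *)
Lemma bessel_eq_at : {ae P, forall w, Z T w <= N T w + al * J (fun s => (Z s w)^-1) 0 T}.
Proof.
have [k0 hk] := ell_cvg (al^-1 * (al + 2)).
have hk0 : al + 2 <= al * ell k0 by rewrite -ler_pdivrMl//; exact: hk.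
pose r w := Z T w - N T w - al * J (fun s => (Z s w)^-1) 0 T.
have cr w : rest^~ w @ \oo --> r w.
  apply: cvgB; first exact: cvg_cst.
  by apply: cvgMr; have [] := bessel_inv al0 (@driver_cont w) (@driver_npos w) (lexx 0) (ltW T0).
have r0 w : 0 <= r w by apply: cvgr_to_ge (cr w) _; apply: nearW => k; exact: rest_ge0.
have rr k w : r w <= rest k w.
  apply: cvgr_to_le (cr w) _; near=> j; rewrite lerD2l lerN2 ler_pM2l//.
  have ic i := (capinv_bessel_cvg al0 (@driver_cont w) (@driver_npos w) i 0 T).1.
  by apply: J_le => // s _; apply: capinv_nd; near: j; exact: nbhs_infty_ge.
have mrest k : measurable_fun setT (rest k).
  have gT := ltW T0; apply: (F_meas uF gT).
  apply: gm_sub; [exact: sF|apply: gm_sub|apply: gm_mul].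
  - exact: sF.
  - exact: (adapted_bessel sF ndF al0 driver_cont driver_npos driver_adapted).
  - exact: driver_adapted.
  - exact: sF.
  - by apply: gm_cst; exact: sF.
  - exact: (adapted_J_cap sF ndF al0 driver_cont driver_npos driver_adapted k gT).
have mr : measurable_fun setT r by apply: (@measurable_fun_cvg _ _ _ _ rest) => // w _; exact: cr.
have ir : P.-integrable setT (EFin \o r).
  have [ir _] := rest_int hk0 (leqnn k0).
  by apply: (le_integrable_EFin _ _ _ ir) => // w _; rewrite ger0_norm.
have Er : E r = 0.
  apply/eqP; rewrite eq_le; apply/andP; split; last first.
    by apply: Rintegral_ge0 => w _; exact: r0.
  apply/ler_addgt0Pr => e e0; rewrite add0r.
  set c := al * (1 + (al + 1) * k0.+1%:R * T).
  have c0 : 0 <= c by rewrite mulr_ge0 ?addr_ge0 ?mulr_ge0 ?addr_ge0 ?(ltW al0) ?(ltW T0).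
  have [k1 hk1] := ell_cvg (al^-1 * (al + 1 + (e^-1 * c + 1))).
  pose k := maxn k0 k1.
  have [irk hE] := rest_int hk0 (leq_maxl k0 k1).
  apply: (@le_trans _ _ (E (rest k))); first by apply: le_Rintegral => // w _; exact: rr.
  apply: le_trans hE _; rewrite /eps -/c.
  have := hk1 k (leq_maxr _ _); rewrite ler_pdivrMl// => h.
  have ec : 0 <= e^-1 * c by rewrite mulr_ge0// invr_ge0 ltW.
  by rewrite ler_pdivrMr -?ler_pdivrMl//; lra.
have : {ae P, forall w, setT w -> (EFin \o r) w = cst 0%E w}.
  apply/(ae_eq_integral_abs P measurableT (measurableT_comp _ mr)) => //.
  rewrite (_ : (\int[P]_(x in setT) _)%E = (\int[P]_(x in setT) (r x)%:E)%E).
    by rewrite fine_integral_EFin// Er.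
  by apply: eq_integral => w _ /=; rewrite ger0_norm.
by apply: ae_imp => w /(_ I) [] rw; have := rw; rewrite /r; lra.
Unshelve. all: by end_near. Qed.
End fixed_time.

Theorem bessel_process : {ae P, forall w, good_path (fun t => Z t w) /\
  forall t, Z t w = N t w + al * J (fun s => (Z s w)^-1) 0 t}.
Proof.
have : {ae P, forall w, forall n : nat, Z n.+1%:R w <=
    N n.+1%:R w + al * J (fun s => (Z s w)^-1) 0 n.+1%:R}.
  by apply: ae_foralln => n; exact: bessel_eq_at.
apply: ae_imp => w h; apply: (bessel_good al0 (@driver_cont w) (@driver_npos w)).
move=> [|n]; last exact: h.
by rewrite (bessel_npos al0 (@driver_cont w) (@driver_npos w) (lexx 0)) (driver_npos w (lexx 0)) J_aa mulr0 addr0.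
Qed.

Theorem bessel_integrable T : 0 <= T -> P.-integrable setT (EFin \o (fun w => Z T w - N T w)).
Proof.
rewrite le_eqVlt => /orP[/eqP <-|]; last exact: bessel_drift_int.
have := integrable_cst_prob P 0; apply: eq_integrable => // w _ /=; congr EFin.
by rewrite (bessel_npos al0 (@driver_cont w) (@driver_npos w) (lexx 0)) (driver_npos w (lexx 0)) subr0.
Qed.
End bessel_process.

(** * Existence, corner avoidance and uniqueness *)

Section augmented_filtration.
Context {R : realType} {d : measure_display} {Omega : measurableType d}.
Variables (P : probability Omega R) (B C : R -> Omega -> R) (X0 Y0 : Omega -> R).
Notation H := (augmented_natural_filtration P B C X0 Y0).

Let Pnull_sub (A A' : set Omega) : A `<=` A' -> Pnull P A' -> Pnull P A.
Proof. by move=> AA [N [mN N0 AN]]; exists N; split => //; exact: subset_trans AN. Qed.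

Let Pnull_bigcup (A : nat -> set Omega) : (forall n, Pnull P (A n)) -> Pnull P (\bigcup_n A n).
Proof. by move=> h; apply: negligible_bigcup => n; exact: h. Qed.

Let Pnull0 : Pnull P set0.
Proof. by exists set0; split. Qed.

Let symd (A A' : set Omega) := (A `\` A') `|` (A' `\` A).

Lemma augmented_sigma t : sigma_algebra setT (H t).
Proof.
have [s0 sC sU] := smallest_sigma_algebra setT (generators B C X0 Y0 t).
split.
- by exists set0; split => //; rewrite setDv setU0.
- move=> A [G [sG nG]]; exists (setT `\` G); split; first exact: sC.
  apply: Pnull_sub nG => w /= [[[_ nA] nnG]|[[_ nG] nnA]].
    by right; split => //; apply: contrapT => nG; apply: nnG.
  by left; split => //; apply: contrapT => nA; apply: nnA.
- move=> A hA; have /choice[G GP] := hA.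
  exists (\bigcup_n G n); split; first by apply: sU => n; have [] := GP n.
  apply: (@Pnull_sub _ (\bigcup_n symd (A n) (G n))); last first.
    by apply: Pnull_bigcup => n; have [] := GP n.
  move=> w [[[n _ An] nG]|[[n _ Gn] nA]]; exists n => //; [left|right]; split => //.
    by move=> Gn; apply: nG; exists n.
  by move=> An; apply: nA; exists n.
Qed.

Lemma augmented_gen t A : generators B C X0 Y0 t A -> H t A.
Proof.
move=> gA; exists A; split; first exact: sub_sigma_algebra.
by rewrite setDv setU0.
Qed.

Lemma augmented_nd s t : s <= t -> H s `<=` H t.
Proof.
move=> st A [G [sG nG]]; exists G; split => //; move: sG.
apply: smallest_sub; first exact: smallest_sigma_algebra.
move=> {nG}A [U [mU h]]; apply: sub_sigma_algebra; exists U; split => //.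
case: h => [->|[->|[u [u0 us h]]]]; [by left|by right; left|].
by right; right; exists u; split => //; exact: le_trans us st.
Qed.

Lemma augmented_null t A : Pnull P A -> H t A.
Proof.
move=> nA; exists set0; split; last by rewrite setD0 set0D setU0.
by have [] := smallest_sigma_algebra setT (generators B C X0 Y0 t).
Qed.

Lemma augmented_adapted : [/\ adapted H B, adapted H C, G_measurable (H 0) X0 & G_measurable (H 0) Y0].
Proof.
split=> [t t0 U mU|t t0 U mU|U mU|U mU]; apply: augmented_gen; exists U; split => //.
- by right; right; exists t; split => //; left.
- by right; right; exists t; split => //; right.
- by left.
- by right; left.
Qed.
End augmented_filtration.

Section path_conversion.
Context {R : realType}.
Notation mu := (@lebesgue_measure R).
Variables (al be ga de : R) (x0 y0 : R) (b c : R -> R).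

(* The clauses of [O2BP] for a single path. *)
Definition path_eqs (X Y : R -> R) := forall t, 0 <= t ->
  [/\ mu (`[0%R, t] `&` [set s | X s = 0]) = 0%E /\ mu (`[0%R, t] `&` [set s | Y s = 0]) = 0%E,
      (\int[mu]_(s in `[0%R, t]) ((X s)^-1)%:E < +oo)%E,
      (\int[mu]_(s in `[0%R, t]) ((Y s)^-1)%:E < +oo)%E,
      X t = x0 + b t + al * Rintegral mu `[0%R, t] (fun s => (X s)^-1)
                     + be * Rintegral mu `[0%R, t] (fun s => (Y s)^-1) &
      Y t = y0 + c t + ga * Rintegral mu `[0%R, t] (fun s => (X s)^-1)
                     + de * Rintegral mu `[0%R, t] (fun s => (Y s)^-1)].

Let zero_null (X : R -> R) t : {ae mu, forall s, 0 <= s -> 0 < X s} -> continuous X ->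
  mu (`[0%R, t] `&` [set s | X s = 0]) = 0%E.
Proof.
move=> [A [mA A0 AP]] cX; apply: (subset_measure0 _ mA _ A0).
  apply: measurableI => //; rewrite -[X in measurable X]setTI.
  have := continuous_measurable_fun cX measurableT (measurable_set1 (0 : R)).
  by congr measurable.
move=> s [/= + X0]; rewrite in_itv/= => /andP[s0 _]; apply: AP => /= h.
by have := h s0; rewrite X0 ltxx.
Qed.

Let int_fin (X : R -> R) t : itg (fun s => (X s)^-1) 0 t ->
  (\int[mu]_(s in `[0%R, t]) ((X s)^-1)%:E < +oo)%E.
Proof. by move=> iX; rewrite fine_integral_EFin// ltry. Qed.

Lemma det_sol_path (X Y : R -> R) : det_sol al be ga de (fun t => x0 + b t) (fun t => y0 + c t) X Y ->
  path_eqs X Y.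
Proof.
move=> [[cX cY] ge0 pos ig E] t t0; have [iX iY] := ig t; have [XE YE] := E t t0.
split => //; [split|exact: int_fin|exact: int_fin].
- by apply: zero_null => //; apply: (ae_imp _ pos) => s h s0; have [] := h s0.
- by apply: zero_null => //; apply: (ae_imp _ pos) => s h s0; have [] := h s0.
Qed.

(** Freezing the paths at their initial value for negative times turns continuity on the half line
    into continuity on the real line, as [det_sol] demands. *)
Lemma path_det_sol (X Y : R -> R) : {within `[0, +oo[, continuous X} ->
  {within `[0, +oo[, continuous Y} -> (forall t, 0 <= t -> 0 <= X t /\ 0 <= Y t) ->
  path_eqs X Y -> det_sol al be ga de (fun t => x0 + b t) (fun t => y0 + c t)
    (fun t => X (Num.max t 0)) (fun t => Y (Num.max t 0)).
Proof.
move=> wX wY ge0 E.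
have cX := within_half_line wX; have cY := within_half_line wY.
have mx0 (t : R) : 0 <= Num.max t 0 by rewrite le_max lexx orbT.
have mxE (t : R) : 0 <= t -> Num.max t 0 = t by move=> t0; exact: (max_idPl t0).
have aez (Z : R -> R) : (forall t, 0 <= t -> 0 <= Z t) -> continuous (fun t : R => Z (Num.max t 0)) ->
    (forall t, 0 <= t -> mu (`[0%R, t] `&` [set s | Z s = 0]) = 0%E) ->
    {ae mu, forall s, 0 <= s -> 0 < Z (Num.max s 0)}.
  move=> Z0 cZ hZ.
  have : {ae mu, forall s, forall n : nat, ~ (`[0%R, n%:R] `&` [set s | Z s = 0]) s}.
    apply: ae_foralln => n; exists (`[0%R, n%:R] `&` [set s | Z s = 0]); split.
    - have := continuous_measurable_fun cZ measurableT (measurable_set1 (0 : R)).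
      rewrite setTI => /(measurableI _ _ (measurable_itv `[0, n%:R])).
      congr measurable; apply/seteqP; split => s /= [sn]; have := sn; rewrite in_itv/= => /andP[s0 _];
        by rewrite mxE.
    - by apply: hZ; rewrite ler0n.
    - by move=> s ns; exact: (contrapT ns).
  apply: ae_imp => s h s0; rewrite mxE// lt_neqAle Z0// andbT eq_sym; apply/eqP => Zs.
  apply: (h (Num.truncn s).+1); split => //=.
  by rewrite in_itv/= s0 ltW// truncnS_gt.
have aeX := aez X (fun t t0 => (ge0 t t0).1) cX (fun t t0 => let: And5 p _ _ _ _ := E t t0 in p.1).
have aeY := aez Y (fun t t0 => (ge0 t t0).2) cY (fun t t0 => let: And5 p _ _ _ _ := E t t0 in p.2).
have ig (Z : R -> R) : (forall t, 0 <= t -> 0 <= Z t) -> continuous (fun t : R => Z (Num.max t 0)) ->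
    (forall t, 0 <= t -> (\int[mu]_(s in `[0%R, t]) ((Z s)^-1)%:E < +oo)%E) ->
    forall T, itg (fun s => (Z (Num.max s 0))^-1) 0 T.
  move=> Z0 cZ hZ T.
  apply: (@itg_sub _ _ 0 (Num.max T 0)) => //; first by rewrite le_max lexx.
  apply/integrableP; split.
    apply/measurable_EFinP; apply: measurable_funTS.
    by apply: measurableT_comp; [exact: measurable_invr|exact: continuous_measurable_fun].
  apply: le_lt_trans (hZ _ (mx0 T)); rewrite le_eqVlt; apply/orP; left; apply/eqP.
  apply: eq_integral => s; rewrite inE/= in_itv/= => /andP[s0 _].
  by rewrite mxE// ger0_norm// invr_ge0 Z0.
have Jeq (Z : R -> R) t : J (fun s => (Z (Num.max s 0))^-1) 0 t =
    Rintegral mu `[0%R, t] (fun s => (Z s)^-1).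
  by apply: J_eq => s /andP[s0 _]; rewrite mxE.
split => //.
- by move=> t t0; rewrite mxE//; exact: ge0.
- by apply: ae_imp2 aeX aeY => s h1 h2 s0; split; [exact: h1|exact: h2].
- move=> T; split; apply: ig => // t t0; have [_ ? ? _ _] := E t t0; try by [].
    by have [] := ge0 t t0.
  by have [] := ge0 t t0.
- by move=> t t0; have [_ _ _ XE YE] := E t t0; rewrite !mxE// !Jeq.
Qed.
End path_conversion.

Section det_existence.
Context {R : realType}.
Variables (al be ga de p q : R) (x y b c : R -> R).
Hypotheses (al0 : 0 < al) (be0 : 0 <= be) (ga0 : 0 <= ga) (de0 : 0 < de)
  (p0 : 0 <= p) (q0 : 0 <= q) (gx : good_path x) (gy : good_path y).
Notation X := (solX al be ga de p q x y).
Notation Y := (solY al be ga de p q x y).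

Lemma sol_init : X 0 = x 0 + p /\ Y 0 = y 0 + q.
Proof.
have hX := @solXE _ _ _ _ _ _ _ _ _ al0 be0 ga0 de0 p0 q0 gx gy 0.
have hY := @solYE _ _ _ _ _ _ _ _ _ al0 be0 ga0 de0 p0 q0 gx gy 0.
move: hX hY; move: (X) (Y) => u v -> ->.
by rewrite !J_aa; split; ring.
Qed.

Lemma det_existence : (forall t, 0 <= t -> x t = b t + al * J (fun s => (x s)^-1) 0 t) ->
  (forall t, 0 <= t -> y t = c t + de * J (fun s => (y s)^-1) 0 t) ->
  det_sol al be ga de (fun t => p + b t) (fun t => q + c t) X Y.
Proof.
move=> xE yE.
have aX := solX_above al0 be0 ga0 de0 p0 q0 gx gy.
have aY := solY_above al0 be0 ga0 de0 p0 q0 gx gy.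
have hX := @solXE _ _ _ _ _ _ _ _ _ al0 be0 ga0 de0 p0 q0 gx gy.
have hY := @solYE _ _ _ _ _ _ _ _ _ al0 be0 ga0 de0 p0 q0 gx gy.
move: aX aY hX hY; move: (X) (Y) => u v aX aY hX hY.
have [_ x0 _ _] := gx; have [_ y0 _ _] := gy.
split.
- by have [] := aX; have [] := aY.
- by move=> t t0; split; [have [_ /(_ t t0)] := aX|have [_ /(_ t t0)] := aY]; exact: le_trans.
- apply: ae_imp2 (above_gt0 gx aX) (above_gt0 gy aY) => s h1 h2 s0.
  by split; [exact: h1|exact: h2].
- by move=> T; split; [exact: (above_itg gx aX)|exact: (above_itg gy aY)].
- by move=> t t0; rewrite {1}hX {1}hY xE// yE//; split; ring.
Qed.
End det_existence.

Section det_bounds.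
Context {R : realType}.

(** Bounds the drift of a solution by that of the Bessel path below it, whose integrability is
    known. *)
Lemma inv_above_le (T k n : R) (x X : R -> R) : 0 < k -> 0 <= T -> good_path x -> above x X ->
  x T = n + k * J (fun s => (x s)^-1) 0 T ->
  0 <= J (fun s => (X s)^-1) 0 T <= k^-1 * (x T - n).
Proof.
move=> k0 T0 gx aX xE; have [_ x0 xp ix] := gx; have [_ xX] := aX.
rewrite J_ge0 => [|s /andP[s0 _]]; last by rewrite invr_ge0 (le_trans (x0 s))// xX.
rewrite xE addrC addKr mulKf ?gt_eqF//=; apply: J_le_ae => //; first exact: (above_itg gx).
apply: (ae_imp _ xp) => s h /andP[s0 _]; have xs := h s0.
by rewrite lef_pV2 ?posrE ?(lt_le_trans xs)// xX.
Qed.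

Lemma det_sol_incr (al be ga de p q : R) (b c X Y : R -> R) T : 0 <= T ->
  det_sol al be ga de (fun t => p + b t) (fun t => q + c t) X Y -> b 0 = 0 -> c 0 = 0 ->
  X T - X 0 - b T = al * J (fun s => (X s)^-1) 0 T + be * J (fun s => (Y s)^-1) 0 T /\
  Y T - Y 0 - c T = ga * J (fun s => (X s)^-1) 0 T + de * J (fun s => (Y s)^-1) 0 T.
Proof.
move=> T0 [_ _ _ _ E] b0 c0; have [-> ->] := E T T0; have [-> ->] := E 0 (lexx 0).
by rewrite !J_aa b0 c0; split; ring.
Qed.
End det_bounds.

Section bessel_exists.
Context {R : realType} {d : measure_display} {Omega : measurableType d}.
Variable P : probability Omega R.

(** Adaptedness is asked for every filtration to which the noise is adapted. It is used with [F] and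
    again with the augmented natural filtration, which makes the solution strong. *)
Definition bessel_from0 (M : R -> Omega -> R) (al : R) (x : R -> Omega -> R) :=
  [/\ forall w, x 0 w = 0,
   {ae P, forall w, good_path (x^~ w) /\
     forall t, 0 <= t -> x t w = M t w + al * J (fun s => (x s w)^-1) 0 t},
   forall H : R -> set (set Omega), (forall t, 0 <= t -> sigma_algebra setT (H t)) ->
     (forall s t, 0 <= s -> s <= t -> H s `<=` H t) -> adapted H M -> adaptedV H x &
   forall T, 0 <= T -> P.-integrable setT (EFin \o (fun w => x T w - M T w))].

Lemma bessel_exists (F : R -> set (set Omega)) (rho : R) (B C : R -> Omega -> R) (l m al : R) :
  usual_filtration P F -> -1 <= rho <= 1 -> correlated_BM P F rho B C ->
  0 < al -> var rho l m = 1 -> exists x, bessel_from0 (BM B C l m) al x.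
Proof.
move=> uF rho1 bm al0 v1.
pose dc : forall w, continuous ((driver B C l m)^~ w) := @driver_cont _ _ _ _ _ _ _ _ bm l m.
pose dn : forall w t, t <= 0 -> driver B C l m t w = 0 := driver_npos bm l m.
exists (fun t w => bessel al ((driver B C l m)^~ w) t); split.
- by move=> w; exact: (bessel_npos al0 (@dc w) (@dn w) (lexx 0)).
- apply: (ae_imp _ (bessel_process uF rho1 bm al0 v1)) => w [g e]; split; first exact: g.
  by move=> t t0; rewrite -(driver_pos B C l m w t0); exact: e.
- move=> H sH ndH aM; apply: (adaptedV_bessel sH ndH al0 dc dn).
  by move=> t t0; rewrite /driver (max_idPl t0); exact: aM.
- move=> T T0; have := bessel_integrable uF rho1 bm al0 v1 T0.
  by apply: eq_integrable => // w _ /=; rewrite (driver_pos _ _ _ _ _ T0).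
Qed.
End bessel_exists.

(** * Assembling the strong solution *)

Section solution.
Context {R : realType} {d : measure_display} {Omega : measurableType d}.
Variable P : probability Omega R.
Variables (F : R -> set (set Omega)) (rho : R) (B C : R -> Omega -> R) (al be ga de : R).
Hypotheses (uF : usual_filtration P F) (bm : correlated_BM P F rho B C).
Hypotheses (al0 : 0 < al) (de0 : 0 < de) (be0 : 0 <= be) (ga0 : 0 <= ga).
Notation mu := (@lebesgue_measure R).
Variables (x y : R -> Omega -> R).
Hypotheses (bx : bessel_from0 P (BM B C 1 0) al x) (by_ : bessel_from0 P (BM B C 0 1) de y).

Let good w := (good_path (x^~ w) /\
    forall t, 0 <= t -> x t w = BM B C 1 0 t w + al * J (fun s => (x s w)^-1) 0 t) /\
  (good_path (y^~ w) /\
    forall t, 0 <= t -> y t w = BM B C 0 1 t w + de * J (fun s => (y s w)^-1) 0 t).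

Let good_ae : {ae P, forall w, good w}.
Proof.
have [_ h1 _ _] := bx; have [_ h2 _ _] := by_.
exact: (ae_imp2 (fun w h1 h2 => conj h1 h2) h1 h2).
Qed.

Let Nul : set Omega := sval (cid good_ae).
Let NulP : [/\ measurable Nul, P Nul = 0%E & ~` [set w | good w] `<=` Nul].
Proof. exact: (svalP (cid good_ae)). Qed.

Let not_Nul w : w \notin Nul -> good w.
Proof.
move=> nN; have [_ _ sub] := NulP; apply: contrapT => ng.
by move/negP: nN; apply; apply/mem_set/sub.
Qed.

Let Nul_ae : {ae P, forall w, w \notin Nul}.
Proof.
have [mN N0 _] := NulP; exists Nul; split => // w /= h.
by apply: contrapT => nN; apply: h; rewrite notin_setE.
Qed.

(** On the null set [Nul] the Bessel path is replaced by the constant 1, so that every sample point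
    has a good path and the pathwise construction applies without exception. *)
Let xg (t : R) w := if w \in Nul then 1 else x t w.
Let yg (t : R) w := if w \in Nul then 1 else y t w.

Let xgE w : w \notin Nul -> xg^~ w = x^~ w.
Proof. by move=> /negbTE nN; apply/funext => t; rewrite /xg nN. Qed.
Let ygE w : w \notin Nul -> yg^~ w = y^~ w.
Proof. by move=> /negbTE nN; apply/funext => t; rewrite /yg nN. Qed.

Let good_cst1 : good_path (fun=> 1 : R).
Proof.
split; [by move=> r; exact: cvg_cst|by []|exact: aeW|move=> T; exact: itg_cst].
Qed.

Let gxg w : good_path (xg^~ w).
Proof.
by rewrite /xg; have [_|/negP/negP nN] := boolP (w \in Nul); [exact: good_cst1|have [[]] := not_Nul nN].
Qed.

Let gyg w : good_path (yg^~ w).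
Proof.
by rewrite /yg; have [_|/negP/negP nN] := boolP (w \in Nul); [exact: good_cst1|have [_ []] := not_Nul nN].
Qed.

Variables X0 Y0 : Omega -> R.
Hypothesis XY0 : forall w, 0 <= X0 w /\ 0 <= Y0 w.
Let X00 w : 0 <= X0 w. Proof. by have [] := XY0 w. Qed.
Let Y00 w : 0 <= Y0 w. Proof. by have [] := XY0 w. Qed.

(* On the exceptional null set, where the Bessel paths may fail to exist, the processes are frozen. *)
Definition solutionX t w : R :=
  if w \in Nul then X0 w else solX al be ga de (X0 w) (Y0 w) (xg^~ w) (yg^~ w) t.
Definition solutionY t w : R :=
  if w \in Nul then Y0 w else solY al be ga de (X0 w) (Y0 w) (xg^~ w) (yg^~ w) t.
Notation X := solutionX.
Notation Y := solutionY.

(** The filtration is kept general for the same two uses; containing the null sets at time 0, it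
    allows the modification on [Nul]. *)
Lemma solution_adapted (H : R -> set (set Omega)) :
  (forall t, 0 <= t -> sigma_algebra setT (H t)) ->
  (forall s t, 0 <= s -> s <= t -> H s `<=` H t) ->
  (forall N, Pnull P N -> H 0 N) -> adapted H B -> adapted H C ->
  G_measurable (H 0) X0 -> G_measurable (H 0) Y0 -> adapted H X /\ adapted H Y.
Proof.
move=> sH ndH nH aB aC gX gY.
have HN t : 0 <= t -> H t Nul.
  move=> t0; apply: (ndH _ _ (lexx 0) t0); apply: nH.
  by have [mN N0 _] := NulP; exists Nul; split.
have aD l m : adapted H (BM B C l m).
  move=> t t0; have sHt := sH t t0.
  by apply: gm_add => //; apply: gm_mul => //; [exact: gm_cst|exact: aB|exact: gm_cst|exact: aC].
have aV (z : R -> Omega -> R) : adaptedV H z -> adaptedV H (fun t w => if w \in Nul then 1 else z t w).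
  move=> [az aJ]; split=> t t0; have sHt := sH t t0.
    by apply: gm_if => //; [exact: HN|exact: gm_cst|exact: az].
  have -> : (fun w => J (fun s => (if w \in Nul then 1 else z s w)^-1) 0 t) =
      (fun w => if w \in Nul then J (fun=> 1^-1) 0 t else J (fun s => (z s w)^-1) 0 t).
    by apply/funext => w; case: (w \in Nul).
  by apply: gm_if => //; [exact: HN|exact: gm_cst|exact: aJ].
have ax : adaptedV H xg by apply: aV; have [_ _ h _] := bx; exact: h.
have ay : adaptedV H yg by apply: aV; have [_ _ h _] := by_; exact: h.
have [aX aY] := adapted_sol sH ndH al0 be0 ga0 de0 X00 Y00 gX gY gxg gyg ax ay.
split=> t t0; have sHt := sH t t0.
  by apply: gm_if => //; [exact: HN|exact: gm_init|exact: aX].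
by apply: gm_if => //; [exact: HN|exact: gm_init|exact: aY].
Qed.

Let aboveX w := solX_above al0 be0 ga0 de0 (X00 w) (Y00 w) (gxg w) (gyg w).
Let aboveY w := solY_above al0 be0 ga0 de0 (X00 w) (Y00 w) (gxg w) (gyg w).

Lemma solution_cont w : continuous (X^~ w) /\ continuous (Y^~ w).
Proof.
rewrite /solutionX /solutionY; case: (w \in Nul); first by split => r; exact: cvg_cst.
by split; [have [] := aboveX w|have [] := aboveY w].
Qed.

Lemma solution_ge0 t w : 0 <= t -> 0 <= X t w /\ 0 <= Y t w.
Proof.
move=> t0; rewrite /solutionX /solutionY; case: (w \in Nul); first exact: XY0.
split.
  by have [_ /(_ t t0)] := aboveX w; apply: le_trans; have [_ + _ _] := gxg w; exact.
by have [_ /(_ t t0)] := aboveY w; apply: le_trans; have [_ + _ _] := gyg w; exact.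
Qed.

Lemma solution_init w : X 0 w = X0 w /\ Y 0 w = Y0 w.
Proof.
have [nN|nN] := boolP (w \in Nul); first by rewrite /solutionX /solutionY nN.
have x0 : xg 0 w = 0 by rewrite /xg (negbTE nN); have [-> _ _ _] := bx.
have y0 : yg 0 w = 0 by rewrite /yg (negbTE nN); have [-> _ _ _] := by_.
have [hX hY] := sol_init al0 be0 ga0 de0 (X00 w) (Y00 w) (gxg w) (gyg w).
rewrite /solutionX /solutionY (negbTE nN); split.
  by apply: (etrans hX); rewrite x0 add0r.
by apply: (etrans hY); rewrite y0 add0r.
Qed.

Let sol_det w : w \notin Nul ->
  det_sol al be ga de (fun t => X0 w + B t w) (fun t => Y0 w + C t w) (X^~ w) (Y^~ w).
Proof.
move=> nN; have [[gx xE] [gy yE]] := not_Nul nN.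
rewrite /solutionX /solutionY (negbTE nN).
rewrite (xgE nN) (ygE nN).
apply (det_existence al0 be0 ga0 de0 (X00 w) (Y00 w) gx gy) => t t0; [rewrite xE//|rewrite yE//];
  by rewrite /BM; ring.
Qed.

Lemma solution_det : {ae P, forall w,
  det_sol al be ga de (fun t => X0 w + B t w) (fun t => Y0 w + C t w) (X^~ w) (Y^~ w)}.
Proof. by apply: (ae_imp _ Nul_ae) => w; exact: sol_det. Qed.

Hypotheses (gX0 : G_measurable (F 0) X0) (gY0 : G_measurable (F 0) Y0).

Lemma solution_F : adapted F X /\ adapted F Y.
Proof.
have [_ _ nF _] := uF; have [_ _ [aB aC] _] := bm.
apply: solution_adapted => //; first by move=> t t0; exact: (F_sigma uF).
by move=> s t; exact: (F_nd uF).
Qed.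

Theorem solution_O2BP : strong_O2BP P F B C al be ga de X0 Y0 X Y.
Proof.
have [aB aC gX gY] := augmented_adapted P B C X0 Y0.
split; last first.
  apply: solution_adapted => //.
  - by move=> t _; exact: augmented_sigma.
  - by move=> s t _; exact: augmented_nd.
  - by move=> N; exact: augmented_null.
split; [exact: solution_F| |by move=> t w; exact: solution_ge0|exact: solution_init|].
  by split=> w; [exact (continuous_subspaceT (solution_cont w).1)|
    exact (continuous_subspaceT (solution_cont w).2)].
by apply: (ae_imp _ solution_det) => w; exact: det_sol_path.
Qed.

(* The solution lies above the Bessel processes, so its drifts are dominated by theirs. *)
Lemma solution_int T : 0 <= T ->
  P.-integrable setT (EFin \o (fun w => X T w - X 0 w - BM B C 1 0 T w)) /\
  P.-integrable setT (EFin \o (fun w => Y T w - Y 0 w - BM B C 0 1 T w)).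
Proof.
move=> T0; have [aX aY] := solution_F.
have [_ _ _ /(_ T T0) ix] := bx; have [_ _ _ /(_ T T0) iy] := by_.
have mD (Z : R -> Omega -> R) l m : adapted F Z ->
    measurable_fun setT (fun w => Z T w - Z 0 w - BM B C l m T w).
  move=> aZ; apply: (F_meas uF T0); have sFT := F_sigma uF T0.
  apply: gm_sub => //; last exact: (BM_adapted uF bm).
  by apply: gm_sub => //; [exact: aZ|apply: (adapted_le (@F_nd _ _ _ _ _ uF) aZ)].
have key w : w \notin Nul ->
   [/\ 0 <= J (fun s => (X s w)^-1) 0 T <= al^-1 * (x T w - BM B C 1 0 T w),
       0 <= J (fun s => (Y s w)^-1) 0 T <= de^-1 * (y T w - BM B C 0 1 T w),
       X T w - X 0 w - BM B C 1 0 T w = al * J (fun s => (X s w)^-1) 0 T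
         + be * J (fun s => (Y s w)^-1) 0 T &
       Y T w - Y 0 w - BM B C 0 1 T w = ga * J (fun s => (X s w)^-1) 0 T
         + de * J (fun s => (Y s w)^-1) 0 T].
  move=> nN; have [[gx xE] [gy yE]] := not_Nul nN.
  have aX' : above (x^~ w) (X^~ w).
    split; first exact (solution_cont w).1.
    by move=> t t0; rewrite /solutionX (negbTE nN); have [_ /(_ t t0)] := aboveX w; rewrite /xg (negbTE nN).
  have aY' : above (y^~ w) (Y^~ w).
    split; first exact (solution_cont w).2.
    by move=> t t0; rewrite /solutionY (negbTE nN); have [_ /(_ t t0)] := aboveY w; rewrite /yg (negbTE nN).
  have [B0 C0] : B 0 w = 0 /\ C 0 w = 0 by have [z _ _ _] := bm.
  have [h1 h2] := det_sol_incr T0 (sol_det nN) B0 C0.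
  have k1 := inv_above_le al0 T0 gx aX' (xE T T0).
  have k2 := inv_above_le de0 T0 gy aY' (yE T T0).
  split; [exact k1|exact k2| |].
    by rewrite -h1 /BM mul1r mul0r addr0.
  by rewrite -h2 /BM mul1r mul0r add0r.
have ixy := integrableD_EFin measurableT (integrableZ_EFin 1 measurableT ix)
   (integrableZ_EFin (be * de^-1) measurableT iy).
have iyx := integrableD_EFin measurableT (integrableZ_EFin 1 measurableT iy)
   (integrableZ_EFin (ga * al^-1) measurableT ix).
have bnd (k k' h j j' u u' D : R) : 0 < k -> 0 <= h -> 0 <= j <= k^-1 * u -> 0 <= j' <= k'^-1 * u' ->
    D = k * j + h * j' -> `|D| <= 1 * u + h * k'^-1 * u'.
  move=> k0 h0 /andP[j0 ju] /andP[j0' ju'] ->.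
  rewrite ger0_norm; last by rewrite addr_ge0// mulr_ge0// ltW.
  by apply: lerD; [rewrite mul1r -ler_pdivlMl|rewrite -mulrA ler_wpM2l].
split.
  apply: (ae_le_integrable (mD X 1 0 aX) ixy).
  apply: (ae_imp _ Nul_ae) => w nN; have [k1 k2 e _] := key w nN.
  exact (bnd _ _ _ _ _ _ _ _ al0 be0 k1 k2 e).
apply: (ae_le_integrable (mD Y 0 1 aY) iyx).
apply: (ae_imp _ Nul_ae) => w nN; have [k1 k2 _ e] := key w nN.
exact (bnd _ _ _ _ _ _ _ _ de0 ga0 k2 k1 (etrans e (addrC _ _))).
Qed.
End solution.

Theorem O2BP_existence (R : realType) (d : measure_display) (Omega : measurableType d)
  (P : probability Omega R) (F : R -> set (set Omega)) (rho : R) (B C : R -> Omega -> R)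
  (al be ga de : R) (X0 Y0 : Omega -> R) :
  usual_filtration P F -> -1 <= rho <= 1 -> correlated_BM P F rho B C ->
  0 < al -> 0 < de -> 0 <= be -> 0 <= ga -> (forall w, 0 <= X0 w /\ 0 <= Y0 w) ->
  G_measurable (F 0) X0 -> G_measurable (F 0) Y0 ->
  exists X Y : R -> Omega -> R, [/\ strong_O2BP P F B C al be ga de X0 Y0 X Y,
    forall w, continuous (X^~ w) /\ continuous (Y^~ w),
    {ae P, forall w, det_sol al be ga de (fun t => X0 w + B t w) (fun t => Y0 w + C t w)
       (X^~ w) (Y^~ w)} &
    forall T, 0 <= T ->
      P.-integrable setT (EFin \o (fun w => X T w - X 0 w - BM B C 1 0 T w)) /\
      P.-integrable setT (EFin \o (fun w => Y T w - Y 0 w - BM B C 0 1 T w))].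
Proof.
move=> uF rho1 bm al0 de0 be0 ga0 XY0 gX gY.
have v10 : var rho 1 0 = 1 by rewrite /var; ring.
have v01 : var rho 0 1 = 1 by rewrite /var; ring.
have [x bx] := bessel_exists uF rho1 bm al0 v10.
have [y by_] := bessel_exists uF rho1 bm de0 v01.
exists (solutionX be ga bx by_ X0 Y0), (solutionY be ga bx by_ X0 Y0); split.
- exact (solution_O2BP uF bm al0 de0 be0 ga0 bx by_ XY0 gX gY).
- exact (solution_cont al0 de0 be0 ga0 bx by_ XY0).
- exact (solution_det al0 de0 be0 ga0 bx by_ XY0).
- exact (solution_int uF bm al0 de0 be0 ga0 bx by_ XY0 gX gY).
Qed.

Section positive_times.
Context {R : realType}.
Notation mu := (@lebesgue_measure R).

(** Rational times reduce the possible starting times to countably many, so the exceptional null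
    sets can be united. *)
Lemma ae_pos_rational (X : R -> R) (t : R) : continuous X ->
  {ae mu, forall s, 0 <= s -> 0 < X s} -> 0 < t ->
  exists i j : nat, i%:R / j.+1%:R <= t /\ 0 < X (i%:R / j.+1%:R).
Proof.
move=> cX pos t0.
have [r [r0 rt Xr]] : exists r, [/\ 0 < r, r < t & 0 < X r].
  apply: contrapT => no; have [A [mA A0 AP]] := pos.
  have : (mu `]0%R, t[ <= mu A)%E.
    apply: le_measure; rewrite ?inE// => r /=; rewrite in_itv/= => /andP[r0 rt].
    apply: AP => /= h; apply: no; exists r; split => //; exact/h/ltW.
  by rewrite A0 lebesgue_measure_itv/= lte_fin t0 -EFinB lee_fin subr0; lra.
have /cvgrPdist_lt /(_ _ Xr) := cX r.
move=> /nbhs_ballP[e /= e0 h].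
pose j := Num.truncn e^-1; pose i := Num.truncn (r * j.+1%:R).
have j0 : 0 < j.+1%:R :> R by [].
have je : j.+1%:R^-1 < e.
  by rewrite -[ltRHS]invrK ltf_pV2 ?posrE ?invr_gt0// truncnS_gt.
have /andP[i1 i2] := truncn_itv (mulr_ge0 (ltW r0) (ltW j0)).
rewrite -/i in i1 i2.
have a1 : i%:R / j.+1%:R <= r by rewrite ler_pdivrMr.
have a2 : r < i%:R / j.+1%:R + j.+1%:R^-1.
  by rewrite -{2}[j.+1%:R^-1]mul1r -mulrDl ltr_pdivlMr// natr1.
exists i, j; split; first by apply: le_trans a1 (ltW rt).
have := h (i%:R / j.+1%:R); rewrite /ball/= ger0_norm ?subr_ge0// => h'.
have /h' : r - i%:R / j.+1%:R < e by apply: lt_trans je; rewrite ltrBlDl.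
by move=> /ltr_normlW; lra.
Qed.
End positive_times.

(** * The corner under each of the four conditions *)

Section corner.
Context {R : realType} {d : measure_display} {Omega : measurableType d}.
Variable P : probability Omega R.
Variables (F : R -> set (set Omega)) (rho : R) (B C : R -> Omega -> R) (al be ga de : R).
Hypotheses (uF : usual_filtration P F) (rho1 : -1 <= rho <= 1) (bm : correlated_BM P F rho B C).
Hypotheses (al0 : 0 < al) (de0 : 0 < de) (be0 : 0 <= be) (ga0 : 0 <= ga).
Notation mu := (@lebesgue_measure R).
Variables (X0 Y0 : Omega -> R) (X Y : R -> Omega -> R).
Hypotheses (aX : adapted F X) (aY : adapted F Y)
  (cXY : forall w, continuous (X^~ w) /\ continuous (Y^~ w))
  (ge0 : forall t w, 0 <= t -> 0 <= X t w /\ 0 <= Y t w)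
  (init : forall w, X 0 w = X0 w /\ Y 0 w = Y0 w)
  (eqs : {ae P, forall w, det_sol al be ga de (fun t => X0 w + B t w) (fun t => Y0 w + C t w)
       (X^~ w) (Y^~ w)})
  (ints : forall T, 0 <= T ->
      P.-integrable setT (EFin \o (fun w => X T w - X 0 w - BM B C 1 0 T w)) /\
      P.-integrable setT (EFin \o (fun w => Y T w - Y 0 w - BM B C 0 1 T w))).
Hypothesis start : P [set w | X0 w = 0 /\ Y0 w = 0] = 0%E.
Hypotheses (gX0 : G_measurable (F 0) X0) (gY0 : G_measurable (F 0) Y0).

Definition off_corner w := forall t, 0 <= t -> ~ (X t w = 0 /\ Y t w = 0).

Let cmax (Z : R -> Omega -> R) w : continuous (Z^~ w) -> continuous (fun r : R => Z (Num.max r 0) w).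
Proof.
move=> cZ r; apply: (continuous_comp (f := fun r : R => Num.max r 0) (g := Z^~ w)); last exact: cZ.
by apply: maxr_cont => s; [exact: cvg_id|exact: cvg_cst].
Qed.

Let start_ae : {ae P, forall w, ~ (X0 w = 0 /\ Y0 w = 0)}.
Proof.
exists [set w | X0 w = 0 /\ Y0 w = 0]; split => //.
  have m0 (Z : Omega -> R) : G_measurable (F 0) Z -> measurable [set w | Z w = 0].
    by move=> gZ; apply: (F_sub uF (lexx 0)); exact: (gZ _ (measurable_set1 0)).
  by have := measurableI _ _ (m0 _ gX0) (m0 _ gY0).
by move=> w h; exact: (contrapT h).
Qed.

(** The pair [(U1, 0)] makes the planar barrier one-dimensional, with [k] equal to the variance of
    the noise of [l X + m Y]. The last hypothesis then says that [U1] times its drift is at least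
    half that variance, the criterion of dimension 2. *)
Let linear_avoid (l m : R) : 0 <= l * al + m * ga -> 0 <= l * be + m * de ->
  (forall a b : R, 0 < a -> 0 < b ->
     var rho l m / 2 <= (l * a + m * b) * ((l * al + m * ga) / a + (l * be + m * de) / b)) ->
  forall s, 0 <= s -> {ae P, forall w, 0 < (l * X s w + m * Y s w) ^+ 2 ->
    forall t, s <= t -> l * X t w + m * Y t w != 0}.
Proof.
move=> u0 v0 key s s0.
set u := l * al + m * ga in u0 key *; set v := l * be + m * de in v0 key *.
pose U1 t w := l * X t w + m * Y t w; pose U2 (t : R) (w : Omega) : R := 0.
have vz : var rho 0 0 = 0 by rewrite /var; ring.
have k0 := var_ge0 rho1 l m.
have aU1 : adapted F U1.
  move=> t t0; have sFt := F_sigma uF t0.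
  by apply: gm_add => //; apply: gm_mul => //; [exact: gm_cst|exact: aX|exact: gm_cst|exact: aY].
have aU2 : adapted F U2 by move=> t t0; apply: gm_cst; exact: (F_sigma uF).
have i1 T : 0 <= T -> P.-integrable setT (EFin \o (fun w => U1 T w - U1 0 w - BM B C l m T w)).
  move=> T0; have [iX iY] := ints T0.
  have := integrableD_EFin measurableT (integrableZ_EFin l measurableT iX)
    (integrableZ_EFin m measurableT iY).
  by apply: eq_integrable => // w _ /=; congr EFin; rewrite /U1 /BM; ring.
have i2 T : 0 <= T -> P.-integrable setT (EFin \o (fun w => U2 T w - U2 0 w - BM B C 0 0 T w)).
  move=> T0; have := integrable_cst_prob P 0; apply: eq_integrable => // w _ /=; congr EFin.
  by rewrite /U2 /BM; ring.
have [z _ _ _] := bm.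
have path : {ae P, forall w, [/\ continuous (fun r : R => U1 (Num.max r 0) w),
     continuous (fun r : R => U2 (Num.max r 0) w) &
     drift_path rho B C l m 0 0 (var rho l m) U1 U2 w]}.
  apply: (ae_imp _ eqs) => w [_ ge pos ig E]; have [cX cY] := cXY w; split.
  - by move=> r; apply: cvgD; apply: cvgMr; [exact: cmax|exact: cmax].
  - by move=> r; exact: cvg_cst.
  exists (fun r => u * (X r w)^-1 + v * (Y r w)^-1), (fun=> 0); split.
  - move=> T; have [iX iY] := ig T; split; last exact: itg_cst.
    by apply: itg_add; exact: itg_scale.
  - move=> r r0; have [x0 y0] := ge r r0; split => //.
    by rewrite addr_ge0// mulr_ge0// invr_ge0.
  - move=> r r0; have [iX iY] := ig r; have [XE YE] := E r r0.
    have [XI YI] := E 0 (lexx 0); have [B0 C0] := z w.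
    split; last by rewrite /U2 J_cst// /BM; ring.
    rewrite J_D; [|exact: itg_scale|exact: itg_scale].
    rewrite /U1 {1}XE {1}YE XI YI !J_aa B0 C0 !J_Z// /BM /u /v.
    by ring.
  - apply: (ae_imp _ pos) => r h r0; have [x0 y0] := h r0.
    have kk := key _ _ x0 y0.
    split; first by rewrite vz /U2 mul0r; move: kk; rewrite /U1; lra.
    rewrite vz /U2; lra.
apply: (ae_imp _ (avoid_zero uF rho1 bm k0 aU1 aU2 i1 i2 path s0)) => w h q0 t st.
have := h _ t st; rewrite /sqn /U2 expr0n addr0 => /(_ q0).
by rewrite addr0 sqrf_eq0.
Qed.

Let nonneg_corner (l m a b : R) : 0 < l -> 0 < m -> 0 <= a -> 0 <= b -> ~ (a = 0 /\ b = 0) ->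
  0 < (l * a + m * b) ^+ 2.
Proof.
move=> l0 m0 a0 b0 nz; rewrite exprn_gt0// lt_neqAle addr_ge0 ?mulr_ge0 ?(ltW l0) ?(ltW m0)// andbT.
rewrite eq_sym paddr_eq0 ?mulr_ge0 ?(ltW l0) ?(ltW m0)//.
rewrite !mulf_eq0 !(gt_eqF l0) !(gt_eqF m0)/=; apply/negP => /andP[/eqP ? /eqP ?]; exact: nz.
Qed.

(** The infimum of [(l a + m b) (u / a + v / b)] over positive [a], [b] is the square of
    [sqrt (l u) + sqrt (m v)]. So C3 is the criterion of [linear_avoid], and positivity of [l], [m]
    makes [l X + m Y] vanish only at the corner. *)
Lemma corner_C3 : cond_C3 rho al be ga de -> {ae P, forall w, off_corner w}.
Proof.
move=> [l [m [l0 m0 u0 v0 h]]].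
set u := l * al + m * ga in u0 h; set v := l * be + m * de in v0 h.
have av := linear_avoid u0 v0 _ (lexx 0).
apply: (ae_imp2 _ start_ae (av _)).
  move=> w nz hw t t0 [Xt Yt]; have [XI YI] := init w; have [x0 y0] := ge0 w (lexx 0).
  have := hw _ t t0; rewrite Xt Yt !mulr0 addr0 eqxx => /(_ _)/negP[]//.
  by apply: nonneg_corner => //; rewrite XI YI.
move=> a b a0 b0.
set p := Num.sqrt (l * u) in h; set q := Num.sqrt (m * v) in h.
have pE : l * u = p ^+ 2 by rewrite sqr_sqrtr// mulr_ge0// ltW.
have qE : m * v = q ^+ 2 by rewrite sqr_sqrtr// mulr_ge0// ltW.
have -> : var rho l m / 2 = (l ^+ 2 + m ^+ 2 + 2 * rho * l * m) / 2 by rewrite /var; ring.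
apply: le_trans h _.
(* Cauchy-Schwarz *)
have l0' : l != 0 by rewrite gt_eqF.
have m0' : m != 0 by rewrite gt_eqF.
have a0' : a != 0 by rewrite gt_eqF.
have b0' : b != 0 by rewrite gt_eqF.
rewrite -subr_ge0.
have -> : (l * a + m * b) * (u / a + v / b) - (p + q) ^+ 2 =
   (m * b * p - l * a * q) ^+ 2 / (l * a * (m * b)).
  have uE : u = p ^+ 2 / l by rewrite -pE; field.
  have vE : v = q ^+ 2 / m by rewrite -qE; field.
  by rewrite uE vE; field; rewrite l0' m0' a0' b0'.
by rewrite divr_ge0 ?sqr_ge0// !mulr_ge0// ltW.
Qed.

Lemma corner_C1 : cond_C1 rho al be ga de -> {ae P, forall w, off_corner w}.
Proof.
move=> [_ _ /andP[_ rho_le]].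
(* On the quadrant [2 rho x y <= max rho 0 (x^2 + y^2)], so this [k] bounds the quadratic form.
   Radial drift plus half the trace is at least [al + de + 1], and C1 makes that at least [k]. *)
pose k : R := 1 + Num.max rho 0.
have mr : rho <= Num.max rho 0 by rewrite le_max lexx.
have m0 : 0 <= Num.max rho 0 by rewrite le_max lexx orbT.
have mle : Num.max rho 0 <= al + de by rewrite ge_max rho_le addr_ge0 ?(ltW al0) ?(ltW de0).
have k0 : 0 <= k by rewrite addr_ge0.
have v10 : var rho 1 0 = 1 by rewrite /var; ring.
have v01 : var rho 0 1 = 1 by rewrite /var; ring.
have c1 : cov rho 1 0 0 1 = rho by rewrite /cov; ring.
have [z _ _ _] := bm.
have path : {ae P, forall w, [/\ continuous (fun r : R => X (Num.max r 0) w),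
     continuous (fun r : R => Y (Num.max r 0) w) &
     drift_path rho B C 1 0 0 1 k X Y w]}.
  apply: (ae_imp _ eqs) => w [_ ge pos ig E]; have [cX cY] := cXY w.
  split; [exact: cmax|exact: cmax|].
  exists (fun r => al * (X r w)^-1 + be * (Y r w)^-1), (fun r => ga * (X r w)^-1 + de * (Y r w)^-1).
  split.
  - by move=> T; have [iX iY] := ig T; split; apply: itg_add; exact: itg_scale.
  - move=> r r0; have [x0 y0] := ge r r0.
    by split; rewrite addr_ge0// mulr_ge0// ?invr_ge0// ltW.
  - move=> r r0; have [iX iY] := ig r; have [XE YE] := E r r0.
    have [XI YI] := E 0 (lexx 0); have [B0 C0] := z w.
    rewrite !J_D; try exact: itg_scale.
    by rewrite {1}XE {1}YE XI YI !J_aa B0 C0 !J_Z// /BM; split; ring.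
  - apply: (ae_imp _ pos) => r h r0; have [x0 y0] := h r0; rewrite v10 v01 c1.
    set a := X r w in x0 *; set b := Y r w in y0 *.
    split.
      have -> : a * (al * a^-1 + be * b^-1) + b * (ga * a^-1 + de * b^-1) =
         al + de + (be * (a * b^-1) + ga * (b * a^-1)) by field; rewrite !gt_eqF.
      have p1 : 0 <= be * (a * b^-1) by rewrite mulr_ge0// mulr_ge0 ?invr_ge0 ?(ltW x0) ?(ltW y0).
      have p2 : 0 <= ga * (b * a^-1) by rewrite mulr_ge0// mulr_ge0 ?invr_ge0 ?(ltW x0) ?(ltW y0).
      by rewrite /k; lra.
    have ab : 0 <= a * b by rewrite mulr_ge0 ?(ltW x0) ?(ltW y0).
    have h1 : rho * (a * b) <= Num.max rho 0 * (a * b) by rewrite ler_wpM2r.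
    have h2 : Num.max rho 0 * (2 * (a * b)) <= Num.max rho 0 * (a ^+ 2 + b ^+ 2).
      by rewrite ler_wpM2l//; have := sqr_ge0 (a - b); rewrite sqrrB; lra.
    by rewrite /k; lra.
have i1 T (T0 : 0 <= T) := (ints T0).1; have i2 T (T0 : 0 <= T) := (ints T0).2.
apply: (ae_imp2 _ start_ae (avoid_zero uF rho1 bm k0 aX aY i1 i2 path (lexx 0))).
move=> w nz hw t t0 [Xt Yt]; have [XI YI] := init w; have [x0 y0] := ge0 w (lexx 0).
have := hw _ t t0; rewrite /sqn Xt Yt expr0n addr0 eqxx => /(_ _)/negP[]//.
rewrite lt_neqAle addr_ge0 ?sqr_ge0// andbT eq_sym paddr_eq0 ?sqr_ge0//.
by rewrite !sqrf_eq0 XI YI; apply/negP => /andP[/eqP ? /eqP ?]; exact: nz.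
Qed.

(** The coordinate [Z] may start at 0 although the pair does not start at the corner. Before any
    [t > 0] there is a rational time with [Z > 0], and from then on [Z] stays nonzero; [t = 0] is
    covered by the assumption on the initial law. *)
Let corner_C2 (l m : R) (Z : R -> Omega -> R) : (forall t w, l * X t w + m * Y t w = Z t w) ->
  (forall w t, X t w = 0 /\ Y t w = 0 -> Z t w = 0) ->
  (forall w, continuous (Z^~ w)) ->
  {ae P, forall w, {ae mu, forall s, 0 <= s -> 0 < Z s w}} ->
  0 <= l * al + m * ga -> 0 <= l * be + m * de ->
  (forall a b : R, 0 < a -> 0 < b ->
     var rho l m / 2 <= (l * a + m * b) * ((l * al + m * ga) / a + (l * be + m * de) / b)) ->
  {ae P, forall w, off_corner w}.
Proof.
move=> ZE Z0 cZ Zp u0 v0 key.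
have av : {ae P, forall w, forall i j : nat, 0 < Z (i%:R / j.+1%:R) w ^+ 2 ->
    forall t, i%:R / j.+1%:R <= t -> Z t w != 0}.
  apply: ae_foralln => i; apply: ae_foralln => j.
  have := linear_avoid u0 v0 key (_ : 0 <= i%:R / j.+1%:R) => /(_ _); rewrite divr_ge0// => /(_ isT).
  by apply: ae_imp => w h; move: h; rewrite ZE => h h0 t it; rewrite -ZE; exact: h.
apply: (ae_imp2 _ start_ae (ae_imp2 (fun w a b => conj a b) Zp av)) => w nz [pos h] t.
rewrite le_eqVlt => /orP[/eqP <-|t0 XY].
  by have [-> ->] := init w.
have [i [j [ijt Zij]]] := ae_pos_rational (@cZ w) pos t0.
have := h i j _ t ijt; rewrite exprn_gt0// => /(_ isT).
by rewrite (Z0 w t XY) eqxx.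
Qed.

Lemma corner_C2a : cond_C2a al be -> {ae P, forall w, off_corner w}.
Proof.
move=> [al2 _]; apply: (@corner_C2 1 0 X).
- by move=> t w; ring.
- by move=> w t [].
- by move=> w; have [] := cXY w.
- apply: (ae_imp _ eqs) => w [_ _ pos _ _].
  by apply: (ae_imp _ pos) => s h s0; have [] := h s0.
- by rewrite mul1r mul0r addr0 ltW.
- by rewrite mul1r mul0r addr0.
move=> a b a0 b0.
have -> : var rho 1 0 / 2 = 1 / 2 by rewrite /var; field.
have -> : (1 * a + 0 * b) * ((1 * al + 0 * ga) / a + (1 * be + 0 * de) / b) = al + be * (a / b).
  by field; rewrite !gt_eqF.
by apply: le_trans al2 _; rewrite lerDl !mulr_ge0// ?invr_ge0 ltW.
Qed.

Lemma corner_C2b : cond_C2b ga de -> {ae P, forall w, off_corner w}.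
Proof.
move=> [de2 _]; apply: (@corner_C2 0 1 Y).
- by move=> t w; ring.
- by move=> w t [].
- by move=> w; have [] := cXY w.
- apply: (ae_imp _ eqs) => w [_ _ pos _ _].
  by apply: (ae_imp _ pos) => s h s0; have [] := h s0.
- by rewrite mul1r mul0r add0r.
- by rewrite mul1r mul0r add0r ltW.
move=> a b a0 b0.
have -> : var rho 0 1 / 2 = 1 / 2 by rewrite /var; field.
have -> : (0 * a + 1 * b) * ((0 * al + 1 * ga) / a + (0 * be + 1 * de) / b) = de + ga * (b / a).
  by field; rewrite !gt_eqF.
by apply: le_trans de2 _; rewrite lerDl !mulr_ge0// ?invr_ge0 ltW.
Qed.
End corner.

Lemma O2BP_det_sol (R : realType) (d : measure_display) (Omega : measurableType d)
  (P : probability Omega R) (F : R -> set (set Omega)) (B C : R -> Omega -> R)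
  (al be ga de : R) (X0 Y0 : Omega -> R) (X Y : R -> Omega -> R) :
  O2BP P F B C al be ga de X0 Y0 X Y ->
  {ae P, forall w, det_sol al be ga de (fun t => X0 w + B t w) (fun t => Y0 w + C t w)
    (fun t => X (Num.max t 0) w) (fun t => Y (Num.max t 0) w)}.
Proof.
move=> [_ [cX cY] ge0 _ E]; apply: (ae_imp _ E) => w Ew.
by apply: (path_det_sol (cX w) (cY w)) => // t; exact: ge0.
Qed.

Theorem mainTheorem8 (R : realType) (d : measure_display) (Omega : measurableType d)
  (P : probability Omega R) (F : R -> set (set Omega)) (rho : R) (B C : R -> Omega -> R)
  (alpha beta gamma delta : R) :
  complete_prob_space P -> usual_filtration P F ->
  -1 <= rho <= 1 -> correlated_BM P F rho B C ->
  0 < alpha -> 0 < delta -> 0 <= beta -> 0 <= gamma ->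
  (cond_C1 rho alpha beta gamma delta \/ cond_C2a alpha beta \/
   cond_C2b gamma delta \/ cond_C3 rho alpha beta gamma delta) ->
  [/\
   (* (1) *)
   (forall X0 Y0 : Omega -> R,
      G_measurable (F 0) X0 -> G_measurable (F 0) Y0 ->
      (forall w, 0 <= X0 w /\ 0 <= Y0 w) ->
      P [set w | X0 w = 0 /\ Y0 w = 0] = 0%E ->
      (exists X Y : R -> Omega -> R,
         strong_O2BP P F B C alpha beta gamma delta X0 Y0 X Y /\
         {ae P, forall w, forall t, 0 <= t -> ~ (X t w = 0 /\ Y t w = 0)})
      /\ pathwise_unique P F B C alpha beta gamma delta X0 Y0),
   (* (2) *)
   (exists X Y : R -> Omega -> R,
      O2BP P F B C alpha beta gamma delta (fun _ => 0) (fun _ => 0) X Y) &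
   (* (3) *)
   (beta * gamma <= alpha * delta ->
    forall X0 Y0 : Omega -> R,
      G_measurable (F 0) X0 -> G_measurable (F 0) Y0 ->
      (forall w, 0 <= X0 w /\ 0 <= Y0 w) ->
      (exists X Y : R -> Omega -> R, O2BP P F B C alpha beta gamma delta X0 Y0 X Y)
      /\ pathwise_unique P F B C alpha beta gamma delta X0 Y0)].
Proof.
move=> _ uF rho1 bm al0 de0 be0 ga0 cond.
have sol X0 Y0 gX gY h := @O2BP_existence _ _ _ P F rho B C alpha beta gamma delta X0 Y0
  uF rho1 bm al0 de0 be0 ga0 h gX gY.
have mxE (t : R) : 0 <= t -> Num.max t 0 = t by move=> t0; exact: (max_idPl t0).
split.
- move=> X0 Y0 gX gY h0 start; have [X [Y [sXY cXY eqs ints]]] := sol X0 Y0 gX gY h0.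
  have [hO _] := sXY; have [[aX aY] _ ge0 init _] := hO.
  have off : {ae P, forall w, off_corner X Y w}.
    case: cond => [c1|[c2|[c2|c3]]].
    + exact: (corner_C1 uF rho1 bm al0 de0 be0 ga0 aX aY cXY ge0 init eqs ints start gX gY c1).
    + exact: (corner_C2a uF rho1 bm al0 be0 aX aY cXY init eqs ints start gX gY c2).
    + exact: (corner_C2b uF rho1 bm de0 ga0 aX aY cXY init eqs ints start gX gY c2).
    + exact: (corner_C3 uF rho1 bm aX aY cXY ge0 init eqs ints start gX gY c3).
  split; first by exists X, Y.
  (* Only the constructed solution is known to avoid the corner. Any two solutions are therefore
     compared with it instead of with each other. *)
  have uni X' Y' : O2BP P F B C alpha beta gamma delta X0 Y0 X' Y' ->
      {ae P, forall w, forall t, 0 <= t -> X t w = X' t w /\ Y t w = Y' t w}.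
    move=> O'; apply: ae_imp2 (ae_imp2 (fun w a b => conj a b) eqs (O2BP_det_sol O')) off.
    move=> w [S S'] offw t t0.
    have := det_unique_off_corner al0 be0 ga0 de0 S S' offw t0.
    by rewrite mxE.
  move=> X1 Y1 X2 Y2 O1 O2; apply: ae_imp2 (uni _ _ O1) (uni _ _ O2).
  by move=> w u1 u2 t t0; have [<- <-] := u1 t t0; exact: u2.
- have g0 : G_measurable (F 0) (fun _ : Omega => 0 : R) by apply: gm_cst; exact: (F_sigma uF).
  have [X [Y [[hO _] _ _ _]]] := sol (fun=> 0) (fun=> 0) g0 g0 (fun=> conj (lexx 0) (lexx 0)).
  by exists X, Y.
- move=> mono X0 Y0 gX gY h0; split.
    by have [X [Y [[hO _] _ _ _]]] := sol X0 Y0 gX gY h0; exists X, Y.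
  (* Solutions may now pass through the corner; the monotone argument compares them directly and
     never localizes away from it. *)
  move=> X1 Y1 X2 Y2 O1 O2; apply: ae_imp2 (O2BP_det_sol O1) (O2BP_det_sol O2).
  move=> w S1 S2 t t0; have := det_unique_monotone al0 be0 ga0 de0 mono S1 S2 t0.
  by rewrite mxE.
Qed.
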